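(* Let $d\in\mathbb{N}^*$ and let $\Omega$ and $\mathcal{W}$ be compact subsets of $\mathbb{R}^d$. For $r>0$ let $P_{LPS}^{(r)}=P_{r\Omega}P_{\mathcal{W}}P_{r\Omega}\colon L^2(\mathbb{R}^d)\to L^2(\mathbb{R}^d)$, where $P_{r\Omega}f=\mathbb{1}_{r\Omega}f$ and $P_{\mathcal{W}}f=\mathcal{F}^{-1}\mathbb{1}_{\mathcal{W}}\mathcal{F}f$. Then for every $\varepsilon\in(0,1]$, \[ \lim_{r\to\infty}\frac{H\!\left(\varepsilon;P_{LPS}^{(r)}\right)}{r^d}=\frac{2\,\mathcal{H}^d(\Omega)\,\mathcal{H}^d(\mathcal{W})}{(2\pi)^d}\log\!\left(\varepsilon^{-1}\right). \]
   Context: $\mathcal{F}$ denotes the Fourier transform on $L^2(\mathbb{R}^d)$, $\mathbb{1}_X$ the indicator function of $X$, $r\Omega=\{rx:x\in\Omega\}$, and $\mathcal{H}^d$ the $d$-dimensional Hausdorff measure. $\log$ is base $2$. For a compact set $K$ in a metric space $(X,d)$, $N(\varepsilon;K,d)$ is the minimal cardinality of a set $\{x_1,\dots,x_N\}\subseteq X$ such that every $x\in K$ has $d(x,x_i)\le\varepsilon$ for some $i$, and $H(\varepsilon;K,d)=\log N(\varepsilon;K,d)$. For a compact linear operator $T$ on $L^2(\mathbb{R}^d)$ with closed unit ball $\mathcal{B}$, the entropy is $H(\varepsilon;T)=H(\varepsilon;\overline{T(\mathcal{B})},\|\cdot\|_{L^2})$. *)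

(* Defs.v *)
From HB Require Import structures.
From mathcomp Require Import all_boot all_order all_algebra.
From mathcomp Require Import all_classical all_reals all_analysis.
From mathcomp Require Import complex.

Set Implicit Arguments.
Unset Strict Implicit.
Unset Printing Implicit Defensive.

Import Order.TTheory GRing.Theory Num.Theory.
Import numFieldNormedType.Exports.
Local Open Scope classical_set_scope.
Local Open Scope ring_scope.

Section LPS.
Variables (R : realType) (d : nat).

Local Notation vec := 'rV[R]_d.
Local Notation cfun := (vec -> R[i]).

Definition dotp (x y : vec) : R := \sum_(k < d) x ord0 k * y ord0 k.
Definition enorm (x : vec) : R := Num.sqrt (dotp x x).

Definition box (a b : vec) : set vec :=
  [set x | forall k : 'I_d, a ord0 k <= x ord0 k < b ord0 k].
Definition vol (a b : vec) : R := \prod_(k < d) Num.max (b ord0 k - a ord0 k) 0.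

Definition leb_out (A : set vec) : \bar R :=
  ereal_inf [set l | exists a b : nat -> vec,
    A `<=` \bigcup_k box (a k) (b k) /\
    l = (\sum_(0 <= k <oo) (vol (a k) (b k))%:E)%E].

Definition leb_measurable (A : set vec) : Prop :=
  forall B, leb_out B = (leb_out (B `&` A) + leb_out (B `&` ~` A))%E.
Definition leb_measurable_fun (f : vec -> R) : Prop :=
  forall t : R, leb_measurable [set x | t < f x].

(* Lebesgue integral of a nonnegative function (layer-cake formula) *)
Definition nnint (h : vec -> R) : \bar R :=
  (\int[@lebesgue_measure R]_(t in `[0%R, +oo[%classic) leb_out [set x | (t < h x)%R])%E.
Definition rint (f : vec -> R) : R :=
  fine (nnint (fun x => Num.max (f x) 0)) - fine (nnint (fun x => Num.max (- f x) 0)).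
Definition cint (f : cfun) : R[i] :=
  Complex (rint (fun x => complex.Re (f x))) (rint (fun x => complex.Im (f x))).

(* L^2 (semi)norm and the space L^2(R^d) (as functions; the norm is a seminorm) *)
Definition l2sq (f : cfun) : \bar R :=
  nnint (fun x => complex.Re (f x) ^+ 2 + complex.Im (f x) ^+ 2).
Definition l2norm (f : cfun) : \bar R :=
  match l2sq f with
  | r%:E => (Num.sqrt r)%:E
  | e => e
  end.
Definition L2 (f : cfun) : Prop :=
  [/\ leb_measurable_fun (fun x => complex.Re (f x)),
      leb_measurable_fun (fun x => complex.Im (f x)) &
      (l2sq f < +oo)%E].

(* L^2 limit of a sequence of functions (0 if it does not exist) *)
Definition L2lim (u : nat -> cfun) : cfun :=
  xget (fun=> 0) [set g | L2 g /\ (fun n => l2norm (u n \- g)%R) @ \oo --> 0%E].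

Definition expi (t : R) : R[i] := Complex (cos t) (sin t).
Definition cube (n : nat) : set vec :=
  [set x | forall k : 'I_d, - n%:R <= x ord0 k <= n%:R].

(* Fourier transform on L^2(R^d) (Plancherel):
   F f (xi) = L^2-lim_n \int_{[-n,n]^d} f(x) e^{-i x.xi} dx,
   F^{-1} g (x) = L^2-lim_n (2 pi)^{-d} \int_{[-n,n]^d} g(xi) e^{i x.xi} dxi *)
Definition fourier (f : cfun) : cfun :=
  L2lim (fun n xi => cint (fun x => \1_(cube n) x * f x * expi (- dotp x xi))).
Definition ifourier (g : cfun) : cfun :=
  L2lim (fun n x => ((2 * pi) ^- d)%:C%C *
    cint (fun xi => \1_(cube n) xi * g xi * expi (dotp x xi))).

Definition P_space (Om : set vec) (f : cfun) : cfun := fun x => \1_Om x * f x.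
Definition P_freq (W : set vec) (f : cfun) : cfun :=
  ifourier (fun xi => \1_W xi * fourier f xi).
Definition scale_set (r : R) (Om : set vec) : set vec := [set r *: x | x in Om].
Definition P_LPS (r : R) (Om W : set vec) : cfun -> cfun :=
  fun f => P_space (scale_set r Om) (P_freq W (P_space (scale_set r Om) f)).

Definition image_ball_closure (T : cfun -> cfun) : set cfun :=
  [set g | L2 g /\ forall e : R, 0 < e -> exists f, [/\ L2 f, (l2norm f <= 1)%E &
      (l2norm (g \- T f)%R < e%:E)%E]].

Definition covering_number (eps : R) (K : set cfun) : \bar R :=
  ereal_inf [set (n%:R)%:E | n in [set n : nat | exists c : 'I_n -> cfun,
    (forall k, L2 (c k)) /\
    forall g, K g -> exists k, (l2norm (g \- c k)%R <= eps%:E)%E]].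
Definition entropy (eps : R) (T : cfun -> cfun) : \bar R :=
  match covering_number eps (image_ball_closure T) with
  | r%:E => (ln r / ln 2)%:E
  | e => e
  end.

Definition diam (C : set vec) : \bar R :=
  ereal_sup ([set 0%E] `|` [set (enorm (x - y))%:E | x in C & y in C]).
Definition unit_ball_vol : \bar R := leb_out [set x | enorm x <= 1].
Definition hausdorff_delta (delta : R) (A : set vec) : \bar R :=
  ereal_inf [set l | exists C : nat -> set vec,
    [/\ A `<=` \bigcup_k C k, (forall k, (diam (C k) <= delta%:E)%E) &
        l = (\sum_(0 <= k <oo) (unit_ball_vol * ((fine (diam (C k)) / 2) ^+ d)%:E))%E]].
Definition hausdorff (A : set vec) : \bar R :=
  ereal_sup [set hausdorff_delta delta A | delta in `]0%R, +oo[%classic].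

End LPS.

(* Main.v *)
(** On r Omega the operator P_LPS has kernel (2 pi)^-d K(x - y), where K(z) is the integral over W of
    exp(i <z, xi>).  Cutting r Omega into small cells turns it, up to an arbitrarily small operator
    error, into a finite Hermitian positive matrix with eigenvalues at most 1 + e, whose trace is
    c r^d with c = |Omega| |W| / (2 pi)^d.  By Plancherel for the indicator of W and the continuity
    of z |-> |Omega /\ (Omega - z)| at 0, the sum of the squared eigenvalues is also
    c r^d - o(r^d), so nearly all the mass sits at eigenvalues near 1: about c r^d eigenvalues are
    close to 1 and o(r^d) are neither close to 0 nor to 1.

    Hence the image of the unit ball lies between Euclidean balls of radius about 1 in real dimension
    about 2 c r^d.  A volume comparison bounds its covering number below by eps^-(2 c r^d).  For the
    upper bound the unit ball of R^m is covered by exp(m (ln (1 / eps) + o(1))) balls of radius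
    eps: the admissible centres of a point x, taken in a ball of radius about sqrt(1 - eps^2), fill a
    proportion at least exp(-o(m)) eps^m of that ball, and a greedy choice of centres loses only
    the logarithm of the cardinality of a fine net.

    The Hausdorff measure equals Lebesgue measure by the isodiametric inequality, which is proved
    by Steiner symmetrization of finite unions of grid cells, so that no measurability of sections
    is needed. *)

Require Import Defs.
From HB Require Import structures.
From mathcomp Require Import all_boot all_order all_algebra.
From mathcomp Require Import all_classical all_reals all_analysis.
From mathcomp Require Import complex.
From mathcomp Require Import measurable_realfun sesquilinear spectral.
From mathcomp Require Import ring lra zify.
Import Order.TTheory GRing.Theory Num.Theory.
Import numFieldNormedType.Exports.
Set Implicit Arguments.
Unset Strict Implicit.
Unset Printing Implicit Defensive.
Local Open Scope classical_set_scope.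
Local Open Scope ring_scope.

(** * Lebesgue outer measure of boxes *)

(** The measure of the statement is a bare outer measure and its Fourier transform is a chosen $L^2$
    limit of functions that are not identified up to null sets. Both are tamed by compactness: on
    [X] and [W] the truncations defining the transform are eventually constant, and
    square-integrable functions restricted to a set of finite measure are integrable. Hence
    Plancherel is needed only as an inequality for integrable functions, plus the reverse inequality
    for the single function [\1_W]. The finite matrix replaces the spectral theory of compact
    operators by that of Hermitian matrices. The mesh is chosen after r, since its error grows with
    the volume of r Omega; this is harmless because the eigenvalue counts use only the trace, the
    sum of squares and the bound 1 + e, none of which depends on the number of cells. A parameter t
    governs all losses: it is fixed before r and tends to 0 at the very end. Discretization errors
    are kept below t ^ 3 because the counts divide them by t and by t ^ 2. The bound of Hausdorff by
    Lebesgue measure uses no Vitali covering: a comparison constant is improved by iterating a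
    contraction with fixed point 1. *)

Section CoverOuter.
Local Open Scope ereal_scope.
Context {R : realType} (I T : Type) (S : I -> set T) (c : I -> \bar R).
Hypothesis c0 : forall i, 0 <= c i.

(** An arbitrary family of sets with costs, because two outer measures below are of this kind: boxes
    with their volumes, and sets of bounded diameter with their Hausdorff cost. *)
Definition cover_out (A : set T) : \bar R :=
  ereal_inf [set l | exists i : nat -> I,
    A `<=` \bigcup_k S (i k) /\ l = \sum_(0 <= k <oo) c (i k)].

Lemma cover_out_ge0 A : 0 <= cover_out A.
Proof. by apply/le_ereal_inf_tmp => _ [i [_ ->]]; exact: nneseries_ge0. Qed.

Lemma le_cover_out : {homo cover_out : A B / A `<=` B >-> A <= B}.
Proof.
move=> A B AB; apply/le_ereal_inf_tmp => _ [i [Bi ->]].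
by apply: ereal_inf_lbound; exists i; split => //; exact: subset_trans Bi.
Qed.

Lemma cover_out_le A (i : nat -> I) : A `<=` \bigcup_k S (i k) ->
  cover_out A <= \sum_(0 <= k <oo) c (i k).
Proof. by move=> Ai; apply: ereal_inf_lbound; exists i. Qed.

Lemma cover_out_approx A (e : R) : (0 < e)%R -> cover_out A < +oo ->
  exists i : nat -> I, A `<=` \bigcup_k S (i k) /\
    \sum_(0 <= k <oo) c (i k) <= cover_out A + e%:E.
Proof.
move=> e0 Aoo.
have Afin : cover_out A \is a fin_num by rewrite ge0_fin_numE ?cover_out_ge0.
have [x [i [Ai ->]] xS] := lb_ereal_inf_adherent e0 Afin.
by exists i; split => //; exact: ltW.
Qed.

Lemma cover_out_sigma_subadditive : sigma_subadditive cover_out.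
Proof.
move=> A; have [[i ioo]|] := pselect (exists i, cover_out (A i) = +oo).
  rewrite (eseries_pinfty _ _ ioo) ?leey// => n _.
  by rewrite -ltNye (lt_le_trans _ (cover_out_ge0 _)).
rewrite -forallNE => Aoo.
suff add2e (e : {posnum R}) :
    cover_out (\bigcup_n A n) <= \sum_(i <oo) cover_out (A i) + e%:num%:E.
  by apply/lee_addgt0Pr => _/posnumP[].
rewrite (le_trans _ (epsilon_trick _ _ _))//; last first.
  by move=> n; exact: cover_out_ge0.
pose P n (i : nat -> I) := A n `<=` \bigcup_k S (i k) /\
    \sum_(0 <= k <oo) c (i k) <= cover_out (A n) + (e%:num / (2 ^ n.+1)%:R)%:E.
have [G PG] : {G : nat -> nat -> I & forall n, P n (G n)}.
  apply: (@choice _ _ P) => n; apply: cover_out_approx => //.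
  by rewrite ltey; apply/eqP/Aoo.
(* The near-optimal covers of the sets [A n] are merged into one sequence along a bijection between
   nat and pairs. *)
have /card_esym/ppcard_eqP[f] := card_nat2.
apply: (@le_trans _ _ (\sum_(0 <= k <oo) c (uncurry G (f k)))).
  apply: cover_out_le => x [n _ /(PG n).1 [k _ Sx]].
  by exists (f^-1%FUN (n, k)) => //; rewrite invK ?inE.
rewrite nneseries_esumT; last by move=> k; exact: c0.
rewrite -(@reindex_esum _ _ _ [set: nat] [set: nat * nat] f (fun z => c (uncurry G z))); last exact: bij.
rewrite (_ : [set: nat * nat] = [set: nat] `*`` (fun=> [set: nat])); last first.
  by apply/seteqP; split => //.
rewrite (_ : (fun z => c (uncurry G z)) = (fun z => c (G z.1 z.2))); last first.
  by apply/funext => -[].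
rewrite -(@esum_esum _ _ _ [set: nat] (fun=> [set: nat]) (fun i j => c (G i j))).
  rewrite -nneseries_esumT; last by move=> n; apply: esum_ge0 => *.
  apply: lee_nneseries => [n _ _|n _]; first by apply: esum_ge0 => *.
  rewrite -nneseries_esumT; last by move=> k; exact: c0.
  exact: (PG n).2.
by move=> *.
Qed.

End CoverOuter.

Section LebOut.
Context {R : realType}.
Implicit Types n : nat.

Lemma vol_ge0 n (a b : 'rV[R]_n) : 0 <= vol a b.
Proof. by apply: prodr_ge0 => k _; rewrite le_max lexx orbT. Qed.

Lemma leb_outE n (A : set 'rV[R]_n) : leb_out A =
  cover_out (fun i : 'rV[R]_n * 'rV[R]_n => box i.1 i.2) (fun i => (vol i.1 i.2)%:E) A.
Proof.
congr ereal_inf; apply/seteqP; split => l /=.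
  by move=> [a [b [Ab ->]]]; exists (fun k => (a k, b k)).
by move=> [i [Ai ->]]; exists (fun k => (i k).1), (fun k => (i k).2).
Qed.

Lemma vol_pair_ge0 n (i : 'rV[R]_n * 'rV[R]_n) : (0 <= (vol i.1 i.2)%:E)%E.
Proof. by rewrite lee_fin vol_ge0. Qed.

Lemma leb_out_ge0 n (A : set 'rV[R]_n) : (0 <= leb_out A)%E.
Proof. by rewrite leb_outE; apply: cover_out_ge0; exact: vol_pair_ge0. Qed.

Lemma vol_eq0 n (a b : 'rV[R]_n) k : b ord0 k <= a ord0 k -> vol a b = 0.
Proof.
by move=> ba; apply/eqP/prodf_eq0; exists k => //; apply/eqP/max_idPr; rewrite subr_le0.
Qed.

(** Positive dimension matters from here on: the cover is completed by degenerate boxes of volume 0.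
    In dimension 0 every box has volume 1, the empty product, so every countable cover costs +oo,
    even that of the empty set. *)
Lemma leb_out_box_le n (a b : 'rV[R]_n.+1) : (leb_out (box a b) <= (vol a b)%:E)%E.
Proof.
rewrite leb_outE; apply: le_trans.
  apply: (@cover_out_le _ _ _ _ _ _ (fun k => if k is 0%N then (a, b) else (0, 0))).
  by move=> x abx; exists 0%N.
rewrite nneseries_recl//; last by move=> [|k] _; exact: vol_pair_ge0.
rewrite eseries0 ?adde0// => -[//|k] _ _ /=.
by rewrite (@vol_eq0 _ _ _ ord0).
Qed.

Lemma leb_out0 n : leb_out (set0 : set 'rV[R]_n.+1) = 0%E.
Proof.
apply/eqP; rewrite eq_le leb_out_ge0 andbT.
apply: (@le_trans _ _ (leb_out (box (0 : 'rV[R]_n.+1) 0))).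
  by rewrite !leb_outE; apply: le_cover_out.
by rewrite (le_trans (leb_out_box_le _ _))// (@vol_eq0 _ _ _ ord0).
Qed.

Lemma le_leb_out n : {homo @leb_out R n : A B / A `<=` B >-> (A <= B)%E}.
Proof. by move=> A B AB; rewrite !leb_outE; exact: le_cover_out. Qed.

Lemma leb_out_sigma_subadditive n : sigma_subadditive (@leb_out R n).
Proof.
move=> A; under eq_eseriesr do rewrite leb_outE.
rewrite leb_outE; apply: cover_out_sigma_subadditive.
exact: vol_pair_ge0.
Qed.

HB.instance Definition _ n := isOuterMeasure.Build R 'rV[R]_n.+1 (@leb_out R n.+1)
  (leb_out0 n) (@leb_out_ge0 n.+1) (@le_leb_out n.+1) (@leb_out_sigma_subadditive n.+1).

Definition row_tail n (a : 'rV[R]_n.+1) : 'rV[R]_n := \row_j a ord0 (lift ord0 j).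
Definition row_cons n (t : R) (v : 'rV[R]_n) : 'rV[R]_n.+1 :=
  \row_j (if unlift ord0 j is Some k then v ord0 k else t).

Lemma row_cons0 n t (v : 'rV[R]_n) : row_cons t v ord0 ord0 = t.
Proof. by rewrite mxE unlift_none. Qed.

Lemma row_consS n t (v : 'rV[R]_n) j : row_cons t v ord0 (lift ord0 j) = v ord0 j.
Proof. by rewrite mxE liftK. Qed.

Lemma vol_rec n (a b : 'rV[R]_n.+1) :
  vol a b = Num.max (b ord0 ord0 - a ord0 ord0) 0 * vol (row_tail a) (row_tail b).
Proof. by rewrite /vol big_ord_recl; congr (_ * _); apply: eq_bigr => k _; rewrite !mxE. Qed.

Lemma box_cons n (a b : 'rV[R]_n.+1) t v : box a b (row_cons t v) <->
  (a ord0 ord0 <= t < b ord0 ord0 /\ box (row_tail a) (row_tail b) v).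
Proof.
split=> [ab|[ab0 abv] k].
  split; first by have := ab ord0; rewrite row_cons0.
  by move=> j; have := ab (lift ord0 j); rewrite row_consS !mxE.
case: (unliftP ord0 k) => [j ->|->]; last by rewrite row_cons0.
by have := abv j; rewrite row_consS !mxE.
Qed.

Lemma indic_box_cons n (a b : 'rV[R]_n.+1) t v : \1_(box a b) (row_cons t v) =
  \1_(`[a ord0 ord0, b ord0 ord0[%classic) t * \1_(box (row_tail a) (row_tail b)) v :> R.
Proof.
rewrite !indicE -natrM mulnb; congr (nat_of_bool _)%:R.
apply/idP/idP => [/set_mem/box_cons[t0 bv]|/andP[/set_mem t0 /set_mem bv]].
  by apply/andP; split; apply/mem_set => //=; rewrite in_itv.
by apply/mem_set/box_cons; split => //; move: t0; rewrite /= in_itv.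
Qed.

Local Open Scope ereal_scope.

(** Instead of compactness, the inequality between indicators is integrated one coordinate at a time
    against the Lebesgue measure of the line. The weights are what the induction requires: freezing
    the first coordinate turns its indicator into a coefficient. *)
Lemma vol_le_series n (a b : 'rV[R]_n) (c : R) (ak bk : nat -> 'rV[R]_n) (ck : nat -> R) :
  (0 <= c)%R -> (forall k, 0 <= ck k)%R ->
  (forall x, (c * \1_(box a b) x)%:E <= \sum_(0 <= k <oo) (ck k * \1_(box (ak k) (bk k)) x)%:E) ->
  (c * vol a b)%:E <= \sum_(0 <= k <oo) (ck k * vol (ak k) (bk k))%:E.
Proof.
elim: n a b c ak bk ck => [|n IH] a b c ak bk ck c0 ck0 H.
  have bT (u v : 'rV[R]_0) : \1_(box u v) (const_mx 0%R : 'rV[R]_0) = 1%R :> R.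
    by rewrite indicE mem_set// => -[].
  have := H (const_mx 0%R); rewrite bT /vol big_ord0; under eq_eseriesr do rewrite bT.
  by under [X in _ -> _ <= X]eq_eseriesr do rewrite big_ord0.
pose I (u v : 'rV[R]_n.+1) : set R := `[u ord0 ord0, v ord0 ord0[%classic.
have mI u v : measurable (I u v) by exact: measurable_itv.
have intI u v : \int[lebesgue_measure]_t (\1_(I u v) t)%:E =
    (Num.max (v ord0 ord0 - u ord0 ord0) 0)%:E.
  rewrite integral_indic//; last exact: mI.
  rewrite setIT /= /I lebesgue_measure_itv/= lte_fin.
  by case: ltP => uv; rewrite ?EFinB; congr EFin; [rewrite max_l// subr_ge0 ltW|rewrite max_r// subr_le0].
have key t : (c * vol (row_tail a) (row_tail b))%:E * (\1_(I a b) t)%:E <=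
    \sum_(0 <= k <oo) (ck k * vol (row_tail (ak k)) (row_tail (bk k)))%:E * (\1_(I (ak k) (bk k)) t)%:E.
  rewrite -EFinM mulrAC; under eq_eseriesr do rewrite -EFinM mulrAC.
  apply: (IH (row_tail a) (row_tail b) (c * \1_(I a b) t)%R
    (fun k => row_tail (ak k)) (fun k => row_tail (bk k)) (fun k => ck k * \1_(I (ak k) (bk k)) t)%R); [by rewrite mulr_ge0|by move=> k; rewrite mulr_ge0|move=> v].
  have := H (row_cons t v); rewrite indic_box_cons mulrA.
  by under eq_eseriesr do rewrite indic_box_cons mulrA.
have vge0 u v : (0 <= vol (row_tail u) (row_tail v :> 'rV[R]_n))%R by exact: vol_ge0.
have mind u v : measurable_fun [set: R] (fun t : R => (\1_(I u v) t : R)%:E).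
  by apply/measurable_EFinP; exact: measurable_indic.
rewrite vol_rec mulrCA mulrC EFinM -intI -ge0_integralZl//; [|exact: mind|by rewrite lee_fin mulr_ge0].
apply: (@le_trans _ _ (\int[lebesgue_measure]_t (\sum_(0 <= k <oo)
    (ck k * vol (row_tail (ak k)) (row_tail (bk k)))%:E * (\1_(I (ak k) (bk k)) t)%:E))).
  apply: ge0_le_integral => //.
  - by move=> t _; rewrite mule_ge0// lee_fin ?mulr_ge0.
  - by apply: measurable_funeM; exact: mind.
  - apply: ge0_emeasurable_sum => k.
      by move=> t _ _; rewrite mule_ge0// lee_fin ?mulr_ge0.
    by move=> _; apply: measurable_funeM; exact: mind.
rewrite integral_nneseries//; last 2 first.
  by move=> k; apply: measurable_funeM; exact: mind.
  by move=> k t _; rewrite mule_ge0// lee_fin ?mulr_ge0.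
apply: lee_nneseries => [k _ _|k _].
  by apply: integral_ge0 => t _; rewrite mule_ge0// lee_fin ?mulr_ge0.
rewrite ge0_integralZl//; [|exact: mind|by rewrite lee_fin mulr_ge0].
by rewrite intI -EFinM vol_rec mulrCA [X in (X%:E <= _)]mulrC.
Qed.

Lemma leb_out_box n (a b : 'rV[R]_n.+1) : leb_out (box a b) = (vol a b)%:E.
Proof.
apply/eqP; rewrite eq_le leb_out_box_le/=.
apply/le_ereal_inf_tmp => _ [ak [bk [abk ->]]].
rewrite -[vol a b]mul1r; apply: le_trans (@vol_le_series _ _ _ _ ak bk (fun=> 1%R) _ _ _) _ => //.
  move=> x; rewrite mul1r indicE; have [/set_mem/abk [k _ xk]|xn] := boolP (x \in _); last first.
    by apply: nneseries_ge0 => k _ _; rewrite lee_fin mulr_ge0.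
  rewrite (@nneseriesD1 _ _ k) => [|j _|//]; last by rewrite lee_fin mulr_ge0.
  rewrite mul1r indicE mem_set// leeDl//.
  by apply: nneseries_ge0 => j _ _; rewrite lee_fin mulr_ge0.
by under eq_eseriesr do rewrite mul1r.
Qed.

End LebOut.

(** * Measurable sets and slicing in R^n *)

Section RowMeasurable.
Context {R : realType}.

Definition boxes n : set (set 'rV[R]_n) := [set A | exists a b, A = box a b].

Definition row_display : measure_display. Proof. exact. Qed.

Lemma boxes_set0 n : <<s @boxes n >> set0.
Proof. exact: sigma_algebra0. Qed.
Lemma boxes_setC n A : <<s @boxes n >> A -> <<s @boxes n >> (~` A).
Proof. exact: sigma_algebraC. Qed.
Lemma boxes_bigcup n (F : (set 'rV[R]_n)^nat) : (forall i, <<s @boxes n >> (F i)) ->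
  <<s @boxes n >> (\bigcup_i F i).
Proof. exact: sigma_algebra_bigcup. Qed.

HB.instance Definition _ n := @isMeasurable.Build row_display 'rV[R]_n
  <<s @boxes n >> (@boxes_set0 n) (@boxes_setC n) (@boxes_bigcup n).

Lemma measurable_box n (a b : 'rV[R]_n) : measurable (box a b).
Proof. by apply: sub_sigma_algebra; exists a, b. Qed.

Lemma measurable_coord n (k : 'I_n) :
  measurable_fun [set: 'rV[R]_n] (fun x : 'rV[R]_n => x ord0 k).
Proof.
move=> _; apply: (measurability _ (RGenInftyO.measurableE R)) => // _ [_ [c ->] <-].
rewrite setTI (_ : _ @^-1` _ = \bigcup_(N in [set: nat])
    box (const_mx (- N%:R)) (\row_j (if j == k then c else N%:R))).
  by apply: bigcupT_measurable => N; exact: measurable_box.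
apply/seteqP; split => [x /=|x [N _ /(_ k)]]; last first.
  by rewrite !mxE eqxx /= in_itv/= => /andP[].
rewrite in_itv/= => xc.
have [N xN] : exists N : nat, forall j, `|x ord0 j| < N%:R.
  exists (Num.truncn (\sum_j `|x ord0 j|)).+1 => j.
  apply: le_lt_trans (truncnS_gt _).
  by rewrite (bigD1 j)//= lerDl sumr_ge0.
exists N => // j; rewrite !mxE.
have /ltr_normlP[xN1 xN2] := xN j.
by apply/andP; split; [rewrite lerNl ltW|case: eqP => [->|]].
Qed.

Lemma measurable_fun_row d (T : measurableType d) n (f : T -> 'rV[R]_n) :
  (forall k, measurable_fun [set: T] (fun x => f x ord0 k)) ->
  measurable_fun [set: T] f.
Proof.
move=> mf _; apply: (@measurability _ _ _ 'rV[R]_n _ f (@boxes n)) => //.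
move=> _ [_ [a [b ->]] <-]; rewrite setTI.
rewrite (_ : _ @^-1` _ = \bigcap_(k in [set: 'I_n]) ((fun x => f x ord0 k) @^-1` `[a ord0 k, b ord0 k[%classic)).
  apply: fin_bigcap_measurable => // k _.
  by rewrite -[X in measurable X]setTI; apply: mf => //; exact: measurable_itv.
apply/seteqP; split => [x fx k _|x fx k]; first by rewrite /= in_itv/=; exact: fx.
by have := fx k I; rewrite /= in_itv.
Qed.

End RowMeasurable.

(** * Lebesgue measure on R^n and iterated integrals *)

Section Leb.
Context {R : realType}.

(** Two measurable structures live on the same vectors: ['rV] carries the sigma-algebra generated by
    boxes, suited to slicing, while this alias carries the Caratheodory sigma-algebra, which is the
    one that [leb_measurable], and hence [L2], refers to. *)
Definition lebT n := caratheodory_type (@leb_out R n.+1).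
HB.instance Definition _ n := Measurable.on (lebT n).

Definition leb n : set (lebT n) -> \bar R := @leb_out R n.+1.

HB.instance Definition _ n := isMeasure.Build _ _ _ (@leb n)
  (caratheodory_measure0 (@leb_out R n.+1))
  (@caratheodory_measure_ge0 _ _ (@leb_out R n.+1))
  (@caratheodory_measure_sigma_additive _ _ (@leb_out R n.+1)).

(** The hyperplane cuts each box of a cover into two boxes whose volumes add up, degenerate cases
    included, so any cover splits into covers of the two parts at no extra cost. *)
Lemma caratheodory_halfspace n (k : 'I_n.+1) (c : R) :
  (@leb_out R n.+1).-caratheodory [set x | x ord0 k < c].
Proof.
apply: le_caratheodory_measurable => X.
set H := [set x | _].
pose lo (b : 'rV[R]_n.+1) : 'rV[R]_n.+1 := \row_j (if j == k then Num.min (b ord0 j) c else b ord0 j).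
pose hi (a : 'rV[R]_n.+1) : 'rV[R]_n.+1 := \row_j (if j == k then Num.max (a ord0 j) c else a ord0 j).
have volE a b : vol a b = vol a (lo b) + vol (hi a) b.
  rewrite /vol (bigD1 k)//= [X in _ = X + _](bigD1 k)//= [X in _ = _ + X](bigD1 k)//=.
  rewrite !mxE eqxx.
  rewrite [X in _ = _ * X + _](eq_bigr (fun j => Num.max (b ord0 j - a ord0 j) 0)) => [|j /negbTE jk]; last first.
    by rewrite !mxE jk.
  rewrite [X in _ = _ + _ * X](eq_bigr (fun j => Num.max (b ord0 j - a ord0 j) 0)) => [|j /negbTE jk]; last first.
    by rewrite !mxE jk.
  rewrite -mulrDl; congr (_ * _).
  have [bc|cb] := leP (b ord0 k) c; have [ac|ca] := leP (a ord0 k) c;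
  do ![case: ltP => ?]; lra.
apply/le_ereal_inf_tmp => _ [a [b [Xab ->]]].
under [leRHS]eq_eseriesr do rewrite volE EFinD.
rewrite nneseriesD; [|by move=> i _; rewrite lee_fin vol_ge0..].
apply: leeD; rewrite /= leb_outE.
  apply: (@cover_out_le _ _ _ _ _ _ (fun i => (a i, lo (b i)))).
  move=> x [/Xab[i _ xi] xc]; exists i => // j /=; rewrite mxE.
  have /andP[-> xb] := xi j; case: eqP => [jk|//].
  by rewrite lt_min xb jk.
apply: (@cover_out_le _ _ _ _ _ _ (fun i => (hi (a i), b i))).
move=> x [/Xab[i _ xi] xc]; exists i => // j /=; rewrite mxE.
have /andP[ax ->] := xi j; case: eqP => [jk|_]; rewrite ?ax//.
by rewrite ge_max ax jk leNgt; move/negP : xc => ->.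
Qed.

Lemma measurable_coordT n (k : 'I_n.+1) :
  measurable_fun [set: lebT n] (fun x : lebT n => (x : 'rV[R]_n.+1) ord0 k).
Proof.
move=> _; apply: (measurability _ (RGenInftyO.measurableE R)) => // _ [_ [c ->] <-].
rewrite setTI (_ : _ @^-1` _ = [set x : 'rV[R]_n.+1 | x ord0 k < c]).
  exact: caratheodory_halfspace.
by apply/seteqP; split => x /=; rewrite in_itv.
Qed.

Lemma measurable_lebT_row n : measurable_fun [set: lebT n] (id : lebT n -> 'rV[R]_n.+1).
Proof. by apply: measurable_fun_row => k; exact: measurable_coordT. Qed.

Lemma measurable_row_leb n (A : set 'rV[R]_n.+1) : measurable A ->
  (leb_measurable A : Prop).
Proof.
move=> mA; have := @measurable_lebT_row n measurableT A mA.
by rewrite setTI.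
Qed.

Lemma leb_cube_fin n (k : nat) :
  (leb_out (box (const_mx (- k%:R)%R) (const_mx k%:R%R) : set 'rV[R]_n.+1) < +oo)%E.
Proof. by rewrite leb_out_box ltry. Qed.

Lemma bigcup_cube n :
  \bigcup_k box (const_mx (- k%:R)) (const_mx k%:R) = [set: 'rV[R]_n].
Proof.
apply/seteqP; split => // x _.
exists (Num.truncn (\sum_j `|x ord0 j|)).+1 => // j; rewrite !mxE.
have : `|x ord0 j| < (Num.truncn (\sum_j `|x ord0 j|)).+1%:R.
  apply: le_lt_trans (truncnS_gt _).
  by rewrite (bigD1 j)//= lerDl sumr_ge0.
by move=> /ltr_normlP[? ->]; rewrite andbT lerNl ltW.
Qed.

Lemma leb_sigma_finite n : sigma_finite [set: lebT n] (@leb n).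
Proof.
exists (fun k => box (const_mx (- k%:R)) (const_mx k%:R)); first by rewrite bigcup_cube.
move=> k; split; last exact: leb_cube_fin.
by apply: measurable_row_leb; exact: measurable_box.
Qed.

HB.instance Definition _ n := Measure_isSigmaFinite.Build _ _ _ (@leb n)
  (@leb_sigma_finite n).

(* [leb] restricted to the sigma-algebra of boxes *)
Definition lebB n : set 'rV[R]_n.+1 -> \bar R := pushforward (@leb n) (id : lebT n -> 'rV[R]_n.+1).
HB.instance Definition _ n := Measure.copy (@lebB n)
  (measure_function_pushforward__canonical__measure_function_Measure (@leb n) (@measurable_lebT_row n)).

Lemma lebBE n (A : set 'rV[R]_n.+1) : lebB A = leb_out A.
Proof. by []. Qed.

Lemma lebB_sigma_finite n : sigma_finite [set: 'rV[R]_n.+1] (@lebB n).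
Proof.
exists (fun k => box (const_mx (- k%:R)) (const_mx k%:R)); first by rewrite bigcup_cube.
by move=> k; split; [exact: measurable_box|exact: leb_cube_fin].
Qed.

HB.instance Definition _ n := Measure_isSigmaFinite.Build _ _ _ (@lebB n)
  (@lebB_sigma_finite n).

Lemma boxI n (a b a' b' : 'rV[R]_n) : box a b `&` box a' b' =
  box (\row_j Num.max (a ord0 j) (a' ord0 j)) (\row_j Num.min (b ord0 j) (b' ord0 j)).
Proof.
apply/seteqP; split => [x [h h'] k|x h].
  by rewrite !mxE ge_max lt_min; have /andP[-> ->] := h k; have /andP[-> ->] := h' k.
split => k; have := h k; rewrite !mxE ge_max lt_min.
  by move=> /andP[/andP[-> _] /andP[-> _]].
by move=> /andP[/andP[_ ->] /andP[_ ->]].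
Qed.

(** Boxes are stable under intersection, generate the sigma-algebra and exhaust the space with
    finite measure. This identifies Lebesgue measure with the image of a product measure, whence the
    slicing formulas. *)
Lemma lebB_unique n (m : {measure set 'rV[R]_n.+1 -> \bar R}) :
  (forall a b, m (box a b) = (vol a b)%:E) ->
  forall A, measurable A -> m A = leb_out A.
Proof.
move=> mE A mA; rewrite -lebBE.
apply: (measure_unique (@boxes R n.+1) (fun k => box (const_mx (- k%:R)) (const_mx k%:R))) => //.
- by move=> _ _ [a [b ->]] [a' [b' ->]]; rewrite boxI; eexists; eexists.
- by move=> k; eexists; eexists.
- by rewrite bigcup_cube.
- by move=> _ [a [b ->]]; rewrite mE -leb_out_box.
- by move=> k; rewrite mE ltry.
Qed.

Lemma integral_lebB_ge0 n (f : 'rV[R]_n.+1 -> \bar R) : measurable_fun [set: 'rV[R]_n.+1] f ->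
  (forall x, 0 <= f x)%E -> (\int[@leb n]_x f x = \int[@lebB n]_x f x)%E.
Proof.
move=> mf f0.
by rewrite (@ge0_integral_pushforward _ _ _ _ _ _ (@measurable_lebT_row n))//.
Qed.

Lemma measurable_row_cons n :
  measurable_fun [set: R * 'rV[R]_n] (fun z => row_cons z.1 z.2).
Proof.
apply: measurable_fun_row => k; case: (unliftP ord0 k) => [j ->|->].
  rewrite (_ : (fun _ => _) = (fun v : 'rV[R]_n => v ord0 j) \o snd); last first.
    by apply/funext => z /=; rewrite row_consS.
  by apply: measurableT_comp => //; exact: measurable_coord.
rewrite (_ : (fun _ => _) = fst)//.
by apply/funext => z /=; rewrite row_cons0.
Qed.

Definition cons_measure n : {measure set 'rV[R]_n.+2 -> \bar R} :=
  measure_function_pushforward__canonical__measure_function_Measure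
    (lebesgue_measure \x @lebB n)%E (@measurable_row_cons n.+1).

Lemma lebesgue_itv_co (a b : R) :
  lebesgue_measure (`[a, b[%classic : set R) = (Num.max (b - a) 0)%:E.
Proof.
rewrite lebesgue_measure_itv/= lte_fin.
by case: ltP => ab; congr EFin; [rewrite max_l// subr_ge0 ltW|rewrite max_r// subr_le0].
Qed.

Lemma cons_measureE n (A : set 'rV[R]_n.+2) : measurable A -> cons_measure n A = leb_out A.
Proof.
apply: lebB_unique => a b; rewrite /cons_measure/= /pushforward.
rewrite (_ : _ @^-1` _ = `[a ord0 ord0, b ord0 ord0[%classic `*` box (row_tail a) (row_tail b)).
  rewrite product_measure1E//; last exact: measurable_box.
  by rewrite vol_rec EFinM -lebesgue_itv_co -leb_out_box.
apply/seteqP; split => -[t v] /=; first by move=> /box_cons[]; rewrite in_itv.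
by rewrite in_itv/= => -[? ?]; apply/box_cons.
Qed.

Lemma integral_slice_ge0 n (f : 'rV[R]_n.+2 -> \bar R) : measurable_fun [set: 'rV[R]_n.+2] f ->
  (forall x, 0 <= f x)%E ->
  (\int[@lebB n.+1]_x f x =
   \int[lebesgue_measure \x @lebB n]_z f (row_cons z.1 z.2))%E.
Proof.
move=> mf f0; transitivity (\int[pushforward (lebesgue_measure \x @lebB n) (fun z => row_cons z.1 z.2)]_x f x)%E.
  by apply: (@eq_measure_integral _ _ _ _ (cons_measure n)) => A mA _; rewrite cons_measureE.
by rewrite ge0_integral_pushforward//; exact: measurable_row_cons.
Qed.

Lemma measurable_row1 : measurable_fun [set: R] (fun t : R => const_mx t : 'rV[R]_1).
Proof.
apply: measurable_fun_row => k; rewrite (_ : (fun _ => _) = id)//.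
by apply/funext => t; rewrite mxE.
Qed.

Definition row1_measure : {measure set 'rV[R]_1 -> \bar R} :=
  measure_function_pushforward__canonical__measure_function_Measure
    lebesgue_measure measurable_row1.

Lemma row1_measureE (A : set 'rV[R]_1) : measurable A -> row1_measure A = leb_out A.
Proof.
apply: (@lebB_unique 0) => a b; rewrite /row1_measure/= /pushforward.
rewrite (_ : _ @^-1` _ = `[a ord0 ord0, b ord0 ord0[%classic).
  by rewrite /vol big_ord1 lebesgue_itv_co.
apply/seteqP; split => t /=; first by move=> /(_ ord0); rewrite mxE in_itv.
by rewrite in_itv/= => h k; rewrite mxE (_ : k = ord0)//; apply/val_inj; case: k => -[].
Qed.

Lemma integral_row1_ge0 (f : 'rV[R]_1 -> \bar R) : measurable_fun [set: 'rV[R]_1] f ->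
  (forall x, 0 <= f x)%E ->
  (\int[@lebB 0]_x f x = \int[lebesgue_measure]_t f (const_mx t))%E.
Proof.
move=> mf f0; transitivity (\int[pushforward lebesgue_measure (fun t => const_mx t : 'rV[R]_1)]_x f x)%E.
  by apply: (@eq_measure_integral _ _ _ _ row1_measure) => A mA _; rewrite row1_measureE.
by rewrite ge0_integral_pushforward//; exact: measurable_row1.
Qed.

Lemma integral_prod_ge0 n (h : 'I_n.+1 -> R -> R) (c : 'I_n.+1 -> R) :
  (forall k, measurable_fun [set: R] (h k)) -> (forall k t, 0 <= h k t) ->
  (forall k, \int[lebesgue_measure]_t (h k t)%:E = (c k)%:E)%E ->
  (\int[@lebB n]_x (\prod_k h k (x ord0 k))%:E = (\prod_k c k)%:E)%E.
Proof.
have mprod m (g : 'I_m -> R -> R) : (forall k, measurable_fun [set: R] (g k)) ->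
    measurable_fun [set: 'rV[R]_m] (fun x => \prod_k g k (x ord0 k)).
  move=> mg; apply: measurable_prod => k _.
  by apply: (measurableT_comp (mg k)); exact: measurable_coord.
elim: n h c => [|n IH] h c mh h0 hc.
  rewrite integral_row1_ge0.
  - under eq_integral do rewrite big_ord1 mxE.
    by rewrite big_ord1 hc.
  - by apply/measurable_EFinP; exact: mprod.
  - by move=> x; rewrite lee_fin prodr_ge0.
have pE z : \prod_k h k (row_cons z.1 z.2 ord0 k) =
    h ord0 z.1 * \prod_k h (lift ord0 k) (z.2 ord0 k) :> R.
  by rewrite big_ord_recl row_cons0; congr (_ * _); apply: eq_bigr => k _; rewrite row_consS.
have c0 : 0 <= c ord0.
  by rewrite -lee_fin -hc; apply: integral_ge0 => t _; rewrite lee_fin.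
rewrite integral_slice_ge0; last 2 first.
- by apply/measurable_EFinP; exact: mprod.
- by move=> x; rewrite lee_fin prodr_ge0.
under eq_integral do rewrite pE EFinM.
have mt : measurable_fun [set: 'rV[R]_n.+1] (fun v => \prod_k h (lift ord0 k) (v ord0 k)).
  by apply: (mprod _ (fun k => h (lift ord0 k))) => k; exact: mh.
rewrite fubini_tonelli1/=; last 2 first.
- apply: emeasurable_funM; apply/measurable_EFinP.
    exact: (measurableT_comp (mh ord0) measurable_fst).
  exact: (measurableT_comp mt measurable_snd).
- by move=> z; rewrite mule_ge0// lee_fin ?prodr_ge0.
rewrite /fubini_F /=.
under eq_integral => t _.
  rewrite ge0_integralZl//; last 3 first.
  + by apply/measurable_EFinP; exact: mt.
  + by move=> v _; rewrite lee_fin prodr_ge0.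
  + by rewrite lee_fin.
  rewrite (IH (fun k => h (lift ord0 k)) (fun k => c (lift ord0 k)))//.
  over.
rewrite ge0_integralZr//; last 3 first.
- by apply/measurable_EFinP; exact: mh.
- by move=> t _; rewrite lee_fin.
- rewrite lee_fin; apply: prodr_ge0 => k _; rewrite -lee_fin -hc.
  by apply: integral_ge0 => t _; rewrite lee_fin.
by rewrite hc -EFinM [in RHS]big_ord_recl.
Qed.

End Leb.

Lemma integrable_prodM {R : realType} d1 d2 (T1 : measurableType d1) (T2 : measurableType d2)
    (m1 : {sigma_finite_measure set T1 -> \bar R}) (m2 : {sigma_finite_measure set T2 -> \bar R})
    (f : T1 -> R) (g : T2 -> R) :
  m1.-integrable setT (EFin \o f) -> m2.-integrable setT (EFin \o g) ->
  (m1 \x m2)%E.-integrable setT (fun z => (f z.1 * g z.2)%:E).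
Proof.
move=> intf intg.
have mf : measurable_fun setT f by apply/measurable_EFinP; exact: measurable_int intf.
have mg : measurable_fun setT g by apply/measurable_EFinP; exact: measurable_int intg.
have mfg : measurable_fun setT (fun z : T1 * T2 => (f z.1 * g z.2)%:E).
  apply/measurable_EFinP/measurable_funM.
    exact: (measurableT_comp mf measurable_fst).
  exact: (measurableT_comp mg measurable_snd).
apply/integrable12ltyP => //=.
under eq_integral => x _.
  under eq_integral do rewrite normrM EFinM.
  rewrite ge0_integralZl//; last first.
    by apply/measurable_EFinP; exact: measurableT_comp.
  over.
rewrite ge0_integralZr//.
- by apply: lte_mul_pinfty; [exact: integral_ge0| |]; [rewrite ge0_fin_numE ?integral_ge0//|];
    [case/integrableP : intf|case/integrableP : intg].
- by apply/measurable_EFinP; exact: measurableT_comp.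
- exact: integral_ge0.
Qed.

(** * Invariance, closed sets, the layer-cake integral and transforms of product weights *)

Section LebMore.
Context {R : realType}.

Lemma leb_out_shift n (z : 'rV[R]_n) (A : set 'rV[R]_n) : leb_out [set x | A (x + z)] = leb_out A.
Proof.
have H (w : 'rV[R]_n) (B : set 'rV[R]_n) : (leb_out [set x | B (x + w)%R] <= leb_out B)%E.
  apply/le_ereal_inf_tmp => _ [a [b [Bab ->]]].
  rewrite (_ : \sum_(0 <= k <oo) _ = \sum_(0 <= k <oo) (vol (a k - w)%R (b k - w)%R)%:E)%E.
    apply: ereal_inf_lbound; exists (fun k => a k - w), (fun k => b k - w); split => //.
    move=> x /Bab[k _ xk]; exists k => // j; have := xk j; rewrite !mxE.
    by rewrite lerBlDr ltrBrDr.
  apply: eq_eseriesr => k _; congr EFin; apply: eq_bigr => j _; rewrite !mxE.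
  by congr Num.max; ring.
apply/eqP; rewrite eq_le H/= -[leLHS](_ : leb_out [set x | [set x | A (x + z)] (x - z)] = _).
  exact: H.
by congr leb_out; apply/seteqP; split => x /=; rewrite addrNK.
Qed.

Lemma leb_out_scale n (r : R) (A : set 'rV[R]_n) : 0 < r ->
  leb_out (scale_set r A) = ((r ^+ n)%:E * leb_out A)%E.
Proof.
have H s (B : set 'rV[R]_n) : 0 < s -> (leb_out (scale_set s B) <= (s ^+ n)%:E * leb_out B)%E.
  move=> s0; rewrite -lee_pdivrMl ?exprn_gt0//.
  apply/le_ereal_inf_tmp => _ [a [b [Bab ->]]].
  rewrite lee_pdivrMl ?exprn_gt0// -nneseriesZl//; last by move=> i _; rewrite lee_fin vol_ge0.
  rewrite (_ : \sum_(0 <= k <oo) _ = \sum_(0 <= k <oo) (vol (s *: a k)%R (s *: b k)%R)%:E)%E.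
    apply: ereal_inf_lbound; exists (fun k => s *: a k), (fun k => s *: b k); split => //.
    move=> _ [x /Bab[k _ xk] <-]; exists k => // j; have := xk j; rewrite !mxE.
    by rewrite ler_pM2l// ltr_pM2l.
  apply: eq_eseriesr => k _; rewrite -EFinM; congr EFin.
  have -> : s ^+ n = \prod_(j < n) s by rewrite prodr_const card_ord.
  rewrite /vol -big_split/=; apply: eq_bigr => j _.
  by rewrite !mxE -mulrBr -[in RHS](mulr0 s) maxr_pMr// ltW.
move=> r0; apply/eqP; rewrite eq_le H//= -lee_pdivlMl ?exprn_gt0//.
rewrite -exprVn; apply: le_trans (H _ _ _); last by rewrite invr_gt0.
apply: le_leb_out => x Ax; exists (r *: x); first by exists x.
by rewrite scalerA mulVf ?gt_eqF// scale1r.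
Qed.

Lemma itv_dist (q p x y : R) : q <= x -> x < q + p -> q <= y -> y < q + p -> `|x - y| < p.
Proof. by move=> *; rewrite ltr_norml; apply/andP; split; lra. Qed.

(** K is the intersection over N of the unions of those cells of side 1 / (N + 1) that meet it: a
    point of all these unions is a limit of points of K. *)
Lemma closed_row_measurable n (K : set 'rV[R]_n.+1) : closed K -> measurable K.
Proof.
move=> cK.
pose lo N (i : 'rV[int]_n.+1) : 'rV[R]_n.+1 := \row_j ((i ord0 j)%:~R / N.+1%:R).
pose hi N (i : 'rV[int]_n.+1) : 'rV[R]_n.+1 := \row_j (((i ord0 j)%:~R + 1) / N.+1%:R).
pose F N (i : 'rV[int]_n.+1) := if `[< box (lo N i) (hi N i) `&` K !=set0 >] then box (lo N i) (hi N i) else set0.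
rewrite (_ : K = \bigcap_N \bigcup_i F N i).
  apply: bigcapT_measurable => N; apply: countable_bigcupT_measurable.
    exact: countableP.
  by move=> i; rewrite /F; case: ifP => _; [exact: measurable_box|exact: measurable0].
apply/seteqP; split => [x Kx N _|x xF].
  pose i : 'rV[int]_n.+1 := \row_j Num.floor (x ord0 j * N.+1%:R).
  exists i => //; rewrite /F.
  have bx : box (lo N i) (hi N i) x.
    move=> j; rewrite !mxE ler_pdivrMr// ltr_pdivlMr//.
    by rewrite floor_le_tmp -intrD1 floorD1_gt.
  by rewrite asboolT//; exists x.
apply: cK => B /nbhs_ballP[e /= e0 xB].
have [N Ne] : exists N : nat, N.+1%:R^-1 < e.
  exists (Num.truncn e^-1); rewrite -[ltRHS]invrK ltf_pV2 ?posrE ?invr_gt0//.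
  exact: truncnS_gt.
have [i _] := xF N I; rewrite /F; case: ifPn => // /asboolP[y [yb Ky]] xb.
exists y; split => //; apply: xB; split => // a j.
rewrite (_ : a = ord0); last by apply/val_inj; case: a => -[].
have := xb j; have := yb j; rewrite !mxE mulrDl mul1r => /andP[y1 y2] /andP[x1 x2].
have xy : `|x ord0 j - y ord0 j| < N.+1%:R^-1.
  exact: (itv_dist x1 x2 y1 y2).
by rewrite -ball_normE; exact: lt_trans xy Ne.
Qed.

Lemma leb_measurable_funP n (h : 'rV[R]_n.+1 -> R) :
  leb_measurable_fun h <-> measurable_fun [set: lebT n] h.
Proof.
split=> [mh|mh t].
  move=> _; apply: (measurability _ (RGenOInfty.measurableE R)) => // _ [_ [t ->] <-].
  rewrite setTI (_ : _ @^-1` _ = [set x | t < h x]); first exact: mh.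
  by apply/seteqP; split => x /=; rewrite in_itv/= andbT.
have := mh measurableT `]t, +oo[%classic (measurable_itv _).
rewrite setTI (_ : _ @^-1` _ = [set x | t < h x]) => [//|].
by apply/seteqP; split => x /=; rewrite in_itv/= andbT.
Qed.

Lemma measurable_fun_lebT n d (T : measurableType d) (h : 'rV[R]_n.+1 -> T) :
  measurable_fun [set: 'rV[R]_n.+1] h -> measurable_fun [set: lebT n] h.
Proof. by move=> mh; exact: (measurableT_comp mh (@measurable_lebT_row _ n)). Qed.

(* The layer-cake formula, by Tonelli on the region under the graph. *)
Lemma nnintE n (h : 'rV[R]_n.+1 -> R) : measurable_fun [set: lebT n] h ->
  (forall x, 0 <= h x) -> (nnint h = \int[@leb _ n]_x (h x)%:E)%E.
Proof.
move=> mh h0; pose D : set (R * lebT n) := [set z | (0 <= z.1) && (z.1 < h z.2)].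
have mD : measurable D.
  rewrite (_ : D = (fst @^-1` `[0%R, +oo[%classic) `&` (fun z => h z.2 - z.1) @^-1` `]0%R, +oo[%classic).
    apply: measurableI; rewrite -[X in measurable X]setTI.
      exact: measurable_fst.
    apply: measurable_funB => //.
    exact: (measurableT_comp mh measurable_snd).
  apply/seteqP; split => z /=; rewrite !in_itv/= !andbT subr_gt0.
    by move=> /andP[].
  by move=> [? ?]; apply/andP.
have mf : measurable_fun setT (fun z : R * lebT n => (\1_D z : R)%:E).
  by apply/measurable_EFinP; exact: measurable_indic.
have f0 z : (0 <= (\1_D z : R)%:E)%E by rewrite lee_fin.
rewrite /nnint integral_mkcond.
transitivity (\int[lebesgue_measure]_t \int[@leb R n]_x (\1_D (t, x) : R)%:E)%E.
  apply: eq_integral => t _; rewrite patchE; case: ifPn => [/set_mem/=|/negP t0].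
    rewrite in_itv/= andbT => t0.
    rewrite (_ : (fun y => _) = (fun y : lebT n => (\1_([set x : lebT n | t < h x]) y : R)%:E)).
      rewrite integral_indic ?setIT//.
      exact: (leb_measurable_funP h).2.
    apply/funext => y; congr (_%:E); rewrite !indicE; congr (nat_of_bool _)%:R.
    by apply/idP/idP => /set_mem/=; [move=> /andP[_ ?]|move=> ?]; apply/mem_set; rewrite /D/= ?t0.
  rewrite integral0_eq// => y _; rewrite indicE memNset// /D/= => /andP[t1 _].
  by apply: t0; apply/mem_set; rewrite /= in_itv/= t1.
rewrite (@fubini_tonelli _ _ _ _ _ (@lebesgue_measure R) (@leb R n) _ mf f0).
apply: eq_integral => x _.
rewrite (_ : (fun t => _) = (fun t : R => (\1_(`[0%R, h x[%classic) t : R)%:E)).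
  by rewrite integral_indic// setIT /= lebesgue_itv_co subr0 max_l.
apply/funext => t; congr (_%:E); rewrite !indicE; congr (nat_of_bool _)%:R.
Qed.

Lemma nnint_shift n (h : 'rV[R]_n -> R) z : nnint (fun x => h (x + z)) = nnint h.
Proof.
by apply: eq_integral => t _; exact: (leb_out_shift z [set x | t < h x]).
Qed.

Lemma integral_shift n (h : 'rV[R]_n.+1 -> R) z : measurable_fun [set: 'rV[R]_n.+1] h ->
  (forall x, 0 <= h x) ->
  (\int[@leb _ n]_x (h ((x : 'rV[R]_n.+1) + z))%:E = \int[@leb _ n]_x (h x)%:E)%E.
Proof.
move=> mh h0; rewrite -!nnintE//; first exact: nnint_shift.
  exact: measurable_fun_lebT.
apply: measurable_fun_lebT; apply: (measurableT_comp mh); apply: measurable_fun_row => k.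
under eq_fun do rewrite mxE.
by apply: measurable_funD => //; exact: measurable_coord.
Qed.

Lemma integral_slice n (f : 'rV[R]_n.+2 -> \bar R) : measurable_fun [set: 'rV[R]_n.+2] f ->
  (\int[@lebB _ n.+1]_x f x =
   \int[lebesgue_measure \x @lebB _ n]_z f (row_cons z.1 z.2))%E.
Proof.
move=> mf.
have Ep : (fun z : R * 'rV[R]_n.+1 => f^\+ (row_cons z.1 z.2))%E = (fun z => f (row_cons z.1 z.2))^\+%E.
  exact: esym (funepos_comp f _).
have En : (fun z : R * 'rV[R]_n.+1 => f^\- (row_cons z.1 z.2))%E = (fun z => f (row_cons z.1 z.2))^\-%E.
  exact: esym (funeneg_comp f _).
rewrite integralE [RHS]integralE !integral_slice_ge0//.
- by rewrite Ep En.
- exact: measurable_funeneg.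
- exact: measurable_funepos.
Qed.

Lemma integral_row1 (f : 'rV[R]_1 -> \bar R) : measurable_fun [set: 'rV[R]_1] f ->
  (\int[@lebB _ 0]_x f x = \int[lebesgue_measure]_t f (const_mx t))%E.
Proof.
move=> mf.
have Ep : (fun z : R => f^\+ (const_mx z))%E = (fun z => f (const_mx z))^\+%E.
  exact: esym (funepos_comp f _).
have En : (fun z : R => f^\- (const_mx z))%E = (fun z => f (const_mx z))^\-%E.
  exact: esym (funeneg_comp f _).
rewrite integralE [RHS]integralE !integral_row1_ge0//.
- by rewrite Ep En.
- exact: measurable_funeneg.
- exact: measurable_funepos.
Qed.

Lemma dotp_cons n (z : 'rV[R]_n.+1) t v :
  dotp z (row_cons t v) = z ord0 ord0 * t + dotp (row_tail z) v.
Proof.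
rewrite /dotp big_ord_recl row_cons0; congr (_ + _).
by apply: eq_bigr => k _; rewrite row_consS mxE.
Qed.

Lemma measurable_dotp n (z : 'rV[R]_n) : measurable_fun [set: 'rV[R]_n] (dotp z).
Proof.
apply: measurable_sum => k; apply: measurable_funM => //; exact: measurable_coord.
Qed.

Lemma measurable_prod_coord n (h : R -> R) : measurable_fun [set: R] h ->
  measurable_fun [set: 'rV[R]_n] (fun x => \prod_k h (x ord0 k)).
Proof.
move=> mh; apply: measurable_prod => k _.
by apply: (measurableT_comp mh); exact: measurable_coord.
Qed.

Section ProdCos.
Variables (h C : R -> R).
Hypotheses (mh : measurable_fun [set: R] h) (h0 : forall t, 0 <= h t).
Hypothesis hcos : forall s, (\int[lebesgue_measure]_t (h t * cos (s * t))%:E = (C s)%:E)%E.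
Hypothesis hsin : forall s, (\int[lebesgue_measure]_t (h t * sin (s * t))%:E = 0)%E.

Lemma integrable_prod_coord n (f : 'rV[R]_n.+1 -> R) :
  measurable_fun [set: 'rV[R]_n.+1] f -> (forall x, `|f x| <= 1) ->
  (@lebB R n).-integrable setT (fun x => (\prod_k h (x ord0 k) * f x)%:E).
Proof.
move=> mf f1; apply: (@le_integrable _ _ _ (@lebB R n) _ _ _ (fun x => (\prod_k h (x ord0 k))%:E)) => //.
- by apply/measurable_EFinP/measurable_funM => //; exact: measurable_prod_coord.
- move=> x _; rewrite /= lee_fin normrM -[leRHS]mulr1 ler_wpM2l//.
apply/integrableP; split; first by apply/measurable_EFinP; exact: measurable_prod_coord.
under eq_integral do rewrite /= ger0_norm ?prodr_ge0//.
rewrite (@integral_prod_ge0 _ _ (fun=> h) (fun=> C 0)) ?ltry// => k.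
by rewrite -hcos; apply: eq_integral => t _; rewrite mul0r cos0 mulr1.
Qed.

(** The Fourier transform of an even product weight in real form. Cosine and sine are treated
    together because the addition formulas, used to split off the first coordinate, mix them. *)
Lemma integral_prod_cos n (z : 'rV[R]_n.+1) :
  (\int[@lebB _ n]_x (\prod_k h (x ord0 k) * cos (dotp z x))%:E = (\prod_k C (z ord0 k))%:E)%E /\
  (\int[@lebB _ n]_x (\prod_k h (x ord0 k) * sin (dotp z x))%:E = 0)%E.
Proof.
have mcosd m (w : 'rV[R]_m) : measurable_fun [set: 'rV[R]_m] (fun x => cos (dotp w x)).
  apply: measurableT_comp; last exact: measurable_dotp.
  by apply: continuous_measurable_fun => x; exact: continuous_cos.
have msind m (w : 'rV[R]_m) : measurable_fun [set: 'rV[R]_m] (fun x => sin (dotp w x)).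
  apply: measurableT_comp; last exact: measurable_dotp.
  by apply: continuous_measurable_fun => x; exact: continuous_sin.
have cos1 (x : R) : `|cos x| <= 1 by rewrite ler_norml cos_geN1 cos_le1.
have sin1 (x : R) : `|sin x| <= 1 by rewrite ler_norml sin_geN1 sin_le1.
have mp m (f : 'rV[R]_m -> R) : measurable_fun setT f ->
    measurable_fun [set: 'rV[R]_m] (fun x => (\prod_k h (x ord0 k) * f x)%:E).
  by move=> mf; apply/measurable_EFinP/measurable_funM => //; exact: measurable_prod_coord.
elim: n z => [|n IH] z.
  rewrite !integral_row1; [|exact: mp..].
  under eq_integral do rewrite big_ord1 mxE /dotp big_ord1 mxE.
  rewrite hcos big_ord1; split => //.
  under eq_integral do rewrite big_ord1 mxE /dotp big_ord1 mxE.
  by rewrite hsin.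
have hint (f : R -> R) : measurable_fun setT f -> (forall x, `|f x| <= 1) ->
    (@lebesgue_measure R).-integrable setT (EFin \o (fun t => h t * f t)).
  move=> mf f1; apply: (@le_integrable _ _ _ (@lebesgue_measure R) _ _ _ (EFin \o h)) => //.
  - by apply/measurable_EFinP/measurable_funM.
  - by move=> x _; rewrite /= lee_fin normrM -[leRHS]mulr1 ler_wpM2l.
  apply/integrableP; split; first exact/measurable_EFinP.
  rewrite (_ : (\int[_]_x _)%E = (C 0)%:E) ?ltry// -hcos; apply: eq_integral => t _.
  by rewrite /= mul0r cos0 mulr1 ger0_norm.
have mcosR s : measurable_fun setT (fun t : R => cos (s * t)).
  by apply: continuous_measurable_fun => x; apply: continuous_comp; [exact: mulrl_continuous|exact: continuous_cos].
have msinR s : measurable_fun setT (fun t : R => sin (s * t)).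
  by apply: continuous_measurable_fun => x; apply: continuous_comp; [exact: mulrl_continuous|exact: continuous_sin].
set z0 := z ord0 ord0; set w := row_tail z.
have [IHc IHs] := IH w.
(* cos and sin of a sum: both integrals are of the form A(t) p(v) + B(t) q(v) *)
have key (f : 'rV[R]_n.+2 -> R) (A B : R -> R) (cA cB : R) :
    measurable_fun setT f ->
    (forall t v, f (row_cons t v) = A t * cos (dotp w v) + B t * sin (dotp w v)) ->
    measurable_fun setT A -> measurable_fun setT B -> (forall t, `|A t| <= 1) -> (forall t, `|B t| <= 1) ->
    (\int[lebesgue_measure]_t (h t * A t)%:E = cA%:E)%E ->
    (\int[@lebB R n.+1]_x (\prod_k h (x ord0 k) * f x)%:E = (cA * \prod_k C (w ord0 k))%:E)%E.
  move=> mf fE mA mB A1 B1 hA.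
  rewrite integral_slice; last exact: mp.
  have E t v : (\prod_k h (row_cons t v ord0 k) * f (row_cons t v))%:E =
    ((h t * A t) * (\prod_k h (v ord0 k) * cos (dotp w v)))%:E +
    ((h t * B t) * (\prod_k h (v ord0 k) * sin (dotp w v)))%:E :> \bar R.
    rewrite -EFinD fE big_ord_recl row_cons0; congr EFin.
    rewrite (eq_bigr (fun k => h (v ord0 k))) => [|k _]; last by rewrite row_consS.
    ring.
  under eq_integral do rewrite E.
  rewrite integralD//; [|exact: (integrable_prodM (hint _ mA A1) (integrable_prod_coord (mcosd _ w) (fun=> cos1 _)))|
    exact: (integrable_prodM (hint _ mB B1) (integrable_prod_coord (msind _ w) (fun=> sin1 _)))].
  rewrite -!integral12_prod_meas1; [|exact: (integrable_prodM (hint _ mB B1) (integrable_prod_coord (msind _ w) (fun=> sin1 _)))|exact: (integrable_prodM (hint _ mA A1) (integrable_prod_coord (mcosd _ w) (fun=> cos1 _)))].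
  rewrite /fubini_F/=.
  under eq_integral => t _.
    under eq_integral do rewrite EFinM.
    rewrite integralZl//; last exact: integrable_prod_coord.
    rewrite IHc; over.
  rewrite integralZr//; last exact: hint.
  under [X in (_ + X)%E]eq_integral => t _.
    under eq_integral do rewrite EFinM.
    rewrite integralZl//; last exact: integrable_prod_coord.
    rewrite IHs mule0; over.
  by rewrite integral0 adde0 hA.
split.
  rewrite (key _ (fun t => cos (z0 * t)) (fun t => - sin (z0 * t)) (C z0))//.
  - by rewrite [in RHS]big_ord_recl; congr (_ * _)%:E; apply: eq_bigr => k _; rewrite mxE.
  - by move=> t v; rewrite dotp_cons cosD mulNr.
  - by apply: measurableT_comp => //; exact: msinR.
  - by move=> t; rewrite normrN.
rewrite (key _ (fun t => sin (z0 * t)) (fun t => cos (z0 * t)) 0) ?mul0r//.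
by move=> t v; rewrite dotp_cons sinD.
Qed.

End ProdCos.

End LebMore.

Lemma outer_measure_cover {R : realType} (T : Type) (mu : {outer_measure set T -> \bar R})
    (I : eqType) (s : seq I) (A : I -> set T) (B : set T) :
  (forall x, B x -> exists2 i, i \in s & A i x) -> (mu B <= \sum_(i <- s) mu (A i))%E.
Proof.
elim: s B => [|i s IH] B BA.
  rewrite big_nil (_ : B = set0) ?outer_measure0//.
  by apply/seteqP; split => // x /BA[].
rewrite big_cons; apply: (@le_trans _ _ (mu (A i `|` (B `\` A i)))).
  by apply: le_outer_measure => x Bx; have [?|?] := pselect (A i x); [left|right].
apply: le_trans (outer_measureU2 mu _ _) _; apply: leeD => //; apply: IH => x [/BA[j]].
by rewrite inE => /orP[/eqP->//|js] Aj _; exists j.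
Qed.

(** * Covering numbers of Euclidean balls *)

Section Enorm.
Context {R : realType}.
Implicit Types n : nat.

Lemma dotpC n (x y : 'rV[R]_n) : dotp x y = dotp y x.
Proof. by apply: eq_bigr => k _; rewrite mulrC. Qed.

Lemma dotpDr n (x y z : 'rV[R]_n) : dotp x (y + z) = dotp x y + dotp x z.
Proof. by rewrite /dotp -big_split; apply: eq_bigr => k _; rewrite mxE mulrDr. Qed.

Lemma dotpDl n (x y z : 'rV[R]_n) : dotp (x + y) z = dotp x z + dotp y z.
Proof. by rewrite dotpC dotpDr ![dotp z _]dotpC. Qed.

Lemma dotpZr n a (x y : 'rV[R]_n) : dotp x (a *: y) = a * dotp x y.
Proof. by rewrite /dotp mulr_sumr; apply: eq_bigr => k _; rewrite mxE mulrCA. Qed.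

Lemma dotpZl n a (x y : 'rV[R]_n) : dotp (a *: x) y = a * dotp x y.
Proof. by rewrite dotpC dotpZr dotpC. Qed.

Lemma dotpNr n (x y : 'rV[R]_n) : dotp x (- y) = - dotp x y.
Proof. by rewrite -scaleN1r dotpZr mulN1r. Qed.

Lemma dotpBr n (x y z : 'rV[R]_n) : dotp x (y - z) = dotp x y - dotp x z.
Proof. by rewrite dotpDr dotpNr. Qed.

Lemma dotpBl n (x y z : 'rV[R]_n) : dotp (x - y) z = dotp x z - dotp y z.
Proof. by rewrite dotpC dotpBr ![dotp z _]dotpC. Qed.

Lemma dotp_ge0 n (x : 'rV[R]_n) : 0 <= dotp x x.
Proof. by apply: sumr_ge0 => k _; rewrite -expr2 sqr_ge0. Qed.

Lemma enorm_ge0 n (x : 'rV[R]_n) : 0 <= enorm x.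
Proof. exact: sqrtr_ge0. Qed.

Lemma enorm_sqr n (x : 'rV[R]_n) : enorm x ^+ 2 = dotp x x.
Proof. by rewrite sqr_sqrtr// dotp_ge0. Qed.

Lemma enorm_leP n (x : 'rV[R]_n) r : 0 <= r -> (enorm x <= r) = (dotp x x <= r ^+ 2).
Proof. by move=> r0; rewrite -enorm_sqr ler_pXn2r// nnegrE enorm_ge0. Qed.

Lemma enormZ n a (x : 'rV[R]_n) : enorm (a *: x) = `|a| * enorm x.
Proof. by rewrite /enorm dotpZl dotpZr mulrA -expr2 sqrtrM ?sqr_ge0// sqrtr_sqr. Qed.

Lemma enormN n (x : 'rV[R]_n) : enorm (- x) = enorm x.
Proof. by rewrite -scaleN1r enormZ normrN1 mul1r. Qed.

Lemma enorm0 n : enorm (0 : 'rV[R]_n) = 0.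
Proof. by rewrite -(scale0r 0) enormZ normr0 mul0r. Qed.

Lemma enorm_eq0 n (x : 'rV[R]_n) : enorm x = 0 -> x = 0.
Proof.
move=> /(congr1 (fun u => u ^+ 2)); rewrite enorm_sqr expr0n/= => /eqP.
rewrite psumr_eq0 => [/allP x0|k _]; last by rewrite -expr2 sqr_ge0.
apply/rowP => k; rewrite mxE; apply/eqP; rewrite -sqrf_eq0 expr2.
by have := x0 k; rewrite mem_index_enum => /(_ isT).
Qed.

Lemma dotp_le n (x y : 'rV[R]_n) : dotp x y <= enorm x * enorm y.
Proof.
have [/eqP a0|a0] := boolP (enorm x == 0).
  by rewrite (enorm_eq0 a0) -(scale0r 0) dotpZl !mul0r enormZ normr0 mul0r mul0r.
have [/eqP b0|b0] := boolP (enorm y == 0).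
  by rewrite (enorm_eq0 b0) -(scale0r 0) dotpZr mul0r enormZ normr0 mul0r mulr0.
have ab : 0 < enorm x * enorm y by rewrite mulr_gt0// lt_def enorm_ge0 ?a0 ?b0.
rewrite -(ler_pM2l ab) -subr_ge0.
(* Expanded, this square is twice the claimed difference, already multiplied by the product of the
   norms. *)
have := dotp_ge0 (enorm y *: x - enorm x *: y).
rewrite dotpBl !dotpBr !dotpZl !dotpZr -!enorm_sqr (dotpC y x) => H.
rewrite -(@pmulr_rge0 _ 2)//; apply: le_trans H _; rewrite le_eqVlt; apply/orP; left; apply/eqP; ring.
Qed.

Lemma enormD n (x y : 'rV[R]_n) : enorm (x + y) <= enorm x + enorm y.
Proof.
rewrite enorm_leP ?addr_ge0 ?enorm_ge0// dotpDl !dotpDr (dotpC y x) -!enorm_sqr.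
have := dotp_le x y; lra.
Qed.

Lemma enorm_coord n (x : 'rV[R]_n) k : `|x ord0 k| <= enorm x.
Proof.
rewrite -(@ler_pXn2r _ 2)// ?nnegrE ?enorm_ge0// enorm_sqr real_normK ?num_real//.
rewrite /dotp (bigD1 k)//= -expr2 lerDl sumr_ge0// => j _.
by rewrite -expr2 sqr_ge0.
Qed.

Lemma enorm_box n (x : 'rV[R]_n) (e : R) : 0 <= e -> (forall k, `|x ord0 k| <= e) -> enorm x <= n%:R * e.
Proof.
move=> e0 xe; rewrite enorm_leP ?mulr_ge0// /dotp.
apply: (@le_trans _ _ (\sum_(k < n) e ^+ 2)).
  by apply: ler_sum => k _; rewrite -expr2 -real_normK ?num_real// ler_pXn2r// nnegrE.
rewrite sumr_const card_ord -[leLHS]mulr_natl exprMn ler_wpM2r ?sqr_ge0//.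
by rewrite -natrX ler_nat; case: n {x xe} => // n; rewrite -{1}[n.+1]expn1 leq_pexp2l.
Qed.

Lemma measurable_dotpxx n : measurable_fun [set: 'rV[R]_n] (fun x => dotp x x).
Proof.
apply: measurable_sum => k; apply: measurable_funM; exact: measurable_coord.
Qed.

Definition eball n (c : 'rV[R]_n) (r : R) : set 'rV[R]_n := [set x | enorm (x - c) <= r].

Lemma measurable_shift n (z : 'rV[R]_n) : measurable_fun [set: 'rV[R]_n] (fun x => x + z).
Proof.
apply: measurable_fun_row => k; under eq_fun do rewrite mxE.
by apply: measurable_funD => //; exact: measurable_coord.
Qed.

Lemma measurable_enorm n : measurable_fun [set: 'rV[R]_n] (@enorm R n).
Proof.
apply: (@measurableT_comp _ _ _ _ _ _ (@Num.sqrt R)); last exact: measurable_dotpxx.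
by apply: continuous_measurable_fun => x; exact: sqrt_continuous.
Qed.

Lemma measurable_eball n (c : 'rV[R]_n) r : measurable (eball c r).
Proof.
rewrite (_ : eball c r = (fun x => enorm (x + - c)) @^-1` `]-oo, r]%classic); last first.
  by apply/seteqP; split => x /=; rewrite in_itv.
rewrite -[X in measurable X]setTI.
apply: (measurableT_comp (@measurable_enorm n) (measurable_shift (- c))) => //.
Qed.

Definition vball n : R := fine (@unit_ball_vol R n).

Lemma vballE n : @unit_ball_vol R n.+1 = (vball n.+1)%:E.
Proof.
rewrite /vball fineK// ge0_fin_numE ?leb_out_ge0//.
apply: (@le_lt_trans _ _ (leb_out (box (const_mx (- 1)%R) (const_mx 2%R) : set 'rV[R]_n.+1))).
  apply: le_leb_out => x /= x1 k; rewrite !mxE.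
  by have := le_trans (enorm_coord x k) x1; rewrite ler_norml => /andP[? ?]; apply/andP; split; lra.
by rewrite leb_out_box ltry.
Qed.

Lemma vball_gt0 n : 0 < vball n.+1.
Proof.
rewrite -lte_fin -vballE.
pose e : R := (n.+1%:R)^-1; have e0 : 0 < e by rewrite invr_gt0.
apply: (@lt_le_trans _ _ (leb_out (box (const_mx 0%R) (const_mx e) : set 'rV[R]_n.+1))).
  rewrite leb_out_box lte_fin; apply: prodr_gt0 => k _; rewrite !mxE.
  by rewrite subr0 lt_max e0.
apply: le_leb_out => x xe /=; rewrite -(@mulfV _ n.+1%:R)//.
apply: enorm_box => [|k]; first exact: ltW.
by have := xe k; rewrite !mxE => /andP[x0 xk]; rewrite ger0_norm// ltW.
Qed.

Lemma leb_eball n (c : 'rV[R]_n.+1) r : 0 < r ->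
  leb_out (eball c r) = (r ^+ n.+1 * vball n.+1)%:E.
Proof.
move=> r0; rewrite EFinM -vballE -leb_out_scale// -(leb_out_shift c); congr leb_out.
apply/seteqP; split => x.
  rewrite /eball/= addrK => xr; exists (r^-1 *: x) => /=; last first.
    by rewrite scalerA divff ?gt_eqF// scale1r.
  by rewrite enormZ gtr0_norm ?invr_gt0// mulrC ler_pdivrMr// mul1r.
move=> [y y1 <-]; rewrite /eball/= addrK enormZ gtr0_norm//.
by rewrite -[leRHS]mulr1 ler_pM2l.
Qed.

Lemma leb_outU n (A B : set 'rV[R]_n.+1) : (leb_out (A `|` B) <= leb_out A + leb_out B)%E.
Proof. exact: outer_measureU2. Qed.

Lemma leb_out_cover n (I : eqType) (s : seq I) (A : I -> set 'rV[R]_n.+1) (B : set 'rV[R]_n.+1) :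
  (forall x, B x -> exists2 i, i \in s & A i x) -> (leb_out B <= \sum_(i <- s) leb_out (A i))%E.
Proof. exact: outer_measure_cover. Qed.

Lemma cover_ball_lower n N (c : 'I_N -> 'rV[R]_n.+1) (r e : R) : 0 < r -> 0 < e ->
  (forall x, enorm x <= r -> exists k, enorm (x - c k) <= e) ->
  r ^+ n.+1 <= N%:R * e ^+ n.+1.
Proof.
move=> r0 e0 H; rewrite -(ler_pM2r (vball_gt0 n)) -lee_fin -(leb_eball 0)//.
apply: le_trans (_ : (\sum_(k <- enum 'I_N) leb_out (eball (c k) e) <= _)%E).
  apply: leb_out_cover => x; rewrite /eball/= subr0 => /H[k xk]; exists k => //.
  by rewrite mem_enum.
rewrite (eq_bigr (fun=> (e ^+ n.+1 * vball n.+1)%:E)) => [|k _]; last exact: leb_eball.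
by rewrite sumEFin big_enum/= lee_fin sumr_const card_ord -[leLHS]mulr_natl mulrA.
Qed.

(** The cap lies in the ball of radius sqrt(1 - c^2) about c x, since |v - c x|^2 <= 1 - 2 c^2 +
    c^2. *)
Lemma leb_cap n (x : 'rV[R]_n.+1) (c : R) : enorm x <= 1 -> 0 < c < 1 ->
  (leb_out [set v : 'rV[R]_n.+1 | (enorm v <= 1)%R /\ (c < dotp x v)%R] <=
   (Num.sqrt (1 - c ^+ 2) ^+ n.+1 * vball n.+1)%:E)%E.
Proof.
move=> x1 /andP[c0 c1].
have s0 : 0 < Num.sqrt (1 - c ^+ 2) by rewrite sqrtr_gt0 subr_gt0 expr_lt1// ltW.
rewrite -(leb_eball (c *: x))//; apply: le_leb_out => v /= [v1 xv].
rewrite /eball/= enorm_leP ?ltW// sqr_sqrtr; last by rewrite subr_ge0 expr_le1// ltW.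
rewrite dotpBl !dotpBr !dotpZl !dotpZr -!enorm_sqr (dotpC v x) enorm_sqr -!enorm_sqr.
have : enorm x ^+ 2 <= 1 by rewrite expr_le1 ?enorm_ge0.
have : enorm v ^+ 2 <= 1 by rewrite expr_le1 ?enorm_ge0.
move: xv; move: (dotp x v) (enorm v ^+ 2) (enorm x ^+ 2) => p a b; nra.
Qed.

(** Concentration near the equator: outside the slab lie only two opposite caps, each an
    exponentially small part of the ball; the hypothesis on the dimension makes them at most half of
    it together. *)
Lemma leb_equator n (x : 'rV[R]_n.+1) (c : R) : enorm x <= 1 -> 0 < c < 1 ->
  2 * Num.sqrt (1 - c ^+ 2) ^+ n.+1 <= 2^-1 ->
  ((2^-1 * vball n.+1)%:E <=
   leb_out [set v : 'rV[R]_n.+1 | (enorm v <= 1)%R /\ (`|dotp x v| <= c)%R])%E.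
Proof.
move=> x1 c01 sm; set s := Num.sqrt _ in sm *; set E := [set v | _].
pose Cp (y : 'rV[R]_n.+1) := [set v : 'rV[R]_n.+1 | (enorm v <= 1)%R /\ (c < dotp y v)%R].
have V0 := vball_gt0 n.
have : (leb_out (eball (0 : 'rV[R]_n.+1) 1) <= leb_out E + (leb_out (Cp x) + leb_out (Cp (- x)%R)))%E.
  apply: (@le_trans _ _ (leb_out (E `|` (Cp x `|` Cp (- x)%R)))).
    apply: le_leb_out => v; rewrite /eball/= subr0 => v1.
    have [xv|] := leP `|dotp x v| c; first by left.
    rewrite ltr_normr => /orP[xv|xv]; first by right; left.
    by right; right; split => //; rewrite dotpC dotpNr dotpC.
  apply: le_trans (leb_outU _ _) _; rewrite leeD2l//; exact: leb_outU.
rewrite leb_eball// expr1n mul1r.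
have xN1 : enorm (- x) <= 1 by rewrite enormN.
have := leeD (leb_cap x1 c01) (leb_cap xN1 c01); rewrite -/s -/(Cp x) -/(Cp (- x)) => H1 H2.
have {H1 H2} := le_trans H2 (leeD2l (leb_out E) H1).
rewrite -EFinD; case: (leb_out E) => [l| |]; rewrite ?leey//= ?lee_fin.
move: sm V0; move: (s ^+ n.+1) (vball _) => q V; nra.
Qed.

Lemma mulr3_le (q r c : R) : 0 < c -> 0 <= q <= 1 -> 0 <= r <= 1 -> q * r * c <= c.
Proof.
move=> c0 /andP[q0 q1] /andP[r0 r1].
by rewrite -[leRHS]mul1r ler_pM2r// mulr_ile1.
Qed.

(** For |x| = 1 the picture is a right triangle with legs rho, e and hypotenuse x: the altitude is
    rho e and its foot is rho^2 x. So the equatorial slab, scaled by rho e and moved to rho^2 x,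
    fits in both balls, up to the cross terms in [dotp x v], which cost at most 2 c in the squared
    radii. *)
Lemma leb_lens n (x : 'rV[R]_n.+1) (e c rho : R) : rho = Num.sqrt (1 - e ^+ 2) -> enorm x <= 1 -> 0 < e < 1 -> 0 < c < 1 ->
  2 * Num.sqrt (1 - c ^+ 2) ^+ n.+1 <= 2^-1 ->
  (((rho * e) ^+ n.+1 * (2^-1 * vball n.+1))%:E <=
   leb_out (eball 0 (Num.sqrt (rho ^+ 2 + 2 * c)) `&` eball x (Num.sqrt (e ^+ 2 + 2 * c))))%E.
Proof.
move=> rhoE x1 /andP[e0 e1] /andP[c0 c1] sm.
have e2 : 0 < 1 - e ^+ 2 by rewrite subr_gt0 expr_lt1// ltW.
have r0 : 0 < rho by rewrite rhoE sqrtr_gt0.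
have r2 : rho ^+ 2 = 1 - e ^+ 2 by rewrite rhoE sqr_sqrtr// ltW.
have r1 : rho <= 1.
  rewrite -(@ler_pXn2r _ 2)// ?nnegrE ?ler01 ?(ltW r0)// r2 expr1n.
  by rewrite gerBl sqr_ge0.
have re0 : 0 < rho * e by rewrite mulr_gt0.
have := leb_equator x1 (introT andP (conj c0 c1)) sm; set E := [set v | _] => HE.
rewrite EFinM; apply: le_trans (lee_wpmul2l _ HE) _; first by rewrite lee_fin exprn_ge0// ltW.
rewrite -leb_out_scale// -(leb_out_shift (- (rho ^+ 2 *: x))); apply: le_leb_out => y /=.
move=> [v [v1 xv] yv]; have {yv}-> : y = rho ^+ 2 *: x + (rho * e) *: v.
  by rewrite yv addrC subrK.
have X1 : 0 <= enorm x ^+ 2 <= 1 by rewrite sqr_ge0 expr_le1 ?enorm_ge0.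
have V1 : 0 <= enorm v ^+ 2 <= 1 by rewrite sqr_ge0 expr_le1 ?enorm_ge0.
have /andP[D1 D2] : - c <= dotp x v <= c by rewrite -ler_norml.
have P1 : 0 <= rho ^+ 2 <= 1 by rewrite sqr_ge0 expr_le1// ltW.
have re1 : 0 <= rho * e <= 1 by rewrite ltW//= mulr_ile1// ltW.
split; rewrite /eball/= enorm_leP ?sqrtr_ge0// sqr_sqrtr; try by rewrite addr_ge0 ?sqr_ge0// mulr_ge0// ltW.
  rewrite subr0 dotpDl !dotpDr !dotpZl !dotpZr (dotpC v x) -!enorm_sqr.
  have -> : rho ^+ 2 * (rho ^+ 2 * enorm x ^+ 2) + rho ^+ 2 * (rho * e * dotp x v) +
    (rho * e * (rho ^+ 2 * dotp x v) + rho * e * (rho * e * enorm v ^+ 2)) =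
    rho ^+ 2 * (rho ^+ 2 * enorm x ^+ 2 + e ^+ 2 * enorm v ^+ 2) + 2 * ((rho ^+ 2 * (rho * e)) * dotp x v) by ring.
  apply: lerD.
    rewrite -[leRHS]mulr1 ler_wpM2l ?sqr_ge0//.
    by move: X1 V1; rewrite r2; have := sqr_ge0 e; move: e2; move: (enorm x ^+ 2) (enorm v ^+ 2) (e ^+ 2) => a b q; nra.
  rewrite ler_pM2l//; apply: (@le_trans _ _ (rho ^+ 2 * (rho * e) * c)).
    by rewrite ler_wpM2l// mulr_ge0// ?sqr_ge0// ltW.
  exact: mulr3_le.
have -> : rho ^+ 2 *: x + rho * e *: v - x = (- e ^+ 2) *: x + (rho * e) *: v.
  rewrite r2 scalerBl scale1r scaleNr; rewrite addrAC; congr (_ + _).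
  by rewrite addrAC subrr add0r.
rewrite dotpDl !dotpDr !dotpZl !dotpZr (dotpC v x) -!enorm_sqr.
have -> : - e ^+ 2 * (- e ^+ 2 * enorm x ^+ 2) + - e ^+ 2 * (rho * e * dotp x v) +
    (rho * e * (- e ^+ 2 * dotp x v) + rho * e * (rho * e * enorm v ^+ 2)) =
    e ^+ 2 * (e ^+ 2 * enorm x ^+ 2 + rho ^+ 2 * enorm v ^+ 2) + 2 * ((e ^+ 2 * (rho * e)) * (- dotp x v)) by ring.
apply: lerD.
  rewrite -[leRHS]mulr1 ler_wpM2l ?sqr_ge0//.
  by move: X1 V1; rewrite r2; have := sqr_ge0 e; move: e2; move: (enorm x ^+ 2) (enorm v ^+ 2) (e ^+ 2) => a b q; nra.
have E1 : 0 <= e ^+ 2 <= 1 by rewrite sqr_ge0 expr_le1// ltW.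
rewrite ler_pM2l//; apply: (@le_trans _ _ (e ^+ 2 * (rho * e) * c)).
  by rewrite ler_wpM2l ?mulr_ge0 ?sqr_ge0 ?(ltW e0) ?(ltW r0)// lerNl.
exact: mulr3_le.
Qed.

(** Averaging: the number of points of [s] within [e] of y, integrated over y in the ball of radius
    [r], is at least [t] per point; if every y captured less than the proportion [p], the integral
    would be too small. *)
Lemma lens_average n (s : seq 'rV[R]_n.+1) (r e p t : R) : 0 < r -> 0 < p -> s != [::] ->
  (forall z, z \in s -> (t%:E <= leb_out (eball 0 r `&` eball z e))%E) ->
  p * (r ^+ n.+1 * vball n.+1) < t ->
  exists y, p * (size s)%:R <= (count (fun z => enorm (y - z) <= e) s)%:R.
Proof.
move=> r0 p0 s0 st pt; apply: contrapT => /forallNP H.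
pose f (z : 'rV[R]_n.+1) (y : lebT n) : \bar R := (\1_(eball z e) (y : 'rV[R]_n.+1) : R)%:E.
have mE z : measurable (eball z e : set (lebT n)).
  exact: measurable_row_leb (measurable_eball z e).
have mB : measurable (eball 0 r : set (lebT n)).
  exact: measurable_row_leb (measurable_eball 0 r).
have sE (y : lebT n) : (\sum_(z <- s) f z y = (count (fun z => enorm ((y : 'rV_n.+1) - z) <= e) s)%:R%:E)%E.
  rewrite /f sumEFin; congr EFin; elim: s {s0 st H} => [|z s IH]; first by rewrite big_nil.
  rewrite big_cons/= natrD IH; congr (_ + _); rewrite indicE; congr (nat_of_bool _)%:R.
  by apply/idP/idP => [/set_mem//|h]; apply/mem_set.
have le1 : (((size s)%:R * t)%:E <= \int[@leb R n]_(y in eball 0%R r) \sum_(z <- s) f z y)%E.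
  rewrite ge0_integral_sum//; last 2 first.
  - by move=> z; apply/measurable_EFinP/measurable_funTS; exact: measurable_indic.
  - by move=> z y _; rewrite lee_fin.
  have -> : ((size s)%:R * t)%:E = (\sum_(z <- s) t%:E)%E.
    by rewrite sumEFin big_const_seq count_predT iter_addr_0 mulr_natl.
  rewrite big_seq [leRHS]big_seq; apply: lee_sum => z zs.
  rewrite integral_indic//.
  by rewrite setIC; exact: st.
have le2 : (\int[@leb R n]_(y in eball 0%R r) \sum_(z <- s) f z y <=
    ((p * (size s)%:R) * (r ^+ n.+1 * vball n.+1))%:E)%E.
  rewrite EFinM -(leb_eball 0)// -(integral_cst (@leb R n)) //.
  apply: ge0_le_integral => //.
  - by move=> y _; apply: sume_ge0 => z _; rewrite lee_fin.
  - apply: emeasurable_sum => z; apply/measurable_EFinP; apply: measurable_funTS.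
    exact: measurable_indic.
  - by move=> y _; rewrite sE lee_fin; have /negP := H y; rewrite -ltNge => /ltW.
have := le_trans le1 le2; rewrite lee_fin leNgt => /negP; apply.
by rewrite (mulrC p) -mulrA ltr_pM2l// ltr0n lt0n size_eq0.
Qed.

(** Each new centre is chosen for the points still uncovered and removes a proportion [p] of them;
    [s'] lists what remains after k choices. *)
Lemma greedy_cover n (P : 'rV[R]_n -> Prop) (e p : R) : p <= 1 ->
  (forall s : seq 'rV[R]_n, (forall z, z \in s -> P z) -> s != [::] ->
    exists y, p * (size s)%:R <= (count (fun z => enorm (y - z) <= e) s)%:R) ->
  forall k (s : seq 'rV[R]_n), (forall z, z \in s -> P z) -> exists c s' : seq 'rV[R]_n,
    [/\ size c = k, (size s')%:R <= (1 - p) ^+ k * (size s)%:R, {subset s' <= s} &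
    forall z, z \in s -> (z \in s') || has (fun y => enorm (y - z) <= e) c].
Proof.
move=> p1 H; elim=> [|k IH] s sP.
  by exists [::], s; split => //; [rewrite expr0 mul1r|move=> z ->].
have [c [s' [ck ss s's cs]]] := IH s sP.
have [y ys] : exists y, p * (size s')%:R <= (count (fun z => enorm (y - z) <= e) s')%:R.
  have [->|s'0] := eqVneq s' [::]; first by exists 0; rewrite /= mulr0.
  by apply: H => // z /s's/sP.
pose a z := enorm (y - z) <= e.
exists (y :: c), [seq z <- s' | predC a z]; split => /=; first by rewrite ck.
- have : (size [seq z <- s' | predC a z])%:R = (size s')%:R - (count a s')%:R :> R.
    by rewrite size_filter -(count_predC a s') natrD addrAC subrr add0r.
  move=> ->; apply: (@le_trans _ _ ((1 - p) * (size s')%:R)).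
    by rewrite mulrBl mul1r lerB.
  by rewrite exprS -mulrA ler_wpM2l// subr_ge0.
- by move=> z; rewrite mem_filter => /andP[_ /s's].
- move=> z zs; rewrite mem_filter /= -/(a z).
  by case: (a z) => //=; rewrite ?orbT//=; exact: cs.
Qed.

Lemma ball_net n (d : R) : 0 < d -> exists s : seq 'rV[R]_n,
  [/\ forall z, z \in s -> enorm z <= 1,
  (size s <= (2 * (Num.truncn (n%:R / d)).+1).+1 ^ n)%N &
  forall x, enorm x <= 1 -> exists2 z, z \in s & enorm (x - z) <= d].
Proof.
move=> d0; set K := (Num.truncn (n%:R / d)).+1.
pose A (f : {ffun 'I_n -> 'I_(2 * K).+1}) : set 'rV[R]_n :=
  [set x | enorm x <= 1 /\ forall j, Num.floor (x ord0 j * K%:R) + K%:Z = (f j)%:Z].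
(* One point of the unit ball is taken in each grid cell of side 1 / K that meets it; other cells
   yield the default 0, which is in the ball too. The floors run from -K to K inclusive, whence 2 K
   + 1 values per coordinate. *)
exists [seq xget 0 (A f) | f : {ffun 'I_n -> 'I_(2 * K).+1}]; split.
- by move=> z /mapP[f _ ->]; case: xgetP => [x _ []|_]; rewrite ?enorm0.
- by rewrite size_map -cardE card_ffun !card_ord.
have K0 : 0 < K%:R :> R by rewrite ltr0n.
move=> x x1.
have fl j : 0 <= Num.floor (x ord0 j * K%:R) + K%:Z <= (2 * K)%:Z.
  have := le_trans (enorm_coord x j) x1; rewrite ler_norml => /andP[xl xu].
  apply/andP; split.
    rewrite -lerBlDr sub0r floor_ge_int_tmp intrN -mulN1r.
    by rewrite ler_pM2r.
  rewrite -lerBrDr mul2n -addnn PoszD addrK -(ler_int R).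
  apply: le_trans (floor_le_tmp _) _.
  by rewrite -[leRHS]mul1r ler_pM2r.
pose f : {ffun 'I_n -> 'I_(2 * K).+1} := [ffun j => inord (absz (Num.floor (x ord0 j * K%:R) + K%:Z))].
have fE j : (f j)%:Z = Num.floor (x ord0 j * K%:R) + K%:Z.
  have /andP[a b] := fl j; rewrite ffunE inordK ?gez0_abs// ltnS -lez_nat gez0_abs//.
exists (xget 0 (A f)); first by apply: map_f; rewrite mem_enum.
have Ax : A f x by split => // j; rewrite fE.
have [y1 yf] : A f (xget 0 (A f)) by exact: (@xgetPex _ 0 (A f) (ex_intro _ x Ax)).
move: (xget 0 (A f)) y1 yf => y y1 yf.
apply: (@le_trans _ _ (n%:R * K%:R^-1)).
  apply: enorm_box; first by rewrite invr_ge0 ltW.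
  move=> j; rewrite !mxE.
  have E : Num.floor (x ord0 j * K%:R) = Num.floor (y ord0 j * K%:R).
    by apply: (addIr K%:Z); rewrite -fE yf.
  apply: ltW; apply: (@itv_dist _ ((Num.floor (x ord0 j * K%:R))%:~R / K%:R)).
  - by rewrite ler_pdivrMr// floor_le_tmp.
  - by rewrite -[X in _ + X]mul1r -mulrDl ltr_pdivlMr// -intrD1 floorD1_gt.
  - by rewrite E ler_pdivrMr// floor_le_tmp.
  - by rewrite E -[X in _ + X]mul1r -mulrDl ltr_pdivlMr// -intrD1 floorD1_gt.
rewrite ler_pdivrMr// mulrC -ler_pdivrMr//; apply: ltW; exact: truncnS_gt.
Qed.

(** The exponential is the cube of one with a third of the rate, which already dominates a multiple
    of n + 1; a cubic then beats the quadratic. *)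
Lemma sqr_le_expR (a C : R) : 0 < a -> exists n0 : nat, forall n, (n0 <= n)%N ->
  C * n.+1%:R ^+ 2 <= expR (n%:R * a).
Proof.
move=> a0; pose b := Num.min 1 (a / 3).
have b0 : 0 < b by rewrite lt_min ltr01 divr_gt0.
exists (Num.truncn (C / b ^+ 3)).+1 => n n0.
have -> : expR (n%:R * a) = expR (n%:R * (a / 3)) ^+ 3.
  by rewrite -expRM_natl; congr expR; field.
have bn : b * n.+1%:R <= expR (n%:R * (a / 3)).
  apply: le_trans (expR_ge1Dx _).
  rewrite -natr1 mulrDr mulr1 addrC lerD//; first by rewrite ge_min lexx.
  by rewrite mulrC ler_wpM2l// ge_min lexx orbT.
apply: (@le_trans _ _ ((b * n.+1%:R) ^+ 3)); last first.
  by rewrite ler_pXn2r// nnegrE ?expR_ge0// mulr_ge0// ltW.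
rewrite exprMn [n.+1%:R ^+ 3]exprSr mulrA mulrAC ler_wpM2r ?sqr_ge0//.
rewrite -ler_pdivrMl ?exprn_gt0// mulrC; apply: ltW; apply: lt_le_trans (truncnS_gt _) _.
by rewrite ler_nat ltnW// ltnS ltnW.
Qed.

Lemma expr_small (s e : R) : 0 <= s < 1 -> 0 < e -> exists n0 : nat, forall n, (n0 <= n)%N ->
  s ^+ n <= e.
Proof.
move=> /andP[s0 s1] e0.
have : (fun n => s ^+ n) @ \oo --> (0 : R) by apply: cvg_expr; rewrite ger0_norm.
move=> /cvgrPdist_le/(_ e e0)[n0 _ H]; exists n0 => n n0n.
by have := H n n0n; rewrite sub0r normrN ger0_norm// exprn_ge0.
Qed.

Let half_split (e e0 : R) : (e0 - e) / 2 + (e + e0) / 2 = e0.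
Proof. by field. Qed.

Let count_bound (M D b : R) : 1 <= M -> 0 < D -> 0 <= b ->
  b <= M * (2 * (M * D + 1) + 1) -> 4 * b + 1 <= 16 * (D + 2) * M ^+ 2.
Proof. nra. Qed.

Let add1_bound (u b : R) : 1 <= u -> 0 <= b -> b * (4 * u) + 1 <= (4 * b + 1) * u.
Proof. nra. Qed.

(** The radius is shared as [em + d = e0]: centres come within [em] of the points of a net of mesh
    [d]. Lenses are taken at the smaller radius [e = e0 * q] to make room for their error. The
    resulting factor q^(2m) = exp(- m eta / 2) in the proportion uses half of [eta]; the factors
    polynomial in m use the other half. *)
Lemma cover_ball_upper (e0 eta : R) : 0 < e0 < 1 -> 0 < eta -> exists n0 : nat, forall n, (n0 <= n)%N ->
  exists s : seq 'rV[R]_n.+1, (size s)%:R <= expR (n.+1%:R * (- ln e0 + eta)) /\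
    forall x, enorm x <= 1 -> exists2 z, z \in s & enorm (x - z) <= e0.
Proof.
move=> /andP[e00 e01] eta0.
have q1 : expR (- (eta / 4)) < 1 by rewrite expR_lt1 oppr_lt0 divr_gt0.
have q0 : 0 < expR (- (eta / 4)) by exact: expR_gt0.
set q := expR _ in q1 q0.
pose e := e0 * q.
have ee0 : e < e0 by rewrite /e gtr_pMr.
have e_gt0 : 0 < e by rewrite mulr_gt0.
have e1 : e < 1 by exact: lt_trans e01.
have e2 : 0 < 1 - e ^+ 2 by rewrite subr_gt0 expr_lt1// ltW.
pose rho := Num.sqrt (1 - e ^+ 2).
have r0 : 0 < rho by rewrite sqrtr_gt0.
have r2 : rho ^+ 2 = 1 - e ^+ 2 by rewrite sqr_sqrtr// ltW.
pose em := (e + e0) / 2.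
have em0 : 0 < em by rewrite divr_gt0// addr_gt0.
(* slack: lens radii grow from e to em and from rho to rho / q *)
pose c := Num.min 2^-1 (Num.min ((em ^+ 2 - e ^+ 2) / 2) ((rho ^+ 2 / q ^+ 2 - rho ^+ 2) / 4)).
have c0 : 0 < c.
  rewrite !lt_min invr_gt0 ltr0n/= !divr_gt0// subr_gt0.
    by rewrite ltr_pdivlMr ?exprn_gt0// gtr_pMr ?exprn_gt0// expr_lt1// ltW.
  by rewrite ltr_pXn2r// ?nnegrE ?ltW// /em; lra.
have c1 : c < 1 by apply: (@le_lt_trans _ _ 2^-1); [rewrite ge_min lexx|lra].
have ce : e ^+ 2 + 2 * c <= em ^+ 2.
  have : c <= (em ^+ 2 - e ^+ 2) / 2 by rewrite !ge_min lexx orbT.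
  lra.
have cr : rho ^+ 2 + 2 * c < (rho / q) ^+ 2.
  have : c <= (rho ^+ 2 / q ^+ 2 - rho ^+ 2) / 4 by rewrite !ge_min lexx !orbT.
  rewrite expr_div_n; lra.
pose r' := Num.sqrt (rho ^+ 2 + 2 * c).
have r'0 : 0 < r' by rewrite sqrtr_gt0 addr_gt0 ?mulr_gt0// exprn_gt0.
have r'q : r' * q < rho.
  rewrite -ltr_pdivlMr// -(@ltr_pXn2r _ 2)// ?nnegrE ?ltW// ?divr_gt0//.
  by rewrite sqr_sqrtr// addr_ge0 ?sqr_ge0// mulr_ge0// ltW.
pose d := (e0 - e) / 2.
have d0 : 0 < d by rewrite divr_gt0// subr_gt0.
have [n1 Hn1] : exists n0 : nat, forall n, (n0 <= n)%N -> Num.sqrt (1 - c ^+ 2) ^+ n <= 4^-1.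
  apply: expr_small => //; rewrite sqrtr_ge0/= -(@ltr_pXn2r _ 2)// ?nnegrE ?sqrtr_ge0//.
  rewrite sqr_sqrtr ?expr1n ?gtrBl ?exprn_gt0// subr_ge0 expr_le1// ltW//.
have [n2 Hn2] := sqr_le_expR (16 * (d^-1 + 2)) (divr_gt0 eta0 (ltr0Sn _ 1)).
exists (maxn n1 n2) => n; rewrite geq_max => /andP[n1n n2n].
set m := n.+1.
have sm : 2 * Num.sqrt (1 - c ^+ 2) ^+ m <= 2^-1.
  by have := Hn1 m (leq_trans n1n (leqnSn n)); lra.
pose p : R := (q * e) ^+ m / 4.
have p0 : 0 < p by rewrite divr_gt0// exprn_gt0// mulr_gt0.
have p1 : p <= 1.
  rewrite ler_pdivrMr// mul1r; apply: (@le_trans _ _ 1); last by rewrite ler1n.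
  by rewrite exprn_ile1// ?mulr_ge0 ?mulr_ile1// ltW.
have qeE : q * e = expR (ln e0 - eta / 2).
  rewrite /e mulrCA expRD lnK ?posrE//; congr (_ * _).
  by rewrite -expRD; congr expR; field.
pose a := - ln e0 + eta / 2.
have a0 : 0 < a by rewrite addr_gt0// ?divr_gt0// oppr_gt0 ln_lt0// e00.
have pE : p^-1 = 4 * expR (m%:R * a).
  rewrite /p qeE -expRM_natl invf_div; congr (_ * _).
  by rewrite -expRN; congr expR; rewrite /a; ring.
have [s0 [s01 s0size s0net]] := ball_net m d0.
set K := (Num.truncn _).+1 in s0size.
have V0 := vball_gt0 n.
have avg (s : seq 'rV[R]_m) : (forall z, z \in s -> enorm z <= 1) -> s != [::] ->
    exists y, p * (size s)%:R <= (count (fun z => enorm (y - z) <= em) s)%:R.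
  move=> sP sN; apply: (@lens_average _ s r' em p ((rho * e) ^+ m * (2^-1 * vball m))) => //.
    move=> z /sP z1.
    apply: le_trans (leb_lens (erefl rho) z1 (introT andP (conj e_gt0 e1)) (introT andP (conj c0 c1)) sm) _.
    apply: le_leb_out; apply: setIS => y; rewrite /eball/= => /le_trans; apply.
    rewrite -(@ler_pXn2r _ 2)// ?nnegrE ?sqrtr_ge0 ?(ltW em0)// sqr_sqrtr//.
    by rewrite addr_ge0 ?sqr_ge0// mulr_ge0// ltW.
  have h : (r' * q) ^+ m <= rho ^+ m by rewrite ler_pXn2r// ?nnegrE ?ltW// mulr_gt0.
  have e0m : 0 < e ^+ m by exact: exprn_gt0.
  have rm0 : 0 < rho ^+ m by exact: exprn_gt0.
  have -> : p * (r' ^+ m * vball m) = (r' * q) ^+ m * (e ^+ m * vball m) / 4 by rewrite /p !exprMn; ring.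
  have -> : (rho * e) ^+ m * (2^-1 * vball m) = rho ^+ m * (e ^+ m * vball m) / 2 by rewrite exprMn; ring.
  have eV : 0 < e ^+ m * vball m by rewrite mulr_gt0.
  move: h rm0 eV; move: (_ ^+ m) (rho ^+ m) (_ * vball m) => u v w; nra.
(* [expR B] bounds the cardinality of the net, so once k > B / p the greedy choice leaves at most
   exp(B - p k) < 1 points, that is none. *)
pose B : R := m%:R * (2 * K).+1%:R.
pose k := (Num.truncn (B / p)).+1.
have [cs [s' [csk s's _ cov]]] := greedy_cover p1 avg k s01.
exists cs; split; last first.
  have s'0 : s' = [::].
    apply/eqP; rewrite -size_eq0 -leqn0 -ltnS -(ltr_nat R); apply: le_lt_trans s's _.
    have LB : (size s0)%:R <= expR B.
      apply: (@le_trans _ _ ((2 * K).+1 ^ m)%:R); first by rewrite ler_nat.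
      rewrite natrX /B expRM_natl ler_pXn2r// ?nnegrE ?expR_ge0//.
      by apply: le_trans (expR_ge1Dx _); rewrite lerDr.
    apply: (@le_lt_trans _ _ (expR (- p) ^+ k * expR B)).
      apply: ler_pM => //; first by rewrite exprn_ge0// subr_ge0.
      by rewrite ler_pXn2r// ?nnegrE ?expR_ge0 ?subr_ge0// expR_ge1Dx.
    rewrite -expRM_natl -expRD expR_lt1 mulrN addrC subr_lt0.
    by rewrite -ltr_pdivrMr// truncnS_gt.
  move=> x /s0net[z zs xz]; have := cov z zs; rewrite s'0 in_nil/= => /hasP[y ycs yz].
  exists y => //; have -> : x - y = (x - z) - (y - z) by rewrite opprB addrA subrK.
  apply: le_trans (enormD _ _) _; rewrite enormN.
  by rewrite -(half_split e e0); exact: lerD xz yz.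
have m1 : 1 <= m%:R :> R by rewrite ler1n.
have KB : K%:R <= m%:R / d + 1.
  by rewrite -natr1 lerD2r truncn_le// divr_ge0// ltW.
have d'0 : 0 < d^-1 by rewrite invr_gt0.
have B0 : 0 <= B by rewrite mulr_ge0.
have BB : 4 * B + 1 <= 16 * (d^-1 + 2) * m%:R ^+ 2.
  have : B <= m%:R * (2 * (m%:R / d + 1) + 1).
    by rewrite /B ler_wpM2l// -natr1 natrM lerD2r ler_pM2l.
  exact: count_bound.
have ea1 : 1 <= expR (m%:R * a) by rewrite -expR0 ler_expR mulr_ge0// ltW.
rewrite csk -natr1; apply: (@le_trans _ _ (B / p + 1)).
  by rewrite lerD2r truncn_le// divr_ge0// ltW.
rewrite pE; apply: (@le_trans _ _ ((4 * B + 1) * expR (m%:R * a))).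
  exact: add1_bound.
have -> : m%:R * (- ln e0 + eta) = m%:R * (eta / 2) + m%:R * a by rewrite /a; field.
rewrite expRD ler_pM2r ?expR_gt0//; apply: le_trans BB _; apply: le_trans (Hn2 n n2n) _.
by rewrite ler_expR ler_wpM2r ?divr_ge0 ?(ltW eta0)// ler_nat.
Qed.

End Enorm.

(** * The isodiametric inequality and Hausdorff measure *)

Section Steiner.
Local Close Scope classical_set_scope.
Local Open Scope set_scope.
Variables (d N : nat).
Local Notation T := ('I_(N + N)).
Local Notation G := {ffun 'I_d -> T}.
Implicit Types (A : {set G}) (x y : G) (k j : 'I_d).

Definition upd x k (i : T) : G := [ffun j => if j == k then i else x j].

Definition line A k x : {set T} := [set i | upd x k i \in A].

(** Each line becomes a centred interval. Its length is rounded down to an even number so that all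
    lines have the same centre of symmetry, the wall between cells N - 1 and N. *)
Definition steiner k A : {set G} :=
  [set x : G | (N <= x k + #|line A k x|./2) && (x k < N + #|line A k x|./2)]%N.

Definition coord_inv (g : T -> T) j A := forall x, (upd x j (g (x j)) \in A) = (x \in A).

Lemma upd_upd x k i i' : upd (upd x k i) k i' = upd x k i'.
Proof. by apply/ffunP => j; rewrite !ffunE; case: eqP. Qed.

Lemma updC x k j i i' : j != k -> upd (upd x k i) j i' = upd (upd x j i') k i.
Proof.
move=> jk; apply/ffunP => l; rewrite !ffunE.
by case: (eqVneq l j) => // ->; rewrite (negbTE jk).
Qed.

Lemma upd_id x k : upd x k (x k) = x.
Proof. by apply/ffunP => j; rewrite !ffunE; case: eqP => // ->. Qed.

Lemma upd_k x k i : upd x k i k = i.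
Proof. by rewrite ffunE eqxx. Qed.

Lemma upd_j x k j i : j != k -> upd x k i j = x j.
Proof. by move=> jk; rewrite ffunE (negbTE jk). Qed.

Lemma line_upd A k x i : line A k (upd x k i) = line A k x.
Proof. by apply/setP => l; rewrite !inE upd_upd. Qed.

Lemma card_line A k : (\sum_x #|line A k x| = (N + N) * #|A|)%N.
Proof.
have -> : (\sum_x #|line A k x| = \sum_x \sum_(i : T) (upd x k i \in A))%N.
  by apply: eq_bigr => x _; rewrite -sum1_card big_mkcond; apply: eq_bigr => i _; rewrite inE; case: ifP.
rewrite pair_big/=.
(* Exchanging the stored value with coordinate k is an involution; it decouples the point from its
   position on the line. *)
pose s (p : G * T) := (upd p.1 k p.2, p.1 k).
have sK : involutive s by case=> x i; rewrite /s/= upd_upd upd_id upd_k.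
rewrite (reindex_inj (inv_inj sK))/=.
under eq_bigr do rewrite upd_upd upd_id.
rewrite -(pair_big predT predT (fun x (i : T) => nat_of_bool (x \in A)))/=.
under eq_bigr do rewrite sum_nat_const card_ord.
rewrite -big_distrr/= -sum1_card [in RHS]big_mkcond/=; congr (_ * _)%N.
Qed.

Lemma card_interval (a b : nat) : (b <= N + N)%N -> #|[set i : T | (a <= i) && (i < b)]%N| = (b - a)%N.
Proof.
move=> bN; rewrite -[RHS](size_iota a) cardE -(size_map val); apply/perm_size/uniq_perm; rewrite ?iota_uniq//.
  by rewrite map_inj_uniq ?enum_uniq//; exact: val_inj.
move=> i; rewrite mem_iota; apply/mapP/idP => [[j]|].
  by rewrite mem_enum inE => /andP[? ?] -> /=; lia.
move=> ab; have iN : (i < N + N)%N by lia.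
by exists (Ordinal iN) => //; rewrite mem_enum inE/=; lia.
Qed.

Lemma line_steiner A k x : #|line (steiner k A) k x| = (#|line A k x|./2).*2.
Proof.
have hN : (#|line A k x|./2 <= N)%N.
  by have := max_card (line A k x); rewrite card_ord; lia.
rewrite -[RHS](_ : (N + #|line A k x|./2 - (N - #|line A k x|./2) = _)%N); last by lia.
rewrite -card_interval; last by lia.
by congr #|pred_of_set _|; apply/setP => i; rewrite !inE line_upd upd_k; lia.
Qed.

Lemma card_steiner A k : (forall x, ~~ odd #|line A k x|) -> #|steiner k A| = #|A|.
Proof.
move=> ev; have [N0|N0] := posnP (N + N).
  have E0 x : False by case: (x k) => i ilt; rewrite N0 in ilt.
  by rewrite !eq_card0// => x; have := E0 x.
apply/eqP; rewrite -(eqn_pmul2l N0) -!(card_line _ k); apply/eqP/eq_bigr => x _.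
by rewrite line_steiner; have := ev x; lia.
Qed.

Lemma steiner_inv_k A k : coord_inv (@rev_ord _) k (steiner k A).
Proof. by move=> x; rewrite !inE line_upd upd_k/=; have := ltn_ord (x k); lia. Qed.

(** Applied with [toggle] for the axes still to be treated, whose lines must stay even, and with
    [rev_ord] for the axes already treated, whose symmetry must survive. *)
Lemma steiner_inv A k j g : j != k -> coord_inv g j A -> coord_inv g j (steiner k A).
Proof.
move=> jk inv x; rewrite !inE upd_j; last by rewrite eq_sym.
suff -> : line A k (upd x j (g (x j))) = line A k x by [].
apply/setP => i; rewrite !inE updC; last by rewrite eq_sym.
by rewrite -[in RHS](inv (upd x k i)) (upd_j _ _ jk).
Qed.

(* A set invariant under [toggle] is a union of pairs {2i, 2i+1}: its lines are even, so that
   [steiner], which only keeps twice the half of each line, preserves its cardinality. *)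
Definition toggle (i : T) : T :=
  insubd i (if odd i then i.-1 else i.+1).

Lemma toggleE (i : T) : toggle i = (if odd i then i.-1 else i.+1) :> nat.
Proof.
rewrite /toggle val_insubd; have := ltn_ord i.
by case: ifP => // /negbT; case: ifP => // ev; rewrite -leqNgt => h1 h2; lia.
Qed.

Lemma toggleK : involutive toggle.
Proof. by move=> i; apply/ord_inj; rewrite !toggleE; case: (boolP (odd i)) => oi; case: ifP; lia. Qed.

(** The involution exchanges the even and the odd positions of a line. *)
Lemma line_even A k : coord_inv toggle k A -> forall x, ~~ odd #|line A k x|.
Proof.
move=> inv x; pose O := [set i : T | odd i].
have E : #|line A k x :\: O| = #|line A k x :&: O|.
  rewrite -(card_imset _ (inv_inj toggleK)); congr #|pred_of_set _|; apply/setP => i.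
  apply/imsetP/idP => [[j]|]; rewrite !inE.
    move=> /andP[oj jA] ->; rewrite toggleE -(inv (upd x k (toggle j))) upd_k toggleK upd_upd jA/=.
    by rewrite (negbTE oj)/=.
  move=> /andP[iA oi]; exists (toggle i); last by rewrite toggleK.
  rewrite !inE toggleE oi -(inv (upd x k (toggle i))) upd_k toggleK upd_upd iA andbT.
  by move: oi; lia.
by rewrite -(cardsID O (line A k x)) E oddD addbb.
Qed.

(** If S has extremes a, b and U has extremes a', b', then (b - a') + (b' - a) is the sum of the two
    spreads, at least 2 h1 + 2 h2 - 2, so one summand reaches h1 + h2 - 1. This is the largest
    distance between points of centred intervals of lengths 2 h1 and 2 h2. *)
Lemma line_spread (S U : {set T}) h1 h2 : (0 < h1)%N -> (0 < h2)%N -> (h1.*2 <= #|S|)%N -> (h2.*2 <= #|U|)%N ->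
  exists s u : T, [/\ s \in S, u \in U & (h1 + h2 <= (s - u).+1)%N || (h1 + h2 <= (u - s).+1)%N].
Proof.
have ext (V : {set T}) : (0 < #|V|)%N -> exists a b : T, [/\ a \in V, b \in V & (#|V| + a <= b.+1)%N].
  rewrite card_gt0 => /set0Pn[v0 v0V].
  pose a := [arg min_(i < v0 in V) (i : nat)]; pose b := [arg max_(i > v0 in V) (i : nat)].
  have [aV amin] : a \in V /\ forall i, i \in V -> (a <= i)%N by rewrite /a; case: arg_minnP.
  have [bV bmax] : b \in V /\ forall i, i \in V -> (i <= b)%N by rewrite /b; case: arg_maxnP.
  exists a, b; split => //; have ab := amin _ bV.
  have /subset_leq_card : V \subset [set i : T | (a <= i) && (i < b.+1)]%N.
    by apply/fintype.subsetP => i iV; rewrite inE amin//= ltnS bmax.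
  rewrite card_interval; last exact: ltn_ord.
  by lia.
move=> h10 h20 Sh Uh.
have [a [b [aS bS abS]]] : exists a b : T, [/\ a \in S, b \in S & (#|S| + a <= b.+1)%N].
  by apply: ext; lia.
have [a' [b' [aU bU abU]]] : exists a b : T, [/\ a \in U, b \in U & (#|U| + a <= b.+1)%N].
  by apply: ext; lia.
have [H|H] := leqP (h1 + h2) (b - a').+1; first by exists b, a'; rewrite H.
by exists a, b'; split => //; apply/orP; right; lia.
Qed.

Section Diameter.
Context {R : realType}.

Definition gdist x y : R := \sum_j ((x j)%:R - (y j)%:R) ^+ 2.

(** Any two points of the symmetrized set are matched with two points of A on the same lines, at
    least as far apart along k and with the other coordinates unchanged. *)
Lemma steiner_gdist A k (M : R) : {in A &, forall x y, gdist x y <= M} ->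
  {in steiner k A &, forall x y, gdist x y <= M}.
Proof.
move=> AM x y; rewrite !inE; set h1 := _./2; set h2 := (#|line A k y|)./2 => /andP[x1 x2] /andP[y1 y2].
have [||||s [u [sS uU su]]] := @line_spread (line A k x) (line A k y) h1 h2 _ _ _ _; rewrite ?/h1 ?/h2; try lia.
move: sS uU; rewrite !inE => sA uA; apply: le_trans (AM _ _ sA uA); apply: ler_sum => j _.
have [->|jk] := eqVneq j k; last by rewrite !upd_j.
rewrite !upd_k -[leLHS]real_normK ?num_real// -[leRHS]real_normK ?num_real//.
rewrite ler_pXn2r// ?nnegrE//.
have nd (a b : nat) (c : nat) : (a <= b + c)%N -> (b <= a + c)%N -> `|a%:R - b%:R| <= c%:R :> R.
  move=> ab ba; rewrite ler_norml lerBlDl -natrD ler_nat ab andbT lerBrDl.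
  by rewrite lerBlDr -natrD ler_nat.
have sub_le (a b : nat) : (a - b)%:R <= `|a%:R - b%:R| :> R.
  have [ab|ab] := leqP a b; first by rewrite (eqP ab) normr_ge0.
  by rewrite natrB ?(ltnW ab)// ler_norm.
apply: (@le_trans _ _ ((h1 + h2).-1)%:R).
  by apply: nd; lia.
case/orP: su => h; [|rewrite distrC]; apply: le_trans (sub_le _ _); rewrite ler_nat; lia.
Qed.

Lemma steiner_full A (M : R) : (forall j, coord_inv toggle j A) -> {in A &, forall x y, gdist x y <= M} ->
  exists A' : {set G}, [/\ #|A'| = #|A|, {in A' &, forall x y, gdist x y <= M} &
    forall j, coord_inv (@rev_ord _) j A'].
Proof.
move=> tA dA.
have [A' [cA' dA' rA' _]] : exists A' : {set G}, [/\ #|A'| = #|A|, {in A' &, forall x y, gdist x y <= M},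
    forall j, j \in enum 'I_d -> coord_inv (@rev_ord _) j A' &
    forall j, j \notin enum 'I_d -> coord_inv toggle j A'].
  elim: (enum 'I_d) (enum_uniq 'I_d) => [_|k s IH]; first by exists A.
  move=> /= /andP[ks us]; have [A' [cA' dA' rA' tA']] := IH us.
  exists (steiner k A'); split.
  - by rewrite card_steiner//; apply: line_even; exact: tA'.
  - exact: steiner_gdist.
  - move=> j; rewrite inE; have [->|jk] := eqVneq j k; first by move=> _; exact: steiner_inv_k.
    by move=> /= js; apply: steiner_inv => //; exact: rA'.
  - by move=> j; rewrite inE negb_or => /andP[jk js]; apply: steiner_inv => //; exact: tA'.
by exists A'; split => // j; apply: rA'; rewrite mem_enum.
Qed.

Lemma rev_full A : (forall j, coord_inv (@rev_ord _) j A) -> forall x, x \in A ->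
  [ffun j => rev_ord (x j)] \in A.
Proof.
move=> rA x xA.
have H (s : seq 'I_d) : uniq s -> [ffun j => if j \in s then rev_ord (x j) else x j] \in A.
  elim: s => [_|k s IH /= /andP[ks us]].
    by rewrite (_ : [ffun _ => _] = x)//; apply/ffunP => j; rewrite ffunE.
  have := IH us; rewrite -(rA k) ffunE (negbTE ks); congr (_ \in A).
  apply/ffunP => j; rewrite !ffunE inE; case: eqVneq => [->|]//=.
have := H _ (enum_uniq 'I_d); congr (_ \in A).
by apply/ffunP => j; rewrite !ffunE mem_enum.
Qed.

(** After all symmetrizations the set contains the antipode of each of its points, at twice the
    distance to the centre. The shift by 1/2 measures from centres of cells. *)
Lemma discrete_isodiametric A (M : R) : (forall j, coord_inv toggle j A) ->
  {in A &, forall x y, gdist x y <= M} ->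
  exists A' : {set G}, #|A'| = #|A| /\ {in A', forall x, \sum_j ((x j)%:R + 2^-1 - N%:R) ^+ 2 <= M / 4}.
Proof.
move=> tA dA; have [A' [cA' dA' rA']] := steiner_full tA dA.
exists A'; split => // x xA; rewrite ler_pdivlMr// mulr_suml.
apply: le_trans (dA' _ _ xA (rev_full rA' xA)); apply: ler_sum => j _.
rewrite !ffunE/= natrB ?ltn_ord// natrD -(natr1 (x j)).
by rewrite le_eqVlt; apply/orP; left; apply/eqP; field.
Qed.

End Diameter.
End Steiner.

(** * The isodiametric inequality for arbitrary sets *)

Section Isodiametric.
Context {R : realType}.

Let cell_le (a b : nat) (c t : R) : a%:R - c <= t -> t < b%:R + 1 - c -> (a <= b)%N.
Proof. by move=> ? ?; rewrite -ltnS -(ltr_nat R) -natr1; lra. Qed.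

(** Only the finite union of cells around C is symmetrized. Its cells are within 2 h of C in each
    coordinate, which adds 4 h m to the diameter, hence 2 h m to the radius; passing from centres to
    whole cells adds another h m. *)
Lemma isodiametric_mesh n (C : set 'rV[R]_n.+1) (x0 : 'rV[R]_n.+1) (D h : R) : 0 < h -> C x0 ->
  (forall x y, C x -> C y -> enorm (x - y) <= D) ->
  (leb_out C <= ((D / 2 + 3 * h * n.+1%:R) ^+ n.+1 * vball n.+1)%:E)%E.
Proof.
move=> h0 Cx0 CD; set m := n.+1.
have D0 : 0 <= D by apply: le_trans (CD _ _ Cx0 Cx0); exact: enorm_ge0.
pose N := (Num.truncn (D / h)).+1.
pose a : 'rV[R]_m := x0 - const_mx D.
(* Cells have side h but are selected in pairs of width 2 h along each axis, which makes the
   selected set invariant under [toggle]. *)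
pose near (i : nat) (t : R) := 2 * h * (i./2)%:R <= t < 2 * h * ((i./2)%:R + 1).
pose inA (x : {ffun 'I_m -> 'I_(N + N)}) := exists2 p, C p & forall j, near (x j) (p ord0 j - a ord0 j).
pose A : {set {ffun 'I_m -> 'I_(N + N)}} := [set x | `[< inA x >]]%SET.
have AP x : x \in A -> inA x by rewrite inE => /asboolP.
have near_dist (i : nat) t : near i t -> `|h * i%:R - t| <= 2 * h.
  move=> /andP[t1 t2]; have := odd_double_half i; rewrite -[in i%:R](odd_double_half i) => _.
  move: t1 t2; rewrite -mul2n natrD natrM; move: (i./2%:R : R) => u t1 t2.
  by rewrite ler_norml; case: (odd i) => /=; apply/andP; split; nra.
have tA j : coord_inv (@toggle N) j A.
  move=> x; rewrite !inE; congr `[< _ >]; apply/propext.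
  have E i : (toggle i)./2 = i./2 by rewrite toggleE; case: ifP; lia.
  split=> -[p Cp pn]; exists p => // l; have := pn l; rewrite /near ffunE;
    by case: eqVneq => [->|//]; rewrite E.
have dA : {in A &, forall x y, gdist x y <= ((D + 4 * h * m%:R) / h) ^+ 2}.
  move=> x y /AP[p Cp px] /AP[q Cq qy].
  pose v : 'rV[R]_m := \row_j ((x j)%:R - (y j)%:R).
  have -> : gdist x y = enorm v ^+ 2.
    by rewrite enorm_sqr /dotp; apply: eq_bigr => j _; rewrite !mxE -expr2.
  rewrite ler_pXn2r ?nnegrE ?enorm_ge0//; last first.
    by rewrite divr_ge0 ?addr_ge0// ?mulr_ge0 ?ltW.
  rewrite ler_pdivlMr// mulrC -(gtr0_norm h0) -enormZ gtr0_norm//.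
  rewrite (_ : h *: v = (p - q) + (h *: v - (p - q))); last by rewrite addrC subrK.
  apply: le_trans (enormD _ _) _; rewrite lerD ?CD// mulrC.
  apply: enorm_box; first by rewrite mulr_ge0 ?ltW.
  move=> j; rewrite !mxE.
  have := near_dist _ _ (px j); have := near_dist _ _ (qy j).
  rewrite !ler_norml => /andP[? ?] /andP[? ?]; apply/andP; split; lra.
have [A' [cA' A'P]] := discrete_isodiametric tA dA.
have cov : (leb_out C <= (#|A|%:R * h ^+ m)%:E)%E.
  pose Bx (x : {ffun 'I_m -> 'I_(N + N)}) : set 'rV[R]_m :=
    box (a + h *: \row_j (x j)%:R) (a + h *: \row_j ((x j)%:R + 1)).
  apply: (@le_trans _ _ (\sum_(x <- enum A) leb_out (Bx x))%E).
    apply: leb_out_cover => p Cp.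
    have t0 j : 0 <= (p ord0 j - a ord0 j) / h < (N + N)%:R.
      have := le_trans (enorm_coord (p - x0) j) (CD _ _ Cp Cx0); rewrite !mxE ler_norml => /andP[p1 p2].
      apply/andP; split; first by rewrite divr_ge0 ?(ltW h0)//; lra.
      rewrite ltr_pdivrMr//; have : D < N%:R * h by rewrite -ltr_pdivrMr// truncnS_gt.
      by rewrite natrD; lra.
    pose x : {ffun 'I_m -> 'I_(N + N)} := [ffun j => insubd (Ordinal (ltn0Sn _)) (Num.truncn ((p ord0 j - a ord0 j) / h))].
    have xE j : x j = Num.truncn ((p ord0 j - a ord0 j) / h) :> nat.
      rewrite ffunE val_insubd -(ltr_nat R); have /andP[t1 t2] := t0 j.
      by rewrite (le_lt_trans _ t2)// truncn_le.
    have xl j : h * (x j)%:R <= p ord0 j - a ord0 j < h * ((x j)%:R + 1).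
      rewrite xE natr1 -!(mulrC _ h) -ler_pdivlMr// -ltr_pdivrMr// truncnS_gt andbT.
      by rewrite truncn_le//; have /andP[] := t0 j.
    exists x.
      rewrite mem_enum inE; apply/asboolP; exists p => // j.
      have /andP[x1 x2] := xl j; rewrite /near.
      have := odd_double_half (x j) => /(congr1 (fun k : nat => k%:R : R)).
      rewrite -mul2n natrD natrM; move: x1 x2; move: ((x j)%:R : R) (((x j)./2)%:R : R) => u w x1 x2.
      by case: (odd (x j)) => /= uw; apply/andP; split; nra.
    move=> j; have := xl j; rewrite !mxE; lra.
  rewrite (eq_bigr (fun=> (h ^+ m)%:E)) => [|x _]; last first.
    rewrite leb_out_box -[in RHS](card_ord m) -prodr_const; congr EFin; apply: eq_bigr => j _.
    by rewrite !mxE max_l; lra.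
  by rewrite sumEFin big_const_seq count_predT iter_addr_0 -cardE mulr_natl.
(* The cells of [A'], seen as disjoint unit cubes about the origin, are counted by the volume of a
   ball containing them; the summand m is a crude bound for the half-diagonal of a cube. *)
have A'V : #|A'|%:R <= ((D + 4 * h * m%:R) / h / 2 + m%:R) ^+ m * vball m.
  pose Q (x : {ffun 'I_m -> 'I_(N + N)}) : set (@lebT R n) :=
    box (\row_j ((x j)%:R - N%:R)) (\row_j ((x j)%:R + 1 - N%:R)).
  have mQ x : measurable (Q x) by exact: measurable_row_leb (measurable_box _ _).
  have Q1 x : leb (Q x) = 1%E.
    rewrite /leb leb_out_box; congr EFin; apply: big1 => j _.
    by rewrite !mxE max_l; lra.
  have Qdisj x y (v : @lebT R n) : Q x v -> Q y v -> x = y.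
    move=> xv yv; apply/ffunP => j; apply/ord_inj/eqP; rewrite eqn_leq.
    have := xv j; have := yv j; rewrite !mxE => /andP[y1 y2] /andP[x1 x2].
    by apply/andP; split; [apply: cell_le x1 y2|apply: cell_le y1 x2].
  rewrite -lee_fin -(leb_eball (0 : 'rV[R]_m)); last first.
    by rewrite ltr_wpDl ?divr_ge0// ?ltW// ?divr_gt0 ?ltr_wpDl// ?mulr_gt0.
  apply: (@le_trans _ _ (leb (\big[setU/set0]_(x <- enum A') Q x))); last first.
    apply: le_leb_out => v; rewrite -bigcup_seq => -[x /= xA xv].
    move: xA; rewrite mem_enum => /A'P xM.
    pose c : 'rV[R]_m := \row_j ((x j)%:R + 2^-1 - N%:R).
    rewrite /eball/= subr0 (_ : v = c + (v - c)); last by rewrite addrC subrK.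
    apply: le_trans (enormD _ _) _; apply: lerD.
      rewrite enorm_leP; last by rewrite ?divr_ge0 ?addr_ge0// ?mulr_ge0 ?ltW.
      rewrite expr_div_n (_ : 2 ^+ 2 = 4)//; last by ring.
      by apply: le_trans xM; apply: ler_sum => j _; rewrite !mxE -expr2.
    rewrite -[leRHS]mulr1; apply: enorm_box => // j; have := xv j; rewrite !mxE => /andP[? ?].
    by rewrite ler_norml; apply/andP; split; lra.
  rewrite cardE; elim: (enum A') (enum_uniq A') => [|x s IH]; first by rewrite big_nil measure0.
  move=> /= /andP[xs us]; rewrite big_cons measureU//; last 2 first.
  - by apply: bigsetU_measurable => y _; exact: mQ.
  - apply/seteqP; split => // v [xv]; rewrite -bigcup_seq => -[y /= ys yv].
    by move: xs; rewrite (Qdisj _ _ _ xv yv) ys.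
  by rewrite -natr1 addrC EFinD; apply: leeD; [rewrite -(Q1 x)|exact: IH].
apply: le_trans cov _; rewrite lee_fin -cA'.
apply: le_trans (_ : ((D + 4 * h * m%:R) / h / 2 + m%:R) ^+ m * vball m * h ^+ m <= _).
  by rewrite ler_wpM2r// exprn_ge0// ltW.
rewrite mulrAC ler_wpM2r ?(ltW (vball_gt0 _))// -exprMn.
have -> : ((D + 4 * h * m%:R) / h / 2 + m%:R) * h = D / 2 + 3 * h * m%:R.
  by field; rewrite gt_eqF.
by [].
Qed.

Lemma pow_limit m (x y v l : R) : (forall k, l <= (x + harmonic k * y) ^+ m * v) -> l <= x ^+ m * v.
Proof.
move=> H.
have cv : (x + harmonic k * y) ^+ m * v @[k --> \oo] --> (x + 0 * y) ^+ m * v.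
  apply: cvgM; last exact: cvg_cst.
  apply: (@cvg_comp _ _ _ (fun k => x + harmonic k * y) (fun t : R => t ^+ m)); last exact: exprn_continuous.
  apply: cvgD; first exact: cvg_cst.
  by apply: cvgM; [exact: cvg_harmonic|exact: cvg_cst].
rewrite mul0r addr0 in cv.
rewrite -(cvg_lim _ cv)//; apply: limr_ge; first by apply/cvg_ex; eexists; exact: cv.
by near=> k; exact: H.
Unshelve. all: by end_near. Qed.

Lemma le_diam n (C : set 'rV[R]_n) x y : C x -> C y -> ((enorm (x - y))%:E <= diam C)%E.
Proof. by move=> Cx Cy; apply: ereal_sup_ubound; right; exists x => //; exists y. Qed.

Lemma diam_ge0 n (C : set 'rV[R]_n) : (0 <= diam C)%E.
Proof. by apply: ereal_sup_ubound; left. Qed.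

Lemma isodiametric n (C : set 'rV[R]_n.+1) (d : R) : (diam C <= d%:E)%E ->
  (leb_out C <= @unit_ball_vol R n.+1 * ((fine (diam C) / 2) ^+ n.+1)%:E)%E.
Proof.
move=> Cd; have [->|/set0P[x0 Cx0]] := eqVneq C set0.
  by rewrite leb_out0 mule_ge0 ?leb_out_ge0// lee_fin exprn_ge0// divr_ge0// fine_ge0// diam_ge0.
have fd : diam C \is a fin_num by rewrite ge0_fin_numE ?diam_ge0// (le_lt_trans Cd)// ltry.
rewrite vballE -EFinM mulrC.
have H (h : R) : 0 < h -> (leb_out C <= ((fine (diam C) / 2 + 3 * h * n.+1%:R) ^+ n.+1 * vball n.+1)%:E)%E.
  move=> h0; apply: (isodiametric_mesh h0 Cx0) => x y Cx Cy.
  by rewrite -lee_fin fineK//; exact: le_diam.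
case E : (leb_out C) => [l| |]; last 2 first.
- by have := H 1 ltr01; rewrite E.
- by rewrite leNye.
rewrite lee_fin; apply: (@pow_limit _ _ (3 * n.+1%:R)) => k.
rewrite -lee_fin -E (_ : harmonic k * _ = 3 * harmonic k * n.+1%:R); last by ring.
by apply: H; rewrite /harmonic/= invr_gt0.
Qed.

(** * Comparison of Hausdorff and Lebesgue measure *)

Section HausdorffDelta.
Variables (n : nat) (delta : R).
Hypothesis delta0 : 0 < delta.
Local Notation m := n.+1.
Local Notation small := {C : set 'rV[R]_m | (diam C <= delta%:E)%E}.

Definition hcost (C : set 'rV[R]_m) : \bar R :=
  (@unit_ball_vol R m * ((fine (diam C) / 2) ^+ m)%:E)%E.

Lemma hcost_ge0 C : (0 <= hcost C)%E.
Proof. by rewrite mule_ge0 ?leb_out_ge0// lee_fin exprn_ge0// divr_ge0// fine_ge0// diam_ge0. Qed.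

Lemma hausdorff_deltaE (A : set 'rV[R]_m) :
  hausdorff_delta delta A = cover_out (fun C : small => sval C) (fun C => hcost (sval C)) A.
Proof.
congr ereal_inf; apply/seteqP; split => l /=.
  by move=> [C [AC Cd ->]]; exists (fun k => exist _ (C k) (Cd k)).
by move=> [C [AC ->]]; exists (fun k => sval (C k)); split => // k; exact: (svalP (C k)).
Qed.

Lemma diam0 : diam (set0 : set 'rV[R]_m) = 0%E.
Proof.
apply/eqP; rewrite eq_le diam_ge0 andbT; apply: ge_ereal_sup => _ [->//|[x []]].
Qed.

Lemma hcost0 : hcost set0 = 0%E.
Proof. by rewrite /hcost diam0/= mul0r expr0n/= mule0. Qed.

Lemma hausdorff_delta_le (C : set 'rV[R]_m) (d : R) : 0 <= d -> d <= delta ->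
  (forall x y, C x -> C y -> enorm (x - y) <= d) ->
  (hausdorff_delta delta C <= @unit_ball_vol R m * ((d / 2) ^+ m)%:E)%E.
Proof.
move=> d0 dd Cd.
have Cdiam : (diam C <= d%:E)%E.
  by apply: ge_ereal_sup => _ [->|[x Cx [y Cy <-]]]; rewrite lee_fin//; exact: Cd.
apply: (@le_trans _ _ (hcost C)).
  rewrite hausdorff_deltaE; have Cs : (diam C <= delta%:E)%E by rewrite (le_trans Cdiam)// lee_fin.
  have zs : (diam (set0 : set 'rV[R]_m) <= delta%:E)%E by rewrite diam0 lee_fin ltW.
  apply: le_trans.
    apply: (@cover_out_le _ _ _ _ _ _ (fun k => if k is 0%N then exist _ C Cs else exist _ set0 zs)).
    by move=> x Cx; exists 0%N.
  rewrite nneseries_recl//; last by move=> k _; exact: hcost_ge0.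
  by rewrite eseries0 ?adde0// => -[//|k] _ _ /=; rewrite hcost0.
rewrite /hcost lee_wpmul2l ?leb_out_ge0// lee_fin ler_pXn2r// ?nnegrE ?divr_ge0 ?fine_ge0 ?diam_ge0//.
by rewrite ler_pM2r// -lee_fin fineK// ge0_fin_numE ?diam_ge0// (le_lt_trans Cdiam)// ltry.
Qed.

Lemma hausdorff_delta_set0 : hausdorff_delta delta (set0 : set 'rV[R]_m) = 0%E.
Proof.
apply/eqP; rewrite eq_le; apply/andP; split; last first.
  by rewrite hausdorff_deltaE; apply: cover_out_ge0 => C; exact: hcost_ge0.
apply: le_trans (@hausdorff_delta_le set0 0 (lexx 0) (ltW delta0) _) _ => //.
by rewrite mul0r expr0n/= mule0.
Qed.

Definition hdelta (A : set 'rV[R]_m) := hausdorff_delta delta A.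

Lemma hdelta_ge0 A : (0 <= hdelta A)%E.
Proof. by rewrite /hdelta hausdorff_deltaE; apply: cover_out_ge0 => C; exact: hcost_ge0. Qed.

Lemma le_hdelta : {homo hdelta : A B / A `<=` B >-> (A <= B)%E}.
Proof. by move=> A B AB; rewrite /hdelta !hausdorff_deltaE; exact: le_cover_out. Qed.

Lemma hdelta_sigma_subadditive : sigma_subadditive hdelta.
Proof.
move=> A; under eq_eseriesr do rewrite /hdelta hausdorff_deltaE.
rewrite /hdelta hausdorff_deltaE; apply: cover_out_sigma_subadditive => C.
exact: hcost_ge0.
Qed.

HB.instance Definition _ := isOuterMeasure.Build R 'rV[R]_m hdelta
  hausdorff_delta_set0 hdelta_ge0 le_hdelta hdelta_sigma_subadditive.

Lemma leb_out_le_hdelta A : (leb_out A <= hdelta A)%E.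
Proof.
apply/le_ereal_inf_tmp => _ [C [AC Cd ->]].
apply: (@le_trans _ _ (leb_out (\bigcup_k C k))); first exact: le_leb_out.
apply: le_trans (leb_out_sigma_subadditive C) _.
apply: lee_nneseries => [k _ _|k _]; first exact: leb_out_ge0.
exact: isodiametric (Cd k).
Qed.

Definition hcube (a : 'rV[R]_m) (s : R) := box a (a + const_mx s).

(* Cut the box into equal cubes whose total volume exceeds that of the box by little. *)
Lemma hdelta_box (C s0 : R) : 0 < s0 ->
  (forall a s, 0 < s <= s0 -> (hdelta (hcube a s) <= (C * s ^+ m)%:E)%E) ->
  forall a b, (hdelta (box a b) <= (C * vol a b)%:E)%E.
Proof.
move=> s00 H a b; have C0 : 0 <= C.
  have := le_trans (hdelta_ge0 _) (H 0 s0 (introT andP (conj s00 (lexx _)))).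
  by rewrite lee_fin pmulr_lge0// exprn_gt0.
have [/existsP[k ba]|/existsPn ab] := boolP [exists k : 'I_m, b ord0 k <= a ord0 k].
  rewrite (_ : box a b = set0) ?outer_measure0 ?lee_fin ?mulr_ge0 ?vol_ge0//.
  by apply/seteqP; split => // x /(_ k) /andP[x1 x2]; have := le_trans ba x1; rewrite leNgt x2.
have {}ab k : a ord0 k < b ord0 k by rewrite ltNge.
have cov s : 0 < s <= s0 -> (hdelta (box a b) <= (C * \prod_k (b ord0 k - a ord0 k + s))%:E)%E.
  move=> ss0; have /andP[s_gt0 _] := ss0.
  pose N k := (Num.truncn ((b ord0 k - a ord0 k) / s)).+1.
  pose M := (\max_k N k)%N.
  pose Q (f : {ffun 'I_m -> 'I_M}) := if [forall k, (f k < N k)%N] then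
    hcube (a + s *: \row_k (f k)%:R) s else set0.
  apply: (@le_trans _ _ (\sum_(f <- enum {: {ffun 'I_m -> 'I_M}}) hdelta (Q f))%E).
    apply: outer_measure_cover => x xab.
    have tx k : 0 <= (x ord0 k - a ord0 k) / s.
      by rewrite divr_ge0 ?(ltW s_gt0)// subr_ge0; have /andP[] := xab k.
    have xN k : (Num.truncn ((x ord0 k - a ord0 k) / s) < N k)%N.
      rewrite -(ltr_nat R); apply: (@le_lt_trans _ _ ((x ord0 k - a ord0 k) / s)); first by rewrite truncn_le.
      apply: lt_trans (truncnS_gt _).
      by rewrite ltr_pM2r ?invr_gt0// ltrD2r; have /andP[] := xab k.
    have xM k : (Num.truncn ((x ord0 k - a ord0 k) / s) < M)%N.
      exact: leq_trans (xN k) (leq_bigmax k).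
    exists [ffun k => Ordinal (xM k)]; first by rewrite mem_enum.
    rewrite /Q ifT; last by apply/forallP => k; rewrite ffunE; exact: xN.
    move=> k; rewrite !mxE ffunE/= -lerBrDl -[X in _ < X]addrA -ltrBlDl.
    rewrite -[X in _ < _ + X]mulr1 -mulrDr natr1 -!(mulrC _ s) -ler_pdivlMr// -ltr_pdivrMr//.
    by rewrite truncnS_gt andbT truncn_le//; exact: tx.
  apply: (@le_trans _ _ (\sum_(f <- enum {: {ffun 'I_m -> 'I_M}}) (C * \prod_k (if (f k < N k)%N then s else 0))%:E)%E).
    apply: lee_sum => f _; rewrite /Q; case: ifPn => [/forallP fN|_]; last first.
      by rewrite outer_measure0 lee_fin mulr_ge0// prodr_ge0// => k _; case: ifP; rewrite ?(ltW s_gt0).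
    apply: le_trans (H _ _ ss0) _; rewrite lee_fin ler_wpM2l//.
    by rewrite (eq_bigr (fun=> s)) ?prodr_const ?card_ord// => k _; rewrite fN.
  rewrite sumEFin big_enum/= lee_fin -mulr_sumr ler_wpM2l//.
  rewrite -(bigA_distr_bigA (fun (k : 'I_m) (i : 'I_M) => if (i < N k)%N then s else 0)).
  apply: ler_prod => k _; apply/andP; split; first by apply: sumr_ge0 => i _; case: ifP; rewrite ?(ltW s_gt0).
  rewrite -big_mkcond/= -(@big_ord_widen _ _ _ (N k) M (fun=> s)); last exact: leq_bigmax.
  rewrite sumr_const card_ord -[leLHS]mulr_natl -natr1 mulrDl mul1r lerD2r -ler_pdivlMr//.
  by rewrite truncn_le// divr_ge0 ?subr_ge0 ?ltW.
pose l k := b ord0 k - a ord0 k.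
have l0 k : 0 < l k by rewrite subr_gt0.
(* A positive number below [s0] and below every side of the box: cubes of side [harmonic k * l1]
   overshoot each side by a factor at most 1 + [harmonic k]. *)
pose l1 := Num.min s0 (1 + \sum_k (l k)^-1)^-1.
have S0 : 0 < 1 + \sum_k (l k)^-1 by rewrite ltr_wpDr// sumr_ge0// => k _; rewrite invr_ge0 ltW.
have l10 : 0 < l1 by rewrite lt_min s00 invr_gt0.
have l1l k : l1 <= l k.
  rewrite ge_min; apply/orP; right; rewrite -[leRHS]invrK lef_pV2 ?posrE ?invr_gt0//.
  rewrite (bigD1 k)//= addrCA lerDl addr_ge0// sumr_ge0// => j _; by rewrite invr_ge0 ltW.
case E : (hdelta (box a b)) => [t| |]; last 2 first.
- by have := cov s0; rewrite E lexx s00 => /(_ isT).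
- by rewrite leNye.
rewrite lee_fin; have -> : C * vol a b = 1 ^+ m * (C * vol a b) by rewrite expr1n mul1r.
apply: (@pow_limit _ _ 1) => k; rewrite mulr1.
have h0 : 0 < harmonic k :> R by rewrite /harmonic/= invr_gt0.
have h1 : harmonic k <= 1 :> R by rewrite /harmonic/= invf_le1// ler1n.
have := cov (harmonic k * l1); rewrite E lee_fin => H1; apply: le_trans (H1 _) _.
  by rewrite mulr_gt0//= (le_trans (ler_piMl (ltW l10) h1))// ge_min lexx.
rewrite mulrCA ler_wpM2l//.
have -> : (1 + harmonic k) ^+ m = \prod_(j < m) (1 + harmonic k) :> R by rewrite prodr_const card_ord.
rewrite /vol -big_split/=; apply: ler_prod => j _.
rewrite max_l ?(ltW (l0 j))// addr_ge0 ?(ltW (l0 j)) ?mulr_ge0 ?(ltW h0) ?(ltW l10)//=.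
by rewrite mulrDl mul1r lerD2l; apply: ler_wpM2l; [exact: ltW h0 | exact: l1l].
Qed.

Lemma hdelta_le_leb (C : R) : 0 < C -> (forall a b, (hdelta (box a b) <= (C * vol a b)%:E)%E) ->
  forall A, (hdelta A <= C%:E * leb_out A)%E.
Proof.
move=> C0 H A; rewrite -lee_pdivrMl//; apply/le_ereal_inf_tmp => _ [a [b [Aab ->]]].
rewrite lee_pdivrMl// -nneseriesZl//; last by move=> i _; rewrite lee_fin vol_ge0.
apply: (@le_trans _ _ (hdelta (\bigcup_k box (a k) (b k)))); first exact: le_hdelta.
apply: le_trans (hdelta_sigma_subadditive _) _.
apply: lee_nneseries => [k _ _|k _]; first exact: hdelta_ge0.
by rewrite -EFinM.
Qed.

(** A cube of side at most [s0] has diameter at most [delta], and [theta] is the proportion of a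
    cube filled by the ball whose radius is a quarter of its side. *)
Let s0 := delta / m%:R.
Let theta := @vball R m / 4 ^+ m.

Lemma vol_hcube (a : 'rV[R]_m) (s : R) : 0 < s -> vol a (a + const_mx s) = s ^+ m.
Proof.
move=> s_gt0; rewrite -[in RHS](card_ord m) -prodr_const; apply: eq_bigr => k _.
by rewrite !mxE addrAC subrr add0r max_l// ltW.
Qed.

(* Put one ball in each small cube and cover what remains, a proportion 1 - theta of the cube,
   with constant C. *)
Lemma hdelta_step (C : R) : 1 <= C ->
  (forall a s, 0 < s <= s0 -> (hdelta (hcube a s) <= (C * s ^+ m)%:E)%E) ->
  forall a s, 0 < s <= s0 -> (hdelta (hcube a s) <= ((theta + (1 - theta) * C) * s ^+ m)%:E)%E.
Proof.
move=> C1 H a s /andP[s_gt0 ss0]; have C0 : 0 < C by exact: lt_le_trans C1.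
have s00 : 0 < s0 by rewrite divr_gt0.
have HC := hdelta_le_leb C0 (hdelta_box s00 H).
have sd : s <= delta.
  by apply: le_trans ss0 _; rewrite ler_pdivrMr// ler_peMr ?(ltW delta0)// ler1n.
pose B := eball (a + const_mx (s / 2)) (s / 4).
have BQ : B `<=` hcube a s.
  move=> x /(le_trans (enorm_coord _ _)) xB k; have := xB k; rewrite !mxE ler_norml => /andP[? ?].
  by apply/andP; split; lra.
have HB : (hdelta B <= (theta * s ^+ m)%:E)%E.
  apply: (le_trans (@hausdorff_delta_le B (s / 2) _ _ _)); [lra|lra| |].
    move=> x y xB yB; rewrite (_ : x - y = (x - (a + const_mx (s / 2))) - (y - (a + const_mx (s / 2)))); last first.
      by rewrite opprB addrA subrK.
    apply: le_trans (enormD _ _) _; rewrite enormN; apply: le_trans (lerD xB yB) _; lra.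
  rewrite vballE -EFinM lee_fin /theta (_ : s / 2 / 2 = s / 4); last by field.
  by rewrite expr_div_n le_eqVlt; apply/orP; left; apply/eqP; ring.
have lB : leb_out B = (theta * s ^+ m)%:E.
  rewrite leb_eball ?divr_gt0//; congr EFin; rewrite /theta expr_div_n; ring.
have lQ : leb_out (hcube a s) = (s ^+ m)%:E by rewrite leb_out_box vol_hcube.
have lQB : leb_out (hcube a s `\` B) = (s ^+ m - theta * s ^+ m)%:E.
  have := measurable_row_leb (measurable_eball (a + const_mx (s / 2)) (s / 4)) (hcube a s).
  rewrite -/B (setIidr BQ) lQ lB -setDE; case: (leb_out _) => [l| |]//.
  by rewrite -EFinD => -[E]; congr EFin; lra.
apply: (@le_trans _ _ (hdelta (B `|` (hcube a s `\` B)))).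
  by apply: le_hdelta => x Qx; have [?|?] := pselect (B x); [left|right].
apply: le_trans (outer_measureU2 _ _ _) _.
rewrite (_ : _ * s ^+ m = theta * s ^+ m + C * (s ^+ m - theta * s ^+ m)); last by ring.
by rewrite EFinD; apply: leeD => //; rewrite EFinM -lQB; exact: HC.
Qed.

Lemma theta_itv : 0 < theta <= 1.
Proof.
apply/andP; split; first by rewrite divr_gt0 ?vball_gt0// exprn_gt0.
have BQ : eball (const_mx 2^-1) 4^-1 `<=` hcube 0 1.
  move=> x /(le_trans (enorm_coord _ _)) xB k; have := xB k; rewrite !mxE ler_norml => /andP[? ?].
  by apply/andP; split; lra.
have := le_leb_out BQ; rewrite leb_eball ?invr_gt0// leb_out_box vol_hcube// lee_fin expr1n.
by rewrite /theta exprVn mulrC.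
Qed.

(** Covering a cube by itself gives a first constant 1 + C0. Each step applies C -> theta + (1 -
    theta) C, which fixes 1 and shrinks the excess by 1 - theta, so the constant tends to 1. *)
Lemma hdelta_le A : (hdelta A <= leb_out A)%E.
Proof.
have /andP[th0 th1] := theta_itv.
have s00 : 0 < s0 by rewrite divr_gt0.
pose C0 := @vball R m * (m%:R / 2) ^+ m.
have C00 : 0 <= C0 by rewrite mulr_ge0 ?(ltW (vball_gt0 _))// exprn_ge0// divr_ge0.
have H0 a s : 0 < s <= s0 -> (hdelta (hcube a s) <= ((1 + C0) * s ^+ m)%:E)%E.
  move=> /andP[s_gt0 ss0].
  apply: (le_trans (@hausdorff_delta_le _ (m%:R * s) _ _ _)).
  - by rewrite mulr_ge0// ltW.
  - by rewrite mulrC -ler_pdivlMr.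
  - move=> x y xQ yQ; apply: enorm_box; first exact: ltW.
    move=> k; have := xQ k; have := yQ k; rewrite !mxE => /andP[? ?] /andP[? ?].
    by rewrite ler_norml; apply/andP; split; lra.
  rewrite vballE -EFinM lee_fin mulrDl ler_wpDl ?mul1r ?exprn_ge0 ?(ltW s_gt0)//.
  by rewrite /C0 -mulrA -exprMn mulrAC.
have Hk k a s : 0 < s <= s0 -> (hdelta (hcube a s) <= ((1 + (1 - theta) ^+ k * C0) * s ^+ m)%:E)%E.
  elim: k a s => [|k IH] a s ss0; first by rewrite expr0 mul1r; exact: H0.
  have -> : 1 + (1 - theta) ^+ k.+1 * C0 = theta + (1 - theta) * (1 + (1 - theta) ^+ k * C0).
    by rewrite exprS; ring.
  by apply: hdelta_step => //; rewrite lerDl mulr_ge0// exprn_ge0// subr_ge0.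
rewrite -[leRHS]mul1e; apply: hdelta_le_leb => // a b; rewrite mul1r.
have vb := vol_ge0 a b.
apply/lee_addgt0Pr => e e0; rewrite -EFinD.
have [k0 Hk0] : exists n0 : nat, forall k, (n0 <= k)%N -> (1 - theta) ^+ k <= e / (1 + C0 * vol a b).
  by apply: expr_small; [rewrite subr_ge0 th1/= gtrBl|rewrite divr_gt0// ltr_wpDr// mulr_ge0].
apply: le_trans (hdelta_box s00 (Hk k0) a b) _.
rewrite lee_fin mulrDl mul1r lerD2l -mulrA.
apply: (@le_trans _ _ (e / (1 + C0 * vol a b) * (C0 * vol a b))).
  by apply: ler_wpM2r; [exact: mulr_ge0|exact: Hk0].
rewrite mulrAC ler_pdivrMr; last by rewrite ltr_wpDr// mulr_ge0.
by rewrite ler_wpM2l ?(ltW e0)// lerDr.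
Qed.

End HausdorffDelta.

Lemma hausdorff_leb n (A : set 'rV[R]_n.+1) : hausdorff A = leb_out A.
Proof.
apply/eqP; rewrite eq_le; apply/andP; split.
  apply: ge_ereal_sup => _ [d d0 <-]; move: d0; rewrite /= in_itv/= andbT => d0.
  exact: hdelta_le.
apply: le_trans (leb_out_le_hdelta 1 A) _; apply: ereal_sup_ubound.
by exists 1 => //=; rewrite in_itv/= ltr01.
Qed.

End Isodiametric.

(** * Plancherel's inequality *)

Section OneDim.
Context {R : realType}.
Local Notation leb1 := (@lebesgue_measure R).

Lemma integral_line_opp (g : R -> R) : continuous g -> (forall x, 0 <= g x) ->
  (\int[leb1]_x (g x)%:E = \int[leb1]_x (g (- x))%:E)%E.
Proof.
move=> cg g0.
have half (f : R -> R) : continuous f -> (forall x, 0 <= f x) ->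
    (\int[leb1]_x (f x)%:E =
     \int[leb1]_(x in `[0%R, +oo[) (f x)%:E + \int[leb1]_(x in `[0%R, +oo[) (f (- x))%:E)%E.
  move=> cf f0.
  have mf D : measurable_fun D (EFin \o f).
    by apply/measurable_EFinP; apply: measurable_funTS; exact: continuous_measurable_fun.
  have -> : [set: R] = `]-oo, 0[%classic `|` `[0, +oo[%classic.
    by apply/seteqP; split => x //= _; rewrite !in_itv/= andbT; case: ltP; [left|right].
  rewrite ge0_integral_setU//=; last 3 first.
  - exact: mf.
  - by move=> x _; rewrite lee_fin.
  - apply/disj_setPLR => x /=; rewrite !in_itv/= andbT => x0; by rewrite leNgt x0.
  rewrite addeC; congr adde.
  rewrite -(@ge0_integration_by_substitutionNy _ f 0) ?oppr0//; last first.
    exact: continuous_subspaceT.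
  by rewrite -integral_itv_bndo_bndc//; exact/measurable_EFinP/measurable_funTS/continuous_measurable_fun.
have cgN : continuous (fun x => g (- x)).
  by move=> x; apply: continuous_comp; [exact: oppr_continuous|exact: cg].
rewrite (half _ cg g0) (half _ cgN (fun=> g0 _)) addeC; congr adde.
by apply: eq_integral => x _; rewrite opprK.
Qed.

Lemma integral_even_FTC (f F : R -> R) (l : R) : continuous f -> (forall x, 0 <= f x) ->
  (forall x, f (- x) = f x) -> F x @[x --> +oo] --> l ->
  (forall x : R, 0 <= x -> is_derive x (1 : R) F (f x)) ->
  (\int[leb1]_x (f x)%:E = (2 * (l - F 0))%:E)%E.
Proof.
move=> cf f0 fe Fl Ff.
have dF x : 0 <= x -> derivable F x 1 by move=> /Ff[].
rewrite ge0_symfun_integralT//.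
rewrite (_ : [set x | 0 <= x] = `[0, +oo[%classic); last by apply/seteqP; split => x /=; rewrite in_itv/= andbT.
rewrite (@ge0_continuous_FTC2y _ f F 0 l)//.
- exact: continuous_subspaceT.
- by move=> x /ltW; exact: dF.
- apply: cvg_at_right_filter; apply: differentiable_continuous; exact/derivable1_diffP/dF.
- move=> x; rewrite in_itv/= andbT => /ltW x0; by rewrite derive1E; case: (Ff x x0) => _ <-.
- by move=> x /=; rewrite fe.
Qed.

(** The Abel weight and its Fourier transform, the Poisson kernel [lorentz]. All the integrals of
    this pair that occur have elementary primitives, the kernel being integrated by an
    arctangent. *)
Definition expw (t x : R) : R := expR (- (t * `|x|)).
Definition lorentz (t s : R) : R := 2 * t / (t ^+ 2 + s ^+ 2).

Lemma expw_ge0 (t x : R) : 0 <= expw t x. Proof. exact: expR_ge0. Qed.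

Lemma continuous_expw (t : R) : continuous (expw t).
Proof.
move=> x; apply: continuous_comp; last exact: continuous_expR.
apply: continuousN; apply: continuousM; [exact: cst_continuous|exact: norm_continuous].
Qed.

Lemma lorentz_ge0 (t s : R) : 0 < t -> 0 <= lorentz t s.
Proof. by move=> t0; rewrite divr_ge0 ?mulr_ge0 ?addr_ge0 ?sqr_ge0 ?ltW. Qed.

Lemma lorentzN (t s : R) : lorentz t (- s) = lorentz t s. Proof. by rewrite /lorentz sqrrN. Qed.

Lemma continuous_lorentz (t : R) : 0 < t -> continuous (lorentz t).
Proof.
move=> t0 x; rewrite /lorentz; apply: cvgM; first exact: cvg_cst.
apply: cvgV; first by rewrite gt_eqF// ltr_wpDr ?sqr_ge0 ?exprn_gt0.
by apply: cvgD; [exact: cvg_cst|exact: exprn_continuous].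
Qed.

Lemma expRN_cvgy (t : R) : 0 < t -> expR (- (t * x)) @[x --> +oo] --> (0 : R).
Proof.
move=> t0; apply/cvgrPdist_le => e e0; near=> x.
rewrite sub0r normrN ger0_norm ?expR_ge0// expRN -[leRHS]invrK lef_pV2 ?posrE ?expR_gt0 ?invr_gt0//.
apply: le_trans (expR_ge1Dx _); rewrite ler_wpDl//.
by rewrite mulrC -ler_pdivrMr//; near: x; exact: nbhs_pinfty_ge.
Unshelve. all: by end_near. Qed.

(** Adding 1 to the cosine makes the integrand nonnegative, as the fundamental theorem on a
    half-line requires; the constant part, the case s = 0 up to a factor 2, is subtracted
    afterwards. *)
Lemma integral_expw_cos1 (t s : R) : 0 < t ->
  (\int[leb1]_x (expw t x * (1 + cos (s * x)))%:E = (2 / t + lorentz t s)%:E)%E.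
Proof.
move=> t0.
pose u := t ^+ 2 + s ^+ 2; have u0 : u != 0 by rewrite gt_eqF// ltr_wpDr ?sqr_ge0 ?exprn_gt0.
have cF : continuous (fun x : R => s * x) by exact: mulrl_continuous.
pose F (x : R) := expR (- (t * x)) * (- t^-1 + (s * sin (s * x) - t * cos (s * x)) / u).
apply: etrans; first apply: (@integral_even_FTC _ F 0); last first.
- rewrite /F !mulr0 oppr0 expR0 sin0 cos0 /lorentz -/u; congr EFin; field; rewrite u0 gt_eqF//.
- move=> x x0; rewrite /F; apply: is_derive_eq.
  rewrite /expw ger0_norm//.
  rewrite /GRing.scale/=; have uE : u = t ^+ 2 + s ^+ 2 by [].
  by field: uE; rewrite u0 gt_eqF.
- have B : forall x, `|- t^-1 + (s * sin (s * x) - t * cos (s * x)) / u| <= t^-1 + (`|s| + t) / `|u|.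
    move=> x; apply: le_trans (ler_normD _ _) _; rewrite normrN gtr0_norm ?invr_gt0// lerD2l.
    rewrite normrM normfV ler_wpM2r ?invr_ge0//; apply: le_trans (ler_normB _ _) _.
    rewrite !normrM (gtr0_norm t0); apply: lerD.
      by rewrite ler_piMr// ler_norml sin_geN1 sin_le1.
    by rewrite ler_piMr ?(ltW t0)// ler_norml cos_geN1 cos_le1.
  set c := t^-1 + _ in B.
  have c0 : 0 < c by rewrite ltr_wpDr ?invr_gt0// divr_ge0// addr_ge0// ltW.
  apply/cvgr0Pnorm_le => e e0.
  have := expRN_cvgy t0 => /cvgr0Pnorm_le /(_ (e / c)) /(_ (divr_gt0 e0 c0)).
  apply: filterS => x H; rewrite normrM; apply: le_trans (ler_pM _ _ H (B x)) _ => //.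
  by rewrite mulfVK ?gt_eqF.
- by move=> x; rewrite /expw normrN mulrN cosN.
- by move=> x; rewrite mulr_ge0 ?expw_ge0// -lerBlDl sub0r cos_geN1.
- move=> x; apply: cvgM; first exact: continuous_expw.
  apply: cvgD; first exact: cvg_cst.
  by apply: continuous_comp; [exact: cF|exact: continuous_cos].
Qed.

Lemma integral_expw (t : R) : 0 < t -> (\int[leb1]_x (expw t x)%:E = (2 / t)%:E)%E.
Proof.
move=> t0; have := integral_expw_cos1 0 t0.
under eq_integral do rewrite mul0r cos0 mulrC EFinM.
rewrite ge0_integralZl//; last 2 first.
- by apply/measurable_EFinP; apply: continuous_measurable_fun; exact: continuous_expw.
- by move=> x _; rewrite lee_fin expw_ge0.
have -> : 2 / t + lorentz t 0 = 2 * (2 / t) by rewrite /lorentz; field; rewrite gt_eqF.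
rewrite EFinM => /(congr1 (fun z => (2^-1)%:E * z)%E).
by rewrite !muleA -!EFinM mulVf ?pnatr_eq0// !mul1e mul1r.
Qed.

Lemma integrable_expw (t : R) (f : R -> R) : 0 < t -> continuous f -> (forall x, `|f x| <= 1) ->
  leb1.-integrable setT (fun x => (expw t x * f x)%:E).
Proof.
move=> t0 cf f1.
have mE := continuous_measurable_fun (@continuous_expw t).
have mf := continuous_measurable_fun cf.
apply: (@le_integrable _ _ _ leb1 _ _ _ (EFin \o expw t)) => //.
- exact/measurable_EFinP/measurable_funM.
- by move=> x _; rewrite /= lee_fin normrM -[leRHS]mulr1 ler_wpM2l.
apply/integrableP; split; first exact/measurable_EFinP.
under eq_integral do rewrite /= ger0_norm ?expw_ge0//.
by rewrite integral_expw ?ltry.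
Qed.

Lemma integral_expw_cos (t s : R) : 0 < t ->
  (\int[leb1]_x (expw t x * cos (s * x))%:E = (lorentz t s)%:E)%E.
Proof.
move=> t0; have := integral_expw_cos1 s t0.
have cF : continuous (fun x : R => cos (s * x)).
  by move=> x; apply: continuous_comp; [exact: mulrl_continuous|exact: continuous_cos].
under eq_integral do rewrite mulrDr EFinD.
rewrite integralD//; last 2 first.
- by apply: integrable_expw => //; [exact: cst_continuous|rewrite normr1].
- by apply: integrable_expw => // x; rewrite ler_norml cos_geN1 cos_le1.
under eq_integral do rewrite mulr1.
rewrite integral_expw// EFinD => /(congr1 (fun z => z - (2 / t)%:E)%E).
by rewrite [in RHS]addeAC subee// add0e addeAC subee// add0e.
Qed.

Lemma integral_expw_sin (t s : R) : 0 < t ->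
  (\int[leb1]_x (expw t x * sin (s * x))%:E = 0)%E.
Proof.
move=> t0.
have cF : continuous (fun x : R => sin (s * x)).
  by move=> x; apply: continuous_comp; [exact: mulrl_continuous|exact: continuous_sin].
have iS : leb1.-integrable setT (fun x => (expw t x * sin (s * x))%:E).
  by apply: integrable_expw => // x; rewrite ler_norml sin_geN1 sin_le1.
have iE : leb1.-integrable setT (fun x => (expw t x * 1)%:E).
  by apply: integrable_expw => //; [exact: cst_continuous|rewrite normr1].
have cG : continuous (fun x => expw t x * (1 + sin (s * x))).
  move=> x; apply: cvgM; first exact: continuous_expw.
  by apply: cvgD; [exact: cvg_cst|exact: cF].
have G0 x : 0 <= expw t x * (1 + sin (s * x)).
  by rewrite mulr_ge0 ?expw_ge0// -lerBlDl sub0r sin_geN1.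
(* Reflection preserves the weight and negates the sine, so the sine integral equals its opposite;
   the added 1 again serves only positivity. *)
have := integral_line_opp cG G0.
have E x : (expw t x * (1 + sin (s * x)))%:E = ((expw t x * 1)%:E + (expw t x * sin (s * x))%:E)%E.
  by rewrite mulrDr EFinD.
under eq_integral do rewrite E.
rewrite integralD//.
have E' x : (expw t (- x) * (1 + sin (s * - x)))%:E = ((expw t x * 1)%:E - (expw t x * sin (s * x))%:E)%E.
  by rewrite /expw normrN mulrN sinN mulrDr EFinD mulrN EFinN.
under [X in _ = X]eq_integral do rewrite E'.
rewrite integralB//.
have {1}-> : (\int[leb1]_x (expw t x * 1)%:E = (2 / t)%:E)%E.
  by under eq_integral do rewrite mulr1; exact: integral_expw.
have -> : (\int[leb1]_x (expw t x * 1)%:E = (2 / t)%:E)%E.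
  by under eq_integral do rewrite mulr1; exact: integral_expw.
have /fineK <- : (\int[leb1]_x (expw t x * sin (s * x))%:E)%E \is a fin_num.
  exact: integrable_fin_num.
by rewrite -EFinD -EFinB => -[H]; congr EFin; lra.
Qed.

Lemma is_derive_lorentz (t s : R) : 0 < t -> is_derive s (1 : R) (fun x => 2 * atan (t^-1 * x)) (lorentz t s).
Proof.
move=> t0; apply: is_derive_eq; rewrite /GRing.scale/= /lorentz.
have tn : t != 0 by rewrite gt_eqF.
have un : t ^+ 2 + s ^+ 2 != 0 by rewrite gt_eqF// ltr_wpDr ?sqr_ge0 ?exprn_gt0.
have -> : 1 + (t^-1 * s) ^+ 2 = (t ^+ 2 + s ^+ 2) / t ^+ 2 by field; rewrite tn.
by field; rewrite tn un.
Qed.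

Lemma integral_lorentz (t : R) : 0 < t -> (\int[leb1]_x (lorentz t x)%:E = (2 * pi)%:E)%E.
Proof.
move=> t0.
apply: etrans; first apply: (@integral_even_FTC _ (fun x => 2 * atan (t^-1 * x)) (2 * (pi / 2))).
- exact: continuous_lorentz.
- by move=> x; exact: lorentz_ge0.
- by move=> x; exact: lorentzN.
- apply: cvgM; first exact: cvg_cst.
  apply: (cvg_comp _ _ _ (@cvgy_atan R)).
  apply/cvgryPge => A; near=> x.
  by rewrite mulrC ler_pdivlMr//; near: x; exact: nbhs_pinfty_ge.
- by move=> x _; exact: is_derive_lorentz.
- by rewrite /= mulr0 atan0 mulr0 subr0; congr EFin; field.
Unshelve. all: by end_near. Qed.

Lemma integral_lorentz_itv (t p : R) : 0 < t -> 0 < p ->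
  (\int[leb1]_(x in `[(- p)%R, p]) (lorentz t x)%:E = (4 * atan (p / t))%:E)%E.
Proof.
move=> t0 p0; have D s := is_derive_lorentz s t0.
rewrite (@continuous_FTC2 _ _ (fun x => 2 * atan (t^-1 * x)))//.
- by rewrite -EFinB mulrN atanN; congr EFin; rewrite (mulrC t^-1); ring.
- by rewrite gtrN.
- by apply: continuous_subspaceT; exact: continuous_lorentz.
- have cF x : {for x, continuous (fun x => 2 * atan (t^-1 * x))}.
    by apply: differentiable_continuous; apply/derivable1_diffP; case: (D x).
  split; [by move=> x _; case: (D x)| | ]; first by apply: cvg_at_right_filter; exact: cF.
  by apply: cvg_at_left_filter; exact: cF.
- by move=> x _; rewrite derive1E; case: (D x) => _ <-.
Qed.

End OneDim.

Lemma Rintegral_prodM {R : realType} d1 d2 (T1 : measurableType d1) (T2 : measurableType d2)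
    (m1 : {sigma_finite_measure set T1 -> \bar R}) (m2 : {sigma_finite_measure set T2 -> \bar R})
    (f : T1 -> R) (g : T2 -> R) :
  m1.-integrable setT (EFin \o f) -> m2.-integrable setT (EFin \o g) ->
  (\int[m1 \x m2]_z (f z.1 * g z.2)%:E = (Rintegral m1 setT f * Rintegral m2 setT g)%:E)%E.
Proof.
move=> intf intg; rewrite -integral12_prod_meas1; last exact: integrable_prodM.
rewrite /fubini_F/=; under eq_integral => x _.
  under eq_integral do rewrite EFinM.
  rewrite integralZl//; over.
have /fineK <- : (\int[m2]_y (g y)%:E)%E \is a fin_num by exact: integrable_fin_num.
have /fineK fE : (\int[m1]_x (f x)%:E)%E \is a fin_num by exact: integrable_fin_num.
under eq_integral do rewrite muleC.
by rewrite integralZl//= -fE -EFinM mulrC.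
Qed.

(* The library's [sigma_finite_measure] instance of a product of measures is shadowed by the one for
   products of subprobabilities, hence this alias. *)
Section Leb2.
Context {R : realType} (n : nat).

Definition leb2 : set (@lebT R n * @lebT R n) -> \bar R := (@leb R n \x @leb R n)%E.
HB.instance Definition _ := Measure.copy leb2 (@leb R n \x @leb R n)%E.

Lemma leb2_sigma_finite : sigma_finite setT leb2.
Proof.
pose B k : set (@lebT R n) := box (const_mx (- k%:R)) (const_mx k%:R).
have ltB k : (@leb R n (B k) < +oo)%E by exact: leb_cube_fin.
have sub i j (ij : (i <= j)%N) : B i `<=` B j.
  move=> z zi k; have := zi k; rewrite !mxE => /andP[h1 h2].
  by rewrite (lt_le_trans h2) ?ler_nat// andbT (le_trans _ h1)// lerN2 ler_nat.
exists (fun k => B k `*` B k).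
  apply/esym/seteqP; split => // -[x y] _.
  have [i _ xi] : (\bigcup_k B k) x by rewrite /B bigcup_cube.
  have [j _ yj] : (\bigcup_k B k) y by rewrite /B bigcup_cube.
  exists (maxn i j) => //; split; first exact: sub (leq_maxl _ _) _ xi.
  exact: sub (leq_maxr _ _) _ yj.
move=> k; have mB : measurable (B k) by apply: measurable_row_leb; exact: measurable_box.
split; first exact: measurableX.
have fB : @leb R n (B k) \is a fin_num by rewrite ge0_fin_numE.
by rewrite /leb2 product_measure1E//; exact: (lte_mul_pinfty (measure_ge0 _ _) fB (ltB k)).
Qed.

HB.instance Definition _ := Measure_isSigmaFinite.Build _ _ _ leb2 leb2_sigma_finite.

Lemma integral_leb2_l (f : @lebT R n * @lebT R n -> \bar R) : measurable_fun setT f ->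
  (forall z, 0 <= f z)%E -> (\int[leb2]_z f z = \int[@leb R n]_x \int[@leb R n]_y f (x, y))%E.
Proof. exact: fubini_tonelli1. Qed.

Lemma integral_leb2_r (f : @lebT R n * @lebT R n -> \bar R) : measurable_fun setT f ->
  (forall z, 0 <= f z)%E -> (\int[leb2]_z f z = \int[@leb R n]_y \int[@leb R n]_x f (x, y))%E.
Proof. exact: fubini_tonelli2. Qed.

End Leb2.

Section Plancherel.
Context {R : realType} (n : nat).
Local Notation rv := 'rV[R]_n.+1.
Local Notation mu := (@leb R n).
Local Notation mu2 := (@leb2 R n).
Local Notation beta := (@lebB R n).

Definition wgt (t : R) (x : rv) : R := \prod_k expw t (x ord0 k).
Definition hwgt (t : R) (x : rv) : R := \prod_k lorentz t (x ord0 k).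

Lemma wgt_gt0 (t : R) (x : rv) : 0 < wgt t x. Proof. by apply: prodr_gt0 => k _; exact: expR_gt0. Qed.
Lemma hwgt_ge0 (t : R) x : 0 < t -> 0 <= hwgt t x.
Proof. by move=> t0; apply: prodr_ge0 => k _; exact: lorentz_ge0. Qed.
Lemma hwgtN (t : R) x : hwgt t (- x) = hwgt t x.
Proof. by apply: eq_bigr => k _; rewrite mxE lorentzN. Qed.

Lemma measurable_wgt (t : R) : measurable_fun [set: rv] (wgt t).
Proof. by apply: measurable_prod_coord; apply: continuous_measurable_fun; exact: continuous_expw. Qed.
Lemma measurable_hwgt (t : R) : 0 < t -> measurable_fun [set: rv] (hwgt t).
Proof. by move=> t0; apply: measurable_prod_coord; apply: continuous_measurable_fun; exact: continuous_lorentz. Qed.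

Lemma integral_hwgt (t : R) : 0 < t -> (\int[mu]_x (hwgt t x)%:E = ((2 * pi) ^+ n.+1)%:E)%E.
Proof.
move=> t0; rewrite integral_lebB_ge0; last 2 first.
- by apply/measurable_EFinP; exact: measurable_hwgt.
- by move=> x; rewrite lee_fin hwgt_ge0.
rewrite (@integral_prod_ge0 _ _ (fun=> lorentz t) (fun=> 2 * pi)) ?prodr_const ?card_ord// => k.
- by apply: continuous_measurable_fun; exact: continuous_lorentz.
- by move=> x; exact: lorentz_ge0.
- exact: integral_lorentz.
Qed.

Lemma integrable_wgt (t : R) (f : rv -> R) : 0 < t -> measurable_fun setT f -> (forall x, `|f x| <= 1) ->
  beta.-integrable setT (fun x => (wgt t x * f x)%:E).
Proof.
move=> t0; apply: (@integrable_prod_coord _ (expw t) (lorentz t)).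
- by apply: continuous_measurable_fun; exact: continuous_expw.
- exact: expw_ge0.
- by move=> s; exact: integral_expw_cos.
Qed.

Lemma integral_wgt_trig (t : R) (z : rv) : 0 < t ->
  (\int[beta]_x (wgt t x * cos (dotp z x))%:E = (hwgt t z)%:E /\
   \int[beta]_x (wgt t x * sin (dotp z x))%:E = 0)%E.
Proof.
move=> t0; apply: (@integral_prod_cos _ (expw t) (lorentz t)).
- by apply: continuous_measurable_fun; exact: continuous_expw.
- exact: expw_ge0.
- by move=> s; exact: integral_expw_cos.
- by move=> s; exact: integral_expw_sin.
Qed.

Lemma measurable_row_sub d (T : measurableType d) (f g : T -> rv) :
  measurable_fun setT f -> measurable_fun setT g -> measurable_fun setT (fun x => f x - g x).
Proof.
move=> mf mg; apply: measurable_fun_row => k; under eq_fun do rewrite !mxE.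
by apply: measurable_funB; apply: (measurableT_comp (measurable_coord k)).
Qed.

Lemma measurable_dotp2 d (T : measurableType d) (f g : T -> rv) :
  measurable_fun setT f -> measurable_fun setT g -> measurable_fun setT (fun x => dotp (f x) (g x)).
Proof.
move=> mf mg; apply: measurable_sum => k.
by apply: measurable_funM; apply: (measurableT_comp (measurable_coord k)).
Qed.

Lemma measurable_cosf d (T : measurableType d) (f : T -> R) :
  measurable_fun setT f -> measurable_fun setT (fun x => cos (f x)).
Proof. by apply: measurableT_comp; apply: continuous_measurable_fun => x; exact: continuous_cos. Qed.

Lemma measurable_sinf d (T : measurableType d) (f : T -> R) :
  measurable_fun setT f -> measurable_fun setT (fun x => sin (f x)).
Proof. by apply: measurableT_comp; apply: continuous_measurable_fun => x; exact: continuous_sin. Qed.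

(* real and imaginary parts of [(a + i b) exp (- i dotp x xi)] *)
Definition fre (a b : rv -> R) (xi x : rv) := a x * cos (dotp x xi) + b x * sin (dotp x xi).
Definition fim (a b : rv -> R) (xi x : rv) := b x * cos (dotp x xi) - a x * sin (dotp x xi).

Lemma fimE a b xi x : fim a b xi x = fre b (fun y => - a y) xi x.
Proof. by rewrite /fim /fre mulNr. Qed.

Lemma cosle1 (x : R) : `|cos x| <= 1. Proof. by rewrite ler_norml cos_geN1 cos_le1. Qed.
Lemma sinle1 (x : R) : `|sin x| <= 1. Proof. by rewrite ler_norml sin_geN1 sin_le1. Qed.

Lemma fre_le a b xi x : `|fre a b xi x| <= `|a x| + `|b x|.
Proof.
by apply: le_trans (ler_normD _ _) _; rewrite !normrM lerD// ler_piMr// ?cosle1 ?sinle1.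
Qed.

Lemma fim_le a b xi x : `|fim a b xi x| <= `|a x| + `|b x|.
Proof. by rewrite fimE (le_trans (fre_le _ _ _ _))// normrN addrC. Qed.

Section Pair.
Variables a b : @lebT R n -> R.
Hypotheses (ia : mu.-integrable setT (EFin \o a)) (ib : mu.-integrable setT (EFin \o b)).

Let ma : measurable_fun setT a. Proof. by apply/measurable_EFinP; exact: measurable_int ia. Qed.
Let mb : measurable_fun setT b. Proof. by apply/measurable_EFinP; exact: measurable_int ib. Qed.

Lemma measurable_fre d (T : measurableType d) (f : T -> rv) (g : T -> @lebT R n) :
  measurable_fun setT f -> measurable_fun setT g -> measurable_fun setT (fun z => fre a b (f z) (g z)).
Proof.
move=> mf mg; have mg' : measurable_fun setT (fun z => g z : rv).
  exact: measurableT_comp (@measurable_lebT_row R n) mg.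
apply: measurable_funD; apply: measurable_funM.
- exact: measurableT_comp ma mg.
- by apply: measurable_cosf; exact: measurable_dotp2.
- exact: measurableT_comp mb mg.
- by apply: measurable_sinf; exact: measurable_dotp2.
Qed.

Lemma integrable_norm2 : mu.-integrable setT (EFin \o (fun x => `|a x| + `|b x|)).
Proof.
have -> : EFin \o (fun x => `|a x| + `|b x|) = ((abse \o (EFin \o a)) \+ (abse \o (EFin \o b)))%E.
  by apply/funext => x.
by apply: integrableD => //; exact: integrable_abse.
Qed.

Lemma integrable_fre xi : mu.-integrable setT (EFin \o fre a b xi).
Proof.
apply: (le_integrable measurableT _ _ integrable_norm2).
- by apply/measurable_EFinP; exact: (measurable_fre (measurable_cst xi) (@measurable_id _ _ setT)).
- by move=> x _; rewrite lee_fin [leRHS]ger0_norm ?addr_ge0// fre_le.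
Qed.

Lemma integrable_wfre t : 0 < t ->
  (beta \x mu)%E.-integrable setT (fun z => (wgt t z.1 * fre a b z.1 z.2)%:E).
Proof.
move=> t0.
have iw : beta.-integrable setT (EFin \o wgt t).
  rewrite (_ : _ \o _ = (fun x => (wgt t x * 1)%:E)); last by apply/funext => x /=; rewrite mulr1.
  by apply: integrable_wgt => //; rewrite normr1.
apply: (le_integrable _ _ _ (integrable_prodM iw integrable_norm2)) => //.
- apply/measurable_EFinP; apply: measurable_funM; last exact: measurable_fre.
  by apply: (measurableT_comp (measurable_wgt t)).
- move=> z _; rewrite lee_fin normrM [leRHS]normrM ler_pM// [leRHS]ger0_norm ?addr_ge0//.
  exact: fre_le.
Qed.

(** The bound on the integrand does not decay in xi, so the Abel weight is inserted to have
    integrability on the product, and then divided out; the inverse of [wgt 1] is [wgt (-1)]. *)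
Lemma measurable_Fre : measurable_fun setT (fun xi => Rintegral mu setT (fre a b xi)).
Proof.
have /measurable_fubini_F := integrable_wfre (ltr01 : 0 < (1 : R)).
rewrite /fubini_F/= => H.
have -> : (fun xi => Rintegral mu setT (fre a b xi)) =
    (fun xi => fine (\int[mu]_y (wgt 1 xi * fre a b xi y)%:E)%E * (wgt 1 xi)^-1).
  apply/funext => xi; under eq_integral do rewrite EFinM.
  rewrite integralZl//; last exact: integrable_fre.
  rewrite fineM//; last exact: integrable_fin_num (integrable_fre xi).
  by rewrite mulrC mulKf// gt_eqF// wgt_gt0.
apply: measurable_funM; first exact: measurableT_comp.
rewrite (_ : (fun x => _) = wgt (-1)); first exact: measurable_wgt.
apply/funext => x; rewrite /wgt -prodfV; apply: eq_bigr => k _.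
by rewrite /expw mul1r mulN1r -expRN !opprK.
Qed.
End Pair.

Definition Fre (a b : @lebT R n -> R) (xi : rv) : R := Rintegral mu setT (fre a b xi).
Definition Fim (a b : @lebT R n -> R) (xi : rv) : R := Rintegral mu setT (fim a b xi).

Section Pair2.
Variables a b : @lebT R n -> R.
Hypotheses (ia : mu.-integrable setT (EFin \o a)) (ib : mu.-integrable setT (EFin \o b)).

Let ma : measurable_fun setT a. Proof. by apply/measurable_EFinP; exact: measurable_int ia. Qed.
Let mb : measurable_fun setT b. Proof. by apply/measurable_EFinP; exact: measurable_int ib. Qed.

Lemma integrable_oppf : mu.-integrable setT (EFin \o (fun x => - a x)).
Proof. by rewrite (_ : _ \o _ = \- (EFin \o a))%E//; exact: integrableN. Qed.

Lemma integrable_fim xi : mu.-integrable setT (EFin \o fim a b xi).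
Proof.
rewrite (_ : fim a b xi = fre b (fun y => - a y) xi); last by apply/funext => x; exact: fimE.
by apply: integrable_fre => //; exact: integrable_oppf.
Qed.

Lemma measurable_fim d (T : measurableType d) (f : T -> rv) (g : T -> @lebT R n) :
  measurable_fun setT f -> measurable_fun setT g -> measurable_fun setT (fun z => fim a b (f z) (g z)).
Proof.
move=> mf mg; under eq_fun do rewrite fimE.
by apply: measurable_fre => //; exact: integrable_oppf.
Qed.

Lemma measurable_Fim : measurable_fun setT (Fim a b).
Proof.
rewrite (_ : Fim a b = (fun xi => Rintegral mu setT (fre b (fun y => - a y) xi))).
  by apply: measurable_Fre => //; exact: integrable_oppf.
by apply/funext => xi; apply: eq_Rintegral => x _; exact: fimE.
Qed.

Lemma measurable_FreFim : measurable_fun setT (fun xi => Fre a b xi ^+ 2 + Fim a b xi ^+ 2).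
Proof.
apply: measurable_funD; apply: measurable_funX; [exact: measurable_Fre|exact: measurable_Fim].
Qed.

(** |F(xi)|^2 is a double integral with phase <x - y, xi>. The weight makes everything absolutely
    integrable, so xi can be integrated first: cosines give the kernel at x - y, sines give 0. *)
Lemma fourier_energy t : 0 < t ->
  (\int[beta]_xi (wgt t xi * (Fre a b xi ^+ 2 + Fim a b xi ^+ 2))%:E =
   \int[mu2]_z ((a z.1 * a z.2 + b z.1 * b z.2) * hwgt t (z.1 - z.2 : rv)%R)%:E)%E.
Proof.
move=> t0.
have i2 := integrable_norm2 ia ib.
pose g (xi : rv) (z : @lebT R n * @lebT R n) :=
  wgt t xi * (fre a b xi z.1 * fre a b xi z.2 + fim a b xi z.1 * fim a b xi z.2).
have ig : (beta \x mu2)%E.-integrable setT (fun w => (g w.1 w.2)%:E).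
  have iw : beta.-integrable setT (EFin \o (fun x => wgt t x * 2)).
    rewrite (_ : _ \o _ = (fun x => 2%:E * (wgt t x * 1)%:E)%E); last first.
      by apply/funext => x /=; rewrite mulr1 mulrC EFinM.
    apply: integrableZl => //.
    by apply: integrable_wgt => //; rewrite normr1.
  pose A (z : @lebT R n * @lebT R n) := (`|a z.1| + `|b z.1|) * (`|a z.2| + `|b z.2|).
  have iA : mu2.-integrable setT (EFin \o A) := integrable_prodM i2 i2.
  have A0 z : 0 <= A z by rewrite mulr_ge0 ?addr_ge0.
  have iT : (beta \x mu2)%E.-integrable setT (fun w => (wgt t w.1 * 2 * A w.2)%:E).
    exact: (integrable_prodM iw iA).
  apply: (le_integrable measurableT _ _ iT) => //.
    apply/measurable_EFinP; apply: measurable_funM.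
      by apply: (measurableT_comp (measurable_wgt t)).
    have mw : measurable_fun setT (fun w : rv * (@lebT R n * @lebT R n) => w.1) by exact: measurable_fst.
    have m12 : measurable_fun setT (fun w : rv * (@lebT R n * @lebT R n) => w.2.1).
      exact: measurableT_comp measurable_fst measurable_snd.
    have m22 : measurable_fun setT (fun w : rv * (@lebT R n * @lebT R n) => w.2.2).
      exact: measurableT_comp measurable_snd measurable_snd.
    exact: (measurable_funD (measurable_funM (measurable_fre ia ib mw m12) (measurable_fre ia ib mw m22))
      (measurable_funM (measurable_fim mw m12) (measurable_fim mw m22))).
  move=> w _; rewrite lee_fin -mulrA normrM [leRHS]normrM ler_wpM2l//.
  rewrite [leRHS]ger0_norm ?mulr_ge0// mulr_natl mulr2n.
  by apply: le_trans (ler_normD _ _) _; rewrite !normrM lerD// ler_pM// ?fre_le ?fim_le.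
transitivity (\int[beta]_xi \int[mu2]_z (g xi z)%:E)%E.
  apply: eq_integral => xi _; rewrite /g.
  have i1 := integrable_prodM (integrable_fre ia ib xi) (integrable_fre ia ib xi).
  have i3 := integrable_prodM (integrable_fim xi) (integrable_fim xi).
  under [RHS]eq_integral do rewrite EFinM EFinD.
  rewrite integralZl//; last exact: integrableD.
  rewrite integralD// (Rintegral_prodM (integrable_fre ia ib xi) (integrable_fre ia ib xi)).
  by rewrite (Rintegral_prodM (integrable_fim xi) (integrable_fim xi)) -EFinD -EFinM !expr2.
rewrite (Fubini ig); apply: eq_integral => -[x y] _ /=.
pose C := a x * a y + b x * b y; pose S := b x * a y - a x * b y.
have gE xi : (g xi (x, y))%:E = (C%:E * (wgt t xi * cos (dotp (x - y : rv) xi))%:E +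
    S%:E * (wgt t xi * sin (dotp (x - y : rv) xi))%:E)%E.
  by rewrite -!EFinM -EFinD dotpBl cosB sinB /g /fre /fim /C /S/=; congr EFin; ring.
have mt : measurable_fun setT (dotp (x - y : rv)) by exact: measurable_dotp.
have ic := integrable_wgt t0 (measurable_cosf mt) (fun=> cosle1 _).
have isn := integrable_wgt t0 (measurable_sinf mt) (fun=> sinle1 _).
under eq_integral do rewrite gE.
rewrite integralD//; [|exact: integrableZl..].
rewrite !integralZl//; have [-> ->] := integral_wgt_trig (x - y : rv) t0.
by rewrite mule0 adde0 -EFinM.
Qed.

End Pair2.

Lemma integral_hwgt_l t (h : @lebT R n -> R) : 0 < t -> measurable_fun setT h -> (forall x, 0 <= h x) ->
  (\int[mu2]_z (h z.1 * hwgt t (z.1 - z.2 : rv)%R)%:E = ((2 * pi) ^+ n.+1)%:E * \int[mu]_x (h x)%:E)%E.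
Proof.
move=> t0 mh h0.
rewrite [LHS]integral_leb2_l; last 2 first.
- apply/measurable_EFinP; apply: measurable_funM; first exact: (measurableT_comp mh measurable_fst).
  apply: (measurableT_comp (measurable_hwgt t0)); apply: measurable_row_sub.
    exact: (measurableT_comp (@measurable_lebT_row R n) measurable_fst).
  exact: (measurableT_comp (@measurable_lebT_row R n) measurable_snd).
- by move=> z; rewrite lee_fin mulr_ge0// hwgt_ge0.
rewrite -ge0_integralZl//; last 3 first.
- exact/measurable_EFinP.
- by move=> x _; rewrite lee_fin.
- by rewrite lee_fin exprn_ge0// mulr_ge0// pi_ge0.
apply: eq_integral => x _ /=.
under eq_integral do rewrite EFinM -hwgtN opprB.
have ms : measurable_fun setT (fun y : @lebT R n => hwgt t ((y : rv) + - x)%R).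
  apply: (measurableT_comp (measurable_hwgt t0)); apply: measurable_row_sub.
    exact: (@measurable_lebT_row R n).
  exact: measurable_cst.
rewrite ge0_integralZl//; last 3 first.
- exact/measurable_EFinP.
- by move=> y _; rewrite lee_fin hwgt_ge0.
- by rewrite lee_fin.
rewrite [RHS]muleC; congr (_ * _)%E; rewrite -(integral_hwgt t0).
by apply: integral_shift; [exact: measurable_hwgt|move=> y; exact: hwgt_ge0].
Qed.

Lemma integral_hwgt_r t (h : @lebT R n -> R) : 0 < t -> measurable_fun setT h -> (forall x, 0 <= h x) ->
  (\int[mu2]_z (h z.2 * hwgt t (z.1 - z.2 : rv)%R)%:E = ((2 * pi) ^+ n.+1)%:E * \int[mu]_x (h x)%:E)%E.
Proof.
move=> t0 mh h0; rewrite -(@integral_hwgt_l t)//.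
have mD (i j : @lebT R n * @lebT R n -> @lebT R n) : measurable_fun setT i -> measurable_fun setT j ->
    measurable_fun setT (fun z => (h (i z) * hwgt t ((i z : rv) - j z))%:E).
  move=> mi mj; apply/measurable_EFinP; apply: measurable_funM; first exact: (measurableT_comp mh mi).
  apply: (measurableT_comp (measurable_hwgt t0)); apply: measurable_row_sub.
    exact: (measurableT_comp (@measurable_lebT_row R n) mi).
  exact: (measurableT_comp (@measurable_lebT_row R n) mj).
rewrite [RHS]integral_leb2_l; last 2 first.
- exact: mD measurable_fst measurable_snd.
- by move=> z; rewrite lee_fin mulr_ge0// hwgt_ge0.
rewrite [LHS]integral_leb2_r; last 2 first.
- under eq_fun do rewrite -hwgtN opprB.
  exact: mD measurable_snd measurable_fst.
- by move=> z; rewrite lee_fin mulr_ge0// hwgt_ge0.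
apply: eq_integral => x _; apply: eq_integral => y _ /=.
by rewrite -hwgtN opprB.
Qed.

Lemma wgtE t (x : rv) : wgt t x = expR (- (t * \sum_k `|x ord0 k|)).
Proof. by rewrite mulr_sumr -sumrN expR_sum. Qed.

Lemma integral_wgt_lim (E : rv -> R) : measurable_fun setT E -> (forall x, 0 <= E x) ->
  (\int[beta]_x (wgt (harmonic k) x * E x)%:E)%E @[k --> \oo] --> (\int[beta]_x (E x)%:E)%E.
Proof.
move=> mE E0.
have -> : (\int[beta]_x (E x)%:E = \int[beta]_x limn (fun k => (wgt (harmonic k) x * E x)%:E))%E.
  apply: eq_integral => x _; apply/esym/cvg_lim => //; apply: cvg_EFin; first exact: nearW.
  suff L : wgt (harmonic k) x @[k --> \oo] --> (1 : R).
    have L' : wgt (harmonic k) x * E x @[k --> \oo] --> 1 * E x by apply: cvgM => //; exact: cvg_cst.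
    by rewrite mul1r in L'; exact: L'.
  under eq_fun do rewrite wgtE.
  rewrite -expR0; apply: (continuous_cvg _ (@continuous_expR R _)).
  have : - (harmonic k * \sum_k `|x ord0 k|) @[k --> \oo] --> - (0 * \sum_k `|x ord0 k|).
    by apply: cvgN; apply: cvgM; [exact: cvg_harmonic|exact: cvg_cst].
  by rewrite mul0r oppr0.
apply: cvg_monotone_convergence => //.
- by move=> k; apply/measurable_EFinP/measurable_funM => //; exact: measurable_wgt.
- by move=> k x _; rewrite lee_fin mulr_ge0// ltW// wgt_gt0.
- move=> x _ i j ij; rewrite lee_fin ler_wpM2r// !wgtE ler_expR lerN2 ler_wpM2r ?sumr_ge0//.
  by rewrite /harmonic/= lef_pV2 ?posrE// ler_nat.
Qed.

Lemma norm_dot2_le (a a' b b' : R) :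
  `|a * a' + b * b'| <= 2^-1 * (a ^+ 2 + b ^+ 2) + 2^-1 * (a' ^+ 2 + b' ^+ 2).
Proof.
have h1 := sqr_ge0 (a - a'); have h2 := sqr_ge0 (a + a').
have h3 := sqr_ge0 (b - b'); have h4 := sqr_ge0 (b + b').
by rewrite ler_norml; apply/andP; split; nra.
Qed.

(** The product of the values at two points is at most the mean of their squares, and the kernel has
    total mass (2 pi)^m in either variable, whatever t. Monotone convergence then removes the weight
    as t decreases to 0. *)
Lemma plancherel_le (a b : @lebT R n -> R) :
  mu.-integrable setT (EFin \o a) -> mu.-integrable setT (EFin \o b) ->
  (\int[beta]_xi (Fre a b xi ^+ 2 + Fim a b xi ^+ 2)%:E <=
   ((2 * pi) ^+ n.+1)%:E * \int[mu]_x (a x ^+ 2 + b x ^+ 2)%:E)%E.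
Proof.
move=> ia ib.
have ma : measurable_fun setT a by apply/measurable_EFinP; exact: measurable_int ia.
have mb : measurable_fun setT b by apply/measurable_EFinP; exact: measurable_int ib.
pose F x := a x ^+ 2 + b x ^+ 2.
have mF : measurable_fun setT F by apply: measurable_funD; apply: measurable_funX.
have F0 x : 0 <= F x by rewrite addr_ge0 ?sqr_ge0.
have E0 xi : 0 <= Fre a b xi ^+ 2 + Fim a b xi ^+ 2 by rewrite addr_ge0 ?sqr_ge0.
have H := integral_wgt_lim (measurable_FreFim ia ib) E0.
rewrite -(cvg_lim _ H)//; apply: lime_le; first by apply/cvg_ex; eexists; exact: H.
apply: nearW => k; have t0 : 0 < harmonic k :> R by rewrite /harmonic/= invr_gt0.
rewrite fourier_energy//.
apply: le_trans (lee_abs _) _.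
have mS (i : @lebT R n * @lebT R n -> @lebT R n) (h : @lebT R n -> R) : measurable_fun setT i -> measurable_fun setT h ->
  measurable_fun setT (fun z => h (i z)) by move=> mi mh; exact: measurableT_comp.
have mw : measurable_fun setT (fun z : @lebT R n * @lebT R n => hwgt (harmonic k) (z.1 - z.2 : rv)%R).
  apply: (measurableT_comp (measurable_hwgt t0)); apply: measurable_row_sub.
    exact: (measurableT_comp (@measurable_lebT_row R n) measurable_fst).
  exact: (measurableT_comp (@measurable_lebT_row R n) measurable_snd).
have [m1 m2] := (@measurable_fst _ _ (@lebT R n) (@lebT R n), @measurable_snd _ _ (@lebT R n) (@lebT R n)).
have mI : measurable_fun setT (fun z : @lebT R n * @lebT R n => a z.1 * a z.2 + b z.1 * b z.2).
  exact: (measurable_funD (measurable_funM (mS _ _ m1 ma) (mS _ _ m2 ma)) (measurable_funM (mS _ _ m1 mb) (mS _ _ m2 mb))).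
have mF1 := measurable_funM (mS _ _ m1 mF) mw.
have mF2 := measurable_funM (mS _ _ m2 mF) mw.
apply: le_trans (le_abse_integral _ _ _) _ => //.
  by apply/measurable_EFinP; exact: (measurable_funM mI mw).
apply: (@le_trans _ _ (\int[mu2]_z (2^-1%:E * (F z.1 * hwgt (harmonic k) (z.1 - z.2 : rv)%R)%:E +
   2^-1%:E * (F z.2 * hwgt (harmonic k) (z.1 - z.2 : rv)%R)%:E)))%E.
  apply: ge0_le_integral; first exact: measurableT.
  - by [].
  - by apply/measurable_EFinP; apply: measurableT_comp => //; exact: (measurable_funM mI mw).
  - apply/measurable_EFinP; apply: (measurable_funD (f := fun z => 2^-1 * _) (g := fun z => 2^-1 * _)).
      exact: (measurable_funM (measurable_cst _) mF1).
    exact: (measurable_funM (measurable_cst _) mF2).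
  - move=> z _; rewrite -!EFinM -EFinD lee_fin normrM (ger0_norm (hwgt_ge0 _ t0)) !mulrA -mulrDl ler_wpM2r ?hwgt_ge0//.
    exact: norm_dot2_le.
have p1 (i : @lebT R n * @lebT R n -> @lebT R n) z : (0 <= (F (i z) * hwgt (harmonic k) (z.1 - z.2 : rv)%R)%:E)%E.
  by rewrite lee_fin mulr_ge0// hwgt_ge0.
rewrite ge0_integralD; [|exact: measurableT| | | |]; last 4 first.
- by move=> z _; rewrite mule_ge0 ?lee_fin ?invr_ge0//; exact: (p1 fst).
- by apply/measurable_EFinP; exact: (measurable_funM (measurable_cst _) mF1).
- by move=> z _; rewrite mule_ge0 ?lee_fin ?invr_ge0//; exact: (p1 snd).
- by apply/measurable_EFinP; exact: (measurable_funM (measurable_cst _) mF2).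
rewrite !ge0_integralZl; [|exact: measurableT|exact/measurable_EFinP|by move=> z _; exact: (p1 snd)|by rewrite lee_fin invr_ge0|
  exact: measurableT|exact/measurable_EFinP|by move=> z _; exact: (p1 fst)|by rewrite lee_fin invr_ge0].
rewrite integral_hwgt_l// integral_hwgt_r// -ge0_muleDl ?lee_fin ?invr_ge0//.
by rewrite -EFinD (_ : 2^-1 + 2^-1 = 1) ?mul1e//; lra.
Qed.

End Plancherel.

(** * Overlaps of a compact set with its translates *)

Section Overlap.
Context {R : realType} (n : nat).
Local Notation rv := 'rV[R]_n.+1.
Local Notation mu := (@leb R n).

Lemma compact_cube (W : set rv) : compact W -> exists N, W `<=` cube N.
Proof.
move=> /compact_bounded[M [_ HM]].
have lt1 : M < (Num.truncn M).+1%:R by exact: truncnS_gt.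
exists (Num.truncn M).+2 => x Wx k; rewrite -ler_norml.
have : `|x| < (Num.truncn M).+2%:R.
  by apply: le_lt_trans (HM _ lt1 _ Wx) _; rewrite ltr_nat.
have p0 : 0 < (Num.truncn M).+2%:R :> R by rewrite ltr0n.
rewrite -[`|x|]normrN -[- x]sub0r => H.
have : ball (0 : rv) (Num.truncn M).+2%:R x by rewrite -ball_normE.
case=> _ /(_ ord0 k); rewrite -ball_normE/= mxE sub0r normrN; exact: ltW.
Qed.

Lemma leb_out_cube N : (leb_out (cube N : set rv) < +oo)%E.
Proof.
apply: le_lt_trans (leb_cube_fin n N.+1); apply: le_leb_out => x xN k; rewrite !mxE.
have /andP[h1 h2] := xN k; apply/andP; split.
  by apply: le_trans h1; rewrite lerN2 ler_nat.
by apply: le_lt_trans h2 _; rewrite ltr_nat.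
Qed.

Lemma compact_leb_fin (W : set rv) : compact W -> (leb_out W < +oo)%E.
Proof. by move=> /compact_cube[N WN]; apply: le_lt_trans (leb_out_cube N); exact: le_leb_out. Qed.

Lemma compact_row_measurable (W : set rv) : compact W -> measurable W.
Proof. by move=> cW; apply: closed_row_measurable; exact: compact_closed. Qed.

Lemma compact_leb_measurable (W : set rv) : compact W -> measurable (W : set (@lebT R n)).
Proof. by move=> cW; apply: measurable_row_leb; exact: compact_row_measurable. Qed.

Lemma measurable_cubeT N : measurable (cube N : set (@lebT R n)).
Proof.
rewrite (_ : cube N = \bigcap_(k : 'I_n.+1) [set x : @lebT R n | - N%:R <= (x : rv) ord0 k <= N%:R]).
  apply: fin_bigcap_measurable => // k _.
  have := @measurable_coordT R n k measurableT `[- N%:R, N%:R]%classic (measurable_itv _).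
  by rewrite setTI; congr measurable; apply/seteqP; split => x /=; rewrite in_itv.
by apply/seteqP; split => [x xN k _|x xN k]; [exact: xN|exact: xN k I].
Qed.

(** The neighbourhoods [U k] decrease to W, so one of them has measure at most |W| + eta. It
    contains W and, for small z, its translate; inclusion-exclusion bounds the overlap from
    below. *)
Lemma compact_overlap (W : set rv) (eta : R) : compact W -> 0 < eta ->
  exists2 p : R, 0 < p & forall z : rv, (forall k, `|z ord0 k| <= p) ->
    (leb_out W <= leb_out (W `&` [set x | W (x + z)%R]) + eta%:E)%E.
Proof.
move=> cW eta0.
pose U k : set rv := \bigcup_(y in W) ball y k.+1%:R^-1.
have mU k : measurable (U k : set (@lebT R n)).
  apply: measurable_row_leb; rewrite -[U k]setCK; apply: measurableC.
  apply: closed_row_measurable; rewrite closedC; apply: bigcup_open => y _; exact: ball_open.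
have UE : \bigcap_k U k = W.
  apply/seteqP; split => [x Ux|x Wx k _]; last first.
    by exists x => //; apply: ballxx; rewrite invr_gt0.
  apply: (compact_closed _ cW) => // B /nbhs_ballP[e /= e0 xB].
  have [k ke] : exists k : nat, k.+1%:R^-1 < e.
    exists (Num.truncn e^-1); rewrite -[ltRHS]invrK ltf_pV2 ?posrE ?invr_gt0//.
    exact: truncnS_gt.
  have [y Wy yx] := Ux k I; exists y; split => //; apply: xB.
  by apply: ball_sym; apply: le_ball yx; exact: ltW.
have [N WN] := compact_cube cW.
have U0 : (mu (U 0%N) < +oo)%E.
  apply: le_lt_trans (leb_out_cube N.+1); apply: le_leb_out => x [y Wy [_ yx]] k.
  have := WN _ Wy k; rewrite -!ler_norml => yk.
  have := yx ord0 k; rewrite -ball_normE/= invr1 => xk.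
  rewrite -[x ord0 k](subrK (y ord0 k)) (le_trans (ler_normD _ _))// -[N.+1]add1n natrD.
  by rewrite lerD// distrC ltW.
have mW := compact_leb_measurable cW.
have fW : mu W \is a fin_num by rewrite ge0_fin_numE ?measure_ge0 ?compact_leb_fin.
have niU : nonincreasing_seq U.
  move=> i j ij; apply/subsetPset => x [y Wy yx]; exists y => //.
  by apply: le_ball yx; rewrite lef_pV2 ?posrE// ler_nat.
have := @nonincreasing_cvg_mu _ _ _ mu U U0 mU; rewrite UE => /(_ mW niU) cv.
have [k kU] : exists k, (mu (U k) <= mu W + eta%:E)%E.
  have cW' : mu \o U @ \oo --> (fine (mu W))%:E by rewrite fineK.
  have [fU cv'] := (fine_cvgP (mu \o U) (fine (mu W))).1 cW'.
  have lt0 : fine (mu W) < fine (mu W) + eta by rewrite ltrDl.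
  have {lt0}lt := @cvgr_lt R _ _ _ _ _ cv' _ lt0; have {}lt := lt eventually_filter.
  have [k _ Hk] := filterI fU lt; exists k; have [fk] := Hk k (leqnn k).
  by rewrite -[mu W]fineK// -[mu (U k)](fineK fk) -EFinD lee_fin; exact: ltW.
exists (k.+1%:R^-1 / 2) => [|z zk]; first by rewrite divr_gt0 ?invr_gt0.
pose V : set (@lebT R n) := [set x | W (x + z)].
have mV : measurable V.
  apply: measurable_row_leb; rewrite -[V]setTI; apply: measurable_shift => //.
  exact: compact_row_measurable.
have VU : V `<=` U k.
  move=> x Vx; exists (x + z) => //; split; first by rewrite invr_gt0.
  move=> i j; rewrite (_ : i = ord0); last by apply/val_inj; case: i => -[].
  rewrite -ball_normE/= mxE addrAC subrr add0r; apply: le_lt_trans (zk j) _.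
  by rewrite ltr_pdivrMr// ltr_pMr ?invr_gt0// ltr1n.
have WU : W `<=` U k by move=> x Wx; exists x => //; apply: ballxx; rewrite invr_gt0.
have EV : mu V = mu W by exact: leb_out_shift.
have UU : (mu (W `|` V) <= mu W + eta%:E)%E.
  by apply: le_trans kU; apply: le_leb_out => x [/WU|/VU].
have ltV : (mu V < +oo)%E by rewrite EV; exact: compact_leb_fin.
have : (mu (W `|` V) = mu W + mu V - mu (W `&` V))%E by exact: measureUfinr mW mV ltV.
have fWV : mu (W `&` V) \is a fin_num.
  rewrite ge0_fin_numE ?measure_ge0//; apply: le_lt_trans (compact_leb_fin cW).
  by apply: le_leb_out => x [].
rewrite EV => E; move: UU; rewrite E -[leb_out W]/(mu W) -[leb_out _]/(mu (W `&` V)).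
rewrite -(fineK fW) -(fineK fWV) -EFinN -!EFinD !lee_fin; lra.
Qed.

Lemma leb_out_overlap (X : set rv) (z : rv) : measurable X ->
  (leb_out (X `&` [set x | X (x + z)%R]) = \int[mu]_y (\1_X (z + (y : rv)) * \1_X (y : rv))%:E)%E.
Proof.
move=> mX; have mV : measurable (X `&` [set x | X (x + z)]).
  by apply: measurableI => //; rewrite -[X in measurable X]setTI; exact: measurable_shift.
have mV' : measurable (X `&` [set x | X (x + z)] : set (@lebT R n)) by exact: measurable_row_leb.
transitivity (\int[mu]_y (\1_(X `&` [set x | X (x + z)]) y)%:E)%E; first by rewrite integral_indic// setIT.
apply: eq_integral => y _; rewrite indicI /= mulrC; congr (_ * _)%:E.
by rewrite addrC !indicE.
Qed.

Lemma measurable_overlap (X : set rv) : measurable X ->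
  measurable_fun setT (fun z : @lebT R n => leb_out (X `&` [set x | X (x + (z : rv))%R])).
Proof.
move=> mX; under eq_fun do rewrite leb_out_overlap//.
have mi : measurable_fun [set: rv] (\1_X : rv -> R) by exact: measurable_indic.
have m1 := measurableT_comp (@measurable_lebT_row R n) (@measurable_fst _ _ (@lebT R n) (@lebT R n)).
have m2 := measurableT_comp (@measurable_lebT_row R n) (@measurable_snd _ _ (@lebT R n) (@lebT R n)).
have m12 : measurable_fun setT (fun z : @lebT R n * @lebT R n => (z.1 : rv) + (z.2 : rv)).
  apply: measurable_fun_row => k; under eq_fun do rewrite !mxE.
  exact: (measurable_funD (measurableT_comp (measurable_coord k) m1) (measurableT_comp (measurable_coord k) m2)).
apply: (measurable_fun_fubini_tonelli_F
  (fun z : @lebT R n * @lebT R n => (\1_X ((z.1 : rv) + (z.2 : rv)) * \1_X (z.2 : rv) : R)%:E)).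
  apply/measurable_EFinP; exact: (measurable_funM (measurableT_comp mi m12) (measurableT_comp mi m2)).
by move=> z; rewrite lee_fin mulr_ge0 ?indicE.
Qed.

(** The substitution x = z + y exhibits the autocorrelation of X. *)
Lemma integral_overlap (X : set rv) (g : rv -> R) : measurable X ->
  measurable_fun [set: rv] g -> (forall z, 0 <= g z) ->
  (\int[@leb2 R n]_z (\1_X (z.1 : rv) * \1_X (z.2 : rv) * g (z.1 - z.2 : rv)%R)%:E =
   \int[mu]_z ((g z)%:E * leb_out (X `&` [set x | X (x + (z : rv))%R])))%E.
Proof.
move=> mX mg g0.
have mi : measurable_fun [set: rv] (\1_X : rv -> R) by exact: measurable_indic.
have m1 := measurableT_comp (@measurable_lebT_row R n) (@measurable_fst _ _ (@lebT R n) (@lebT R n)).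
have m2 := measurableT_comp (@measurable_lebT_row R n) (@measurable_snd _ _ (@lebT R n) (@lebT R n)).
have m12 : measurable_fun setT (fun z : @lebT R n * @lebT R n => (z.1 : rv) + (z.2 : rv)).
  apply: measurable_fun_row => k; under eq_fun do rewrite !mxE.
  exact: (measurable_funD (measurableT_comp (measurable_coord k) m1) (measurableT_comp (measurable_coord k) m2)).
have i0 (x : rv) : 0 <= \1_X x :> R by rewrite indicE.
rewrite integral_leb2_r; last 2 first.
- apply/measurable_EFinP; apply: measurable_funM.
    exact: (measurable_funM (measurableT_comp mi m1) (measurableT_comp mi m2)).
  exact: (measurableT_comp mg (measurable_row_sub m1 m2)).
- by move=> z; rewrite lee_fin !mulr_ge0.
transitivity (\int[mu]_y \int[mu]_x (\1_X ((x : rv) + (y : rv)) * \1_X (y : rv) * g x)%:E)%E.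
  apply: eq_integral => y _.
  rewrite -(@integral_shift _ _ (fun x : rv => \1_X (x + (y : rv)) * \1_X (y : rv) * g x) (- (y : rv))).
  - by apply: eq_integral => x _; rewrite subrK.
  - apply: measurable_funM => //; apply: measurable_funM => //.
    exact: (measurableT_comp mi (measurable_shift _)).
  - by move=> x; rewrite !mulr_ge0.
rewrite -(@integral_leb2_r _ _ (fun z => (\1_X ((z.1 : rv) + (z.2 : rv)) * \1_X (z.2 : rv) * g z.1)%:E)); last 2 first.
- apply/measurable_EFinP; apply: measurable_funM; last exact: (measurableT_comp mg m1).
  exact: (measurable_funM (measurableT_comp mi m12) (measurableT_comp mi m2)).
- by move=> z; rewrite lee_fin !mulr_ge0.
rewrite integral_leb2_l; last 2 first.
- apply/measurable_EFinP; apply: measurable_funM; last exact: (measurableT_comp mg m1).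
  exact: (measurable_funM (measurableT_comp mi m12) (measurableT_comp mi m2)).
- by move=> z; rewrite lee_fin !mulr_ge0.
apply: eq_integral => z _ /=.
rewrite leb_out_overlap// -ge0_integralZl//; last 2 first.
- apply/measurable_EFinP; apply: (measurable_funM _ (measurableT_comp mi (@measurable_lebT_row R n))).
  by under eq_fun do rewrite addrC; exact: (measurableT_comp mi (measurableT_comp (measurable_shift _) (@measurable_lebT_row R n))).
- by rewrite lee_fin.
by apply: eq_integral => y _; rewrite -EFinM mulrC.
Qed.

Lemma integrable_set (A : set (@lebT R n)) : measurable A -> (mu A < +oo)%E ->
  mu.-integrable setT (EFin \o (\1_A : @lebT R n -> R)).
Proof.
move=> mA fA; apply/integrableP; split; first exact/measurable_EFinP/measurable_indic.
under eq_integral do rewrite /= ger0_norm ?indicE//.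
by under eq_integral do rewrite -indicE; rewrite integral_indic// setIT.
Qed.

Lemma integral_hwgt_cube (t p : R) : 0 < t -> 0 < p ->
  (\int[mu]_z (\prod_k (\1_(`[- p, p]) ((z : rv) ord0 k) * lorentz t ((z : rv) ord0 k)))%:E =
   ((4 * atan (p / t)) ^+ n.+1)%:E)%E.
Proof.
move=> t0 p0.
have mh : measurable_fun setT (fun x : R => \1_(`[- p, p]) x * lorentz t x).
  by apply: measurable_funM; [exact: measurable_indic|apply: continuous_measurable_fun; exact: continuous_lorentz].
have h0 x : 0 <= \1_(`[- p, p]) x * lorentz t x by rewrite mulr_ge0 ?lorentz_ge0// indicE.
rewrite (@integral_lebB_ge0 _ _ (fun z => (\prod_k (\1_(`[- p, p]) (z ord0 k) * lorentz t (z ord0 k)))%:E)); last 2 first.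
- by apply/measurable_EFinP; exact: (measurable_prod_coord mh).
- by move=> z; rewrite lee_fin prodr_ge0.
rewrite (@integral_prod_ge0 _ _ (fun=> fun x => \1_(`[- p, p]) x * lorentz t x) (fun=> 4 * atan (p / t))) ?prodr_const ?card_ord// => k.
rewrite -integral_lorentz_itv// [RHS]integral_mkcond; apply: eq_integral => x _.
by rewrite patchE indicE; case: ifP; rewrite ?mul1r ?mul0r.
Qed.

(** The reverse inequality for an indicator. Its weighted energy is the overlap of W with its
    translates, integrated against the Poisson kernel; near z = 0 the overlap is at least |W| - eta,
    and the mass of the kernel there, (4 atan(p / t))^m, tends to (2 pi)^m. *)
Lemma plancherel_set (W : set rv) : compact W ->
  (((2 * pi) ^+ n.+1)%:E * leb_out W <=
   \int[@lebB R n]_xi (Fre (\1_W : rv -> R) (cst 0) xi ^+ 2 + Fim (\1_W : rv -> R) (cst 0) xi ^+ 2)%:E)%E.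
Proof.
move=> cW; pose E xi := Fre (\1_W : rv -> R) (cst 0) xi ^+ 2 + Fim (\1_W : rv -> R) (cst 0) xi ^+ 2.
have mW := compact_leb_measurable cW.
have ia : mu.-integrable setT (EFin \o (\1_W : @lebT R n -> R)).
  by apply: integrable_set => //; exact: compact_leb_fin.
have ib : mu.-integrable setT (EFin \o (cst 0 : @lebT R n -> R)) by exact: integrable0.
have mE := measurable_FreFim ia ib.
have E0 xi : 0 <= E xi by rewrite addr_ge0 ?sqr_ge0.
have fW : leb_out W \is a fin_num by rewrite ge0_fin_numE ?leb_out_ge0 ?compact_leb_fin.
set w := fine (leb_out W); have wE : leb_out W = w%:E by rewrite fineK.
have w0 : 0 <= w by rewrite fine_ge0 ?leb_out_ge0.
suff key eta : 0 < eta -> (((w - eta) * (2 * pi) ^+ n.+1)%:E <= \int[@lebB R n]_xi (E xi)%:E)%E.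
  rewrite wE -EFinM; case EI : (\int[@lebB R n]_xi (E xi)%:E)%E => [e| |]; last 2 first.
  - by rewrite leey.
  - by have := key 1 ltr01; rewrite EI.
  rewrite lee_fin; apply/ler_addgt0Pr => d d0.
  have pp : 0 < (2 * pi) ^+ n.+1 :> R by rewrite exprn_gt0// mulr_gt0// pi_gt0.
  have := key (d / (2 * pi) ^+ n.+1) (divr_gt0 d0 pp); rewrite EI lee_fin mulrBl divfK ?gt_eqF//.
  by rewrite lerBlDr mulrC.
move=> eta0; have [p p0 Hp] := compact_overlap cW eta0.
have step k : (((w - eta) * (4 * atan (p / harmonic k)) ^+ n.+1)%:E <= \int[@lebB R n]_xi (E xi)%:E)%E.
  have t0 : 0 < harmonic k :> R by rewrite /harmonic/= invr_gt0.
  apply: (@le_trans _ _ (\int[@lebB R n]_xi (wgt (harmonic k) xi * E xi)%:E)%E); last first.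
    apply: ge0_le_integral; first exact: measurableT.
    - by move=> xi _; rewrite lee_fin mulr_ge0// ltW// wgt_gt0.
    - by apply/measurable_EFinP; apply: measurable_funM => //; exact: measurable_wgt.
    - exact/measurable_EFinP.
    - move=> xi _; rewrite lee_fin ler_piMl// wgtE -expR0 ler_expR oppr_le0 mulr_ge0 ?sumr_ge0//; exact: ltW.
  rewrite fourier_energy//.
  under eq_integral do rewrite mulr0 addr0.
  rewrite integral_overlap//; last 3 first.
  - exact: compact_row_measurable.
  - exact: measurable_hwgt.
  - by move=> z; exact: hwgt_ge0.
  have [wle|wgt] := leP w eta.
    apply: (@le_trans _ _ 0%E).
      rewrite lee_fin mulr_le0_ge0 ?subr_le0// exprn_ge0// mulr_ge0// -(@atan0 R); apply: le_atan.
      by rewrite divr_ge0// ltW.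
    by apply: integral_ge0 => z _; rewrite mule_ge0 ?leb_out_ge0 ?lee_fin ?hwgt_ge0.
  pose h (z : rv) := \prod_j (\1_(`[- p, p]) (z ord0 j) * lorentz (harmonic k) (z ord0 j)) : R.
  have mh : measurable_fun setT (h : @lebT R n -> R).
    apply: measurable_fun_lebT; apply: (@measurable_prod_coord _ _ (fun x => \1_(`[- p, p]) x * lorentz (harmonic k) x)).
    by apply: measurable_funM; [exact: measurable_indic|apply: continuous_measurable_fun; exact: continuous_lorentz].
  have h0 z : 0 <= h z by apply: prodr_ge0 => j _; rewrite mulr_ge0 ?lorentz_ge0// indicE.
  rewrite EFinM -integral_hwgt_cube// -ge0_integralZl//; last 3 first.
  - exact/measurable_EFinP.
  - by move=> z _; rewrite lee_fin; exact: h0.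
  - by rewrite lee_fin subr_ge0 ltW.
  apply: ge0_le_integral; first exact: measurableT.
  - by move=> z _; rewrite mule_ge0 ?lee_fin ?subr_ge0 ?(ltW wgt)//; exact: h0.
  - by apply/measurable_EFinP; exact: (measurable_funM (measurable_cst _) mh).
  - have mo := measurable_overlap (compact_row_measurable cW).
    have mg : measurable_fun setT (fun z : @lebT R n => (hwgt (harmonic k) (z : rv))%:E).
      by apply/measurable_EFinP; apply: measurable_fun_lebT; exact: measurable_hwgt.
    exact: (emeasurable_funM mg mo).
  - move=> z _; have [zp|] := boolP [forall j, `|(z : rv) ord0 j| <= p].
      rewrite muleC (_ : \prod_j _ = hwgt (harmonic k) z); last first.
        apply: eq_bigr => j _; rewrite indicE mem_set ?mul1r//=.
        by rewrite in_itv/= -ler_norml (forallP zp).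
      rewrite lee_wpmul2l ?lee_fin ?hwgt_ge0// EFinB leeBlDr// -wE.
      exact: Hp (fun j => forallP zp j).
    rewrite negb_forall => /existsP[j zj].
    rewrite (bigD1 j)//= indicE memNset ?mul0r ?mule0; last by rewrite /= in_itv/= -ler_norml; exact/negP.
    by rewrite mule_ge0 ?leb_out_ge0 ?lee_fin ?hwgt_ge0.
have lim : (fun k => (w - eta) * (4 * atan (p / harmonic k)) ^+ n.+1) @ \oo --> (w - eta) * (2 * pi) ^+ n.+1.
  apply: cvgM; first exact: cvg_cst.
  rewrite (_ : 2 * pi = 4 * (pi / 2)); last by field.
  apply: (continuous_cvg _ (@exprn_continuous _ n.+1 _)); apply: cvgM; first exact: cvg_cst.
  apply: (cvg_comp _ _ _ (@cvgy_atan R)); apply/cvgryPge => A; near=> k.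
  rewrite /harmonic/= invrK mulrC -ler_pdivrMr//; apply: ltW; apply: lt_le_trans (truncnS_gt _) _.
  by rewrite ler_nat ltnS; near: k; exact: nbhs_infty_ge.
case EI : (\int[@lebB R n]_xi (E xi)%:E)%E => [e| |]; last 2 first.
- by rewrite leey.
- by have := step 0%N; rewrite EI.
rewrite lee_fin -(cvg_lim _ lim)//; apply: limr_le; first by apply/cvg_ex; eexists; exact: lim.
by apply: nearW => k; have := step k; rewrite EI lee_fin.
Unshelve. all: by end_near. Qed.

End Overlap.

Import Normc.

(** * Complex-valued square-integrable functions *)

Section Cplx.
Context {R : realType}.
Local Notation C := R[i].
Local Notation Re := (@complex.Re R).
Local Notation Im := (@complex.Im R).
Implicit Types z w : C.

Lemma cReM z w : Re (z * w) = Re z * Re w - Im z * Im w. Proof. by case: z w => [a b] [c d]. Qed.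
Lemma cImM z w : Im (z * w) = Re z * Im w + Im z * Re w.
Proof. by case: z w => [a b] [c d]. Qed.
Lemma cReD z w : Re (z + w) = Re z + Re w. Proof. by case: z w => [a b] [c d]. Qed.
Lemma cImD z w : Im (z + w) = Im z + Im w. Proof. by case: z w => [a b] [c d]. Qed.
Lemma cReN z : Re (- z) = - Re z. Proof. by case: z. Qed.
Lemma cImN z : Im (- z) = - Im z. Proof. by case: z. Qed.

Lemma normc_sqr z : normc z ^+ 2 = Re z ^+ 2 + Im z ^+ 2.
Proof. by case: z => a b; rewrite /normc sqr_sqrtr// addr_ge0 ?sqr_ge0. Qed.
Lemma normc_ge0 z : 0 <= normc z. Proof. by case: z => a b; exact: sqrtr_ge0. Qed.
Lemma normRe_le z : `|Re z| <= normc z.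
Proof. by case: z => a b; rewrite /normc -sqrtr_sqr ler_wsqrtr// lerDl sqr_ge0. Qed.
Lemma normIm_le z : `|Im z| <= normc z.
Proof. by case: z => a b; rewrite /normc -sqrtr_sqr ler_wsqrtr// lerDr sqr_ge0. Qed.
Lemma normc_le_abs z : normc z <= `|Re z| + `|Im z|.
Proof.
rewrite -(ler_pXn2r (ltn0Sn 1)) ?nnegrE ?normc_ge0 ?addr_ge0// normc_sqr sqrrD !real_normK ?num_real//.
by rewrite addrAC lerDl mulrn_wge0// mulr_ge0.
Qed.
Lemma normc_conj z : normc (conjc z) = normc z. Proof. by case: z => a b; rewrite /normc/= sqrrN. Qed.
Lemma normc_distC z w : normc (z - w) = normc (w - z). Proof. by rewrite -normcN opprB. Qed.
Lemma normc_real (a : R) : normc (a%:C)%C = `|a|. Proof. by rewrite /normc/= expr0n addr0 sqrtr_sqr. Qed.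
Lemma mulc_conj z : z * conjc z = ((normc z ^+ 2)%:C)%C.
Proof. by rewrite normc_sqr; case: z => a b; apply/eqP; rewrite eq_complex/=; apply/andP; split; apply/eqP; ring. Qed.

Lemma conjcM z w : conjc (z * w) = conjc z * conjc w.
Proof. by case: z w => [a b] [c d]; apply/eqP; rewrite eq_complex/=; apply/andP; split; apply/eqP; ring. Qed.

Lemma normc_expi (t : R) : normc (expi t) = 1.
Proof. by rewrite /normc/= cos2Dsin2 sqrtr1. Qed.
Lemma expiD (s t : R) : expi (s + t) = expi s * expi t.
Proof. by apply/eqP; rewrite eq_complex/= cosD sinD eqxx/= addrC. Qed.
Lemma expiN (t : R) : expi (- t) = conjc (expi t).
Proof. by rewrite /expi/= cosN sinN. Qed.
Lemma expi0 : expi 0 = 1 :> C.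
Proof. by rewrite /expi cos0 sin0. Qed.

Lemma MVT_le1 (f df : R -> R) (s t : R) : (forall x, is_derive x (1 : R) f (df x)) -> (forall x, `|df x| <= 1) ->
  `|f s - f t| <= `|s - t|.
Proof.
move=> fd d1; wlog st : s t / s <= t => [H|].
  by have [/H//|/ltW/H] := leP s t; rewrite distrC (distrC s).
have cf : {within `[s, t], continuous f}.
  by apply: continuous_subspaceT => x; apply/differentiable_continuous/derivable1_diffP; case: (fd x).
have [c _ E] := MVT_segment st (fun x _ => fd x) cf.
by rewrite distrC E normrM (distrC s) ler_piMl.
Qed.

Lemma normc_expiB (s t : R) : normc (expi s - expi t) <= 2 * `|s - t|.
Proof.
apply: le_trans (normc_le_abs _) _; rewrite mulr_natl mulr2n; apply: lerD.
  by apply: (@MVT_le1 _ (fun x => - sin x)) => x; rewrite normrN sinle1.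
by apply: (@MVT_le1 _ cos) => x; rewrite cosle1.
Qed.

Lemma measurable_normc d (T : measurableType d) (f : T -> C) :
  measurable_fun setT (fun x => Re (f x)) -> measurable_fun setT (fun x => Im (f x)) ->
  measurable_fun setT (fun x => normc (f x)).
Proof.
move=> m1 m2; rewrite (_ : (fun x => _) = (fun x => Num.sqrt (Re (f x) ^+ 2 + Im (f x) ^+ 2))); last first.
  by apply/funext => x; case: (f x).
apply: (measurableT_comp (f := @Num.sqrt R)); last by apply: measurable_funD; exact: measurable_funX.
by apply: continuous_measurable_fun => x; exact: sqrt_continuous.
Qed.

End Cplx.

Section ComplexIntegral.
Context {R : realType} (n : nat).
Local Notation C := R[i].
Local Notation Re := (@complex.Re R).
Local Notation Im := (@complex.Im R).
Local Notation rv := 'rV[R]_n.+1.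
Local Notation T := (@lebT R n).
Local Notation mu := (@leb R n).
Implicit Types f g : T -> C.

Definition cmeas f := measurable_fun setT (Re \o f) /\ measurable_fun setT (Im \o f).
Definition cintegrable f := mu.-integrable setT (EFin \o (Re \o f)) /\ mu.-integrable setT (EFin \o (Im \o f)).
Definition CI f : C := Complex (Rintegral mu setT (Re \o f)) (Rintegral mu setT (Im \o f)).

Lemma rintE (h : T -> R) : mu.-integrable setT (EFin \o h) -> rint (h : rv -> R) = Rintegral mu setT h.
Proof.
move=> ih; have mh : measurable_fun setT h by apply/measurable_EFinP; exact: measurable_int ih.
have E (k : T -> R) : measurable_fun setT k ->
    nnint (fun x => Num.max (k x) 0) = (\int[mu]_x ((EFin \o k)^\+ x))%E.
  move=> mk; rewrite nnintE//; last 2 first.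
  - exact: measurable_funrpos.
  - by move=> x; rewrite le_max lexx orbT.
  by apply: eq_integral => x _; rewrite funeposE -EFin_max.
rewrite /rint E// E//; last exact: measurableT_comp.
rewrite (_ : ((EFin \o (fun x => (- h x)%R))^\+)%E = ((EFin \o h)^\-)%E); last first.
  by apply/funext => x; rewrite funeposE funenegE.
rewrite -fineB; [|exact: integrable_pos_fin_num|exact: integrable_neg_fin_num].
by congr fine; exact/esym/integralE.
Qed.

Lemma cintegrable_meas f : cintegrable f -> cmeas f.
Proof. by case=> i1 i2; split; apply/measurable_EFinP; [exact: measurable_int i1|exact: measurable_int i2]. Qed.

Lemma cintE f : cintegrable f -> cint (f : rv -> C) = CI f.
Proof. by case=> i1 i2; rewrite /cint (rintE i1) (rintE i2). Qed.

Lemma cintegrable_le f (g : T -> R) : cmeas f -> mu.-integrable setT (EFin \o g) ->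
  (forall x, normc (f x) <= g x) -> cintegrable f.
Proof.
move=> [m1 m2] ig fg; split; apply: (le_integrable measurableT _ _ ig).
- exact/measurable_EFinP.
- by move=> x _; rewrite lee_fin (le_trans (normRe_le _))// (le_trans (fg x))// ler_norm.
- exact/measurable_EFinP.
- by move=> x _; rewrite lee_fin (le_trans (normIm_le _))// (le_trans (fg x))// ler_norm.
Qed.

Lemma integrable_normc f : cintegrable f -> mu.-integrable setT (EFin \o (@normc R \o f)).
Proof.
move=> /[dup] /cintegrable_meas[m1 m2] [i1 i2].
apply: (le_integrable measurableT _ _ (integrable_norm2 i1 i2)).
  exact/measurable_EFinP/measurable_normc.
by move=> x _; rewrite lee_fin ger0_norm ?normc_ge0// ger0_norm ?addr_ge0// normc_le_abs.
Qed.

Lemma cmeasM f g : cmeas f -> cmeas g -> cmeas (fun x => f x * g x).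
Proof.
move=> [f1 f2] [g1 g2]; split.
  rewrite (_ : _ \o _ = (fun x => Re (f x) * Re (g x) - Im (f x) * Im (g x))); last first.
    by apply/funext => x /=; rewrite cReM.
  exact: (measurable_funB (measurable_funM f1 g1) (measurable_funM f2 g2)).
rewrite (_ : _ \o _ = (fun x => Re (f x) * Im (g x) + Im (f x) * Re (g x))); last first.
  by apply/funext => x /=; rewrite cImM.
exact: (measurable_funD (measurable_funM f1 g2) (measurable_funM f2 g1)).
Qed.

Lemma cmeasD f g : cmeas f -> cmeas g -> cmeas (fun x => f x + g x).
Proof.
move=> [f1 f2] [g1 g2]; split.
  rewrite (_ : _ \o _ = (fun x => Re (f x) + Re (g x))); last by apply/funext => x /=; rewrite cReD.
  exact: (measurable_funD f1 g1).
rewrite (_ : _ \o _ = (fun x => Im (f x) + Im (g x))); last by apply/funext => x /=; rewrite cImD.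
exact: (measurable_funD f2 g2).
Qed.

Lemma cmeas_cst (c : C) : cmeas (cst c).
Proof. by split; exact: measurable_cst. Qed.

Lemma cmeas_real (h : T -> R) : measurable_fun setT h -> cmeas (fun x => (h x)%:C%C).
Proof. by move=> mh; split; [exact: mh|exact: measurable_cst]. Qed.

Lemma cmeas_indic (A : set T) : measurable A -> cmeas (\1_A : T -> C).
Proof.
move=> mA; rewrite (_ : \1_A = (fun x => ((\1_A x : R)%:C)%C)); last first.
  by apply/funext => x; rewrite !indicE; case: (_ \in _).
by apply: cmeas_real; exact: measurable_indic.
Qed.

Lemma cmeas_expi (h : T -> R) : measurable_fun setT h -> cmeas (fun x => expi (h x)).
Proof. by move=> mh; split; [exact: measurable_cosf|exact: measurable_sinf]. Qed.

Lemma CID f g : cintegrable f -> cintegrable g ->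
  cintegrable (fun x => f x + g x) /\ CI (fun x => f x + g x) = CI f + CI g.
Proof.
move=> [f1 f2] [g1 g2].
have E1 : Re \o (fun x => f x + g x) = (fun x => Re (f x) + Re (g x)) by apply/funext => x /=; rewrite cReD.
have E2 : Im \o (fun x => f x + g x) = (fun x => Im (f x) + Im (g x)) by apply/funext => x /=; rewrite cImD.
split; first by rewrite /cintegrable E1 E2; split; [exact: integrableD f1 g1|exact: integrableD f2 g2].
by rewrite /CI E1 E2 !RintegralD.
Qed.

Lemma CIZ (c : C) f : cintegrable f -> cintegrable (fun x => c * f x) /\ CI (fun x => c * f x) = c * CI f.
Proof.
move=> [f1 f2].
have E1 : Re \o (fun x => c * f x) = (fun x => Re c * Re (f x) - Im c * Im (f x)) by apply/funext => x /=; rewrite cReM.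
have E2 : Im \o (fun x => c * f x) = (fun x => Re c * Im (f x) + Im c * Re (f x)) by apply/funext => x /=; rewrite cImM.
have iZ (a : R) (h : T -> R) : mu.-integrable setT (EFin \o h) -> mu.-integrable setT (EFin \o (fun x => a * h x)).
  by move=> ih; rewrite (_ : _ \o _ = (fun x => a%:E * (EFin \o h) x)%E)//; exact: integrableZl.
have i11 := iZ (Re c) _ f1; have i12 := iZ (Im c) _ f2; have i21 := iZ (Re c) _ f2; have i22 := iZ (Im c) _ f1.
split; first by rewrite /cintegrable E1 E2; split; [exact: integrableB i11 i12|exact: integrableD i21 i22].
rewrite /CI E1 E2 RintegralB// RintegralD// !RintegralZl//.
by apply/eqP; rewrite eq_complex cReM cImM !eqxx.
Qed.

Lemma CI_sum (I : Type) (s : seq I) (F : I -> T -> C) : (forall i, cintegrable (F i)) ->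
  cintegrable (fun x => \sum_(i <- s) F i x) /\ CI (fun x => \sum_(i <- s) F i x) = \sum_(i <- s) CI (F i).
Proof.
move=> iF; elim: s => [|i s [IH1 IH2]].
  have -> : (fun x : T => \sum_(i <- [::]) F i x) = cst 0 by apply/funext => x; rewrite big_nil.
  rewrite big_nil; split; first by split; exact: integrable0.
  by rewrite /CI /comp/= /Rintegral/= !integral0.
have -> : (fun x : T => \sum_(i <- i :: s) F i x) = (fun x => F i x + \sum_(i <- s) F i x).
  by apply/funext => x; rewrite big_cons.
by rewrite big_cons -IH2; exact: CID.
Qed.

Lemma CI_conj f : cintegrable f -> CI (fun x => conjc (f x)) = conjc (CI f).
Proof.
move=> [f1 f2]; rewrite /CI /=; congr Complex; first by congr Rintegral; apply/funext => x /=; case: (f x).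
rewrite -mulN1r -RintegralZl//; congr Rintegral; apply/funext => x /=; rewrite mulN1r; by case: (f x).
Qed.

Lemma eq_CI f g : f =1 g -> CI f = CI g.
Proof. by move=> fg; congr CI; apply/funext. Qed.

Lemma normc_CI f : cintegrable f -> normc (CI f) <= Rintegral mu setT (@normc R \o f).
Proof.
move=> cf; have in_ := integrable_normc cf.
have [->|z0] := eqVneq (CI f) 0; first by rewrite normc0; apply: Rintegral_ge0 => x _; exact: normc_ge0.
have nz : normc (CI f) != 0 by apply: contra_neq z0 => /eq0_normc.
(* Rotating by the inverse phase makes the integral real, so that only real parts need to be
   compared. *)
pose u : C := conjc (CI f) * ((normc (CI f))^-1%:C)%C.
have nu : normc u = 1 by rewrite normcM normc_conj normc_real ger0_norm ?invr_ge0 ?normc_ge0// divff.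
have [[i1 i2] E] := CIZ u cf.
have -> : normc (CI f) = Re (CI (fun x => u * f x)).
  rewrite E /u mulrAC [conjc _ * _]mulrC mulc_conj cReM/= mulr0 subr0 expr2 mulfK//.
apply: le_Rintegral => // x _ /=.
by apply: le_trans (ler_norm _) _; apply: le_trans (normRe_le _) _; rewrite normcM nu mul1r.
Qed.

End ComplexIntegral.

Section L2theory.
Context {R : realType} (n : nat).
Local Notation C := R[i].
Local Notation Re := (@complex.Re R).
Local Notation Im := (@complex.Im R).
Local Notation rv := 'rV[R]_n.+1.
Local Notation T := (@lebT R n).
Local Notation mu := (@leb R n).
Implicit Types f g : T -> C.

Definition E2 f : \bar R := (\int[mu]_x (normc (f x) ^+ 2)%:E)%E.
Definition nn f : R := Num.sqrt (fine (E2 f)).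

Lemma E2_ge0 f : (0 <= E2 f)%E.
Proof. by apply: integral_ge0 => x _; rewrite lee_fin sqr_ge0. Qed.
Lemma nn_ge0 f : 0 <= nn f. Proof. exact: sqrtr_ge0. Qed.

Lemma l2sqE f : cmeas f -> l2sq (f : rv -> C) = E2 f.
Proof.
move=> [m1 m2]; rewrite /l2sq nnintE; last 2 first.
- by apply: measurable_funD; exact: measurable_funX.
- by move=> x; rewrite addr_ge0 ?sqr_ge0.
by apply: eq_integral => x _; rewrite normc_sqr.
Qed.

Definition sqint f := cmeas f /\ (E2 f < +oo)%E.

Lemma L2P f : L2 (f : rv -> C) <-> sqint f.
Proof.
split=> [[/leb_measurable_funP m1 /leb_measurable_funP m2]|[cf]].
  by rewrite l2sqE.
by rewrite -l2sqE// => h; case: cf => m1 m2; split => //; exact/leb_measurable_funP.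
Qed.

Lemma E2E f : sqint f -> E2 f = (nn f ^+ 2)%:E.
Proof.
move=> [_ fin]; rewrite /nn sqr_sqrtr ?fine_ge0 ?E2_ge0// fineK// ge0_fin_numE ?E2_ge0//.
Qed.

Lemma l2normE f : sqint f -> l2norm (f : rv -> C) = (nn f)%:E.
Proof.
move=> Lf; rewrite /l2norm l2sqE; last by case: Lf.
by rewrite (E2E Lf) sqrtr_sqr (ger0_norm (nn_ge0 f)).
Qed.

Lemma nn_le f (c : R) : 0 <= c -> (E2 f <= (c ^+ 2)%:E)%E -> nn f <= c.
Proof.
move=> c0 Ec; rewrite -[leRHS](ger0_norm c0) -sqrtr_sqr ler_wsqrtr//.
have ff : E2 f \is a fin_num by rewrite ge0_fin_numE ?E2_ge0// (le_lt_trans Ec)// ltry.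
by rewrite -lee_fin fineK.
Qed.

Lemma measurable_normc2 f : cmeas f -> measurable_fun setT (fun x => normc (f x) ^+ 2).
Proof. by move=> [m1 m2]; apply: measurable_funX; exact: measurable_normc. Qed.

Lemma sqint_le f g : cmeas f -> sqint g -> (forall x, normc (f x) <= normc (g x)) ->
  sqint f /\ nn f <= nn g.
Proof.
move=> mf Lg fg.
have le : (E2 f <= (nn g ^+ 2)%:E)%E.
  rewrite -(E2E Lg); apply: ge0_le_integral; first exact: measurableT.
  - by move=> x _; rewrite lee_fin sqr_ge0.
  - by apply/measurable_EFinP; exact: measurable_normc2.
  - by apply/measurable_EFinP/measurable_normc2; case: Lg.
  - by move=> x _; rewrite lee_fin ler_pXn2r ?nnegrE ?normc_ge0.
split; last by apply: nn_le => //; exact: nn_ge0.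
by split => //; rewrite (le_lt_trans le)// ltry.
Qed.

(** Minkowski's inequality is obtained by integrating |f + g|^2 <= (1 + s) |f|^2 + (1 + 1/s) |g|^2
    and optimizing in s. The best s is B / A; the shift by [d] allows A or B to vanish. *)
Lemma ler_sqr_weighted (X A B : R) : 0 <= A -> 0 <= B ->
  (forall s, 0 < s -> X <= (1 + s) * A ^+ 2 + (1 + s^-1) * B ^+ 2) -> X <= (A + B) ^+ 2.
Proof.
move=> A0 B0 H; apply/ler_addgt0Pr => e e0.
pose d := Num.min 1 (e / (4 * (A + B + 1))).
have q0 : 0 < 4 * (A + B + 1) by rewrite mulr_gt0// ltr_wpDl ?addr_ge0.
have d0 : 0 < d by rewrite lt_min ltr01 divr_gt0.
have d1 : d <= 1 by rewrite ge_min lexx.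
have d2 : d * (4 * (A + B + 1)) <= e by rewrite -ler_pdivlMr// ge_min lexx orbT.
have a0 : 0 < A + d by rewrite ltr_wpDl.
have b0 : 0 < B + d by rewrite ltr_wpDl.
have := H ((B + d) / (A + d)) (divr_gt0 b0 a0); rewrite invf_div => /le_trans; apply.
apply: (@le_trans _ _ ((A + d + (B + d)) ^+ 2)).
  apply: (@le_trans _ _ ((1 + (B + d) / (A + d)) * (A + d) ^+ 2 + (1 + (A + d) / (B + d)) * (B + d) ^+ 2)).
    apply: lerD; rewrite ler_wpM2l ?addr_ge0 ?divr_ge0// ?(ltW a0) ?(ltW b0)//;
      by rewrite ler_pXn2r ?nnegrE ?addr_ge0// ?(ltW d0)// lerDl ltW.
  have -> // : (1 + (B + d) / (A + d)) * (A + d) ^+ 2 + (1 + (A + d) / (B + d)) * (B + d) ^+ 2 = (A + d + (B + d)) ^+ 2.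
  by field; rewrite !gt_eqF.
nra.
Qed.

Lemma sqintD f g : sqint f -> sqint g ->
  sqint (fun x => f x + g x) /\ nn (fun x => f x + g x) <= nn f + nn g.
Proof.
move=> Lf Lg; have mf := Lf.1; have mg := Lg.1.
have m2 (h : T -> C) : cmeas h -> measurable_fun setT (fun x => (normc (h x) ^+ 2)%:E).
  by move=> mh; apply/measurable_EFinP; exact: measurable_normc2.
have key s : 0 < s -> (E2 (fun x => f x + g x)%R <= ((1 + s) * nn f ^+ 2 + (1 + s^-1) * nn g ^+ 2)%:E)%E.
  move=> s0; have s1 : 0 <= 1 + s by rewrite addr_ge0// ltW.
  have s2 : 0 <= 1 + s^-1 by rewrite addr_ge0// invr_ge0 ltW.
  rewrite EFinD (EFinM (1 + s)) (EFinM (1 + s^-1)) -(E2E Lf) -(E2E Lg) -!ge0_integralZl//; [|exact: m2|by move=> x _; rewrite lee_fin sqr_ge0|exact: m2|by move=> x _; rewrite lee_fin sqr_ge0].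
  rewrite -ge0_integralD; [|exact: measurableT| | | |]; last 4 first.
  - by move=> x _; rewrite -EFinM lee_fin mulr_ge0// sqr_ge0.
  - by apply/measurable_EFinP; exact: (measurable_funM (measurable_cst _) (measurable_normc2 mf)).
  - by move=> x _; rewrite -EFinM lee_fin mulr_ge0// sqr_ge0.
  - by apply/measurable_EFinP; exact: (measurable_funM (measurable_cst _) (measurable_normc2 mg)).
  apply: ge0_le_integral; first exact: measurableT.
  - by move=> x _; rewrite lee_fin sqr_ge0.
  - exact/m2/cmeasD.
  - apply/measurable_EFinP; exact: (measurable_funD (measurable_funM (measurable_cst _) (measurable_normc2 mf)) (measurable_funM (measurable_cst _) (measurable_normc2 mg))).
  - move=> x _; rewrite -!EFinM -EFinD lee_fin.
    apply: (@le_trans _ _ ((normc (f x) + normc (g x)) ^+ 2)).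
      by rewrite ler_pXn2r ?nnegrE ?addr_ge0 ?normc_ge0// le_normcD.
    set a := normc _; set b := normc _; rewrite -subr_ge0.
    have -> : (1 + s) * a ^+ 2 + (1 + s^-1) * b ^+ 2 - (a + b) ^+ 2 = s * (a - s^-1 * b) ^+ 2.
      by field; rewrite gt_eqF.
    by rewrite mulr_ge0 ?sqr_ge0// ltW.
have L : sqint (fun x => f x + g x).
  split; first exact: cmeasD.
  by apply: le_lt_trans (key 1 ltr01) _; rewrite ltry.
split => //; apply: nn_le; first by rewrite addr_ge0 ?nn_ge0.
rewrite (E2E L) lee_fin; apply: ler_sqr_weighted; rewrite ?nn_ge0// => s /key.
by rewrite (E2E L) lee_fin.
Qed.

Lemma sqintN f : sqint f -> sqint (fun x => - f x) /\ nn (fun x => - f x) = nn f.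
Proof.
move=> Lf; have E : E2 (fun x => - f x) = E2 f by apply: eq_integral => x _; rewrite normcN.
split; last by rewrite /nn E.
rewrite /sqint E; have [[m1 m2] fin] := Lf; split; last exact: fin.
split.
  rewrite (_ : _ \o _ = (fun x => - Re (f x))); last by apply/funext => x /=; rewrite cReN.
  exact: (measurableT_comp (@oppr_measurable R _) m1).
rewrite (_ : _ \o _ = (fun x => - Im (f x))); last by apply/funext => x /=; rewrite cImN.
exact: (measurableT_comp (@oppr_measurable R _) m2).
Qed.

Lemma sqintB f g : sqint f -> sqint g ->
  sqint (fun x => f x - g x) /\ nn (fun x => f x - g x) <= nn f + nn g.
Proof. by move=> Lf Lg; have [LN <-] := sqintN Lg; exact: sqintD. Qed.

Lemma nn_sub f g h : sqint f -> sqint g -> sqint h ->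
  nn (fun x => f x - h x) <= nn (fun x => f x - g x) + nn (fun x => g x - h x).
Proof.
move=> Lf Lg Lh; have [L1 _] := sqintB Lf Lg; have [L2' _] := sqintB Lg Lh.
have [_] := sqintD L1 L2'; rewrite (_ : (fun x => _ + _) = (fun x => f x - h x))//.
by apply/funext => x; rewrite addrA subrK.
Qed.

Lemma nn_distC f g : nn (fun x => f x - g x) = nn (fun x => g x - f x).
Proof. by congr Num.sqrt; congr fine; apply: eq_integral => x _; rewrite normc_distC. Qed.

Lemma sqint_indic (A : set T) f : measurable A -> sqint f ->
  sqint (fun x => \1_A x * f x) /\ nn (fun x => \1_A x * f x) <= nn f.
Proof.
move=> mA Lf; have mm := cmeasM (cmeas_indic mA) Lf.1.
apply: (sqint_le mm Lf) => x; rewrite normcM indicE; case: (_ \in _).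
  by rewrite (_ : normc true%:R = 1) ?mul1r//; exact: normc1.
by rewrite (_ : normc false%:R = 0) ?mul0r ?normc_ge0//; exact: normc0.
Qed.

Lemma sqint_cauchy_schwarz (A : set T) f : measurable A -> (mu A < +oo)%E -> sqint f ->
  mu.-integrable setT (fun x => (\1_A x * normc (f x))%:E) /\
  Rintegral mu setT (fun x => \1_A x * normc (f x)) ^+ 2 <=
    fine (mu A) * nn (fun x => \1_A x * f x) ^+ 2.
Proof.
move=> mA fA Lf; have mf := Lf.1.
have [LA _] := sqint_indic mA Lf.
have i1 : mu.-integrable setT (EFin \o (\1_A : T -> R)) by exact: integrable_set.
have i2 : mu.-integrable setT (EFin \o (fun x => normc (\1_A x * f x) ^+ 2)).
  apply/integrableP; split; first by apply/measurable_EFinP/measurable_normc2; case: LA.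
  have := E2E LA; rewrite /E2 => E; under eq_integral do rewrite /= ger0_norm ?sqr_ge0//.
  by rewrite E ltry.
have mh : measurable_fun setT (fun x => \1_A x * normc (f x)).
  by apply: measurable_funM; [exact: measurable_indic|case: mf => m1 m2; exact: measurable_normc].
have nA x : normc (\1_A x * f x) = \1_A x * normc (f x).
  rewrite normcM !indicE; case: (_ \in _).
    by congr (_ * _); exact: normc1.
  by congr (_ * _); exact: normc0.
have ih : mu.-integrable setT (EFin \o (fun x => \1_A x * normc (f x))).
  apply: (le_integrable measurableT _ _ (integrableD measurableT i1 i2)); first exact/measurable_EFinP.
  move=> x _; rewrite /= lee_fin nA indicE; case: (_ \in _); rewrite ?mul0r ?expr0n ?addr0 ?normr0// !mul1r.
  have := normc_ge0 (f x); set c := normc _ => c0.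
  rewrite !ger0_norm ?addr_ge0 ?sqr_ge0//= -subr_ge0.
  have := sqr_ge0 (c - 1); nra.
split => //.
set I := Rintegral _ _ _; set Q := nn _; have I0 : 0 <= I.
  by apply: Rintegral_ge0 => x _; rewrite mulr_ge0 ?normc_ge0// indicE.
set m := fine (mu A); have m0 : 0 <= m by rewrite fine_ge0 ?measure_ge0.
have RA : Rintegral mu setT (\1_A : T -> R) = m by rewrite /Rintegral integral_indic ?setIT.
have RQ : Rintegral mu setT (fun x => normc (\1_A x * f x) ^+ 2) = Q ^+ 2.
  by rewrite /Rintegral -[X in fine X]/(E2 _) (E2E LA).
(* Integrating 2 l a <= a^2 + l^2 over A; the choice l = I / m is the Cauchy-Schwarz inequality. *)
have key (l : R) : 2 * l * I <= Q ^+ 2 + l ^+ 2 * m.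
  have iZ (a : R) (h : T -> R) : mu.-integrable setT (EFin \o h) -> mu.-integrable setT (EFin \o (fun x => a * h x)).
    by move=> ih'; rewrite (_ : _ \o _ = (fun x => a%:E * (EFin \o h) x)%E)//; exact: integrableZl.
  rewrite -RQ -RA -RintegralZl// -RintegralZl// -RintegralD//; last exact: iZ.
  apply: le_Rintegral => //.
  - exact: iZ.
  - exact: (integrableD measurableT i2 (iZ _ _ i1)).
  - move=> x _; rewrite nA indicE; case: (_ \in _); rewrite ?mul0r ?mulr0 ?expr0n ?addr0// !mul1r mulr1.
    by have := sqr_ge0 (l - normc (f x)); nra.
move: m0; rewrite le_eqVlt => /predU1P[m0|m0]; last first.
  have := key (I / m); have -> : 2 * (I / m) * I = 2 * I ^+ 2 / m by field; rewrite gt_eqF.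
  have -> : (I / m) ^+ 2 * m = I ^+ 2 / m by field; rewrite gt_eqF.
  rewrite -lerBlDr -mulrBl -[2 * _ - _](_ : I ^+ 2 = _); last ring.
  by rewrite ler_pdivrMr// mulrC.
(* On a null set the previous bound reads 2 l I <= Q^2 for every l, which forces I = 0. *)
rewrite -m0 mul0r; have [->|I1] := eqVneq I 0; first by rewrite expr0n.
have Ip : 0 < I by rewrite lt_def I1.
have := key ((Q ^+ 2 + 1) / (2 * I)); rewrite -m0 mulr0 addr0.
have -> : 2 * ((Q ^+ 2 + 1) / (2 * I)) * I = Q ^+ 2 + 1 by field.
by rewrite gerDl ler10.
Qed.

End L2theory.

(** * The truncated Fourier operator *)

Section Operator.
Context {R : realType} (n : nat).
Local Notation C := R[i].
Local Notation Re := (@complex.Re R).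
Local Notation Im := (@complex.Im R).
Local Notation rv := 'rV[R]_n.+1.
Local Notation T := (@lebT R n).
Local Notation mu := (@leb R n).
Implicit Types f g : T -> C.

Lemma normc_indic (A : set T) x : normc (\1_A x : C) = \1_A x.
Proof. by rewrite !indicE; case: (_ \in _); [exact: normc1|exact: normc0]. Qed.

Lemma sqint_conj f : sqint f -> sqint (fun x => conjc (f x)).
Proof.
move=> [[m1 m2] fin]; split; last first.
  rewrite (_ : E2 _ = E2 f)//; by apply: eq_integral => x _; rewrite normc_conj.
split; first by rewrite (_ : _ \o _ = Re \o f)//; apply/funext => x /=; case: (f x).
rewrite (_ : _ \o _ = (fun x => - Im (f x))); last by apply/funext => x /=; case: (f x).
exact: (measurableT_comp (@oppr_measurable R _) m2).
Qed.

Lemma cintegrable_expi (A : set T) f (h : T -> R) : measurable A -> (mu A < +oo)%E -> sqint f ->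
  measurable_fun setT h -> cintegrable (fun x => \1_A x * f x * expi (h x)).
Proof.
move=> mA fA Lf mh; have [ih _] := sqint_cauchy_schwarz mA fA Lf.
apply: (cintegrable_le (cmeasM (cmeasM (cmeas_indic mA) Lf.1) (cmeas_expi mh)) ih) => x.
by rewrite !normcM normc_indic normc_expi mulr1.
Qed.

Lemma normc_CI_expi (A : set T) f (h : T -> R) : measurable A -> (mu A < +oo)%E -> sqint f ->
  measurable_fun setT h ->
  normc (CI (fun x => \1_A x * f x * expi (h x))) ^+ 2 <= fine (mu A) * nn (fun x => \1_A x * f x) ^+ 2.
Proof.
move=> mA fA Lf mh; have [ih le] := sqint_cauchy_schwarz mA fA Lf; apply: le_trans le.
rewrite ler_pXn2r ?nnegrE ?normc_ge0//; last first.
  by apply: Rintegral_ge0 => x _; rewrite mulr_ge0 ?normc_ge0// indicE.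
apply: le_trans (normc_CI (cintegrable_expi mA fA Lf mh)) _.
rewrite le_eqVlt; apply/orP; left; apply/eqP; apply: eq_Rintegral => x _ /=.
by rewrite !normcM normc_indic normc_expi mulr1.
Qed.

Definition FT (A : set rv) f (xi : T) : C := CI (fun x : T => \1_A (x : rv) * f x * expi (- dotp (x : rv) (xi : rv))).
Definition iFT (A : set rv) g (x : T) : C :=
  (((2 * pi) ^- n.+1)%:C)%C * CI (fun xi : T => \1_A (xi : rv) * g xi * expi (dotp (x : rv) (xi : rv))).

Lemma measurable_dotT (xi : rv) : measurable_fun setT (fun x : T => dotp (x : rv) xi).
Proof. by apply: measurable_dotp2; [exact: measurable_lebT_row|exact: measurable_cst]. Qed.

Lemma measurable_dotT_r (xi : rv) : measurable_fun setT (fun x : T => dotp xi (x : rv)).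
Proof. by apply: measurable_dotp2; [exact: measurable_cst|exact: measurable_lebT_row]. Qed.

Lemma FTE (A : set rv) f (xi : T) :
  FT A f xi = Complex (Fre (fun x => Re (\1_A (x : rv) * f x)) (fun x => Im (\1_A (x : rv) * f x)) xi)
                      (Fim (fun x => Re (\1_A (x : rv) * f x)) (fun x => Im (\1_A (x : rv) * f x)) xi).
Proof.
rewrite /FT /CI /Fre /Fim; congr Complex; congr Rintegral; apply/funext => x /=.
  by rewrite cReM /= cosN sinN /fre mulrN opprK.
by rewrite cImM /= cosN sinN /fim mulrN addrC.
Qed.

Section Bounded.
Variable A : set rv.
Hypotheses (mA : measurable (A : set T)) (fA : (leb_out A < +oo)%E).

Lemma FT_sqint f : sqint f ->
  sqint (FT A f) /\ nn (FT A f) ^+ 2 <= (2 * pi) ^+ n.+1 * nn f ^+ 2.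
Proof.
move=> Lf; have [LA leA] := sqint_indic mA Lf.
have [i1 i2] := cintegrable_expi mA fA Lf (@measurable_cst _ _ T R setT 0).
have E0 : (fun x : T => \1_A (x : rv) * f x * expi 0) = (fun x => \1_A (x : rv) * f x).
  by apply/funext => x; rewrite expi0 mulr1.
rewrite E0 in i1 i2.
have mF := measurable_FreFim i1 i2.
have cm : cmeas (FT A f).
  rewrite (_ : FT A f = (fun xi => Complex (Fre (Re \o (fun x => \1_A (x : rv) * f x)) (Im \o (fun x => \1_A (x : rv) * f x)) xi)
                      (Fim (Re \o (fun x => \1_A (x : rv) * f x)) (Im \o (fun x => \1_A (x : rv) * f x)) xi))).
    split; apply: measurable_fun_lebT; [exact: measurable_Fre|exact: measurable_Fim].
  by apply/funext => xi; exact: FTE.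
have E : (E2 (FT A f) <= ((2 * pi) ^+ n.+1 * nn f ^+ 2)%:E)%E.
  have P := plancherel_le i1 i2.
  apply: (@le_trans _ _ (((2 * pi) ^+ n.+1)%:E * E2 (fun x => (\1_A (x : rv) * f x)%R))%E); last first.
    rewrite (E2E LA) -EFinM lee_fin ler_wpM2l ?exprn_ge0 ?mulr_ge0 ?pi_ge0//.
    by rewrite ler_pXn2r ?nnegrE ?nn_ge0.
  apply: le_trans (_ : (_ <= ((2 * pi) ^+ n.+1)%:E * \int[mu]_x (Re (\1_A (x : rv) * f x) ^+ 2 + Im (\1_A (x : rv) * f x) ^+ 2)%:E)%E) _; last first.
    rewrite le_eqVlt; apply/orP; left; apply/eqP; congr (_ * _)%E.
    by apply: eq_integral => x _; rewrite normc_sqr.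
  apply: le_trans P; rewrite -integral_lebB_ge0; last 2 first.
  - exact/measurable_EFinP.
  - by move=> x; rewrite lee_fin addr_ge0 ?sqr_ge0.
  rewrite le_eqVlt; apply/orP; left; apply/eqP.
  by apply: eq_integral => xi _; rewrite normc_sqr FTE.
have S : sqint (FT A f) by split => //; apply: le_lt_trans E _; rewrite ltry.
by split => //; rewrite -lee_fin -(E2E S).
Qed.

(** Conjugation exchanges the two transforms, so every estimate for the inverse is inherited from
    the direct one. *)
Lemma iFTE g (x : T) : sqint g ->
  iFT A g x = (((2 * pi) ^- n.+1)%:C)%C * conjc (FT A (fun xi => conjc (g xi)) x).
Proof.
move=> Lg; rewrite /iFT /FT -CI_conj; last first.
  apply: cintegrable_expi; [exact: mA|exact: fA|exact: sqint_conj|].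
  exact: (measurableT_comp (@oppr_measurable R _) (measurable_dotT x)).
congr (_ * CI _); apply/funext => xi.
rewrite !conjcM conjcK -expiN opprK dotpC; congr (_ * _ * _).
by rewrite indicE; case: (_ \in _); rewrite ?conjc1 ?conjc0.
Qed.

Lemma iFT_sqint g : sqint g ->
  sqint (iFT A g) /\ nn (iFT A g) ^+ 2 <= (2 * pi) ^- n.+1 * nn g ^+ 2.
Proof.
move=> Lg; have [LF leF] := FT_sqint (sqint_conj Lg).
have p0 : 0 < (2 * pi) ^+ n.+1 :> R by rewrite exprn_gt0// mulr_gt0// pi_gt0.
set c : R := (2 * pi) ^- n.+1; have c0 : 0 <= c by rewrite invr_ge0 ltW.
have Ng : nn (fun xi => conjc (g xi)) = nn g.
  by congr Num.sqrt; congr fine; apply: eq_integral => x _; rewrite normc_conj.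
rewrite Ng in leF.
have cm : cmeas (iFT A g).
  rewrite (_ : iFT A g = (fun x => (c%:C)%C * conjc (FT A (fun xi => conjc (g xi)) x))); last first.
    by apply/funext => x; exact: iFTE.
  apply: cmeasM; first exact: cmeas_cst.
  by case: (sqint_conj LF).
have E : (E2 (iFT A g) <= (c * nn g ^+ 2)%:E)%E.
  apply: (@le_trans _ _ ((c ^+ 2)%:E * E2 (FT A (fun xi => conjc (g xi))))%E).
    rewrite -ge0_integralZl; [|exact: measurableT| | |]; last 3 first.
    - by apply/measurable_EFinP/measurable_normc2; case: LF.
    - by move=> x _; rewrite lee_fin sqr_ge0.
    - by rewrite lee_fin sqr_ge0.
    rewrite le_eqVlt; apply/orP; left; apply/eqP; apply: eq_integral => x _.
    by rewrite iFTE// normcM normc_conj normc_real ger0_norm// exprMn EFinM.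
  rewrite (E2E LF) -EFinM lee_fin (@le_trans _ _ (c ^+ 2 * ((2 * pi) ^+ n.+1 * nn g ^+ 2)))//.
    by rewrite ler_wpM2l ?sqr_ge0.
  by rewrite mulrA expr2 -(mulrA c) /c mulVf ?mulr1// gt_eqF.
have S : sqint (iFT A g) by split => //; apply: le_lt_trans E _; rewrite ltry.
by split => //; rewrite -lee_fin -(E2E S).
Qed.

(** The Fourier transform of the statement is known only up to distance 0; by Cauchy-Schwarz the
    truncated integrals do not see the difference. *)
Lemma eq0_CI_expi f g (h : T -> R) : sqint f -> sqint g -> measurable_fun setT h ->
  nn (fun x => f x - g x) = 0 ->
  CI (fun x : T => \1_A (x : rv) * f x * expi (h x)) = CI (fun x : T => \1_A (x : rv) * g x * expi (h x)).
Proof.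
move=> Lf Lg mh fg0; have [Lfg _] := sqintB Lf Lg.
have ig := cintegrable_expi mA fA Lg mh; have ifg := cintegrable_expi mA fA Lfg mh.
have [_ E] := CID ig ifg.
have -> : (fun x : T => \1_A (x : rv) * f x * expi (h x)) =
    (fun x => \1_A (x : rv) * g x * expi (h x) + \1_A (x : rv) * (f x - g x) * expi (h x)).
  by apply/funext => x; ring.
rewrite E -[RHS]addr0; congr (_ + _); apply: eq0_normc; apply/eqP.
have := normc_CI_expi mA fA Lfg mh.
have [_ le0] := sqint_indic mA Lfg; rewrite fg0 in le0.
have -> : nn (fun x => \1_A (x : rv) * (f x - g x)) = 0 by apply/eqP; rewrite eq_le le0 nn_ge0.
by rewrite expr0n mulr0 -sqrf_eq0 eq_le sqr_ge0 andbT.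
Qed.

End Bounded.

Lemma l2norm_sub f g : sqint f -> sqint g ->
  l2norm ((f : rv -> C) \- g) = (nn (fun x => f x - g x))%:E.
Proof. by move=> Lf Lg; have [L _] := sqintB Lf Lg; exact: l2normE L. Qed.

(** [xget] may pick any function at distance 0 from the eventual value, so this distance is all that
    can be asserted about the limit. *)
Lemma L2lim_eventually (u : nat -> rv -> C) (g : T -> C) N : sqint g ->
  (forall k, (N <= k)%N -> u k = g) -> sqint (L2lim u) /\ nn (fun x => g x - L2lim u x) = 0.
Proof.
move=> Lg ug.
have cvgE (h : rv -> C) : L2 h -> ((fun k => l2norm (u k \- h)) @ \oo --> 0%E <-> nn (fun x => g x - h x) = 0).
  move=> /L2P Lh; have E k : (N <= k)%N -> l2norm (u k \- h) = (nn (fun x => g x - h x))%:E.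
    by move=> Nk; rewrite ug// l2norm_sub.
  have cv : (fun k => l2norm (u k \- h)) @ \oo --> (nn (fun x => g x - h x))%:E.
    by apply: cvg_near_cst; near=> k; apply: E; near: k; exact: nbhs_infty_ge.
  split => [cv0|E0]; last by rewrite E0 in cv; exact: cv.
  by have [] : (nn (fun x => g x - h x))%:E = 0%E by rewrite -(cvg_lim _ cv)// (cvg_lim _ cv0).
have : [set h | L2 h /\ (fun k => l2norm (u k \- h)) @ \oo --> 0%E] (L2lim u).
  apply: (@xgetPex _ _ _); exists g; have LG : L2 (g : rv -> C) by exact/L2P.
  split => //; apply/(cvgE _ LG).
  rewrite /nn (_ : E2 _ = 0%E) ?sqrtr0//; apply: integral0_eq => x _.
  by rewrite subrr normc0 expr0n.
move=> [LL /(cvgE _ LL) cv]; split; [exact/L2P|exact: cv].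
Unshelve. all: by end_near. Qed.

Definition Sop (X W : set rv) f (x : T) : C := \1_X (x : rv) * iFT W (FT X f) x.

Section PLPS.
Variables (X W : set rv).
Hypotheses (cX : compact X) (cW : compact W).

Let mX : measurable (X : set T). Proof. exact: compact_leb_measurable. Qed.
Let mW : measurable (W : set T). Proof. exact: compact_leb_measurable. Qed.
Let fX := compact_leb_fin cX.
Let fW := compact_leb_fin cW.

Lemma Sop_sqint f : sqint f -> sqint (Sop X W f) /\ nn (Sop X W f) <= nn f.
Proof.
move=> Lf; have [LF leF] := FT_sqint mX fX Lf; have [LG leG] := iFT_sqint mW fW LF.
have [LS leS] := sqint_indic mX LG; split; first exact: LS.
apply: le_trans leS _; rewrite -(ler_pXn2r (ltn0Sn 1)) ?nnegrE ?nn_ge0//.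
apply: le_trans leG _; rewrite mulrC ler_pdivrMr ?exprn_gt0 ?mulr_gt0 ?pi_gt0//.
by rewrite mulrC.
Qed.

Lemma indic_cube (B : set rv) N (x : rv) : B `<=` cube N -> (\1_(cube N) x * \1_B x : C) = \1_B x.
Proof.
move=> BN; rewrite !indicE; case: (boolP (x \in B)) => [/set_mem/BN xN|]; last by rewrite mulr0.
by rewrite mem_set// mulr1.
Qed.

Lemma sub_cube (B : set rv) N k : B `<=` cube N -> (N <= k)%N -> B `<=` cube k.
Proof.
move=> BN Nk x /BN xN j; have /andP[h1 h2] := xN j.
by rewrite (le_trans _ h1) ?lerN2 ?ler_nat// (le_trans h2)// ler_nat.
Qed.

(** The truncations to cubes stop acting once the cube contains X, respectively W, so the two limits
    are the explicit integrals in [Sop] up to null functions. *)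
Lemma P_LPS_Sop r Om f : X = scale_set r Om -> sqint f ->
  sqint (P_LPS r Om W f) /\ nn (fun x => Sop X W f x - P_LPS r Om W f x) = 0.
Proof.
move=> XE Lf; have [LF _] := FT_sqint mX fX Lf.
have [N XN] := compact_cube cX; have [M WM] := compact_cube cW.
have FE k xi : (N <= k)%N -> cint (fun x => \1_(cube k) x * P_space X f x * expi (- dotp x xi)) = FT X f xi.
  move=> Nk; rewrite /FT -cintE; last first.
    apply: (cintegrable_expi mX fX Lf).
    exact: (measurableT_comp (@oppr_measurable R _) (measurable_dotT xi)).
  by congr cint; apply/funext => x; rewrite /P_space mulrA indic_cube//; exact: sub_cube Nk.
have [LL L0] := @L2lim_eventually (fun k xi => cint (fun x => \1_(cube k) x * P_space X f x * expi (- dotp x xi)))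
  (FT X f) N LF (fun k Nk => funext (fun xi => FE k xi Nk)).
set F := L2lim _ in LL L0; have FourE : fourier (P_space X f) = F by [].
have [LG _] := iFT_sqint mW fW LF.
have GE k x : (M <= k)%N -> ((2 * pi) ^- n.+1)%:C%C *
    cint (fun xi => \1_(cube k) xi * (\1_W xi * fourier (P_space X f) xi) * expi (dotp x xi)) = iFT W (FT X f) x.
  move=> Mk; rewrite /iFT FourE; congr (_ * _).
  rewrite -(eq0_CI_expi mW fW LL LF (measurable_dotT_r x)); last by rewrite nn_distC.
  rewrite -cintE; last exact: (cintegrable_expi mW fW LL (measurable_dotT_r x)).
  by congr cint; apply/funext => xi; rewrite mulrA indic_cube//; exact: sub_cube Mk.
have [LL' L0'] := @L2lim_eventually (fun k x => ((2 * pi) ^- n.+1)%:C%C *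
    cint (fun xi => \1_(cube k) xi * (\1_W xi * fourier (P_space X f) xi) * expi (dotp x xi)))
  (iFT W (FT X f)) M LG (fun k Mk => funext (fun x => GE k x Mk)).
set G := L2lim _ in LL' L0'.
have -> : P_LPS r Om W f = (fun x => \1_X x * G x) by rewrite /G XE.
have [LXG _] := sqint_indic mX LL'; split; first exact: LXG.
have [LD _] := sqintB LG LL'; have [_ le0] := sqint_indic mX LD; rewrite L0' in le0.
apply/eqP; rewrite eq_le nn_ge0 andbT; apply: le_trans le0.
by rewrite (_ : (fun x : T => _ - _) = (fun x => \1_X (x : rv) * (iFT W (FT X f) x - G x)))//; apply/funext => x; rewrite /Sop; ring.
Qed.

End PLPS.

End Operator.

(** * Discretization by cells *)

Section Discretization.
Context {R : realType} (n : nat).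
Local Notation C := R[i].
Local Notation Re := (@complex.Re R).
Local Notation Im := (@complex.Im R).
Local Notation rv := 'rV[R]_n.+1.
Local Notation T := (@lebT R n).
Local Notation mu := (@leb R n).
Implicit Types f g : T -> C.

Lemma cintegrable_set (A : set T) : measurable A -> (mu A < +oo)%E -> cintegrable (\1_A : T -> C).
Proof.
move=> mA fA; apply: (cintegrable_le (cmeas_indic mA) (integrable_set mA fA)) => x.
by rewrite normc_indic.
Qed.

Lemma CI_set (A : set T) : measurable A -> CI (\1_A : T -> C) = ((fine (mu A))%:C)%C.
Proof.
move=> mA; rewrite /CI; congr Complex.
  rewrite (_ : _ \o _ = (\1_A : T -> R)); first by rewrite /Rintegral integral_indic// setIT.
  by apply/funext => x; rewrite /= !indicE; case: (_ \in _).
rewrite (_ : _ \o _ = cst 0); first by rewrite /Rintegral integral0.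
by apply/funext => x; rewrite /= !indicE; case: (_ \in _).
Qed.

Lemma normc_CI_le (A : set T) (D : T -> C) (b : R) : measurable A -> (mu A < +oo)%E -> cmeas D ->
  0 <= b -> (forall x, A x -> normc (D x) <= b) ->
  cintegrable (fun x => \1_A x * D x) /\ normc (CI (fun x => \1_A x * D x)) <= b * fine (mu A).
Proof.
move=> mA fA mD b0 Db; have iA := integrable_set mA fA.
have le x : normc (\1_A x * D x) <= b * \1_A x.
  rewrite normcM normc_indic indicE; case: (boolP (x \in A)) => [/set_mem/Db|]; last by rewrite mul0r mulr0.
  by rewrite mul1r mulr1.
have ib : mu.-integrable setT (EFin \o (fun x => b * \1_A x)).
  by rewrite (_ : _ \o _ = (fun x => b%:E * (EFin \o (\1_A : T -> R)) x)%E)//; exact: integrableZl.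
have ci := cintegrable_le (cmeasM (cmeas_indic mA) mD) ib le.
split; first exact: ci.
apply: le_trans (normc_CI ci) _.
have -> : fine (mu A) = Rintegral mu setT (\1_A : T -> R) by rewrite /Rintegral integral_indic// setIT.
rewrite -RintegralZl//; apply: le_Rintegral => //; first exact: integrable_normc.
Qed.

Section Cells.
Variables (X W : set rv) (L : nat) (E : 'I_L -> set rv) (p : 'I_L -> rv).
Hypotheses (cX : compact X) (cW : compact W).
Hypothesis mE : forall j, measurable (E j : set T).
Hypothesis disjE : forall x j k, E j x -> E k x -> j = k.
Hypothesis covE : forall x, X x <-> exists j, E j x.

Let mX : measurable (X : set T). Proof. exact: compact_leb_measurable. Qed.
Let mW : measurable (W : set T). Proof. exact: compact_leb_measurable. Qed.
Let fX := compact_leb_fin cX.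
Let fW := compact_leb_fin cW.

Let c0 : R := (2 * pi) ^- n.+1.

Definition cellm j : R := fine (leb_out (E j)).
Definition kap j k : C := (c0%:C)%C * CI (fun xi : T => \1_W (xi : rv) * expi (dotp (p j - p k) (xi : rv))).
Definition fhat f k : C := CI (fun x : T => \1_(E k) (x : rv) * f x).
Definition step (u : 'I_L -> C) (x : T) : C := \sum_j u j * \1_(E j) (x : rv).

Lemma fE j : (leb_out (E j) < +oo)%E.
Proof. by apply: le_lt_trans fX; apply: le_leb_out => x Ex; apply/covE; exists j. Qed.

Lemma cellm_ge0 j : 0 <= cellm j. Proof. by rewrite fine_ge0 ?leb_out_ge0. Qed.

Lemma sum_cell (V : pzRingType) (u : 'I_L -> V) j x : E j x -> \sum_k u k * \1_(E k) x = u j.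
Proof.
move=> Ex; rewrite (bigD1 j)//= indicE mem_set// mulr1 big1 ?addr0// => k kj.
by rewrite indicE memNset ?mulr0// => Ek; move: kj; rewrite (disjE Ek Ex) eqxx.
Qed.

Lemma sum_cell0 (V : pzRingType) (u : 'I_L -> V) x : ~ X x -> \sum_k u k * \1_(E k) x = 0.
Proof. by move=> Xx; apply: big1 => k _; rewrite indicE memNset ?mulr0// => Ek; apply: Xx; apply/covE; exists k. Qed.

Lemma sum_indic (V : pzRingType) x : \sum_k \1_(E k) x = \1_X x :> V.
Proof.
have [Xx|Xx] := pselect (X x).
  have [j Ej] := (covE x).1 Xx; rewrite [RHS]indicE mem_set//.
  by rewrite -(@sum_cell V (fun=> 1) j x Ej); apply: eq_bigr => k _; rewrite mul1r.
rewrite [RHS]indicE memNset//; transitivity (\sum_k 1 * \1_(E k) x : V); last exact: sum_cell0.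
by apply: eq_bigr => k _; rewrite mul1r.
Qed.

Lemma cmeas_sum (I : Type) (s : seq I) (F : I -> T -> C) : (forall i, cmeas (F i)) ->
  cmeas (fun x => \sum_(i <- s) F i x).
Proof.
move=> mF; elim: s => [|i s IH].
  by rewrite (_ : (fun x => _) = cst 0); [exact: cmeas_cst|apply/funext => x; rewrite big_nil].
rewrite (_ : (fun x => _) = (fun x => F i x + \sum_(j <- s) F j x)); first exact: cmeasD.
by apply/funext => x; rewrite big_cons.
Qed.

Lemma cmeas_step u : cmeas (step u).
Proof. by apply: cmeas_sum => j; apply: cmeasM; [exact: cmeas_cst|exact: cmeas_indic]. Qed.

Lemma E2_step u : E2 (step u) = (\sum_j cellm j * normc (u j) ^+ 2)%:E.
Proof.
have -> : E2 (step u) = (\int[mu]_x \sum_j ((normc (u j) ^+ 2)%:E * (\1_(E j) (x : rv))%:E))%E.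
  apply: eq_integral => x _; under eq_bigr do rewrite -EFinM; rewrite sumEFin; congr EFin.
  have [Xx|Xx] := pselect (X x); last by rewrite /step !sum_cell0// normc0 expr0n.
  by have [j Ej] := (covE x).1 Xx; rewrite /step !(sum_cell _ Ej).
rewrite ge0_integral_sum; [|exact: measurableT| |]; last 2 first.
- move=> j; apply/measurable_EFinP; apply: measurable_funM; [exact: measurable_cst|exact: measurable_indic].
- by move=> j x _; rewrite -EFinM lee_fin mulr_ge0 ?sqr_ge0// indicE.
rewrite -sumEFin; apply: eq_bigr => j _.
rewrite ge0_integralZl//; last 2 first.
- by apply/measurable_EFinP; exact: measurable_indic.
- by rewrite lee_fin sqr_ge0.
rewrite integral_indic// setIT mulrC [RHS]EFinM; congr (_ * _)%E.
by rewrite /cellm fineK// ge0_fin_numE ?leb_out_ge0// fE.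
Qed.

Lemma sqint_step u : sqint (step u).
Proof. by split; [exact: cmeas_step|rewrite E2_step ltry]. Qed.

Lemma nn_step u : nn (step u) ^+ 2 = \sum_j normc (((Num.sqrt (cellm j))%:C)%C * u j) ^+ 2.
Proof.
have := E2_step u; rewrite (E2E (sqint_step u)) => -[->]; apply: eq_bigr => j _.
by rewrite normcM normc_real (ger0_norm (sqrtr_ge0 _)) exprMn sqr_sqrtr ?cellm_ge0.
Qed.

(** Coordinates of the orthogonal projection on step functions in the normalized indicators of
    cells. Cells may be null: their coordinate is 0, because the inverse of 0 is 0. *)
Definition Phi f : 'cV[C]_L := \col_j (((Num.sqrt (cellm j))^-1%:C)%C * fhat f j).

Lemma cintegrable_cell f j : sqint f -> cintegrable (fun x : T => \1_(E j) (x : rv) * f x).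
Proof.
move=> Lf; have := cintegrable_expi (mE j) (fE j) Lf (@measurable_cst _ _ T R setT 0).
by rewrite (_ : (fun x => _ * expi _) = (fun x : T => \1_(E j) (x : rv) * f x))//; apply/funext => x; rewrite expi0 mulr1.
Qed.

Lemma normc_fhat f j : sqint f ->
  normc (fhat f j) ^+ 2 <= cellm j * nn (fun x : T => \1_(E j) (x : rv) * f x) ^+ 2.
Proof.
move=> Lf; have := normc_CI_expi (mE j) (fE j) Lf (@measurable_cst _ _ T R setT 0).
by rewrite (_ : (fun x => _ * expi _) = (fun x : T => \1_(E j) (x : rv) * f x))//; apply/funext => x; rewrite expi0 mulr1.
Qed.

Lemma Phi_fhat f j : sqint f -> ((Num.sqrt (cellm j))%:C)%C * Phi f j ord0 = fhat f j.
Proof.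
move=> Lf; rewrite mxE mulrA -rmorphM/=; have := cellm_ge0 j; rewrite le_eqVlt => /predU1P[m0|m0].
  (* On a null cell Cauchy-Schwarz makes the integral of f vanish, so both sides are 0. *)
  have := normc_fhat j Lf; rewrite -m0 mul0r => /(conj (sqr_ge0 _))/andP/le_anti/esym/eqP.
  by rewrite sqrf_eq0 => /eqP/eq0_normc ->; rewrite mulr0.
by rewrite divff ?mul1r// gt_eqF// sqrtr_gt0.
Qed.

Lemma PhiB f g : sqint f -> sqint g -> Phi (fun x => f x - g x) = Phi f - Phi g.
Proof.
move=> Lf Lg; apply/colP => j; rewrite !mxE -mulrBr; congr (_ * _).
have [iN EN] := CIZ (-1) (cintegrable_cell j Lg); have [_ ED] := CID (cintegrable_cell j Lf) iN.
rewrite /fhat -[X in _ - X]mul1r -mulNr -EN -ED; congr CI; apply/funext => x.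
by rewrite mulN1r mulrBr.
Qed.

Lemma Phi_step u j : Phi (step u) j ord0 = ((Num.sqrt (cellm j))%:C)%C * u j.
Proof.
rewrite mxE /fhat (@eq_CI _ _ _ (fun x : T => u j * \1_(E j) (x : rv))); last first.
  move=> x; have [Ej|Ej] := pselect (E j x); first by rewrite /step (sum_cell _ Ej) mulrC.
  by rewrite indicE memNset// mul0r mulr0.
have [_ ->] := CIZ (u j) (cintegrable_set (mE j) (fE j)); rewrite CI_set// mulrCA mulrC -rmorphM/=.
congr (_ * _); rewrite -[fine _]/(cellm j); have := cellm_ge0 j; rewrite le_eqVlt => /predU1P[<-|m0].
  by rewrite sqrtr0 mulr0.
by rewrite -[X in _^-1 * X](sqr_sqrtr (cellm_ge0 j)) expr2 mulrA mulVf ?mul1r// gt_eqF// sqrtr_gt0.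
Qed.

Lemma Phi_le f : sqint f -> \sum_j normc (Phi f j ord0) ^+ 2 <= nn f ^+ 2.
Proof.
move=> Lf.
have mf2 : measurable_fun setT (fun x => normc (f x) ^+ 2) by apply: measurable_normc2; case: Lf.
apply: (@le_trans _ _ (\sum_j nn (fun x : T => \1_(E j) (x : rv) * f x) ^+ 2)).
  apply: ler_sum => j _; rewrite mxE normcM exprMn normc_real ger0_norm ?invr_ge0 ?sqrtr_ge0//.
  rewrite exprVn sqr_sqrtr ?cellm_ge0//; have := cellm_ge0 j; rewrite le_eqVlt => /predU1P[<-|m0].
    by rewrite invr0 mul0r sqr_ge0.
  by rewrite ler_pdivrMl//; exact: normc_fhat.
rewrite -lee_fin -(E2E Lf) -sumEFin.
under eq_bigr => j _ do rewrite -(E2E (sqint_indic (mE j) Lf).1).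
rewrite /E2 -ge0_integral_sum; [|exact: measurableT| |]; last 2 first.
- move=> j; apply/measurable_EFinP; apply: measurable_normc2.
  by have [[]] := sqint_indic (mE j) Lf.
- by move=> j x _; rewrite lee_fin sqr_ge0.
apply: ge0_le_integral; first exact: measurableT.
- by move=> x _; apply: sume_ge0 => j _; rewrite lee_fin sqr_ge0.
- apply: emeasurable_sum => j; apply/measurable_EFinP; apply: measurable_normc2.
  by have [[]] := sqint_indic (mE j) Lf.
- exact/measurable_EFinP.
- move=> x _; rewrite sumEFin lee_fin.
  under eq_bigr => j _ do rewrite normcM normc_indic exprMn mulrC.
  rewrite -mulr_sumr ler_piMr ?sqr_ge0// (_ : \sum_j _ = \1_X (x : rv)); last first.
    rewrite -(sum_indic R x); apply: eq_bigr => j _; rewrite indicE.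
    by case: (_ \in _); rewrite ?expr0n ?expr1n.
  by rewrite indicE; case: (_ \in _).
Qed.

Definition iota_ (a : 'cV[C]_L) : T -> C := step (fun j => ((Num.sqrt (cellm j))^-1%:C)%C * a j ord0).

Lemma nn_iota a : nn (iota_ a) ^+ 2 <= \sum_j normc (a j ord0) ^+ 2.
Proof.
rewrite nn_step; apply: ler_sum => j _; rewrite mulrA -rmorphM/= normcM normc_real exprMn.
apply: ler_piMl; first exact: sqr_ge0.
have [->|m0] := eqVneq (Num.sqrt (cellm j)) 0; first by rewrite mul0r normr0 expr0n.
by rewrite divff// normr1 expr1n.
Qed.

Definition cellM : 'M[C]_L :=
  \matrix_(j, k) (((Num.sqrt (cellm j))%:C)%C * kap j k * ((Num.sqrt (cellm k))%:C)%C).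

(** [Phi] inverts [iota_] except at null cells, and there the columns of the matrix vanish. *)
Lemma cellM_iota a : cellM *m Phi (iota_ a) = cellM *m a.
Proof.
have H k (z : C) : ((Num.sqrt (cellm k))%:C)%C * (((Num.sqrt (cellm k))%:C)%C * (((Num.sqrt (cellm k))^-1%:C)%C * z)) =
    ((Num.sqrt (cellm k))%:C)%C * z.
  rewrite !mulrA -!rmorphM/=; have [->|m0] := eqVneq (Num.sqrt (cellm k)) 0; first by rewrite !mul0r.
  by rewrite mulfK.
by apply/colP => j; rewrite !mxE; apply: eq_bigr => k _; rewrite Phi_step [cellM j k]mxE -!mulrA H.
Qed.

Section Approx.
Variables (h CW : R).
Hypotheses (h0 : 0 <= h) (CW0 : 0 <= CW).
Hypothesis closeE : forall x j, E j x -> enorm (x - p j) <= h.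
Hypothesis boundW : forall xi, W xi -> enorm xi <= CW.

Definition discr f : T -> C := step (fun j => \sum_k kap j k * fhat f k).

Lemma discr_cellM f j : sqint f ->
  ((Num.sqrt (cellm j))%:C)%C * (\sum_k kap j k * fhat f k) = (cellM *m Phi f) j ord0.
Proof.
move=> Lf; rewrite !mxE mulr_sumr; apply: eq_bigr => k _.
by rewrite [cellM j k]mxE -!mulrA Phi_fhat.
Qed.

Lemma nn_discr f : sqint f -> nn (discr f) ^+ 2 = \sum_j normc ((cellM *m Phi f) j ord0) ^+ 2.
Proof. by move=> Lf; rewrite nn_step; apply: eq_bigr => j _; rewrite discr_cellM. Qed.

Lemma Phi_discr f : sqint f -> Phi (discr f) = cellM *m Phi f.
Proof. by move=> Lf; apply/colP => j; rewrite Phi_step discr_cellM. Qed.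

Lemma dotp_abs_le (x y : rv) : `|dotp x y| <= enorm x * enorm y.
Proof.
rewrite ler_norml dotp_le andbT lerNl -(enormN x) (le_trans _ (dotp_le _ _))//.
by rewrite -mulN1r -dotpZl scaleN1r.
Qed.

Definition Fdiscr f (xi : T) : C := \sum_k fhat f k * expi (- dotp (p k) (xi : rv)).

Lemma cmeas_Fdiscr f : cmeas (Fdiscr f).
Proof.
apply: cmeas_sum => k; apply: cmeasM; first exact: cmeas_cst.
by apply: cmeas_expi; exact: (measurableT_comp (@oppr_measurable R _) (measurable_dotT_r (p k))).
Qed.

Lemma normc_FT f xi : sqint f -> normc (FT X f xi) ^+ 2 <= fine (leb_out X) * nn f ^+ 2.
Proof.
move=> Lf; have m1 := measurableT_comp (@oppr_measurable R _) (measurable_dotT (xi : rv)).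
apply: le_trans (normc_CI_expi mX fX Lf m1) _.
rewrite ler_wpM2l ?fine_ge0 ?leb_out_ge0// ler_pXn2r ?nnegrE ?nn_ge0//.
by have [] := sqint_indic mX Lf.
Qed.

(** Moving x to the point of its cell changes the phase by at most h CW, and the integral of |f|
    over X is at most sqrt|X| times its norm. *)
Lemma Fdiscr_near f xi : sqint f -> W xi ->
  normc (FT X f xi - Fdiscr f xi) <= 2 * h * CW * (Num.sqrt (fine (leb_out X)) * nn f).
Proof.
move=> Lf Wxi.
have m1 := measurableT_comp (@oppr_measurable R _) (measurable_dotT (xi : rv)).
have i1 := cintegrable_expi mX fX Lf m1.
have i2 k := CIZ (- expi (- dotp (p k) xi)) (cintegrable_cell k Lf).
have [i3 E3] := CI_sum (index_enum _) (fun k => (i2 k).1).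
have [i4 E4] := CID i1 i3.
have -> : FT X f xi - Fdiscr f xi = CI (fun x : T => \1_X (x : rv) * f x * expi (- dotp (x : rv) xi) +
    \sum_k - expi (- dotp (p k) xi) * (\1_(E k) (x : rv) * f x)).
  rewrite E4 E3 /Fdiscr -sumrN; congr (_ + _); apply: eq_bigr => k _.
  by rewrite (i2 k).2 mulNr mulrC.
apply: le_trans (normc_CI i4) _.
have [ih le] := sqint_cauchy_schwarz mX fX Lf.
have le2 : Rintegral mu setT (fun x : T => \1_X (x : rv) * normc (f x)) <= Num.sqrt (fine (leb_out X)) * nn f.
  rewrite -(ler_pXn2r (ltn0Sn 1)) ?nnegrE ?mulr_ge0 ?sqrtr_ge0 ?nn_ge0//; last first.
    by apply: Rintegral_ge0 => x _; rewrite mulr_ge0 ?normc_ge0// indicE.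
  apply: le_trans le _; rewrite exprMn [Num.sqrt (fine (leb_out X)) ^+ 2]sqr_sqrtr ?fine_ge0 ?leb_out_ge0//.
  rewrite ler_wpM2l ?fine_ge0 ?leb_out_ge0// ler_pXn2r ?nnegrE ?nn_ge0//.
  by have [] := sqint_indic mX Lf.
have c1 : 0 <= 2 * h * CW by rewrite !mulr_ge0.
apply: le_trans (ler_wpM2l c1 le2); rewrite -RintegralZl//.
apply: le_Rintegral => //; first exact: integrable_normc.
  by rewrite (_ : _ \o _ = (fun x => (2 * h * CW)%:E * (fun x : T => (\1_X (x : rv) * normc (f x))%:E) x)%E)//; exact: integrableZl.
move=> x _ /=.
have [Xx|Xx] := pselect (X x); last first.
  rewrite big1 => [|k _]; last by rewrite indicE memNset ?mul0r ?mulr0// => Ek; apply: Xx; apply/covE; exists k.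
  by rewrite !indicE memNset// !mul0r addr0 mulr0 normc0.
have [j Ej] := (covE x).1 Xx.
have -> : \sum_k - expi (- dotp (p k) xi) * (\1_(E k) (x : rv) * f x) = - expi (- dotp (p j) xi) * f x.
  under eq_bigr do rewrite mulrCA mulrC.
  exact: (sum_cell (fun k => - expi (- dotp (p k) xi) * f x) Ej).
rewrite !indicE mem_set// !mul1r [f x * _]mulrC -mulrDl normcM ler_wpM2r ?normc_ge0//.
apply: le_trans (normc_expiB _ _) _; rewrite -mulrA ler_wpM2l//.
rewrite (_ : _ - _ = - dotp ((x : rv) - p j) xi); last by rewrite dotpBl; ring.
rewrite normrN (le_trans (dotp_abs_le _ _))// ler_pM ?enorm_ge0//; [exact: closeE Ej|exact: boundW].
Qed.

Lemma discrE f j x : sqint f -> E j x ->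
  cintegrable (fun xi : T => \1_W (xi : rv) * (Fdiscr f xi * expi (dotp (p j) (xi : rv)))) /\
  discr f x = (c0%:C)%C * CI (fun xi : T => \1_W (xi : rv) * (Fdiscr f xi * expi (dotp (p j) (xi : rv)))).
Proof.
move=> Lf Ej.
have iW k : cintegrable (fun xi : T => \1_W (xi : rv) * expi (dotp (p j - p k) (xi : rv))).
  have [|x' _|//] := @normc_CI_le W (fun xi : T => expi (dotp (p j - p k) (xi : rv))) 1 mW fW _ ler01.
    by apply: cmeas_expi; exact: measurable_dotT_r.
  by rewrite normc_expi.
have iZ k := CIZ (fhat f k) (iW k).
have [iS ES] := CI_sum (index_enum _) (fun k => (iZ k).1).
have EI : (fun xi : T => \sum_k fhat f k * (\1_W (xi : rv) * expi (dotp (p j - p k) (xi : rv)))) =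
    (fun xi : T => \1_W (xi : rv) * (Fdiscr f xi * expi (dotp (p j) (xi : rv)))).
  apply/funext => xi; rewrite mulr_suml mulr_sumr; apply: eq_bigr => k _.
  by rewrite dotpBl addrC expiD; ring.
rewrite -EI; split; first exact: iS.
rewrite ES /discr /step (sum_cell _ Ej) mulr_sumr; apply: eq_bigr => k _.
by rewrite (iZ k).2 /kap mulrA mulrAC.
Qed.

(** Both variables of the kernel are frozen, each at the price 2 h CW sqrt|X| |f| for every xi in W.
    This gives a pointwise bound on X, whose norm contributes the second factor sqrt|X|. *)
Lemma Sop_discr f : sqint f ->
  nn (fun x => Sop X W f x - discr f x) <=
    4 * c0 * h * CW * fine (leb_out W) * fine (leb_out X) * nn f.
Proof.
move=> Lf; set wX := fine (leb_out X); set wW := fine (leb_out W).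
have wX0 : 0 <= wX by rewrite fine_ge0 ?leb_out_ge0.
have wW0 : 0 <= wW by rewrite fine_ge0 ?leb_out_ge0.
have c00 : 0 <= c0 by rewrite invr_ge0 exprn_ge0// mulr_ge0// pi_ge0.
pose B := Num.sqrt wX * nn f; have B0 : 0 <= B by rewrite mulr_ge0 ?sqrtr_ge0 ?nn_ge0.
pose b := c0 * (4 * h * CW * B * wW); have q0 : 0 <= 4 * h * CW * B by do 3![apply: mulr_ge0 => //].
have b0 : 0 <= b by do 2![apply: mulr_ge0 => //].
have [LF _] := FT_sqint mX fX Lf.
have FB xi : normc (FT X f xi) <= B.
  rewrite -(ler_pXn2r (ltn0Sn 1)) ?nnegrE ?normc_ge0// exprMn [Num.sqrt wX ^+ 2]sqr_sqrtr//.
  exact: normc_FT.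
have pt x : normc (Sop X W f x - discr f x) <= b * \1_X (x : rv).
  have [Xx|Xx] := pselect (X x); last first.
    by rewrite /Sop !indicE memNset// mul0r /discr /step sum_cell0// subr0 normc0 mulr0.
  have [j Ej] := (covE x).1 Xx; have [i6 ->] := discrE Lf Ej.
  have i5 := cintegrable_expi mW fW LF (measurable_dotT_r (x : rv)).
  have [i7 E7] := CIZ (-1) i6; have [i8 E8] := CID i5 i7.
  pose D (xi : T) : C := FT X f xi * expi (dotp (x : rv) (xi : rv)) - Fdiscr f xi * expi (dotp (p j) (xi : rv)).
  have ED : (fun xi : T => \1_W (xi : rv) * FT X f xi * expi (dotp (x : rv) (xi : rv)) +
      -1 * (\1_W (xi : rv) * (Fdiscr f xi * expi (dotp (p j) (xi : rv))))) = (fun xi : T => \1_W (xi : rv) * D xi).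
    by apply/funext => xi; rewrite /D; ring.
  have mD : cmeas D.
    have mN : cmeas (fun xi : T => -1 * (Fdiscr f xi * expi (dotp (p j) (xi : rv)))).
      apply: cmeasM; first exact: cmeas_cst.
      apply: cmeasM; first exact: cmeas_Fdiscr.
      by apply: cmeas_expi; exact: measurable_dotT_r.
    have mP : cmeas (fun xi : T => FT X f xi * expi (dotp (x : rv) (xi : rv))).
      by apply: cmeasM; [case: LF|apply: cmeas_expi; exact: measurable_dotT_r].
    rewrite (_ : D = (fun xi => FT X f xi * expi (dotp (x : rv) (xi : rv)) + -1 * (Fdiscr f xi * expi (dotp (p j) (xi : rv))))).
      exact: cmeasD.
    by apply/funext => xi; rewrite mulN1r.
  have DB xi : W xi -> normc (D xi) <= 4 * h * CW * B.
    move=> Wxi; rewrite (_ : D xi = (FT X f xi - Fdiscr f xi) * expi (dotp (p j) (xi : rv)) +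
      FT X f xi * (expi (dotp (x : rv) (xi : rv)) - expi (dotp (p j) (xi : rv)))); last by rewrite /D; ring.
    apply: le_trans (le_normcD _ _) _; rewrite !normcM normc_expi mulr1.
    have h1 := Fdiscr_near Lf Wxi.
    have h2 : normc (expi (dotp (x : rv) (xi : rv)) - expi (dotp (p j) (xi : rv))) <= 2 * (h * CW).
      apply: le_trans (normc_expiB _ _) _; rewrite ler_wpM2l// -dotpBl (le_trans (dotp_abs_le _ _))//.
      by rewrite ler_pM ?enorm_ge0//; [exact: closeE Ej|exact: boundW].
    have h3 := ler_pM (normc_ge0 _) (normc_ge0 _) (FB xi) h2.
    apply: le_trans (lerD h1 h3) _; rewrite -/B le_eqVlt; apply/orP; left; apply/eqP; ring.
  have [_ le] := normc_CI_le mW fW mD q0 DB.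
  rewrite /Sop !indicE mem_set// mul1r /iFT -mulrBr normcM normc_real (ger0_norm c00) mulr1.
  rewrite ler_wpM2l// -mulN1r -E7 -E8 ED; exact: le.
have [LS _] := Sop_sqint cX cW Lf.
have [LD _] := sqintB LS (sqint_step (fun j => \sum_k kap j k * fhat f k)).
have -> : 4 * c0 * h * CW * wW * wX * nn f = b * Num.sqrt wX.
  by rewrite /b /B -{1}[wX](sqr_sqrtr wX0); ring.
apply: nn_le; first by rewrite mulr_ge0 ?sqrtr_ge0.
have -> : ((b * Num.sqrt wX) ^+ 2)%:E = (\int[mu]_x ((b ^+ 2)%:E * (\1_X (x : rv))%:E))%E.
  rewrite ge0_integralZl//; last 2 first.
  - by apply/measurable_EFinP; exact: measurable_indic.
  - by rewrite lee_fin sqr_ge0.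
  rewrite integral_indic// setIT exprMn sqr_sqrtr// [LHS]EFinM /wX fineK//.
  by rewrite ge0_fin_numE ?leb_out_ge0// fX.
apply: ge0_le_integral; first exact: measurableT.
- by move=> x _; rewrite lee_fin sqr_ge0.
- by apply/measurable_EFinP; apply: measurable_normc2; case: LD.
- by apply/measurable_EFinP; apply: measurable_funM; [exact: measurable_cst|exact: measurable_indic].
- move=> x _; rewrite -EFinM lee_fin; apply: (@le_trans _ _ ((b * \1_X (x : rv)) ^+ 2)).
    by rewrite ler_pXn2r ?nnegrE ?normc_ge0 ?(le_trans (normc_ge0 _) (pt x)) ?pt.
  by rewrite exprMn indicE; case: (_ \in _); rewrite ?expr0n ?expr1n.
Qed.

End Approx.

End Cells.
End Discretization.

(** * The matrix of the discretized operator *)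

Section CellMatrix.
Context {R : realType} (n : nat).
Local Notation C := R[i].
Local Notation Re := (@complex.Re R).
Local Notation Im := (@complex.Im R).
Local Notation rv := 'rV[R]_n.+1.
Local Notation T := (@lebT R n).
Local Notation mu := (@leb R n).

Definition cvn L (v : 'cV[C]_L) : R := \sum_j normc (v j ord0) ^+ 2.

Definition setK (W : set rv) (z : rv) : C := CI (fun xi : T => \1_W (xi : rv) * expi (dotp z (xi : rv))).

Section SetKernel.
Variables (W : set rv) (CW : R).
Hypotheses (cW : compact W) (CW0 : 0 <= CW) (boundW : forall xi, W xi -> enorm xi <= CW).
Let mW : measurable (W : set T). Proof. exact: compact_leb_measurable. Qed.
Let fW := compact_leb_fin cW.
Local Notation wW := (fine (leb_out W)).
Let wW0 : 0 <= wW. Proof. by rewrite fine_ge0 ?leb_out_ge0. Qed.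

Lemma setK_int z : cintegrable (fun xi : T => \1_W (xi : rv) * expi (dotp z (xi : rv))) /\ normc (setK W z) <= wW.
Proof.
have mD : cmeas (fun xi : T => expi (dotp z (xi : rv))) by apply: cmeas_expi; exact: measurable_dotT_r.
have bD (x : T) : W x -> normc (expi (dotp z (x : rv))) <= 1 by rewrite normc_expi.
by have := normc_CI_le mW fW mD ler01 bD; rewrite mul1r.
Qed.

Lemma setK_lip z z' : normc (setK W z - setK W z') <= 2 * (enorm (z - z') * CW) * wW.
Proof.
have [iz _] := setK_int z; have [iz' _] := setK_int z'.
have [iN EN] := CIZ (-1) iz'; have [_ ED] := CID iz iN.
have -> : setK W z - setK W z' = CI (fun xi : T => \1_W (xi : rv) * (expi (dotp z (xi : rv)) - expi (dotp z' (xi : rv)))).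
  rewrite /setK -[X in _ - X]mul1r -mulNr -EN -ED; congr CI; apply/funext => xi; ring.
have q0 : 0 <= 2 * (enorm (z - z') * CW) by rewrite mulr_ge0// mulr_ge0// enorm_ge0.
have [|xi Wxi|//] := @normc_CI_le _ _ W (fun xi : T => expi (dotp z (xi : rv)) - expi (dotp z' (xi : rv))) _ mW fW _ q0.
  have m1 : cmeas (fun xi : T => expi (dotp z (xi : rv))) by apply: cmeas_expi; exact: measurable_dotT_r.
  have m2 : cmeas (fun xi : T => -1 * expi (dotp z' (xi : rv))).
    by apply: cmeasM; [exact: cmeas_cst|apply: cmeas_expi; exact: measurable_dotT_r].
  have := cmeasD m1 m2; rewrite (_ : (fun x => _) = (fun xi : T => expi (dotp z (xi : rv)) - expi (dotp z' (xi : rv))))//.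
  by apply/funext => xi; rewrite mulN1r.
apply: le_trans (normc_expiB _ _) _; rewrite ler_wpM2l// -dotpBl (le_trans (dotp_abs_le _ _))//.
by rewrite ler_wpM2l ?enorm_ge0// boundW.
Qed.

Lemma setK_sqr z : normc (setK W z) ^+ 2 = Fre (\1_W : rv -> R) (cst 0) z ^+ 2 + Fim (\1_W : rv -> R) (cst 0) z ^+ 2.
Proof.
rewrite normc_sqr /setK /CI /=; congr (_ ^+ 2 + _).
  apply: eq_Rintegral => x _; rewrite /fre /= mul0r addr0 cReM dotpC !indicE /=.
  by case: (_ \in _); rewrite /= ?mul0r ?mul1r ?subr0.
have E : Fim (\1_W : rv -> R) (cst 0) z = - Rintegral mu setT (Im \o (fun xi : T => \1_W (xi : rv) * expi (dotp z (xi : rv)))).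
  have [[_ i2] _] := setK_int z.
  rewrite -mulN1r -RintegralZl//; apply: eq_Rintegral => x _; rewrite /fim /= mul0r add0r cImM dotpC !indicE /=.
  by case: (_ \in _); rewrite /= ?mul0r ?mul1r ?addr0 ?mulN1r ?oppr0 ?mulr0.
by rewrite E sqrrN.
Qed.

Lemma setK_sqr_lip z z' : normc (setK W z) ^+ 2 <= normc (setK W z') ^+ 2 + 4 * enorm (z - z') * CW * wW ^+ 2.
Proof.
have [_ b1] := setK_int z; have [_ b2] := setK_int z'; have l := setK_lip z z'.
have t : normc (setK W z) <= normc (setK W z') + normc (setK W z - setK W z').
  by rewrite -{1}[setK W z](subrK (setK W z')) addrC le_normcD.
have := normc_ge0 (setK W z); have := normc_ge0 (setK W z'); move: b1 b2 l t.
set a := normc _; set b := normc (setK W z'); set d := normc (_ - _) => b1 b2 l t a0 b0.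
have d0 : 0 <= d by exact: normc_ge0.
have h1 : a ^+ 2 - b ^+ 2 <= d * (2 * wW).
  have [ab|ab] := leP a b.
    have ab2 : a ^+ 2 <= b ^+ 2 by rewrite ler_pXn2r ?nnegrE.
    have dw : 0 <= d * (2 * wW) by rewrite mulr_ge0// mulr_ge0.
    lra.
  rewrite subr_sqr; apply: ler_pM; rewrite ?subr_ge0 ?(ltW ab) ?addr_ge0//; lra.
have h2 : d * (2 * wW) <= 2 * (enorm (z - z') * CW) * wW * (2 * wW) by rewrite ler_wpM2r// mulr_ge0.
have -> : 4 * enorm (z - z') * CW * wW ^+ 2 = 2 * (enorm (z - z') * CW) * wW * (2 * wW) by ring.
lra.
Qed.
End SetKernel.

Section Cells2.
Variables (X W : set rv) (L : nat) (E : 'I_L -> set rv) (p : 'I_L -> rv).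
Hypotheses (cX : compact X) (cW : compact W).
Hypothesis mE : forall j, measurable (E j : set T).
Hypothesis disjE : forall x j k, E j x -> E k x -> j = k.
Hypothesis covE : forall x, X x <-> exists j, E j x.
Variables (h CW : R).
Hypotheses (h0 : 0 <= h) (CW0 : 0 <= CW).
Hypothesis closeE : forall x j, E j x -> enorm (x - p j) <= h.
Hypothesis boundW : forall xi, W xi -> enorm xi <= CW.

Let mX : measurable (X : set T). Proof. exact: compact_leb_measurable. Qed.
Let mW : measurable (W : set T). Proof. exact: compact_leb_measurable. Qed.
Let fX := compact_leb_fin cX.
Let fW := compact_leb_fin cW.
Let c0 : R := (2 * pi) ^- n.+1.
Let c00 : 0 <= c0. Proof. by rewrite invr_ge0 exprn_ge0// mulr_ge0// pi_ge0. Qed.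
Local Notation wW := (fine (leb_out W)).
Local Notation wX := (fine (leb_out X)).
Local Notation M := (cellM W E p).
Let wW0 : 0 <= wW. Proof. by rewrite fine_ge0 ?leb_out_ge0. Qed.
Let wX0 : 0 <= wX. Proof. by rewrite fine_ge0 ?leb_out_ge0. Qed.

Lemma cellME j k : M j k = ((Num.sqrt (cellm E j))%:C)%C * kap W p j k * ((Num.sqrt (cellm E k))%:C)%C.
Proof. by rewrite mxE. Qed.

Lemma kapE j k : kap W p j k = (c0%:C)%C * setK W (p j - p k). Proof. by []. Qed.

Lemma cellM_herm j k : M k j = conjc (M j k).
Proof.
have K : setK W (p k - p j) = conjc (setK W (p j - p k)).
  rewrite -CI_conj; last by have [] := setK_int cW (p j - p k).
  apply: eq_CI => xi; rewrite conjcM -expiN -[p k - p j]opprB -scaleN1r dotpZl mulN1r; congr (_ * _).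
  by rewrite indicE; case: (_ \in _); rewrite ?conjc1 ?conjc0.
by rewrite !cellME !kapE K !conjcM !conjc_real; ring.
Qed.

(** Up to a positive factor the quadratic form is the integral over W of the squared modulus of the
    exponential sum [G]. *)
Lemma cellM_psd (v : 'cV[C]_L) : 0 <= Re (\sum_j \sum_k conjc (v j ord0) * M j k * v k ord0).
Proof.
pose a j : C := ((Num.sqrt (cellm E j))%:C)%C * v j ord0.
pose G (xi : T) : C := \sum_k a k * expi (- dotp (p k) (xi : rv)).
pose F jk (xi : T) : C := conjc (a jk.1) * a jk.2 * (\1_W (xi : rv) * expi (dotp (p jk.1 - p jk.2) (xi : rv))).
have iF jk : cintegrable (F jk) /\ CI (F jk) = conjc (a jk.1) * a jk.2 * setK W (p jk.1 - p jk.2).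
  by apply: CIZ; have [] := setK_int cW (p jk.1 - p jk.2).
have [iS ES] := CI_sum (index_enum _) (fun jk => (iF jk).1).
have -> : \sum_j \sum_k conjc (v j ord0) * M j k * v k ord0 = (c0%:C)%C * CI (fun xi => \sum_jk F jk xi).
  rewrite ES mulr_sumr pair_bigA/=; apply: eq_bigr => jk _.
  by rewrite (iF jk).2 cellME kapE /a conjcM conjc_real; ring.
have FE xi : \sum_jk F jk xi = ((\1_W (xi : rv) * normc (G xi) ^+ 2)%:C)%C.
  rewrite rmorphM/= -mulc_conj.
  have -> : conjc (G xi) = \sum_j conjc (a j) * expi (dotp (p j) (xi : rv)).
    rewrite /G raddf_sum; apply: eq_bigr => j _; by rewrite [LHS]conjcM -expiN opprK.
  rewrite (_ : ((\1_W (xi : rv) : R)%:C)%C = \1_W (xi : rv)); last by rewrite !indicE; case: (_ \in _).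
  rewrite [G xi * _]mulrC big_distrlr/= pair_bigA/= mulr_sumr; apply: eq_bigr => -[j k] _ /=.
  by rewrite /F /= dotpBl expiD; ring.
rewrite cReM/= mul0r subr0 mulr_ge0//; apply: Rintegral_ge0 => xi _ /=.
by rewrite FE /= mulr_ge0 ?sqr_ge0// indicE.
Qed.

Lemma sum_cellm : \sum_j cellm E j = wX.
Proof.
have E1 := E2_step cX mE disjE covE (fun=> 1).
have EX : E2 (step E (fun=> 1)) = leb_out X.
  rewrite -[leb_out X](_ : \int[mu]_x (\1_X (x : rv))%:E = _)%E; last by rewrite integral_indic// setIT.
  apply: eq_integral => x _; rewrite /step; under eq_bigr do rewrite mul1r.
  by rewrite (sum_indic disjE covE) normc_indic !indicE; case: (_ \in _); rewrite ?expr1n ?expr0n.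
rewrite -EX E1 [RHS]/fine; apply: eq_bigr => j _; rewrite (_ : normc 1 = 1) ?expr1n ?mulr1//.
exact: normc1.
Qed.

Lemma cellM_trace : \sum_j M j j = ((c0 * wW * wX)%:C)%C.
Proof.
rewrite -sum_cellm mulr_sumr rmorph_sum/=; apply: eq_bigr => j _.
have K0 : setK W (p j - p j) = (wW%:C)%C.
  rewrite subrr /setK -(CI_set mW); apply: eq_CI => xi.
  by rewrite -(scale0r 0) dotpZl mul0r expi0 mulr1.
rewrite cellME mulrAC -rmorphM/= -expr2 sqr_sqrtr ?cellm_ge0// kapE K0 -!rmorphM/=.
by congr (_%:C)%C; ring.
Qed.

(** The bound is inherited rather than computed: on step functions the matrix acts as the
    discretized operator, which is within the error of the contraction [Sop]. *)
Lemma cellM_bound (v : 'cV[C]_L) : cvn (M *m v) <= (1 + 4 * c0 * h * CW * wW * wX) ^+ 2 * cvn v.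
Proof.
set e := 4 * c0 * h * CW * wW * wX.
have e0 : 0 <= e by rewrite /e; do 5![apply: mulr_ge0 => //].
have Lf := sqint_step cX mE disjE covE (fun j => (((Num.sqrt (cellm E j))^-1%:C)%C * v j ord0)).
rewrite -(cellM_iota W p cX mE disjE covE) /cvn -(nn_discr W p cX mE disjE covE)//.
apply: (@le_trans _ _ (((1 + e) * nn (iota_ E v)) ^+ 2)).
  rewrite ler_pXn2r ?nnegrE ?nn_ge0 ?mulr_ge0 ?addr_ge0 ?nn_ge0//.
  have [LS leS] := Sop_sqint cX cW Lf.
  have Ld := sqint_step cX mE disjE covE (fun j => \sum_k kap W p j k * fhat E (iota_ E v) k).
  have [LD _] := sqintB LS Ld.
  have [_] := sqintB LS LD; rewrite (_ : (fun x => _ - _) = discr W E p (iota_ E v)); last first.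
    by apply/funext => x; rewrite opprB addrC subrK.
  move=> /le_trans; apply; rewrite mulrDl mul1r; apply: lerD => //.
  exact: (Sop_discr cX cW mE disjE covE h0 CW0 closeE boundW Lf).
by rewrite exprMn ler_wpM2l ?sqr_ge0// (nn_iota cX mE disjE covE).
Qed.

Lemma cellM_frobenius :
  c0 ^+ 2 * fine (\int[@leb2 R n]_z (\1_X (z.1 : rv) * \1_X (z.2 : rv) * normc (setK W (z.1 - z.2 : rv)%R) ^+ 2)%:E)%E
    <= \sum_j \sum_k normc (M j k) ^+ 2 + c0 ^+ 2 * (8 * h * CW * wW ^+ 2 * wX ^+ 2).
Proof.
pose g (z : rv) := normc (setK W z) ^+ 2.
(* For two points in given cells, x - y differs from the difference of the cell points by at most 2
   h, which in the Lipschitz bound for the squared kernel gives 4 (2 h) CW |W|^2. *)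
pose D := 8 * h * CW * wW ^+ 2.
have D0 : 0 <= D by rewrite /D; do 3![apply: mulr_ge0 => //]; rewrite sqr_ge0.
have g0 z : 0 <= g z by rewrite sqr_ge0.
pose c jk := g (p jk.1 - p jk.2) + D; have c_ge0 jk : 0 <= c jk by rewrite addr_ge0.
have iE j : mu.-integrable setT (EFin \o (\1_(E j) : T -> R)) by apply: integrable_set => //; exact: fE cX covE j.
have m1 := measurableT_comp (@measurable_lebT_row R n) (@measurable_fst _ _ (@lebT R n) (@lebT R n)).
have m2 := measurableT_comp (@measurable_lebT_row R n) (@measurable_snd _ _ (@lebT R n) (@lebT R n)).
have mg : measurable_fun [set: rv] g.
  have ia : mu.-integrable setT (EFin \o (\1_W : T -> R)) by exact: integrable_set.
  have ib : mu.-integrable setT (EFin \o (cst 0 : T -> R)) by exact: integrable0.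
  by have := measurable_FreFim ia ib; congr measurable_fun; apply/funext => z; rewrite /g setK_sqr.
pose B (jk : 'I_L * 'I_L) (z : T * T) : R := \1_(E jk.1) (z.1 : rv) * \1_(E jk.2) (z.2 : rv).
have mB jk : measurable_fun setT (B jk).
  apply: measurable_funM; [exact: (measurableT_comp (measurable_indic (mE jk.1)) measurable_fst)|
    exact: (measurableT_comp (measurable_indic (mE jk.2)) measurable_snd)].
have B0 jk z : 0 <= B jk z by rewrite mulr_ge0// indicE.
have IB jk : (\int[@leb2 R n]_z (B jk z)%:E = (cellm E jk.1 * cellm E jk.2)%:E)%E.
  rewrite [LHS](Rintegral_prodM (iE jk.1) (iE jk.2)) /Rintegral.
  by rewrite !integral_indic ?setIT//; exact: mE.
have le : (\int[@leb2 R n]_z (\1_X (z.1 : rv) * \1_X (z.2 : rv) * g (z.1 - z.2 : rv)%R)%:E <=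
    (\sum_jk c jk * (cellm E jk.1 * cellm E jk.2))%:E)%E.
  have mBE jk : measurable_fun setT (fun z => (B jk z)%:E) by exact/measurable_EFinP.
  have -> : ((\sum_jk c jk * (cellm E jk.1 * cellm E jk.2))%:E = \int[@leb2 R n]_z (\sum_jk c jk * B jk z)%:E)%E.
    transitivity (\int[@leb2 R n]_z (\sum_jk (c jk)%:E * (B jk z)%:E))%E; last first.
      by apply: eq_integral => z _; rewrite -sumEFin; apply: eq_bigr => jk _; rewrite EFinM.
    rewrite ge0_integral_sum; [|exact: measurableT| |]; last 2 first.
    - by move=> jk; apply: emeasurable_funM; [exact: measurable_cst|exact: mBE].
    - by move=> jk z _; rewrite -EFinM lee_fin mulr_ge0.
    rewrite -sumEFin; apply: eq_bigr => jk _; rewrite ge0_integralZl; first by rewrite IB -EFinM.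
    - exact: measurableT.
    - exact: mBE.
    - by move=> z _; rewrite lee_fin.
    - by rewrite lee_fin.
  have mi : measurable_fun setT (\1_X : T -> R) by exact: measurable_indic.
  have iX0 (x : T) : 0 <= \1_X x :> R by rewrite indicE.
  apply: ge0_le_integral; first exact: measurableT.
  - by move=> z _; rewrite lee_fin mulr_ge0// mulr_ge0//; exact: iX0.
  - apply/measurable_EFinP; apply: measurable_funM; last exact: (measurableT_comp mg (measurable_row_sub m1 m2)).
    by apply: measurable_funM; [exact: (measurableT_comp mi measurable_fst)|exact: (measurableT_comp mi measurable_snd)].
  - apply/measurable_EFinP; apply: measurable_sum => jk.
    by apply: measurable_funM; [exact: measurable_cst|exact: mB].
  - move=> [x y] _ /=; rewrite lee_fin.
    have S0 : 0 <= \sum_jk c jk * B jk (x, y) by apply: sumr_ge0 => jk _; rewrite mulr_ge0.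
    have [Xx|Xx] := pselect (X x); last by rewrite indicE memNset// !mul0r.
    have [Xy|Xy] := pselect (X y); last by rewrite [\1_X y]indicE memNset// mulr0 mul0r.
    have [j Ej] := (covE x).1 Xx; have [k Ek] := (covE y).1 Xy.
    have -> : \sum_jk c jk * B jk (x, y) = c (j, k).
      rewrite -(pair_bigA _ (fun j k => c (j, k) * B (j, k) (x, y)))/=.
      under eq_bigr => j' _ do under eq_bigr => k' _ do rewrite /B /= [\1_(E j') x * _]mulrC mulrA.
      under eq_bigr => j' _ do rewrite -mulr_suml (sum_cell disjE (fun k' => c (j', k')) Ek).
      exact: (sum_cell disjE (fun j' => c (j', k)) Ej).
    rewrite !indicE !mem_set// !mul1r /c /=.
    have le := setK_sqr_lip cW CW0 boundW ((x : rv) - y) (p j - p k).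
    apply: le_trans le _; rewrite lerD2l /D.
    have d2 : enorm ((x : rv) - y - (p j - p k)) <= 2 * h.
      rewrite (_ : _ - _ = ((x : rv) - p j) + - ((y : rv) - p k)); last by apply/rowP => i; rewrite !mxE; ring.
      apply: le_trans (enormD _ _) _; rewrite enormN mulr_natl mulr2n.
      by apply: lerD; [exact: closeE Ej|exact: closeE Ek].
    rewrite ler_wpM2r ?sqr_ge0// ler_wpM2r//.
    by rewrite (_ : 8 * h = 4 * (2 * h)) ?ler_wpM2l//; ring.
have fin : (0 <= \int[@leb2 R n]_z (\1_X (z.1 : rv) * \1_X (z.2 : rv) * g (z.1 - z.2 : rv)%R)%:E)%E.
  by apply: integral_ge0 => z _; rewrite lee_fin mulr_ge0// mulr_ge0 ?indicE.
have le' : fine (\int[@leb2 R n]_z (\1_X (z.1 : rv) * \1_X (z.2 : rv) * g (z.1 - z.2 : rv)%R)%:E)%E <=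
    \sum_jk c jk * (cellm E jk.1 * cellm E jk.2).
  by rewrite -lee_fin fineK// ge0_fin_numE// (le_lt_trans le)// ltry.
apply: le_trans (ler_wpM2l (sqr_ge0 c0) le') _.
rewrite pair_bigA/= /c; under eq_bigr do rewrite mulrDl.
rewrite big_split/= mulrDr; apply: lerD; rewrite le_eqVlt; apply/orP; left; apply/eqP.
  rewrite mulr_sumr; apply: eq_bigr => -[j k] _ /=; rewrite cellME kapE !normcM !normc_real.
  rewrite (ger0_norm c00) (ger0_norm (sqrtr_ge0 (cellm E j))) (ger0_norm (sqrtr_ge0 (cellm E k))).
  move: (sqr_sqrtr (cellm_ge0 E j)) (sqr_sqrtr (cellm_ge0 E k)).
  by set sj := Num.sqrt (cellm E j); set sk := Num.sqrt (cellm E k) => <- <-; rewrite /g; ring.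
congr (_ * _); rewrite -mulr_sumr -/D; congr (_ * _).
rewrite expr2 -sum_cellm big_distrlr/= pair_bigA/=; exact: eq_bigr.
Qed.

End Cells2.
End CellMatrix.

(** * Eigenvalue counting *)

Section Spectral.
Context {R : realType}.
Local Notation C := R[i].
Local Notation Re := (@complex.Re R).
Local Notation Im := (@complex.Im R).

Lemma herm_spectral L (M : 'M[C]_L) : (forall j k, M k j = conjc (M j k)) ->
  exists (P Q : 'M[C]_L) (d : 'rV[C]_L),
    [/\ P *m Q = 1%:M, Q *m P = 1%:M, forall i j, Q i j = conjc (P j i) & M = Q *m diag_mx d *m P].
Proof.
move=> MH.
have nM : M \is normalmx.
  apply/normalmxP; congr (_ *m _); [|apply/esym]; apply/matrixP => i j; rewrite !mxE MH //.
exists (spectralmx M), (invmx (spectralmx M)), (spectral_diag M).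
have U := spectral_unitarymx M; have uP := spectral_unit M.
split; [exact: mulmxV|exact: mulVmx| |exact/orthomx_spectralP].
by move=> i j; rewrite invmx_unitary// !mxE.
Qed.

Lemma cvnE L (v : 'cV[C]_L) : ((cvn v)%:C)%C = \sum_j conjc (v j ord0) * v j ord0.
Proof. by rewrite rmorph_sum; apply: eq_bigr => j _; rewrite mulrC mulc_conj. Qed.

Lemma cvn_isometry L (P Q : 'M[C]_L) (v : 'cV[C]_L) : Q *m P = 1%:M -> (forall i j, Q i j = conjc (P j i)) ->
  cvn (P *m v) = cvn v.
Proof.
move=> QP QE; apply: (@complexI R); rewrite !cvnE.
have conj_sum (F : 'I_L -> C) : conjc (\sum_j F j) = \sum_j conjc (F j) by rewrite raddf_sum.
transitivity ((map_mx conjc v^T *m (Q *m P) *m v) ord0 ord0); last first.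
  by rewrite QP mulmx1 mxE; apply: eq_bigr => j _; rewrite !mxE.
rewrite mulmxA -mulmxA mxE; apply: eq_bigr => j _; congr (_ * _).
rewrite !mxE conj_sum; apply: eq_bigr => k _; rewrite !mxE conjcM QE mulrC.
by [].
Qed.

Section Herm.
Variables (L : nat) (M P Q : 'M[C]_L) (d : 'rV[C]_L).
Hypotheses (PQ : P *m Q = 1%:M) (QP : Q *m P = 1%:M) (QE : forall i j, Q i j = conjc (P j i)).
Hypothesis ME : M = Q *m diag_mx d *m P.

Lemma eigen_mul (v : 'cV[C]_L) i : (P *m (M *m v)) i ord0 = d ord0 i * (P *m v) i ord0.
Proof. by rewrite ME !mulmxA PQ mul1mx -mulmxA mul_diag_mx mxE. Qed.

(** A column of the unitary [Q], through which bounds on M and on its quadratic form pass to the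
    eigenvalue. *)
Lemma eigenvec i : exists v : 'cV[C]_L, [/\ cvn v = 1, cvn (M *m v) = normc (d ord0 i) ^+ 2 &
  \sum_j \sum_k conjc (v j ord0) * M j k * v k ord0 = d ord0 i].
Proof.
have [v Pv] : exists v : 'cV[C]_L, P *m v = delta_mx i ord0.
  by exists (Q *m delta_mx i ord0); rewrite mulmxA PQ mul1mx.
have PMv : P *m (M *m v) = d ord0 i *: delta_mx i ord0.
  apply/colP => j; rewrite eigen_mul Pv !mxE eqxx andbT; case: eqVneq => [->//|]; by rewrite !mulr0.
have cd (c : C) : cvn (c *: (delta_mx i ord0 : 'cV[C]_L)) = normc c ^+ 2.
  rewrite /cvn (bigD1 i)//= big1 ?addr0 => [|j ji]; rewrite !mxE.
    by rewrite !eqxx mulr1.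
  by rewrite (negPf ji) mulr0 normc0 expr0n.
exists v; split.
- by rewrite -(cvn_isometry v QP QE) Pv -[delta_mx _ _]scale1r cd (_ : normc 1 = 1) ?expr1n//; exact: normc1.
- by rewrite -(cvn_isometry (M *m v) QP QE) PMv cd.
- have -> : \sum_j \sum_k conjc (v j ord0) * M j k * v k ord0 = \sum_j conjc (v j ord0) * (M *m v) j ord0.
    by apply: eq_bigr => j _; rewrite [(M *m v) j ord0]mxE mulr_sumr; apply: eq_bigr => k _; rewrite mulrA.
  have Mv : M *m v = d ord0 i *: v by rewrite -[M *m v]mul1mx -QP -mulmxA PMv -scalemxAr -Pv mulmxA QP mul1mx.
  have : cvn v = 1 by rewrite -(cvn_isometry v QP QE) Pv -[delta_mx _ _]scale1r cd (_ : normc 1 = 1) ?expr1n//; exact: normc1.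
  move=> /(congr1 (fun x => (x%:C)%C)); rewrite cvnE => v1.
  rewrite Mv; under eq_bigr => j _ do rewrite [(_ *: v) j ord0]mxE mulrCA.
  by rewrite -mulr_sumr v1 mulr1.
Qed.

Lemma mxtrace_similar (A : 'M[C]_L) : \tr (Q *m A *m P) = \tr A.
Proof. by rewrite mxtrace_mulC mulmxA PQ mul1mx. Qed.

Lemma eigen_trace : \sum_j M j j = \sum_i d ord0 i.
Proof.
rewrite -[LHS]/(\tr M) ME mxtrace_similar.
by apply: eq_bigr => i _; rewrite mxE eqxx.
Qed.

Lemma eigen_frobenius : (forall j k, M k j = conjc (M j k)) ->
  ((\sum_j \sum_k normc (M j k) ^+ 2)%:C)%C = \sum_i d ord0 i ^+ 2.
Proof.
move=> MH.
transitivity (\tr (M *m M)).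
  rewrite rmorph_sum; apply: eq_bigr => j _; rewrite mxE rmorph_sum; apply: eq_bigr => k _.
  by rewrite [M k j]MH mulc_conj.
have -> : M *m M = Q *m (diag_mx d *m diag_mx d) *m P.
  by rewrite ME !mulmxA -[Q *m _ *m P *m Q]mulmxA PQ mulmx1.
rewrite mxtrace_similar mulmx_diag.
by apply: eq_bigr => i _; rewrite !mxE eqxx expr2.
Qed.
End Herm.

Lemma le_of_lt_gap (e s l : R) : 0 <= e -> s < 1 -> l <= 1 - s -> s <= 1 + e - l.
Proof. by move=> *; lra. Qed.

Section Counting.
Variables (I : finType) (lam : I -> R) (e s : R).
Hypotheses (e0 : 0 <= e) (s0 : 0 < s) (s1 : s < 1).
Hypotheses (lam0 : forall i, 0 <= lam i) (lame : forall i, lam i <= 1 + e).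
(** A sum of nonnegative terms lam (1 + e - lam), each at least s lam when lam <= 1 - s and at least
    s^2 when lam lies between s and 1 - s. A small [D] thus forbids both lost trace and intermediate
    eigenvalues. *)
Let D : R := (1 + e) * (\sum_i lam i) - \sum_i lam i ^+ 2.

Let DE : D = \sum_i lam i * (1 + e - lam i).
Proof. by rewrite /D mulr_sumr -sumrB; apply: eq_bigr => i _; ring. Qed.

Lemma count_large : \sum_i lam i - D / s <= (1 + e) * #|[pred i | 1 - s < lam i]|%:R.
Proof.
rewrite -sum1_card natr_sum mulr_sumr [X in _ <= X]big_mkcond/= DE mulr_suml -sumrB.
apply: ler_sum => i _; rewrite inE; move: (lame i) (lam0 i); move: (lam i) => l l1 l0.
case: ifPn => [_|]; last rewrite -leNgt => ls.
  by rewrite mulr1 lerBlDr (le_trans l1)// lerDl divr_ge0 ?(ltW s0)// mulr_ge0// subr_ge0.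
rewrite subr_le0 -{1}[l]mulr1 -mulrA ler_wpM2l// ler_pdivlMr// mul1r; exact: (le_of_lt_gap e0 s1 ls).
Qed.

(** Eigenvalues from 1 - s on are counted by the trace, those between s and 1 - s by the defect. *)
Lemma count_small : #|[pred i | s < lam i]|%:R <= (\sum_i lam i) / (1 - s) + D / s ^+ 2.
Proof.
rewrite -sum1_card natr_sum big_mkcond/= DE !mulr_suml -big_split/=.
have s1' : 0 < 1 - s by rewrite subr_gt0.
apply: ler_sum => i _; rewrite inE; move: (lame i) (lam0 i); move: (lam i) => l l1 l0.
have p1 : 0 <= l / (1 - s) by rewrite divr_ge0// ltW.
have p2 : 0 <= l * (1 + e - l) / s ^+ 2 by rewrite divr_ge0 ?sqr_ge0// mulr_ge0// subr_ge0.
case: ifPn => [sl|_]; last by rewrite addr_ge0.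
have [ls|ls] := leP (1 - s) l.
  by rewrite ler_wpDr// ler_pdivlMr// mul1r.
rewrite ler_wpDl// ler_pdivlMr ?exprn_gt0// mul1r expr2; apply: (ler_pM (ltW s0) (ltW s0) (ltW sl)); exact: (le_of_lt_gap e0 s1 (ltW ls)).
Qed.
End Counting.

(** * Real coordinates for the kept eigenvalues *)

Section Coordinates.
Local Close Scope classical_set_scope.
Local Open Scope set_scope.
Variables (L m : nat) (B : {set 'I_L}).
Hypothesis Bm : (#|B| <= m.+1)%N.

Definition pos (i : 'I_L) : 'I_m.+1 := inord (index i (enum B)).

Lemma pos_inj : {in B &, injective pos}.
Proof.
move=> i j iB jB /(congr1 (@nat_of_ord _)); rewrite !inordK; last 2 first.
- by apply: leq_trans Bm; rewrite cardE index_mem mem_enum.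
- by apply: leq_trans Bm; rewrite cardE index_mem mem_enum.
move=> ij; have iB' : i \in enum B by rewrite mem_enum.
have jB' : j \in enum B by rewrite mem_enum.
by rewrite -(nth_index i iB') ij nth_index.
Qed.

(** The fibres of [pos] in B have at most one element, so each sum is a single coordinate, or 0 at
    the positions left over when B has fewer than m + 1 elements. *)
Definition mkrow (w : 'I_L -> C) : 'rV[R]_(m.+1 + m.+1) :=
  row_mx (\row_a Re (\sum_(i in B | pos i == a) w i)) (\row_a Im (\sum_(i in B | pos i == a) w i)).

Definition crd (x : 'rV[R]_(m.+1 + m.+1)) (i : 'I_L) : C :=
  Complex (x ord0 (lshift m.+1 (pos i))) (x ord0 (rshift m.+1 (pos i))).

Lemma enorm_split (x : 'rV[R]_(m.+1 + m.+1)) :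
  enorm x ^+ 2 = \sum_a (x ord0 (lshift m.+1 a) ^+ 2 + x ord0 (rshift m.+1 a) ^+ 2).
Proof.
rewrite enorm_sqr /dotp big_split_ord/= big_split/=; congr (_ + _);
  by apply: eq_bigr => a _; rewrite expr2.
Qed.

Lemma fiber1 (i : 'I_L) (V : nmodType) (w : 'I_L -> V) : i \in B -> \sum_(j in B | pos j == pos i) w j = w i.
Proof.
move=> iB; rewrite (bigD1 i) ?iB ?eqxx//= big1 ?addr0// => j /andP[/andP[jB /eqP ji]].
by rewrite (pos_inj jB iB ji) eqxx.
Qed.

Lemma sum_pos (V : nmodType) (f : 'I_m.+1 -> V) : \sum_(i in B) f (pos i) = \sum_(a in [set pos i | i in B]) f a.
Proof. by rewrite big_imset//=; exact: pos_inj. Qed.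

Lemma crd_le x : \sum_(i in B) normc (crd x i) ^+ 2 <= enorm x ^+ 2.
Proof.
under eq_bigr do rewrite normc_sqr /crd/=.
rewrite (sum_pos (fun a => x ord0 (lshift m.+1 a) ^+ 2 + x ord0 (rshift m.+1 a) ^+ 2)) enorm_split.
rewrite [leRHS](bigID (mem [set pos i | i in B]))/= lerDl.
by apply: sumr_ge0 => a _; rewrite addr_ge0 ?sqr_ge0.
Qed.

Lemma crd_mkrow w i : i \in B -> crd (mkrow w) i = w i.
Proof.
move=> iB; rewrite /crd /mkrow row_mxEl row_mxEr !mxE fiber1//; by case: (w i).
Qed.

Lemma crdB x y i : crd (x - y) i = crd x i - crd y i.
Proof. by rewrite /crd !mxE; apply/eqP; rewrite eq_complex cReD cImD/= !eqxx. Qed.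

Lemma enorm_mkrow w : enorm (mkrow w) ^+ 2 = \sum_(i in B) normc (w i) ^+ 2.
Proof.
rewrite enorm_split (bigID (mem [set pos i | i in B]))/= [X in _ + X]big1 ?addr0; last first.
  move=> a aB; rewrite /mkrow row_mxEl row_mxEr !mxE big1 ?expr0n ?addr0// => i /andP[iB /eqP pia].
  by move: aB; rewrite -pia imset_f.
rewrite -(sum_pos (fun a => mkrow w ord0 (lshift m.+1 a) ^+ 2 + mkrow w ord0 (rshift m.+1 a) ^+ 2)).
by apply: eq_bigr => i iB; rewrite /mkrow row_mxEl row_mxEr !mxE fiber1// normc_sqr.
Qed.

Lemma mkrow_crd x : #|B| = m.+1 -> mkrow (crd x) = x.
Proof.
move=> Bcard; have all_pos a : a \in [set pos i | i in B].
  have /eqP -> : [set pos i | i in B] == [set: 'I_m.+1].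
    by rewrite eqEcard finset.subsetT cardsT card_ord card_in_imset ?Bcard ?leqnn//; exact: pos_inj.
  by rewrite finset.in_setT.
apply/rowP => k; rewrite -(splitK k) /unsplit; case: (fintype.split k) => a; rewrite /mkrow ?row_mxEl ?row_mxEr !mxE.
  by have /imsetP[i iB ->] := all_pos a; rewrite fiber1.
by have /imsetP[i iB ->] := all_pos a; rewrite fiber1.
Qed.

Lemma mkrowB w v : mkrow (fun i => w i - v i) = mkrow w - mkrow v.
Proof.
apply/rowP => k; rewrite -(splitK k) /unsplit; case: (fintype.split k) => a;
  rewrite [RHS]mxE [X in _ + X]mxE /mkrow.
  by rewrite !row_mxEl !mxE sumrB cReD cReN.
by rewrite !row_mxEr !mxE sumrB cImD cImN.
Qed.
End Coordinates.

End Spectral.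

(** * Covering numbers of the operator *)

Section CellCovering.
Context {R : realType} (n : nat).
Local Notation C := R[i].
Local Notation Re := (@complex.Re R).
Local Notation rv := 'rV[R]_n.+1.
Local Notation T := (@lebT R n).
Implicit Types f g : T -> C.

Lemma compact_cells (X : set rv) (h : R) : compact X -> 0 < h ->
  exists L (E : 'I_L -> set rv) (p : 'I_L -> rv),
    [/\ forall j, measurable (E j : set T), forall x j k, E j x -> E k x -> j = k,
        forall x, X x <-> exists j, E j x & forall x j, E j x -> enorm (x - p j) <= h].
Proof.
move=> cX h0; have [N XN] := compact_cube cX.
pose K : R := n.+1%:R * N%:R + 1.
have K0 : 0 < K by rewrite ltr_wpDl// mulr_ge0.
have [s [_ _ sP]] := @ball_net R n.+1 (h / K) (divr_gt0 h0 K0).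
pose p (j : 'I_(size s)) : rv := K *: nth 0 s j.
pose Q j : set rv := X `&` eball (p j) h.
(* A cell is what a ball adds to those of smaller index; it may be empty or null. *)
pose E (j : 'I_(size s)) : set rv := Q j `\` \bigcup_(k in [set k : 'I_(size s) | (k < j)%N]) Q k.
have mQ j : measurable (Q j) by apply: measurableI; [exact: compact_row_measurable|exact: measurable_eball].
exists (size s), E, p; split.
- by move=> j; apply: measurable_row_leb; apply: measurableD => //; apply: fin_bigcup_measurable.
- move=> x j k [Qj nj] [Qk nk]; apply/val_inj/eqP; rewrite eqn_leq; apply/andP; split; rewrite leqNgt; apply/negP => lt.
    by apply: nj; exists k.
  by apply: nk; exists j.
- move=> x; split => [Xx|[j [[]]]//].
  have xK : enorm (K^-1 *: x) <= 1.
    rewrite enormZ gtr0_norm ?invr_gt0// mulrC ler_pdivrMr// mul1r.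
    apply: le_trans (@enorm_box _ _ x N%:R _ _) _; [by []| |by rewrite lerDl].
    by move=> k; rewrite ler_norml; exact: XN.
  have [z zs xz] := sP _ xK.
  have zi : (index z s < size s)%N by rewrite index_mem.
  have Qz : Q (Ordinal zi) x.
    split => //; rewrite /eball /= /p /= nth_index//.
    have -> : x - K *: z = K *: (K^-1 *: x - z) by rewrite scalerBr scalerA mulfV ?gt_eqF// scale1r.
    by rewrite enormZ gtr0_norm// mulrC -ler_pdivlMr.
  pose P : pred 'I_(size s) := fun j => `[< Q j x >].
  have Pz : P (Ordinal zi) by exact/asboolP.
  case: (@arg_minnP _ (Ordinal zi) P (@nat_of_ord _) Pz) => j /asboolP Qj jmin.
  exists j; split => // -[k /= kj Qk].
  by have := jmin k (introT (asboolP _) Qk); rewrite leqNgt kj.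
- by move=> x j [[]].
Qed.

Section Covering.
Variables (r : R) (Om X W : set rv) (L : nat) (E : 'I_L -> set rv) (p : 'I_L -> rv).
Hypotheses (cX : compact X) (cW : compact W) (XE : X = scale_set r Om).
Hypothesis mE : forall j, measurable (E j : set T).
Hypothesis disjE : forall x j k, E j x -> E k x -> j = k.
Hypothesis covE : forall x, X x <-> exists j, E j x.
Variables (h CW : R).
Hypotheses (h0 : 0 <= h) (CW0 : 0 <= CW).
Hypothesis closeE : forall x j, E j x -> enorm (x - p j) <= h.
Hypothesis boundW : forall xi, W xi -> enorm xi <= CW.
Local Notation M := (cellM W E p).
Local Notation e := (4 * (2 * pi) ^- n.+1 * h * CW * fine (leb_out W) * fine (leb_out X)).
Local Notation A := (P_LPS r Om W).
Let e_ge0 : 0 <= e.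
Proof. by rewrite !mulr_ge0 ?fine_ge0 ?leb_out_ge0 ?invr_ge0 ?exprn_ge0 ?mulr_ge0 ?pi_ge0. Qed.

Lemma sqint_discr f : sqint (discr W E p f).
Proof. exact: (sqint_step cX mE disjE covE). Qed.

Lemma sqint_iota a : sqint (iota_ E a).
Proof. exact: (sqint_step cX mE disjE covE). Qed.

Lemma P_LPS_discr f : sqint f -> nn (fun x => A f x - discr W E p f x) <= e * nn f.
Proof.
move=> Lf; have [LA A0] := P_LPS_Sop cX cW XE Lf; have [LS _] := Sop_sqint cX cW Lf.
apply: le_trans (nn_sub LA LS (sqint_discr f)) _; rewrite nn_distC A0 add0r.
exact: (Sop_discr cX cW mE disjE covE h0 CW0 closeE boundW Lf).
Qed.

(** Only an inequality, since entries of [a] at null cells do not contribute to the function. *)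
Lemma nn_discr_iota f a : sqint f ->
  nn (fun x => discr W E p f x - iota_ E a x) ^+ 2 <= cvn (M *m Phi E f - a).
Proof.
move=> Lf.
have -> : (fun x => discr W E p f x - iota_ E a x) = step E (fun j =>
    \sum_k kap W p j k * fhat E f k - ((Num.sqrt (cellm E j))^-1%:C)%C * a j ord0).
  by apply/funext => x; rewrite /discr /iota_ /step -sumrB; apply: eq_bigr => j _; rewrite mulrBl.
rewrite (nn_step cX mE disjE covE); apply: ler_sum => j _.
rewrite mulrBr (discr_cellM W p cX mE covE j Lf) [in leRHS]mxE [X in _ <= normc (_ + X) ^+ 2]mxE mulrA.
have [m0|m0] := eqVneq (Num.sqrt (cellm E j)) 0.
  rewrite -(discr_cellM W p cX mE covE j Lf) m0 !mul0r subr0 normc0 expr0n; exact: sqr_ge0.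
by rewrite -rmorphM/= divff// mul1r.
Qed.

Lemma image_ball_closure_P_LPS f : sqint f -> nn f <= 1 -> image_ball_closure A (A f).
Proof.
move=> Lf f1; have [LA _] := P_LPS_Sop cX cW XE Lf.
split=> [|u u0]; first exact/L2P.
exists f; split; [exact/L2P|by rewrite l2normE// lee_fin|].
rewrite l2norm_sub// lte_fin (_ : (fun x => _) = (fun x : T => 0 : C)); last by apply/funext => x; rewrite subrr.
rewrite (_ : nn _ = 0)//; apply/eqP; rewrite eq_le nn_ge0 andbT.
by apply: nn_le => //; rewrite /E2 integral0_eq// => x _; rewrite normc0 expr0n.
Qed.

Section Spectrum.
Variables (P Q : 'M[C]_L) (lam : 'I_L -> R).
Hypotheses (PQ : P *m Q = 1%:M) (QP : Q *m P = 1%:M) (QE : forall i j, Q i j = conjc (P j i)).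
Hypothesis lamE : forall (v : 'cV[C]_L) i, (P *m (M *m v)) i ord0 = ((lam i)%:C)%C * (P *m v) i ord0.
Hypotheses (lam0 : forall i, 0 <= lam i) (lam1 : forall i, lam i <= 1 + e).

Let PE i j : P i j = conjc (Q j i). Proof. by rewrite QE; case: (P i j) => x y; rewrite /= opprK. Qed.

(** A point of the ball of radius 1 - s in the kept eigencoordinates, divided by the eigenvalues,
    stays in the unit ball, hence is an image up to the error e. Projecting the centres to these
    coordinates does not increase distances, so they cover that ball with radius eps + e. *)
Lemma covering_lower (eps s : R) N (c : 'I_N -> T -> C) : 0 < eps -> 0 < s < 1 ->
  (forall k, sqint (c k)) ->
  (forall g, image_ball_closure A g -> exists k, (l2norm ((g : rv -> C) \- c k)%R <= eps%:E)%E) ->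
  (1 - s) ^+ (2 * #|[pred i | 1 - s < lam i]|) <= N%:R * (eps + e) ^+ (2 * #|[pred i | (1 - s < lam i)%R]|).
Proof.
move=> eps0 /andP[s0 s1] Lc cov.
pose B := finset (fun i : 'I_L => 1 - s < lam i).
have BE : #|[pred i | 1 - s < lam i]| = #|B| by apply: eq_card => i; rewrite !inE.
have s1' : 0 < 1 - s by rewrite subr_gt0.
(* The volume comparison needs positive dimension. Without kept eigenvalues the claim is N >= 1,
   which holds because the image is not empty. *)
rewrite BE; case Bm : #|B| => [|m].
  rewrite muln0 !expr0 mulr1 ler1n.
  have L0 : sqint (iota_ E 0) by exact: sqint_iota.
  have n0 : nn (iota_ E 0) <= 1.
    rewrite -(@ler_pXn2r _ 2)// ?nnegrE ?nn_ge0// expr1n.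
    apply: le_trans (nn_iota cX mE disjE covE 0) _.
    by rewrite big1 ?ler01// => j _; rewrite mxE normc0 expr0n.
  by have [k _] := cov _ (image_ball_closure_P_LPS L0 n0); case: N k {c Lc cov} => // -[].
have Bm' : (#|B| <= m.+1)%N by rewrite Bm.
rewrite mul2n -addnn addSn.
apply: (@cover_ball_lower R (m + m.+1) N (fun k => @mkrow R L m B (fun i => (P *m Phi E (c k)) i ord0))) => //.
  by rewrite ltr_wpDr.
move=> x xs.
pose a : 'cV[C]_L := \col_i (if i \in B then ((lam i)^-1%:C)%C * crd B x i else 0).
have laB i : i \in B -> 1 - s < lam i by rewrite inE.
have la0 i : i \in B -> 0 < lam i by move=> /laB; exact: lt_trans.
have a1 : cvn a <= 1.
  apply: (@le_trans _ _ (\sum_(i in B) (1 - s) ^- 2 * normc (crd B x i) ^+ 2)).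
    rewrite /cvn [leRHS]big_mkcond/=; apply: ler_sum => i _; rewrite mxE; case: ifPn => [iB|_]; last by rewrite normc0 expr0n.
    rewrite normcM normc_real exprMn ler_wpM2r ?sqr_ge0// ger0_norm ?invr_ge0// exprVn lef_pV2 ?posrE ?exprn_gt0 ?la0//.
    by rewrite ler_pXn2r ?nnegrE ?(ltW s1') ?lam0// ltW ?laB.
  rewrite -mulr_sumr mulrC ler_pdivrMr ?exprn_gt0// mul1r.
  apply: le_trans (crd_le Bm' x) _.
  by rewrite ler_pXn2r ?nnegrE ?enorm_ge0// ltW.
pose f := iota_ E (Q *m a); have Lf : sqint f by exact: sqint_iota.
have f1 : nn f <= 1.
  rewrite -(@ler_pXn2r _ 2)// ?nnegrE ?nn_ge0// expr1n.
  apply: le_trans (nn_iota cX mE disjE covE _) _.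
  by rewrite -/(cvn _) (cvn_isometry _ PQ PE).
have [LA _] := P_LPS_Sop cX cW XE Lf.
have [k] := cov _ (image_ball_closure_P_LPS Lf f1); rewrite l2norm_sub// lee_fin => gk.
exists k.
have Ld := sqint_discr f.
have [Ldk _] := sqintB Ld (Lc k).
have dk : nn (fun x => discr W E p f x - c k x) <= eps + e.
  apply: le_trans (nn_sub Ld LA (Lc k)) _; rewrite addrC; apply: lerD; first exact: gk.
  rewrite nn_distC; apply: le_trans (P_LPS_discr Lf) _; exact: ler_piMr.
pose u := P *m Phi E (fun x => discr W E p f x - c k x).
have uE i : i \in B -> u i ord0 = crd B x i - (P *m Phi E (c k)) i ord0.
  move=> iB; rewrite /u (PhiB cX mE covE Ld (Lc k)) mulmxBr mxE [X in _ + X]mxE.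
  rewrite (Phi_discr W p cX mE disjE covE Lf) (cellM_iota W p cX mE disjE covE) lamE mulmxA PQ mul1mx mxE iB.
  by rewrite mulrA -rmorphM/= divff ?mul1r// gt_eqF ?la0.
have -> : x - @mkrow R L m B (fun i => (P *m Phi E (c k)) i ord0) =
    @mkrow R L m B (fun i => crd B x i - (P *m Phi E (c k)) i ord0).
  by rewrite mkrowB mkrow_crd.
rewrite -(@ler_pXn2r _ 2)// ?nnegrE ?enorm_ge0 ?addr_ge0// ?(ltW eps0)// enorm_mkrow//.
apply: (@le_trans _ _ (cvn u)).
  rewrite [leRHS](bigID (mem B))/= ler_wpDr//; first by apply: sumr_ge0 => *; exact: sqr_ge0.
  by apply: ler_sum => i iB; rewrite uE.
rewrite (cvn_isometry _ QP QE); apply: le_trans (Phi_le cX mE disjE covE Ldk) _.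
by rewrite ler_pXn2r ?nnegrE ?nn_ge0// addr_ge0// ltW.
Qed.

(** The budget for eps: the kept coordinates lie in a ball of radius 1 + e and are covered within (1
    + e) e0; the discarded ones have size at most s; e is the discretization error; s' is the
    distance from a point of the closure to an actual image. The dimension may exceed the number of
    kept eigenvalues. *)
Lemma covering_upper (eps s e0 s' : R) m (zs : seq 'rV[R]_(m.+1 + m.+1)) : 0 <= s -> 0 < s' -> 0 <= e0 ->
  (1 + e) * e0 + s + e + s' <= eps ->
  (#|[pred i | (s < lam i)%R]| <= m.+1)%N ->
  (forall x : 'rV[R]_(m.+1 + m.+1), enorm x <= 1 -> exists2 z, z \in zs & enorm (x - z) <= e0) ->
  exists c : 'I_(size zs) -> T -> C, (forall k, sqint (c k)) /\
    forall g, image_ball_closure A g -> exists k, (l2norm ((g : rv -> C) \- c k)%R <= eps%:E)%E.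
Proof.
move=> s0 s'0 e00 epsE.
pose B := finset (fun i : 'I_L => s < lam i).
have -> : #|[pred i | s < lam i]| = #|B| by apply: eq_card => i; rewrite !inE.
move=> Bm net.
have e1 : 0 < 1 + e by rewrite ltr_wpDr.
pose v (z : 'rV[R]_(m.+1 + m.+1)) : 'cV[C]_L := \col_i (if i \in B then ((1 + e)%:C)%C * crd B z i else 0).
exists (fun k => iota_ E (Q *m v (nth 0 zs k))); split=> [k|g [/L2P Lg gcl]]; first exact: sqint_iota.
have [f [/L2P Lf f1]] := gcl _ s'0.
have [LA _] := P_LPS_Sop cX cW XE Lf.
rewrite l2norm_sub// lte_fin => gA; move: f1; rewrite l2normE// lee_fin => f1.
pose w := P *m Phi E f.
have w1 : cvn w <= 1.
  rewrite /w (cvn_isometry _ QP QE); apply: le_trans (Phi_le cX mE disjE covE Lf) _.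
  by rewrite -(expr1n _ 2) ler_pXn2r ?nnegrE ?nn_ge0.
pose b i : C := ((lam i)%:C)%C * w i ord0.
pose x := @mkrow R L m B (fun i => (((1 + e)^-1)%:C)%C * b i).
have x1 : enorm x <= 1.
  rewrite -(@ler_pXn2r _ 2)// ?nnegrE ?enorm_ge0// enorm_mkrow// expr1n.
  apply: le_trans w1; rewrite /cvn [leLHS]big_mkcond/=; apply: ler_sum => i _; case: ifPn => _; last exact: sqr_ge0.
  rewrite /b mulrA -rmorphM/= normcM normc_real exprMn ler_piMl ?sqr_ge0//.
  apply: exprn_ile1; first exact: normr_ge0.
  rewrite ger0_norm; last by rewrite mulr_ge0// invr_ge0 ltW.
  by rewrite mulrC ler_pdivrMr// mul1r.
have [z zin xz] := net _ x1.
have zi : (index z zs < size zs)%N by rewrite index_mem.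
exists (Ordinal zi); rewrite /= nth_index//.
have Li := sqint_iota (Q *m v z); have Ld := sqint_discr f.
rewrite l2norm_sub// lee_fin; apply: le_trans (nn_sub Lg LA Li) _.
have di : nn (fun x => discr W E p f x - iota_ E (Q *m v z) x) <= (1 + e) * e0 + s.
  have q0 : 0 <= (1 + e) * e0 by rewrite mulr_ge0// ltW.
  rewrite -(@ler_pXn2r _ 2)// ?nnegrE ?nn_ge0 ?addr_ge0//.
  apply: le_trans (nn_discr_iota _ Lf) _; rewrite -(cvn_isometry _ QP QE) mulmxBr [P *m (Q *m _)]mulmxA PQ mul1mx.
  apply: (@le_trans _ _ (((1 + e) * e0) ^+ 2 + s ^+ 2)); last by rewrite sqrrD addrAC lerDl mulrn_wge0// mulr_ge0.
  rewrite /cvn (bigID (mem B))/=; apply: lerD.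
    apply: (@le_trans _ _ (\sum_(i in B) (1 + e) ^+ 2 * normc (crd B (x - z) i) ^+ 2)).
      apply: ler_sum => i iB; rewrite mxE lamE -/w [X in normc (_ + X)]mxE [X in - X]mxE iB.
      rewrite crdB /x (crd_mkrow Bm)// -exprMn -[X in (X * _) ^+ 2](ger0_norm (ltW e1)) -(normc_real (1 + e)) -normcM.
      by rewrite mulrBr mulrA -rmorphM/= divff ?gt_eqF// mul1r.
    rewrite -mulr_sumr [leRHS]exprMn ler_wpM2l ?sqr_ge0//; apply: le_trans (crd_le Bm _) _.
    by rewrite ler_pXn2r ?nnegrE ?enorm_ge0.
  apply: (@le_trans _ _ (\sum_(i | i \notin B) s ^+ 2 * normc (w i ord0) ^+ 2)).
    apply: ler_sum => i iB; rewrite mxE lamE -/w [X in normc (_ + X)]mxE [X in - X]mxE (negPf iB) subr0.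
    rewrite normcM normc_real exprMn ler_wpM2r ?sqr_ge0// ger0_norm// ler_pXn2r ?nnegrE//.
    by move: iB; rewrite inE -leNgt.
  rewrite -mulr_sumr ler_piMr ?sqr_ge0//; apply: le_trans w1.
  rewrite /cvn [leRHS](bigID (mem B))/= ler_wpDl// sumr_ge0// => *; exact: sqr_ge0.
have Ad : nn (fun x => A f x - discr W E p f x) <= e.
  apply: le_trans (P_LPS_discr Lf) _; exact: ler_piMr.
have t := nn_sub LA Ld Li.
apply: le_trans epsE; rewrite [leRHS]addrC; apply: lerD; first exact: ltW.
by rewrite [leRHS]addrC; apply: le_trans t _; exact: lerD.
Qed.
End Spectrum.

Lemma cell_spectrum : exists (P Q : 'M[C]_L) (lam : 'I_L -> R),
  [/\ [/\ P *m Q = 1%:M, Q *m P = 1%:M & forall i j, Q i j = conjc (P j i)],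
      forall (v : 'cV[C]_L) i, (P *m (M *m v)) i ord0 = ((lam i)%:C)%C * (P *m v) i ord0,
      forall i, 0 <= lam i <= 1 + e,
      \sum_i lam i = (2 * pi) ^- n.+1 * fine (leb_out W) * fine (leb_out X) &
      \sum_i lam i ^+ 2 = \sum_j \sum_k normc (M j k) ^+ 2].
Proof.
have MH := cellM_herm E p cW.
have [P [Q [d [PQ QP QE ME]]]] := herm_spectral MH.
(* The eigenvalue is a value of the quadratic form of a Hermitian matrix, hence equal to its
   conjugate. *)
have dE i : d ord0 i = ((Re (d ord0 i))%:C)%C.
  have [v [_ _ vE]] := eigenvec PQ QP QE ME i.
  have : conjc (d ord0 i) = d ord0 i.
    rewrite -{1}vE raddf_sum/=; under eq_bigr do rewrite raddf_sum/=.
    rewrite exchange_big/= -vE; apply: eq_bigr => k _; apply: eq_bigr => j _.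
    by rewrite !conjcM -MH conjcK; ring.
  by case: (d ord0 i) => a b /= [] /eqP; rewrite -subr_eq0 -opprD oppr_eq0 -mulr2n mulrn_eq0/= => /eqP ->.
exists P, Q, (fun i => Re (d ord0 i)); split.
- by split.
- by move=> v i; rewrite (eigen_mul PQ ME) -dE.
- move=> i; have [v [v1 Mv vE]] := eigenvec PQ QP QE ME i; apply/andP; split.
    by rewrite -vE; exact: cellM_psd.
  have := cellM_bound cX cW mE disjE covE h0 CW0 closeE boundW v.
  rewrite Mv v1 mulr1 dE normc_real ler_pXn2r ?nnegrE ?addr_ge0// => /(le_trans _); apply; exact: ler_norm.
- apply: (@complexI R); rewrite rmorph_sum/=; under eq_bigr do rewrite -dE.
  rewrite -(eigen_trace PQ ME); exact: cellM_trace.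
- apply: (@complexI R); rewrite (eigen_frobenius PQ ME MH) rmorph_sum; apply: eq_bigr => i _.
  by rewrite [in RHS]dE rmorphXn.
Qed.
End Covering.
End CellCovering.

(** * The energy of the kernel *)

Section KernelEnergy.
Context {R : realType} (n : nat).
Local Notation C := R[i].
Local Notation rv := 'rV[R]_n.+1.
Local Notation T := (@lebT R n).
Local Notation mu := (@leb R n).
Implicit Types (Om W X : set rv).

Lemma compact_scale_set r Om : compact Om -> compact (scale_set r Om).
Proof.
move=> cO; apply: continuous_compact => //.
by apply: continuous_subspaceT => x; exact: scaler_continuous.
Qed.

Lemma scale_setP r Om x : 0 < r -> scale_set r Om x <-> Om (r^-1 *: x).
Proof.
move=> r0; split=> [[y Oy <-]|Ox]; first by rewrite scalerA mulVf ?gt_eqF// scale1r.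
by exists (r^-1 *: x) => //; rewrite scalerA mulfV ?gt_eqF// scale1r.
Qed.

Section Kernel.
Variable W : set rv.
Hypothesis cW : compact W.
Local Notation wW := (fine (leb_out W)).
Local Notation g := (fun z : rv => normc (setK W z) ^+ 2).

Let mg : measurable_fun [set: rv] g.
Proof.
have ia : mu.-integrable setT (EFin \o (\1_W : T -> R)).
  by apply: integrable_set; [exact: compact_leb_measurable|exact: compact_leb_fin].
have ib : mu.-integrable setT (EFin \o (cst 0 : T -> R)) by exact: integrable0.
by have := measurable_FreFim ia ib; congr measurable_fun; apply/funext => z; rewrite setK_sqr.
Qed.

Let g_le z : g z <= wW ^+ 2.
Proof.
have [_ le] := setK_int cW z.
by rewrite ler_pXn2r ?nnegrE ?normc_ge0 ?fine_ge0 ?leb_out_ge0.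
Qed.

Let mgc N : measurable_fun setT (fun z : T => g (z : rv) * \1_(cube N) (z : rv)).
Proof.
apply: measurable_funM; first by apply: measurable_fun_lebT; exact: mg.
by apply: measurable_indic; exact: measurable_cubeT.
Qed.

Lemma kernel_mass_fin N : (\int[mu]_z (g (z : rv) * \1_(cube N) (z : rv))%:E < +oo)%E.
Proof.
apply: (@le_lt_trans _ _ (\int[mu]_z ((wW ^+ 2)%:E * (\1_(cube N) (z : rv))%:E))%E).
  apply: ge0_le_integral; first exact: measurableT.
  - by move=> z _; rewrite lee_fin mulr_ge0 ?sqr_ge0// indicE.
  - by apply/measurable_EFinP; exact: mgc.
  - by apply: emeasurable_funM; [exact: measurable_cst|apply/measurable_EFinP/measurable_indic; exact: measurable_cubeT].
  - by move=> z _; rewrite -EFinM lee_fin ler_wpM2r ?indicE//; exact: g_le.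
rewrite ge0_integralZl; first last.
- by rewrite lee_fin sqr_ge0.
- by move=> z _; rewrite lee_fin indicE.
- by apply/measurable_EFinP/measurable_indic; exact: measurable_cubeT.
- exact: measurableT.
rewrite integral_indic ?setIT//; last exact: measurable_cubeT.
by rewrite lte_mul_pinfty ?lee_fin ?sqr_ge0//; exact: leb_out_cube.
Qed.

Lemma kernel_mass d : 0 < d -> exists N,
  (((2 * pi) ^+ n.+1 * wW - d)%:E <= \int[mu]_z (g (z : rv) * \1_(cube N) (z : rv))%:E)%E.
Proof.
move=> d0; apply: contrapT => /forallNP H.
have mE : measurable_fun setT (fun z : T => (g (z : rv))%:E).
  by apply/measurable_EFinP; apply: measurable_fun_lebT; exact: mg.
have L : (\int[mu]_z (g (z : rv) * \1_(cube N) (z : rv))%:E)%E @[N --> \oo] --> (\int[mu]_z (g (z : rv))%:E)%E.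
  have -> : (\int[mu]_z (g (z : rv))%:E = \int[mu]_z limn (fun N => (g (z : rv) * \1_(cube N) (z : rv))%:E))%E.
    apply: eq_integral => z _; apply/esym/cvg_lim => //.
    have [N zN] : exists N, cube N (z : rv).
      have [N sub] := @compact_cube R n [set (z : rv)] (@compact_set1 _ _).
      by exists N; exact: sub.
    apply: cvg_near_cst; near=> k; rewrite indicE mem_set ?mulr1// => j.
    have Nk : (N <= k)%N by near: k; exact: nbhs_infty_ge.
    have /andP[h1 h2] := zN j.
    by rewrite (le_trans _ h1) ?lerN2 ?ler_nat// (le_trans h2)// ler_nat.
  apply: cvg_monotone_convergence; first exact: measurableT.
  - by move=> N; apply/measurable_EFinP; exact: mgc.
  - by move=> N z _; rewrite lee_fin mulr_ge0 ?sqr_ge0// indicE.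
  - move=> z _ i j ij; rewrite lee_fin ler_wpM2l ?sqr_ge0// !indicE.
    case: (boolP (_ \in cube i)) => [/set_mem zi|_]; last by rewrite ler0n.
    rewrite mem_set// => k; have /andP[h1 h2] := zi k.
    by rewrite (le_trans _ h1) ?lerN2 ?ler_nat// (le_trans h2)// ler_nat.
have : (\int[mu]_z (g (z : rv))%:E <= ((2 * pi) ^+ n.+1 * wW - d)%:E)%E.
  rewrite -(cvg_lim _ L)//; apply: lime_le; first by apply/cvg_ex; eexists; exact: L.
  by apply: nearW => N; rewrite leNgt; apply/negP => /ltW; exact: H.
have : (((2 * pi) ^+ n.+1)%:E * leb_out W <= \int[mu]_z (g (z : rv))%:E)%E.
  rewrite integral_lebB_ge0; last 2 first.
  - by apply/measurable_EFinP; exact: mg.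
  - by move=> z; rewrite lee_fin sqr_ge0.
  apply: le_trans (plancherel_set cW) _; rewrite le_eqVlt; apply/orP; left; apply/eqP.
  by apply: eq_integral => z _; rewrite setK_sqr.
move=> /le_trans h /h; rewrite -[leb_out W]fineK; last by rewrite ge0_fin_numE ?leb_out_ge0 ?compact_leb_fin.
by rewrite -EFinM lee_fin -subr_ge0 addrAC subrr add0r oppr_ge0 leNgt d0.
Unshelve. all: by end_near. Qed.

(** Nearly all the mass (2 pi)^m |W| of the squared kernel lies in a fixed cube. For z in it, the
    overlap of r Omega with its translate is r^m times that of Omega with its translate by z / r,
    close to r^m |Omega|. One factor (2 pi)^m cancels one of the two prefactors. *)
Lemma frobenius_lower Om (eta : R) : compact Om -> 0 < eta -> exists r0 : R, forall r, r0 <= r -> 0 < r ->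
  ((2 * pi) ^- n.+1 * wW * fine (leb_out Om) - eta) * r ^+ n.+1 <=
  ((2 * pi) ^- n.+1) ^+ 2 * fine (\int[@leb2 R n]_z
    (\1_(scale_set r Om) (z.1 : rv) * \1_(scale_set r Om) (z.2 : rv) * normc (setK W (z.1 - z.2 : rv)%R) ^+ 2)%:E)%E.
Proof.
move=> cO eta0; set c0 : R := (2 * pi) ^- n.+1; set wO := fine (leb_out Om).
have p0 : 0 < (2 * pi) ^+ n.+1 :> R by rewrite exprn_gt0// mulr_gt0// pi_gt0.
have c00 : 0 < c0 by rewrite invr_gt0.
have wO0 : 0 <= wO by rewrite fine_ge0 ?leb_out_ge0.
have wOE : leb_out Om = wO%:E by rewrite fineK// ge0_fin_numE ?leb_out_ge0 ?compact_leb_fin.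
(* [d1] and [d2] are the losses in kernel mass and in overlap; after multiplication by c0^2 and the
   other factor each costs at most eta / 2. The added 1 avoids a zero denominator. *)
pose d1 := eta / (2 * c0 ^+ 2 * (wO + 1)).
have d1_gt0 : 0 < d1 by rewrite divr_gt0// !mulr_gt0 ?exprn_gt0// ltr_wpDl.
have [N HN] := kernel_mass d1_gt0.
have GE := kernel_mass_fin N.
have G0 : (0 <= \int[mu]_z (g (z : rv) * \1_(cube N) (z : rv))%:E)%E.
  by apply: integral_ge0 => z _; rewrite lee_fin mulr_ge0 ?sqr_ge0// indicE.
pose G := fine (\int[mu]_z (g (z : rv) * \1_(cube N) (z : rv))%:E)%E.
have GE' : (\int[mu]_z (g (z : rv) * \1_(cube N) (z : rv))%:E = G%:E)%E by rewrite /G fineK// ge0_fin_numE.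
have G_ge0 : 0 <= G by rewrite fine_ge0.
rewrite GE' lee_fin in HN.
pose d2 := eta / (2 * c0 ^+ 2 * (G + 1)).
have d2_gt0 : 0 < d2 by rewrite divr_gt0// !mulr_gt0 ?exprn_gt0// ltr_wpDl.
have [q q0 Hq] := compact_overlap cO d2_gt0.
(* Beyond this r, a shift in the cube of half-side N has coordinates at most q after division by
   r. *)
exists (N%:R / q) => r rq r0.
set X := scale_set r Om; have cX : compact X by exact: compact_scale_set.
have mX := compact_row_measurable cX.
have rn0 : 0 < r ^+ n.+1 by rewrite exprn_gt0.
have ov z : leb_out (X `&` [set x | X (x + z)%R]) = ((r ^+ n.+1)%:E * leb_out (Om `&` [set x | Om (x + r^-1 *: z)%R]))%E.
  rewrite -leb_out_scale//; congr leb_out; apply/seteqP; split => x /=.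
    by move=> [/(scale_setP _ _ r0) h1 /(scale_setP _ _ r0) h2]; apply/(scale_setP _ _ r0); split; rewrite /= -?scalerDr.
  by move=> /(scale_setP _ _ r0)[h1 /= h2]; split; apply/(scale_setP _ _ r0); rewrite ?scalerDr.
have I_le : (\int[@leb2 R n]_z (\1_X (z.1 : rv) * \1_X (z.2 : rv) * g (z.1 - z.2 : rv)%R)%:E < +oo)%E.
  have iX : mu.-integrable setT (EFin \o (\1_X : T -> R)).
    by apply: integrable_set; [exact: compact_leb_measurable|exact: compact_leb_fin].
  have mi : measurable_fun setT (\1_X : T -> R) by apply: measurable_indic; exact: compact_leb_measurable.
  have mB : measurable_fun setT (fun z : T * T => \1_X (z.1 : rv) * \1_X (z.2 : rv) : R).
    apply: measurable_funM; [exact: (measurableT_comp mi measurable_fst)|exact: (measurableT_comp mi measurable_snd)].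
  have B0 (z : T * T) : 0 <= \1_X (z.1 : rv) * \1_X (z.2 : rv) :> R by rewrite mulr_ge0 ?indicE.
  have m1 := measurableT_comp (@measurable_lebT_row R n) (@measurable_fst _ _ (@lebT R n) (@lebT R n)).
  have m2 := measurableT_comp (@measurable_lebT_row R n) (@measurable_snd _ _ (@lebT R n) (@lebT R n)).
  apply: (@le_lt_trans _ _ (\int[@leb2 R n]_z ((wW ^+ 2)%:E * (\1_X (z.1 : rv) * \1_X (z.2 : rv))%:E))%E).
    apply: ge0_le_integral; first exact: measurableT.
    - by move=> z _; rewrite lee_fin mulr_ge0 ?B0 ?sqr_ge0.
    - by apply/measurable_EFinP; apply: (measurable_funM mB); exact: (measurableT_comp mg (measurable_row_sub m1 m2)).
    - by apply: emeasurable_funM; [exact: measurable_cst|exact/measurable_EFinP].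
    - by move=> z _; rewrite -EFinM lee_fin mulrC ler_wpM2r ?B0//; exact: g_le.
  rewrite ge0_integralZl; first last.
  - by rewrite lee_fin sqr_ge0.
  - by move=> z _; rewrite lee_fin B0.
  - exact/measurable_EFinP.
  - exact: measurableT.
  rewrite lte_mul_pinfty ?lee_fin ?sqr_ge0//.
  by rewrite [X in (X < _)%E](Rintegral_prodM iX iX) ltry.
have I0 (z : T * T) : 0 <= \1_X (z.1 : rv) * \1_X (z.2 : rv) * g (z.1 - z.2 : rv).
  by apply: mulr_ge0; [rewrite mulr_ge0 ?indicE|exact: sqr_ge0].
have lower : (((wO - d2) * G * r ^+ n.+1)%:E <= \int[@leb2 R n]_z (\1_X (z.1 : rv) * \1_X (z.2 : rv) * g (z.1 - z.2 : rv)%R)%:E)%E.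
  have [wle|wgt] := leP wO d2.
    apply: (@le_trans _ _ 0%E); last by apply: integral_ge0 => z _; exact: I0.
    by rewrite lee_fin mulr_le0_ge0 ?(ltW rn0)// mulr_le0_ge0// subr_le0.
  rewrite (integral_overlap mX mg (fun z => sqr_ge0 _)).
  have k0 : 0 <= (wO - d2) * r ^+ n.+1 by rewrite mulr_ge0 ?subr_ge0 ?ltW.
  rewrite mulrAC EFinM -GE' -ge0_integralZl; last 4 first.
  - exact: measurableT.
  - by apply/measurable_EFinP; exact: mgc.
  - by move=> z _; rewrite lee_fin mulr_ge0 ?sqr_ge0// indicE.
  - by rewrite lee_fin.
  apply: ge0_le_integral; first exact: measurableT.
  - by move=> z _; rewrite -EFinM lee_fin mulr_ge0// mulr_ge0 ?sqr_ge0// indicE.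
  - by apply: emeasurable_funM; [exact: measurable_cst|apply/measurable_EFinP; exact: mgc].
  - apply: emeasurable_funM; first by apply/measurable_EFinP; apply: measurable_fun_lebT; exact: mg.
    exact: measurable_overlap.
  - move=> z _; rewrite muleC indicE; case: (boolP (_ \in _)) => [/set_mem zN|_]; last first.
      by rewrite mulr0 mul0e mule_ge0 ?lee_fin ?sqr_ge0 ?leb_out_ge0.
    rewrite mulr1 lee_wpmul2l ?lee_fin ?sqr_ge0// ov mulrC EFinM lee_wpmul2l ?lee_fin ?(ltW rn0)//.
    rewrite EFinB leeBlDr// -wOE; apply: Hq => k; rewrite mxE normrM gtr0_norm ?invr_gt0// mulrC ler_pdivrMr//.
    by apply: (@le_trans _ _ N%:R); [rewrite ler_norml; exact: zN|rewrite mulrC -ler_pdivrMr].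
have lower' : (wO - d2) * G * r ^+ n.+1 <= fine (\int[@leb2 R n]_z (\1_X (z.1 : rv) * \1_X (z.2 : rv) * g (z.1 - z.2 : rv)%R)%:E)%E.
  rewrite -lee_fin fineK// ge0_fin_numE//.
  by apply: integral_ge0 => z _; exact: I0.
apply: le_trans (ler_wpM2l (sqr_ge0 c0) lower'); rewrite mulrA ler_wpM2r ?(ltW rn0)//.
have half a : 0 <= a -> c0 ^+ 2 * (a * (eta / (2 * c0 ^+ 2 * (a + 1)))) <= eta / 2.
  move=> a0; have a1 : 0 < a + 1 by rewrite ltr_wpDl.
  have -> : c0 ^+ 2 * (a * (eta / (2 * c0 ^+ 2 * (a + 1)))) = eta / 2 * (a / (a + 1)).
    by field; rewrite !gt_eqF.
  by rewrite ler_piMr ?divr_ge0 ?ltW// ltr_pdivrMr// mul1r ltrDl.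
have e1 : c0 ^+ 2 * (wO * d1) <= eta / 2 by exact: half.
have e2 : c0 ^+ 2 * (d2 * G) <= eta / 2 by rewrite [d2 * _]mulrC; exact: half.
have e3 : c0 ^+ 2 * (wO * ((2 * pi) ^+ n.+1 * wW - d1)) <= c0 ^+ 2 * (wO * G).
  by rewrite ler_wpM2l ?sqr_ge0// ler_wpM2l.
have e4 : c0 ^+ 2 * (wO * ((2 * pi) ^+ n.+1 * wW - d1)) = c0 * wW * wO - c0 ^+ 2 * (wO * d1).
  rewrite /c0; field; exact: lt0r_neq0.
rewrite mulrBl mulrBr; lra.
Qed.
End Kernel.
End KernelEnergy.

(** * Elementary inequalities for the error terms *)

Section Estimates.
Context {R : realType}.
Implicit Types c e k rho t u S D : R.

Lemma trace_defect c e rho u S : 0 <= c -> 0 <= rho -> e <= u ->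
  (c - 2 * u) * rho <= S -> (1 + e) * (c * rho) - S <= u * (c + 2) * rho.
Proof.
move=> c0 rho0 eu H; have : e * (c * rho) <= u * (c * rho) by rewrite ler_wpM2r// mulr_ge0.
lra.
Qed.

Lemma large_count_rate c e rho t k D : 0 < t -> 0 <= k -> e <= t ^+ 3 ->
  D <= t ^+ 3 * (c + 2) * rho -> c * rho - D / t <= (1 + e) * k ->
  rho * ((c - t ^+ 2 * (c + 2)) / (1 + t ^+ 3)) <= k.
Proof.
move=> t0 k0 et DE H; have t3 : 0 < 1 + t ^+ 3 by rewrite addr_gt0 ?exprn_gt0.
rewrite mulrA ler_pdivrMr//.
have h1 : D / t <= t ^+ 2 * (c + 2) * rho.
  rewrite ler_pdivrMr//; apply: le_trans DE _; rewrite le_eqVlt; apply/orP; left; apply/eqP; ring.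
have h2 : (1 + e) * k <= k * (1 + t ^+ 3) by rewrite mulrC ler_wpM2l// lerD2l.
have -> : rho * (c - t ^+ 2 * (c + 2)) = c * rho - t ^+ 2 * (c + 2) * rho by ring.
by apply: le_trans h2; apply: le_trans H; rewrite lerD2l lerN2.
Qed.

Lemma small_count_rate c rho t k D m0 : 0 < t -> k <= c * rho / (1 - t) + D / t ^+ 2 ->
  D <= t ^+ 3 * (c + 2) * rho -> m0 <= t * rho ->
  2 * (k + m0) <= rho * (2 * (c / (1 - t) + t * (c + 2) + t)).
Proof.
move=> t0 H DE mE.
have h1 : D / t ^+ 2 <= t * (c + 2) * rho.
  rewrite ler_pdivrMr ?exprn_gt0//; apply: le_trans DE _; rewrite le_eqVlt; apply/orP; left; apply/eqP; ring.
have -> : rho * (2 * (c / (1 - t) + t * (c + 2) + t)) =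
  2 * (c * rho / (1 - t) + t * (c + 2) * rho + t * rho) by ring.
by rewrite ler_wpM2l// lerD// (le_trans H)// lerD2l.
Qed.

Lemma radius_lt1 (eps t : R) : 0 < t -> eps <= 1 -> (eps - 3 * t) / (1 + t) < 1.
Proof.
move=> t0 e1; rewrite ltr_pdivrMr ?addr_gt0// mul1r; lra.
Qed.

Lemma radius_budget (eps t e : R) : 0 < t -> e <= t -> 3 * t < eps ->
  (1 + e) * ((eps - 3 * t) / (1 + t)) + t + e + t <= eps.
Proof.
move=> t0 et teps; have t1 : 0 < 1 + t by rewrite addr_gt0.
have q0 : 0 <= (eps - 3 * t) / (1 + t) by rewrite divr_ge0 ?ltW// subr_gt0.
have : (1 + e) * ((eps - 3 * t) / (1 + t)) <= (1 + t) * ((eps - 3 * t) / (1 + t)) by rewrite ler_wpM2r// lerD2l.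
have -> : (1 + t) * ((eps - 3 * t) / (1 + t)) = eps - 3 * t by rewrite mulrC divfK// gt_eqF.
lra.
Qed.

Lemma mesh_size (eta a1 a2 : R) : 0 < eta -> 0 <= a1 -> 0 <= a2 ->
  exists h : R, [/\ 0 < h, h * a1 <= eta & h * a2 <= eta].
Proof.
move=> eta0 a10 a20; have den : 0 < 1 + a1 + a2 by rewrite -addrA ltr_pwDl// addr_ge0.
exists (eta / (1 + a1 + a2)); split; first by rewrite divr_gt0.
  rewrite mulrAC ler_pdivrMr// ler_wpM2l ?(ltW eta0)//; lra.
rewrite mulrAC ler_pdivrMr// ler_wpM2l ?(ltW eta0)//; lra.
Qed.

Lemma energy_defect c eta rho F S D : 1 <= rho -> 0 < eta -> (c - eta) * rho <= F -> F <= S + D -> D <= eta ->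
  (c - 2 * eta) * rho <= S.
Proof.
move=> rho1 eta0 H1 H2 H3; have : eta <= eta * rho by rewrite ler_pMr.
lra.
Qed.
End Estimates.

(** * Asymptotics *)

Section Asymptotics.
Context {R : realType} (n : nat).
Local Notation C := R[i].
Local Notation rv := 'rV[R]_n.+1.
Local Notation T := (@lebT R n).
Variables (Om W : set rv) (eps : R).
Hypotheses (cO : compact Om) (cW : compact W) (eps0 : 0 < eps) (eps1 : eps <= 1).
Local Notation wW := (fine (leb_out W)).
Local Notation wO := (fine (leb_out Om)).
Let c0 : R := (2 * pi) ^- n.+1.
Let c : R := c0 * wW * wO.
Let c00 : 0 < c0. Proof. by rewrite invr_gt0 exprn_gt0// mulr_gt0// pi_gt0. Qed.
Let wW0 : 0 <= wW. Proof. by rewrite fine_ge0 ?leb_out_ge0. Qed.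
Let wO0 : 0 <= wO. Proof. by rewrite fine_ge0 ?leb_out_ge0. Qed.
Let c_ge0 : 0 <= c. Proof. by rewrite !mulr_ge0// ltW. Qed.

Definition covers (r : R) (N : nat) := exists c : 'I_N -> rv -> C,
  (forall k, L2 (c k)) /\
  forall g, image_ball_closure (P_LPS r Om W) g -> exists k, (l2norm (g \- c k)%R <= eps%:E)%E.

(* Eigenvalues above 1 - t (lower bound) or above t (upper bound) are kept, the discretization errors
   are at most t ^ 3, and the covering radius left to the kept coordinates is (eps - 3 t) / (1 + t). *)
Definition lower_rate (t : R) : R :=
  2 * ((c - t ^+ 2 * (c + 2)) / (1 + t ^+ 3)) * (ln (1 - t) - ln (eps + t ^+ 3)).
Definition upper_rate (t : R) : R :=
  2 * (c / (1 - t) + t * (c + 2) + t) * (- ln ((eps - 3 * t) / (1 + t)) + t).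

(** The mesh is chosen after r, since the error constants [a1] and [a2] involve the volume of r
    Omega. With r >= 1 the additive error eta in the sum of squares is absorbed into eta r^m, whence
    the 2 eta. *)
Lemma spectrum_discretized (eta : R) : 0 < eta -> exists r0 : R, forall r, r0 <= r -> 1 <= r ->
  exists L (E : 'I_L -> set rv) (p : 'I_L -> rv) (h CW : R),
  let X := scale_set r Om in
  let e := 4 * c0 * h * CW * wW * fine (leb_out X) in
  [/\ [/\ forall j, measurable (E j : set T), forall x j k, E j x -> E k x -> j = k,
        forall x, X x <-> exists j, E j x & forall x j, E j x -> enorm (x - p j) <= h],
      [/\ 0 <= h, 0 <= CW & forall xi, W xi -> enorm xi <= CW],
      e <= eta,
      c0 * wW * fine (leb_out X) = c * r ^+ n.+1 &
      (c - 2 * eta) * r ^+ n.+1 <= \sum_j \sum_k normc (cellM W E p j k) ^+ 2].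
Proof.
move=> eta0; have [r0 Hr] := frobenius_lower cW cO eta0.
have [N WN] := compact_cube cW.
pose CW : R := n.+1%:R * N%:R.
have CW0 : 0 <= CW by rewrite mulr_ge0.
have boundW xi : W xi -> enorm xi <= CW.
  by move=> Wx; apply: enorm_box => // k; rewrite ler_norml; exact: WN.
exists r0 => r r0r r1; have r_gt0 : 0 < r by apply: lt_le_trans r1.
pose X := scale_set r Om; have cX : compact X by exact: compact_scale_set.
set wX := fine (leb_out X).
have wX0 : 0 <= wX by rewrite fine_ge0 ?leb_out_ge0.
have wXE : wX = r ^+ n.+1 * wO.
  by rewrite /wX /X leb_out_scale// fineM// ge0_fin_numE ?leb_out_ge0 ?compact_leb_fin.
have rn1 : 1 <= r ^+ n.+1 by rewrite exprn_ege1.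
pose a1 := 4 * c0 * CW * wW * wX.
pose a2 := c0 ^+ 2 * (8 * CW * wW ^+ 2 * wX ^+ 2).
have c00' := ltW c00.
have a1_ge0 : 0 <= a1 by rewrite /a1; do 4![apply: mulr_ge0 => //].
have a2_ge0 : 0 <= a2 by rewrite /a2; do 4![apply: mulr_ge0 => //]; exact: sqr_ge0.
have [h [h0 ha1 ha2]] := mesh_size eta0 a1_ge0 a2_ge0.
have [L [E [p [mE disjE covE closeE]]]] := compact_cells cX h0.
exists L, E, p, h, CW; split; [by split|by split => //; exact: ltW| | |].
- by apply: le_trans ha1; rewrite le_eqVlt; apply/orP; left; apply/eqP; rewrite /a1 -/wX; ring.
- by rewrite -/X -/wX wXE /c; ring.
- have F := cellM_frobenius cX cW mE disjE covE (ltW h0) CW0 closeE boundW.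
  apply: (energy_defect rn1 eta0 (Hr r r0r r_gt0) F).
  apply: le_trans ha2; rewrite le_eqVlt; apply/orP; left; apply/eqP; rewrite -/c0 -/wX /a2; generalize c0 wX wW => *; ring.
Qed.

(** The lower estimate multiplies a lower bound for the count by the logarithmic gap, so it needs
    that gap to be nonnegative. *)
Lemma covering_rates (t : R) : 0 < t -> t < 1 -> 3 * t < eps ->
  exists r1 : R, forall r, r1 <= r -> 0 < r /\
    ((forall N, covers r N -> (0 < N)%N /\
        (0 <= ln (1 - t) - ln (eps + t ^+ 3) -> r ^+ n.+1 * lower_rate t <= ln N%:R)) /\
     (exists2 N, covers r N & ln N%:R <= r ^+ n.+1 * upper_rate t)).
Proof.
move=> t0 t1 teps.
have t3 : 0 < t ^+ 3 by rewrite exprn_gt0.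
have t3t : t ^+ 3 <= t by rewrite exprS ger_pMr// exprn_ile1// ltW.
pose e0 := (eps - 3 * t) / (1 + t).
have t1' : 0 < 1 + t by rewrite addr_gt0.
have e0_gt0 : 0 < e0 by rewrite divr_gt0 ?subr_gt0.
have e0_lt1 : e0 < 1 by exact: radius_lt1.
have e0b : 0 < e0 < 1 by rewrite e0_gt0.
have [n0 Hn0] := @cover_ball_upper R e0 t e0b t0.
(* With precision t ^ 3 the defect stays of order t^2 and t relative to r^m after the divisions by t
   and t ^ 2 in the two counts. *)
have [r0 Hr0] := spectrum_discretized t3.
(* The last threshold makes the n0 + 1 complex coordinates added below at most t r^m. *)
exists (Num.max r0 (Num.max 1 (n0.+1%:R / t))) => r; rewrite !ge_max => /andP[rr0 /andP[r1 rt]].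
have r_gt0 : 0 < r by apply: lt_le_trans r1.
split=> //.
have [L [E [p [h [CW [[mE disjE covE closeE] [h0 CW0 boundW] et trE frE]]]]]] := Hr0 r rr0 r1.
pose X := scale_set r Om; have cX : compact X by exact: compact_scale_set.
have [P [Q [lam [[PQ QP QE] lamE lamb trL frL]]]] := cell_spectrum cX cW mE disjE covE h0 CW0 closeE boundW.
rewrite -/X -/c0 in et trE lamb trL.
rewrite -frL in frE; rewrite trE in trL.
set rho := r ^+ n.+1 in trL frE *.
have rho_gt0 : 0 < rho by rewrite exprn_gt0.
have rho_ge : r <= rho by rewrite /rho exprS ler_pMr// exprn_ege1.
pose e := 4 * c0 * h * CW * wW * fine (leb_out X); rewrite -/e in et lamb.
have e_ge0 : 0 <= e.
  by rewrite /e; do 5?[apply: mulr_ge0 => //]; [exact: ltW c00|rewrite fine_ge0 ?leb_out_ge0].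
have lam0 i : 0 <= lam i by have /andP[] := lamb i.
have lam1 i : lam i <= 1 + e by have /andP[] := lamb i.
have Dle : (1 + e) * (\sum_i lam i) - \sum_i lam i ^+ 2 <= t ^+ 3 * (c + 2) * rho.
  by rewrite trL; apply: trace_defect => //; exact: ltW.
split.
- move=> N [cs [Lcs cov]].
  have Lcs' k : sqint (cs k : T -> C) by exact/L2P.
  have t01 : 0 < t < 1 by rewrite t0.
  have low := covering_lower cX cW erefl mE disjE covE h0 CW0 closeE boundW PQ QP QE lamE lam0 eps0 t01 Lcs' cov.
  move: low; rewrite -/c0 -/X -/e; set nb := #|_| => low.
  have N0 : (0 < N)%N.
    by rewrite lt0n; apply/eqP => N0; move: low; rewrite N0 mul0r leNgt exprn_gt0// subr_gt0.
  split => // l0.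
  have nbE : rho * ((c - t ^+ 2 * (c + 2)) / (1 + t ^+ 3)) <= nb%:R.
    by apply: (large_count_rate t0 _ et Dle) => //; rewrite -trL; exact: count_large.
  have N0' : 0 < N%:R :> R by rewrite ltr0n.
  have ee : 0 < eps + t ^+ 3 by rewrite addr_gt0.
  have tt : 0 < 1 - t by rewrite subr_gt0.
  have : (2 * nb)%:R * (ln (1 - t) - ln (eps + t ^+ 3)) <= ln N%:R.
    have : (1 - t) ^+ (2 * nb) <= N%:R * (eps + t ^+ 3) ^+ (2 * nb).
      apply: le_trans low _; rewrite ler_wpM2l//.
      by apply: lerXn2r; rewrite ?nnegrE ?lerD2l ?addr_ge0 ?(ltW eps0) ?(ltW t3).
    rewrite -(@ler_ln _ ((1 - t) ^+ _)) ?posrE ?mulr_gt0 ?exprn_gt0//.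
    rewrite lnM ?posrE ?exprn_gt0// !lnXn//.
    by rewrite mulrBr !mulr_natl lerBlDr.
  move=> H; apply: le_trans H; rewrite /lower_rate (mulrA rho).
  apply: ler_wpM2r; first exact: l0.
  by rewrite mulrCA natrM ler_wpM2l.
(* Padding by n0 reaches the dimensions where the covering of Euclidean balls is available, even
   when few eigenvalues are kept. *)
- pose m := (#|[pred i | (t < lam i)%R]| + n0)%N.
  have [zs [szs netzs]] := Hn0 (m + m.+1)%N (leq_trans (leq_addl _ _) (leq_addr _ _)).
  have msm : (#|[pred i | (t < lam i)%R]| <= m.+1)%N by rewrite leqW// leq_addr.
  have epsE : (1 + e) * e0 + t + e + t <= eps.
    by apply: radius_budget => //; exact: le_trans t3t.
  have [cs [Lcs cov]] := covering_upper cX cW erefl mE disjE covE h0 CW0 closeE boundW PQ QP QE lamE lam0 lam1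
    (ltW t0) t0 (ltW e0_gt0) epsE msm netzs.
  exists (size zs); first by exists cs; split => // k; exact/L2P.
  have q0 : 0 <= - ln e0 + t by rewrite addr_ge0 ?(ltW t0)// oppr_ge0 ln_le0// ltW.
  apply: (@le_trans _ _ ((m + m.+1).+1%:R * (- ln e0 + t))).
    have [->|zs0] := eqVneq (size zs) 0%N; first by rewrite ln0// mulr_ge0.
    by rewrite -[leRHS]expRK ler_ln ?posrE ?expR_gt0// ltr0n lt0n.
  rewrite /upper_rate -/e0 mulrA ler_wpM2r//.
  have -> : (m + m.+1).+1%:R = 2 * (#|[pred i | (t < lam i)%R]|%:R + n0.+1%:R) :> R.
    by rewrite -natrD [in RHS]addnS -[(m + m.+1).+1]/(m.+1 + m.+1)%N addnn -mul2n natrM.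
  apply: (small_count_rate t0 _ Dle).
    by rewrite -trL; exact: count_small.
  by rewrite mulrC -ler_pdivrMr//; apply: le_trans rt rho_ge.
Qed.
End Asymptotics.

(* [lim0] unfolds to a product, whose binders would be taken for implicit arguments. *)
Unset Implicit Arguments.

(** * Limits of the two rates as t tends to 0 from the right *)

Section RateLimits.
Context {R : realType} (n : nat).
Variables (Om W : set 'rV[R]_n.+1) (eps : R).
Hypothesis eps0 : 0 < eps.
Local Notation c := ((2 * pi) ^- n.+1 * fine (leb_out W) * fine (leb_out Om)).

Local Notation F := ((0 : R)^'+).
Let lim0 (f : R -> R) (a : R) := f t @[t --> F] --> a.

Let lim_cst (a : R) : lim0 (fun=> a) a.
Proof. exact: cvg_cst. Qed.

Let lim_id : lim0 id 0.
Proof. by apply: cvg_at_right_filter; exact: cvg_id. Qed.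

Let lim_pow k : lim0 (fun t => t ^+ k) (0 ^+ k).
Proof. by apply: cvg_at_right_filter; exact: exprn_continuous. Qed.

Let lim_ln {f : R -> R} {a : R} : 0 < a -> lim0 f a -> lim0 (fun t => ln (f t)) (ln a).
Proof. by move=> a0; apply: continuous_cvg; exact: continuous_ln. Qed.

Let lim_add {f g : R -> R} {a b : R} : lim0 f a -> lim0 g b -> lim0 (fun t => f t + g t) (a + b).
Proof. exact: cvgD. Qed.

Let lim_opp {f : R -> R} {a : R} : lim0 f a -> lim0 (fun t => - f t) (- a).
Proof. exact: cvgN. Qed.

Let lim_mul {f g : R -> R} {a b : R} : lim0 f a -> lim0 g b -> lim0 (fun t => f t * g t) (a * b).
Proof. exact: cvgM. Qed.

Let lim_inv {f : R -> R} {a : R} : a != 0 -> lim0 f a -> lim0 (fun t => (f t)^-1) a^-1.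
Proof. exact: cvgV. Qed.

Let lim_gap : lim0 (fun t => ln (1 - t) - ln (eps + t ^+ 3)) (- ln eps).
Proof.
have -> : - ln eps = ln (1 - 0) - ln (eps + 0 ^+ 3) by rewrite subr0 expr0n addr0 ln1 add0r.
have p1 : 0 < 1 - 0 :> R by rewrite subr0.
have p2 : 0 < eps + 0 ^+ 3 by rewrite expr0n addr0.
exact (lim_add (lim_ln p1 (lim_add (lim_cst 1) (lim_opp lim_id)))
  (lim_opp (lim_ln p2 (lim_add (lim_cst eps) (lim_pow 3))))).
Qed.

Let lim_lower_count (a : R) : lim0 (fun t => 2 * ((a - t ^+ 2 * (a + 2)) / (1 + t ^+ 3))) (2 * a).
Proof.
have -> : 2 * a = 2 * ((a - 0 ^+ 2 * (a + 2)) / (1 + 0 ^+ 3)) by rewrite !expr0n mul0r subr0 addr0 divr1.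
have n0 : 1 + 0 ^+ 3 != 0 :> R by rewrite expr0n addr0 oner_eq0.
exact (lim_mul (lim_cst 2) (lim_mul (lim_add (lim_cst a) (lim_opp (lim_mul (lim_pow 2) (lim_cst (a + 2)))))
  (lim_inv n0 (lim_add (lim_cst 1) (lim_pow 3))))).
Qed.

Let lim_upper_count (a : R) : lim0 (fun t => 2 * (a / (1 - t) + t * (a + 2) + t)) (2 * a).
Proof.
have -> : 2 * a = 2 * (a / (1 - 0) + 0 * (a + 2) + 0) by rewrite mul0r subr0 !addr0 divr1.
have n0 : 1 - 0 != 0 :> R by rewrite subr0 oner_eq0.
exact (lim_mul (lim_cst 2) (lim_add (lim_add (lim_mul (lim_cst a) (lim_inv n0 (lim_add (lim_cst 1) (lim_opp lim_id))))
  (lim_mul lim_id (lim_cst (a + 2)))) lim_id)).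
Qed.

Let lim_upper_log : lim0 (fun t => - ln ((eps - 3 * t) / (1 + t)) + t) (- ln eps).
Proof.
have epsE : eps = (eps - 3 * 0) / (1 + 0) by rewrite mulr0 subr0 addr0 divr1.
have p : 0 < (eps - 3 * 0) / (1 + 0) by rewrite -epsE.
have n0 : 1 + 0 != 0 :> R by rewrite addr0 oner_eq0.
have -> : - ln eps = - ln ((eps - 3 * 0) / (1 + 0)) + 0 by rewrite addr0 -epsE.
exact (lim_add (lim_opp (lim_ln p (lim_mul (lim_add (lim_cst eps) (lim_opp (lim_mul (lim_cst 3) lim_id)))
  (lim_inv n0 (lim_add (lim_cst 1) lim_id))))) lim_id).
Qed.

Lemma cvg_lower_rate : lower_rate Om W eps t @[t --> F] --> 2 * c * - ln eps.
Proof. exact (lim_mul (lim_lower_count c) lim_gap). Qed.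

Lemma cvg_upper_rate : upper_rate Om W eps t @[t --> F] --> 2 * c * - ln eps.
Proof. exact (lim_mul (lim_upper_count c) lim_upper_log). Qed.

Lemma rates_near {d : R} : 0 < d -> exists t : R, [/\ 0 < t < 1, 3 * t < eps,
  eps < 1 -> 0 <= ln (1 - t) - ln (eps + t ^+ 3),
  2 * c * - ln eps - d <= lower_rate Om W eps t & upper_rate Om W eps t <= 2 * c * - ln eps + d].
Proof.
move=> d0.
(* The gap tends to - ln eps, positive only for eps < 1; at eps = 1 it is negative for every small t
   > 0, hence the implication. *)
have ell : \forall t \near F, eps < 1 -> 0 <= ln (1 - t) - ln (eps + t ^+ 3).
  have [eps_lt1|_] := ltP eps 1; last exact: nearW.
  have gap0 : 0 < - ln eps by rewrite oppr_gt0 ln_lt0// eps0.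
  have H : \forall t \near F, 0 <= ln (1 - t) - ln (eps + t ^+ 3) by exact: (cvgr_ge (- ln eps) lim_gap).
  by near=> t; move=> _; near: t; exact: H.
near (0 : R)^'+ => t; exists t; split.
- by apply/andP; split; near: t; [exact: nbhs_right_gt|exact: nbhs_right_lt].
- by rewrite mulrC -ltr_pdivlMr//; near: t; apply: nbhs_right_lt; exact: divr_gt0.
- by near: t; exact: ell.
- by near: t; apply: (cvgr_ge _ cvg_lower_rate); rewrite ltrBlDr ltrDl.
- by near: t; apply: (cvgr_le _ cvg_upper_rate); rewrite ltrDl.
Unshelve. all: by end_near. Qed.
End RateLimits.
Set Implicit Arguments.

Theorem theorem2 (R : realType) (d : nat) (Om W : set 'rV[R]_d) :
  (0 < d)%N -> compact Om -> compact W ->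
  forall eps : R, 0 < eps <= 1 ->
  ((entropy eps (P_LPS r Om W) * ((r ^+ d)^-1)%:E)%E @[r --> +oo] -->
   ((2 / (2 * pi) ^+ d * (ln (eps^-1) / ln 2))%:E
      * hausdorff Om * hausdorff W)%E).
Proof.
case: d Om W => // n Om W _ cO cW eps /andP[eps0 eps1].
have fin (A : set 'rV[R]_n.+1) : compact A -> leb_out A = (fine (leb_out A))%:E.
  by move=> cA; rewrite fineK// ge0_fin_numE ?leb_out_ge0 ?compact_leb_fin.
rewrite !hausdorff_leb (fin _ cO) (fin _ cW) -!EFinM.
set c := (2 * pi) ^- n.+1 * fine (leb_out W) * fine (leb_out Om).
have ln2 : 0 < ln 2 :> R by rewrite ln_gt0// ltr1n.
have -> : 2 / (2 * pi) ^+ n.+1 * (ln eps^-1 / ln 2) * fine (leb_out Om) * fine (leb_out W) = 2 * c * - ln eps / ln 2.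
  by rewrite lnV ?posrE// /c; ring.
have c0 : 0 <= c by rewrite !mulr_ge0 ?fine_ge0 ?leb_out_ge0 ?invr_ge0 ?exprn_ge0 ?mulr_ge0 ?pi_ge0.
have L0 : 0 <= - ln eps by rewrite oppr_ge0 ln_le0.
(* The covering number is an infimum in the extended reals. A lower bound valid for all admissible N
   together with one admissible N makes it a positive real, so its logarithm lies between the
   bounds. *)
have entropyE r a b : (forall N, covers Om W eps r N -> (0 < N)%N /\ a <= ln N%:R) ->
    (exists2 N, covers Om W eps r N & ln N%:R <= b) ->
    exists2 x, entropy eps (P_LPS r Om W) = (x / ln 2)%:E & a <= x <= b.
  move=> Ha [N1 cN1 Hb].
  have N1gt : (0 < N1)%N by have [] := Ha _ cN1.
  have lo : ((expR a)%:E <= covering_number eps (image_ball_closure (P_LPS r Om W)))%E.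
    apply: le_ereal_inf_tmp => _ /= [N cN <-]; have [N0 aN] := Ha _ cN.
    by rewrite lee_fin -[leRHS]lnK ?posrE ?ltr0n// ler_expR.
  have hi : (covering_number eps (image_ball_closure (P_LPS r Om W)) <= N1%:R%:E)%E.
    by apply: ereal_inf_lbound; exists N1.
  rewrite /entropy; move: lo hi; case: (covering_number _ _) => [x| |]//=; rewrite !lee_fin => lo hi.
  have x0 : 0 < x by apply: lt_le_trans lo; exact: expR_gt0.
  exists (ln x) => //; apply/andP; split; first by rewrite -[leLHS]expRK ler_ln ?posrE ?expR_gt0.
  by apply: le_trans Hb; rewrite ler_ln ?posrE// ltr0n.
have bound e : 0 < e -> exists r1 : R, forall r, r1 <= r -> exists2 y,
    (entropy eps (P_LPS r Om W) * ((r ^+ n.+1)^-1)%:E)%E = y%:E & `|2 * c * - ln eps / ln 2 - y| <= e.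
  move=> e0; have d0 : 0 < e * ln 2 by exact: mulr_gt0.
  have [t [/andP[t0 t1] teps lnt lo hi]] := rates_near n Om W eps eps0 d0.
  have [r1 Hr1] := covering_rates cO cW eps0 eps1 t0 t1 teps.
  exists r1 => r /Hr1[r0 [Hlo [N1 cN1 HN1]]].
  have rn0 : 0 < r ^+ n.+1 by rewrite exprn_gt0.
  have Hlo' N : covers Om W eps r N -> (0 < N)%N /\ r ^+ n.+1 * (2 * c * - ln eps - e * ln 2) <= ln N%:R.
    move=> cN; have [N0 HN] := Hlo _ cN; split => //.
    (* At eps = 1 the limit is 0 and the lower bound is trivial, because N >= 1 gives ln N >= 0. *)
    have [eps_lt1|eps_ge1] := ltP eps 1.
      by apply: le_trans (HN (lnt eps_lt1)); rewrite ler_wpM2l// ltW.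
    have -> : eps = 1 by apply/eqP; rewrite eq_le eps1.
    rewrite ln1 oppr0 mulr0 sub0r mulrN; apply: (@le_trans _ _ 0); last by rewrite ln_ge0// ler1n.
    by rewrite oppr_le0 mulr_ge0// ltW.
  have Hhi' : exists2 N, covers Om W eps r N & ln N%:R <= r ^+ n.+1 * (2 * c * - ln eps + e * ln 2).
    by exists N1 => //; apply: le_trans HN1 _; rewrite ler_wpM2l// ltW.
  have [x -> /andP[xlo xhi]] := entropyE _ _ _ Hlo' Hhi'.
  exists (x / ln 2 / r ^+ n.+1); first by rewrite -EFinM.
  have -> : 2 * c * - ln eps / ln 2 - x / ln 2 / r ^+ n.+1 = (2 * c * - ln eps - x / r ^+ n.+1) / ln 2.
    by rewrite mulrBl; congr (_ - _); exact: mulrAC.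
  rewrite normrM [`|_^-1|]gtr0_norm ?invr_gt0// ler_pdivrMr// ler_distlC.
  by rewrite ler_pdivlMr// ler_pdivrMr// mulrC xlo mulrC xhi.
apply/fine_cvgP; split.
  have [r1 Hr1] := bound 1 ltr01.
  by exists r1; split => [|r /ltW/Hr1[y -> _]]; rewrite ?num_real.
apply/cvgrPdist_le => e e0; have [r1 Hr1] := bound e e0.
exists r1; split => [|r /ltW/Hr1[y]]; rewrite ?num_real//= => ->.
by [].
Qed.
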